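(* Let $\Psi_\nu$, $\nu\in\Xi$, be the family of normal form coordinates on $\mathcal V(\delta)$ described in the context, and let $M\ge1$ be an integer. There exists $\sigma_M>0$ so that for any $\mathfrak x\in\mathcal V^{\sigma_M}(\delta)$ and $\nu\in\Xi$, the operator $d\Psi_\nu(\mathfrak x)^\top$ extends to a bounded linear operator $d\Psi_\nu(\mathfrak x)^\top:H^{-M-1}_0(\mathbb T_1)\to E_{-M-1}$ and for any $\widehat q\in H_0^{-M-1}(\mathbb T_1)$, $d\Psi_\nu(\mathfrak x)^\top[\widehat q]$ admits an expansion of the form $$d\Psi_\nu(\mathfrak x)^\top[\widehat q]=\Big(0,0,\Pi_\perp\widehat q+\Pi_\perp\sum_{k=1}^Ma^{ext}_{-k}(\mathfrak x;\nu;d\Psi^\top)\,\partial_x^{-k}\widehat q\Big)+\mathcal R_M^{ext}(\mathfrak x;\nu;d\Psi^\top)[\widehat q]$$ with the following properties. (i) For any $s\ge0$ the maps $\mathcal V^{\sigma_M}(\delta)\times\Xi\to H^s(\mathbb T_1)$, $(\mathfrak x,\nu)\mapsto a^{ext}_{-k}(\mathfrak x;\nu;d\Psi^\top)$, $1\le k\le M$, are $\mathcal C^\infty$. They satisfy $a_{-1}^{ext}(\mathfrak x;\nu;d\Psi^\top)=a_{-1}^{d\Psi^\top}(\mathfrak x;\nu)$ and, for any $\alpha\in\mathbb N^{\mathbb S_+}$, $l\ge1$, $\widehat{\mathfrak x}_1,\dots,\widehat{\mathfrak x}_l\in E_{\sigma_M}$ and $(\mathfrak x,\nu)\in\mathcal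 V^{\sigma_M}(\delta)\times\Xi$, $$\|\partial_\nu^\alpha a^{ext}_{-k}(\mathfrak x;\nu;d\Psi^\top)\|_{H^s_x}\lesssim_{s,M,\alpha}1,\qquad \|\partial_\nu^\alpha d^la^{ext}_{-k}(\mathfrak x;\nu;d\Psi^\top)[\widehat{\mathfrak x}_1,\dots,\widehat{\mathfrak x}_l]\|_{H^s_x}\lesssim_{s,M,l,\alpha}\prod_{j=1}^l\|\widehat{\mathfrak x}_j\|_{E_{\sigma_M}} .$$ (ii) For any $-1\le s\le M+1$ the map $\mathcal R_M^{ext}(\cdot;\cdot;d\Psi^\top):\mathcal V^{\sigma_M}(\delta)\times\Xi\to\mathcal B(H_0^{-s}(\mathbb T_1),E_{M+1-s})$ is $\mathcal C^\infty$ and satisfies, for any $\alpha\in\mathbb N^{\mathbb S_+}$, $l\ge1$, $\widehat{\mathfrak x}_1,\dots,\widehat{\mathfrak x}_l\in E_{\sigma_M}$, $\widehat q\in H_0^{-s}(\mathbb T_1)$, $(\mathfrak x,\nu)\in\mathcal V^{\sigma_M}(\delta)\times\Xi$, $$\|\partial_\nu^\alpha\mathcal R_M^{ext}(\mathfrak x;\nu;d\Psi^\top)[\widehat q]\|_{E_{M+1-s}}\lesssim_{M,\alpha}\|\widehat q\|_{H^{-s}_x},$$ $$\|\partial_\nu^\alpha d^l\mathcal R_M^{ext}(\mathfrak x;\nu;d\Psi^\top)[\widehat{\mathfrak x}_1,\dots,\widehat{\mathfrak x}_l][\widehat q]\|_{E_{M+1-s}}\lesssim_{s,M,l,\alpha}\|\widehat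 q\|_{H_x^{-s}}\prod_{j=1}^l\|\widehat{\mathfrak x}_j\|_{E_{\sigma_M}} .$$ (iii) For any $s\ge1$ the map $\mathcal R_M^{ext}(\cdot;\cdot;d\Psi^\top):(\mathcal V^{\sigma_M}(\delta)\cap\mathcal E_{s+\sigma_M})\times\Xi\to\mathcal B(H^s_0(\mathbb T_1),E_{s+M+1})$ is $\mathcal C^\infty$ and satisfies, for any $\alpha\in\mathbb N^{\mathbb S_+}$, $l\ge1$, $\widehat{\mathfrak x}_1,\dots,\widehat{\mathfrak x}_l\in E_{s+\sigma_M}$, $\widehat q\in H_0^s(\mathbb T_1)$, $(\mathfrak x,\nu)\in(\mathcal V^{\sigma_M}(\delta)\cap\mathcal E_{s+\sigma_M})\times\Xi$, $$\|\partial_\nu^\alpha\mathcal R_M^{ext}(\mathfrak x;\nu;d\Psi^\top)[\widehat q]\|_{E_{M+1+s}}\lesssim_{s,M,\alpha}\|\widehat q\|_{H^s_x}+\|\mathfrak x\|_{E_{s+\sigma_M}}\|\widehat q\|_{H^1_x},$$ $$\|\partial_\nu^\alpha d^l\mathcal R_M^{ext}(\mathfrak x;\nu;d\Psi^\top)[\widehat{\mathfrak x}_1,\dots,\widehat{\mathfrak x}_l][\widehat q]\|_{E_{M+1+s}}\lesssim_{s,M,l,\alpha}\|\widehat q\|_{H_x^s}\prod_{j=1}^l\|\widehat{\mathfrak x}_j\|_{E_{\sigma_M}}+\|\widehat q\|_{H^1_x}\Big(\sum_{j=1}^l\|\widehat{\mathfrak x}_j\|_{E_{s+\sigma_M}}\prod_{i\ne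 j}\|\widehat{\mathfrak x}_i\|_{E_{\sigma_M}}+\|\mathfrak x\|_{E_{s+\sigma_M}}\prod_{j=1}^l\|\widehat{\mathfrak x}_j\|_{E_{\sigma_M}}\Big).$$
   Context: Notation. $\mathbb N=\{0,1,\dots\}$, $\mathbb N_+=\{1,2,\dots\}$, $\mathbb T=\mathbb R/2\pi\mathbb Z$, $\mathbb T_1=\mathbb R/\mathbb Z$; $\mathbb S_+\subset\mathbb N_+$ is finite and $\mathbb S^\perp=\mathbb Z\setminus(\mathbb S_+\cup(-\mathbb S_+)\cup\{0\})$. $H^s_x=H^s(\mathbb T_1)$ is the Sobolev space of real valued functions (distributions if $s<0$) with norm $\|u\|_{H^s_x}^2=\sum_n\langle n\rangle^{2s}|u_n|^2$, $u=\sum_nu_ne^{i2\pi nx}$, $\langle n\rangle=\max\{1,|n|\}$; $H^s_0(\mathbb T_1)$ is its subspace with $u_0=0$, $H^s_\perp(\mathbb T_1)$ the subspace with $u_n=0$ for $n\notin\mathbb S^\perp$; $L^2_0=H^0_0$, $L^2_\perp=H^0_\perp$; $\Pi_\perp$ is the projector onto $L^2_\perp(\mathbb T_1)$. $(f,g)_{L^2_x}=\int_{\mathbb T_1}fg\,dx$. For $m\in\mathbb Z$, $\partial_x^me^{i2\pi jx}=(i2\pi j)^me^{i2\pi jx}$ if $j\ne0$ and $\partial_x^m1=0$. Let $\mathcal E_s=\mathbb T^{\mathbb S_+}\times\mathbb R^{\mathbb S_+}\times H^s_\perp(\mathbb T_1)$, $E_s=\mathbb R^{\mathbb S_+}\times\mathbb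 R^{\mathbb S_+}\times H^s_\perp(\mathbb T_1)$ (product norm), $E=E_0$, with elements $\mathfrak x=(\theta,y,w)$, resp. $\widehat{\mathfrak x}=(\widehat\theta,\widehat y,\widehat w)$; $\|\mathfrak x\|_{E_s}$ for $\mathfrak x\in\mathcal E_s$ is computed with the representative of $\theta$ in $[0,2\pi)^{\mathbb S_+}$. On $E$ use $\langle\widehat{\mathfrak x}_1,\widehat{\mathfrak x}_2\rangle=\widehat\theta_1\cdot\widehat\theta_2+\widehat y_1\cdot\widehat y_2+(\widehat w_1,\widehat w_2)_{L^2_x}$. $\Pi_\perp$ also denotes the projection $E_s\to H^s_\perp$ onto the third component. $B_{\mathbb S_+}(\delta)$ and $B^s_\perp(\delta)$ are the open balls of radius $\delta$ centered at $0$ in $\mathbb R^{\mathbb S_+}$ and $H^s_\perp(\mathbb T_1)$; $\mathcal V^s(\delta)=\mathbb T^{\mathbb S_+}\times B_{\mathbb S_+}(\delta)\times B^s_\perp(\delta)$, $\mathcal V(\delta)=\mathcal V^0(\delta)$. $d$ is the differential with respect to $\mathfrak x$, $d_\perp$ the differential with respect to $w$, and $^\top$ denotes the transpose with respect to $\langle\cdot,\cdot\rangle$ and $(\cdot,\cdot)_{L^2_x}$. $\mathcal B(X,Y)$ is the space of bounded linear operators. $a\lesssim_{p}b$ means $a\le C(p)b$. The symplectic form on $L^2_0$ is $\mathcal W_{L^2_0}(u,v)=\int_{\mathbb T_1}(\partial_x^{-1}u)v\,dx$; on $\mathcal V(\delta)$ it is $\mathcal W=(\sum_{j\in\mathbb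 S_+}dy_j\wedge d\theta_j)\oplus\mathcal W_{L^2_0}|_{L^2_\perp}$. Birkhoff map (known). $\Psi^{kdv}:h^0_0\to L^2_0(\mathbb T_1)$ is the real analytic symplectic Birkhoff diffeomorphism of the KdV equation $\partial_tu=\partial_x\nabla H^{kdv}(u)$, $H^{kdv}(u)=\int_{\mathbb T_1}\frac12u_x^2+u^3dx$, in which $h_0^0$ is the space of $\ell^2$ sequences $(z_n)_{n\in\mathbb Z}$ with $z_0=0$, $z_{-n}=\overline{z_n}$, with bracket $\{z_n,z_k\}=i2\pi n\delta_{k,-n}$, and $H^{kdv}\circ\Psi^{kdv}=\mathcal H^{kdv}_o$ is a real analytic function of the actions $I_k=\frac1{2\pi k}z_kz_{-k}$, $k\ge1$; also $\Psi^{kdv}(0)=0$ and $d_0\Psi^{kdv}$ is the inverse Fourier transform. $\Psi^{kdv}(\theta,I,0)$ denotes $\Psi^{kdv}(z)$ with $z_n=\sqrt{2\pi nI_n}e^{-i\theta_n}$, $z_{-n}=\overline{z_n}$ ($n\in\mathbb S_+$) and $z_n=0$ otherwise. For $n\ge1$, $\omega^{kdv}_n=\partial_{I_n}\mathcal H_o^{kdv}$, $\omega_{-n}^{kdv}=-\omega_n^{kdv}$, and $\omega_n^{kdv}(\nu,0)$ is its value at $I_k=\nu_k$ ($k\in\mathbb S_+$), $I_k=0$ ($k\notin\mathbb S_+$); $\omega^{kdv}(\nu)=(\omega^{kdv}_n(\nu,0))_{n\in\mathbb S_+}$. Normal form coordinates (known theorem of Kappeler–Montalto, taken as given). Let $\Xi\subset\mathbb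 R^{\mathbb S_+}_{>0}$ be open and bounded with $\Xi+B_{\mathbb S_+}(\delta)\subseteq\mathbb R^{\mathbb S_+}_{>0}$. For $\delta>0$ small enough there is a canonical (i.e. symplectic) $\mathcal C^\infty$ family of diffeomorphisms $\Psi_\nu:\mathcal V(\delta)\to\Psi_\nu(\mathcal V(\delta))\subseteq L^2_0(\mathbb T_1)$, $\nu\in\Xi$, with $\Psi_\nu(\theta,y,0)=\Psi^{kdv}(\theta,\nu+y,0)$, whose restriction to $\mathcal V(\delta)\cap\mathcal E_s$ is for each $s\in\mathbb N$ a $\mathcal C^\infty$-diffeomorphism onto its image in $H^s_0(\mathbb T_1)$, and such that, for every integer $M\ge1$: (AE1) $\Psi_\nu(\theta,y,w)=\Psi^{kdv}(\theta,\nu+y,0)+w+\sum_{k=1}^Ma^\Psi_{-k}(\mathfrak x;\nu)\partial_x^{-k}w+\mathcal R^\Psi_M(\mathfrak x;\nu)$ with $\mathcal R_M^\Psi(\theta,y,0;\nu)=0$, and for $s\in\mathbb N$ the maps $a_{-k}^\Psi:\mathcal V(\delta)\times\Xi\to H^s(\mathbb T_1)$ and $\mathcal R_M^\Psi:(\mathcal V(\delta)\cap\mathcal E_s)\times\Xi\to H^{s+M+1}(\mathbb T_1)$ are $\mathcal C^\infty$. (AE2) For $\mathfrak x\in\mathcal V^1(\delta)$, $d\Psi_\nu(\mathfrak x)^\top:H^1_0\to E_1$ is bounded and $$d\Psi_\nu(\mathfrak x)^\top[\widehat q]=\Big(0,0,\Pi_\perp\widehat q+\Pi_\perp\sum_{k=1}^Ma_{-k}^{d\Psi^\top}(\mathfrak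 x;\nu)\partial_x^{-k}\widehat q+\Pi_\perp\sum_{k=1}^M(\partial_x^{-k}w)\mathcal A_{-k}^{d\Psi^\top}(\mathfrak x;\nu)[\widehat q]\Big)+\mathcal R_M^{d\Psi^\top}(\mathfrak x;\nu)[\widehat q],$$ where for $s\ge1$ the maps $a_{-k}^{d\Psi^\top}:\mathcal V^1(\delta)\times\Xi\to H^s(\mathbb T_1)$, $\mathcal A_{-k}^{d\Psi^\top}:\mathcal V^1(\delta)\times\Xi\to\mathcal B(H_0^1,H^s)$, $\mathcal R_M^{d\Psi^\top}:(\mathcal V^1(\delta)\cap\mathcal E_s)\times\Xi\to\mathcal B(H^s_0,E_{s+M+1})$ are $\mathcal C^\infty$, and $a_{-1}^{d\Psi^\top}=-a_{-1}^\Psi$. (AE3) $\mathcal H^{kdv}(\cdot;\nu):=H^{kdv}\circ\Psi_\nu$ satisfies on $\mathcal V^1(\delta)$: $\mathcal H^{kdv}=\omega^{kdv}(\nu)\cdot y+\frac12(\Omega^{kdv}(D;\nu)w,w)_{L^2_x}+\frac12\Omega^{kdv}_{\mathbb S_+}(\nu)[y]\cdot y+\mathcal R^{kdv}(\mathfrak x;\nu)$, where $\Omega^{kdv}(D;\nu)w=\sum_{n\in\mathbb S^\perp}\frac{1}{2\pi n}\omega_n^{kdv}(\nu,0)w_ne^{i2\pi nx}$, $\Omega^{kdv}_{\mathbb S_+}(\nu)=(\partial_{I_j}\omega_k^{kdv}(\nu,0))_{j,k\in\mathbb S_+}$, $\mathcal R^{kdv}$ is $\mathcal C^\infty$, $\mathcal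 R^{kdv}=O((\|y\|+\|w\|_{H^1_x})^3)$, and for $s\ge1$ the gradient $\nabla\mathcal R^{kdv}:(\mathcal V^1(\delta)\cap\mathcal E_s)\times\Xi\to E_s$ is $\mathcal C^\infty$. (Est1) For $\alpha\in\mathbb N^{\mathbb S_+}$, $l\ge1$, $1\le k\le M$, $s\in\mathbb N$: $\|\partial_\nu^\alpha a^\Psi_{-k}\|_{H^s_x}\lesssim1$, $\|d^l\partial_\nu^\alpha a^\Psi_{-k}[\widehat{\mathfrak x}_1,\dots,\widehat{\mathfrak x}_l]\|_{H^s_x}\lesssim\prod_j\|\widehat{\mathfrak x}_j\|_{E_0}$ on $\mathcal V(\delta)\times\Xi$, and on $(\mathcal V(\delta)\cap\mathcal E_s)\times\Xi$: $\|\partial_\nu^\alpha\mathcal R_M^\Psi\|_{H_x^{s+M+1}}\lesssim\|w\|_{H^s_x}$, $\|d^l\partial_\nu^\alpha\mathcal R_M^\Psi[\widehat{\mathfrak x}_1,\dots,\widehat{\mathfrak x}_l]\|_{H_x^{s+M+1}}\lesssim\sum_j\|\widehat{\mathfrak x}_j\|_{E_s}\prod_{i\ne j}\|\widehat{\mathfrak x}_i\|_{E_0}+\|w\|_{H_x^s}\prod_j\|\widehat{\mathfrak x}_j\|_{E_0}$. (Est2) For $s\ge1$, on $\mathcal V^1(\delta)\times\Xi$: $\|\partial^\alpha_\nu a_{-k}^{d\Psi^\top}\|_{H^s_x}\lesssim1$, $\|d^l\partial_\nu^\alpha a_{-k}^{d\Psi^\top}[\widehat{\mathfrak x}_1,\dots,\widehat{\mathfrak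 x}_l]\|_{H^s_x}\lesssim\prod_j\|\widehat{\mathfrak x}_j\|_{E_1}$, the same bounds for $\mathcal A_{-k}^{d\Psi^\top}$ in $\mathcal B(H^1_0,H^s_x)$, and on $(\mathcal V^1(\delta)\cap\mathcal E_s)\times\Xi$: $\|\partial_\nu^\alpha\mathcal R_M^{d\Psi^\top}[\widehat q]\|_{E_{s+M+1}}\lesssim\|\widehat q\|_{H^s_x}+\|w\|_{H^s_x}\|\widehat q\|_{H^1_x}$, $\|d^l(\partial_\nu^\alpha\mathcal R_M^{d\Psi^\top}[\widehat q])[\widehat{\mathfrak x}_1,\dots,\widehat{\mathfrak x}_l]\|_{E_{s+M+1}}\lesssim\|\widehat q\|_{H^s_x}\prod_j\|\widehat{\mathfrak x}_j\|_{E_1}+\|\widehat q\|_{H_x^1}\sum_j\|\widehat{\mathfrak x}_j\|_{E_s}\prod_{i\ne j}\|\widehat{\mathfrak x}_i\|_{E_1}+\|\widehat q\|_{H^1_x}\|w\|_{H_x^s}\prod_j\|\widehat{\mathfrak x}_j\|_{E_1}$. (Constants depend on $s,M,l,\alpha$.) *)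

(* Defs.v *)
From HB Require Import structures.
From mathcomp Require Import all_boot all_order all_algebra.
From mathcomp Require Import finmap.
From mathcomp Require Import complex.
From mathcomp Require Import all_classical all_reals all_analysis.
Set Implicit Arguments.
Unset Strict Implicit.
Unset Printing Implicit Defensive.
Import Order.TTheory GRing.Theory Num.Theory.
Import numFieldNormedType.Exports.
Local Open Scope classical_set_scope.
Local Open Scope ring_scope.

(** A member of a scale (H^s, E_s, operators between them) is a domain inside
    a fixed ambient vector space together with a norm that is meaningful on
    that domain, so that one function can be smooth for many pairs of norms. *)
Record nspace (R : realType) (V : lmodType R) :=
  NSpace { dom : set V ; nrm : V -> R }.

Section NSpaces.
Variable R : realType.

Definition subsp (V : lmodType R) (X : nspace V) (A : set V) : nspace V :=
  NSpace (dom X `&` A) (nrm X).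

Definition prodsp (V W : lmodType R) (X : nspace V) (Y : nspace W) :
    nspace (V * W)%type :=
  NSpace [set p | dom X p.1 /\ dom Y p.2] (fun p => nrm X p.1 + nrm Y p.2).

(** The bounded operators B(X, Y).  An operator is represented by a function on
    the ambient space whose values outside [dom X] are irrelevant: two
    functions agreeing on [dom X] are at distance 0. *)
Definition Bop (V W : lmodType R) (X : nspace V) (Y : nspace W) :
    nspace (V -> W) :=
  NSpace
    [set T | [/\ forall v, dom X v -> dom Y (T v),
                 forall (a : R) u v, dom X u -> dom X v ->
                   T (a *: u + v) = a *: T u + T v &
                 exists C : R, forall v, dom X v -> nrm Y (T v) <= C * nrm X v]]
    (fun T => sup [set nrm Y (T v) | v in [set v | dom X v /\ nrm X v <= 1]]).

Definition nball (V : lmodType R) (X : nspace V) (c : V) (r : R) : set V :=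
  [set x | dom X x /\ nrm X (x - c) < r].

Definition nopen (V : lmodType R) (X : nspace V) (U : set V) :=
  U `<=` dom X /\
  forall x, U x -> exists2 r : R, 0 < r & nball X x r `<=` U.

Definition all_in (V : lmodType R) (X : nspace V) (vs : seq V) :=
  forall v, v \in vs -> dom X v.

Definition nprod (V : lmodType R) (X : nspace V) (vs : seq V) : R :=
  \prod_(v <- vs) nrm X v.

(** sum_j |v_j|_{X1} prod_{i <> j} |v_i|_{X0} *)
Definition ntame (V : lmodType R) (X1 X0 : nspace V) (vs : seq V) : R :=
  \sum_(j < size vs)
     nrm X1 vs`_j * \prod_(i < size vs | i != j) nrm X0 vs`_i.

(** [is_jet X Y U f D]: f : U -> Y is C^infinity in the sense of Frechet, and
    [D x [:: v_1; ...; v_l]] is its l-th derivative d^l f(x)[v_1, ..., v_l].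
    The last condition is Frechet differentiability of the l-th derivative,
    as a map into the l-linear bounded maps with the operator norm; it makes
    multilinearity in the first slot propagate to all slots.  Linearity is
    stated through the norm of Y because of the convention of [Bop]. *)
Definition is_jet (V W : lmodType R) (X : nspace V) (Y : nspace W) (U : set V)
    (f : V -> W) (D : V -> seq V -> W) :=
  [/\ forall x, U x -> D x [::] = f x,
      forall x vs, U x -> all_in X vs -> dom Y (D x vs),
      forall x (a : R) h k vs, U x -> dom X h -> dom X k -> all_in X vs ->
        nrm Y (D x ((a *: h + k) :: vs)
               - (a *: D x (h :: vs) + D x (k :: vs))) = 0,
      forall x (l : nat), U x -> exists C : R,
        forall vs, size vs = l -> all_in X vs ->
          nrm Y (D x vs) <= C * nprod X vs &
      forall x (l : nat) (e : R), U x -> 0 < e -> exists2 r : R, 0 < r &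
        forall h, dom X h -> nrm X h < r -> U (x + h) ->
        forall vs, size vs = l -> all_in X vs ->
          nrm Y (D (x + h) vs - D x vs - D x (h :: vs))
            <= e * nrm X h * nprod X vs].

(** Real analyticity: local norm-convergent power series.  If U is not open
    (as the cone of actions below), the expansions are required on U only. *)
Definition analytic (V W : lmodType R) (X : nspace V) (Y : nspace W)
    (U : set V) (f : V -> W) (D : V -> seq V -> W) :=
  is_jet X Y U f D /\
  forall x, U x -> exists r C : R,
    [/\ 0 < r,
        forall vs, all_in X vs ->
          nrm Y (D x vs) <= C * (size vs)`!%:R / r ^+ size vs * nprod X vs &
        forall h, dom X h -> nrm X h < r -> U (x + h) ->
          (fun N : nat => nrm Y (f (x + h)
             - \sum_(l < N) (l`!%:R : R)^-1 *: D x (nseq l h))) @ \oo --> 0].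

End NSpaces.

(** u : int -> C stands for sum_n u_n e^{i 2 pi n x} on R/Z.  [Rcomplex R] is
    R[i] seen as a real vector space. *)
Section Fourier.
Variable R : realType.
Implicit Types (u v : int -> Rcomplex R) (s : R).

Definition dist := (int -> Rcomplex R)%type.

Definition zsum (f : int -> R) : R :=
  lim ((fun N : nat => \sum_(k < N.*2.+1) f (k%:Z - N%:Z)) @ \oo).

Definition csum (f : int -> R[i]) : R[i] :=
  Complex (zsum (fun n => complex.Re (f n))) (zsum (fun n => complex.Im (f n))).

Definition jbr (n : int) : R := Num.max 1 (`|n|%N%:R).

Definition Hs_sum s u : \bar R :=
  \esum_(n in [set: int])
    (jbr n `^ (2 * s) * (complex.Re (u n) ^+ 2 + complex.Im (u n) ^+ 2))%:E.

Definition real_valued u := forall n : int, u (- n) = conjc (u n).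

Definition Hs s : nspace dist :=
  NSpace [set u | real_valued u /\ (Hs_sum s u < +oo)%E]
         (fun u => Num.sqrt (fine (Hs_sum s u))).

Definition Hs0 s : nspace dist := subsp (Hs s) [set u | u 0 = 0].

Definition Sperp (S : {fset nat}) : pred int :=
  fun n => (n != 0) && (`|n|%N \notin S).

Definition Hsperp (S : {fset nat}) s : nspace dist :=
  subsp (Hs s) [set u | forall n, ~~ Sperp S n -> u n = 0].

Definition Pperp (S : {fset nat}) (u : dist) : dist :=
  fun n => if Sperp S n then u n else 0.

Definition dx (m : int) (u : dist) : dist :=
  fun n => if n == 0 then 0
           else (Complex 0 (2 * pi * n%:~R : R) : R[i]) ^ m * (u n : R[i]).

(** product of a function and a distribution *)
Definition pmul (u v : dist) : dist :=
  fun n => csum (fun m => (u (n - m) : R[i]) * (v m : R[i])).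

(** int_{R/Z} u v dx for real valued u, v *)
Definition l2dot (u v : dist) : R :=
  zsum (fun n => complex.Re ((u n : R[i]) * (v (- n) : R[i]))).

(** The symplectic form int (d_x^{-1} u) v.  On sequences it is
    sum_n (i 2 pi n)^{-1} z_n z'_{-n}, the form dual to the bracket
    {z_n, z_k} = i 2 pi n delta_{k,-n}. *)
Definition WL2 (u v : dist) : R := l2dot (dx (-1) u) v.

Definition Hkdv (u : dist) : R :=
  2^-1 * l2dot (dx 1 u) (dx 1 u) + l2dot u (pmul u u).

Definition Rsp : nspace (R^o : lmodType R) := NSpace setT (fun x => `|x : R|).

End Fourier.

Arguments Hs R s : clear implicits.
Arguments Hs0 R s : clear implicits.
Arguments Rsp R : clear implicits.
Arguments Hsperp R S s : clear implicits.

Section Birkhoff.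
Variable R : realType.

(** Action variables I_k, k >= 1, with sum_k k^3 |I_k| < oo (the actions of
    elements of h^1_0, on which H^kdv is defined). *)
Definition act_sum (I : nat -> R^o) : \bar R :=
  \esum_(k in [set: nat]) (k%:R ^+ 3 * `|I k : R|)%:E.

Definition actsp : nspace (nat -> R^o) :=
  NSpace [set I | I 0%N = 0 /\ (act_sum I < +oo)%E] (fun I => fine (act_sum I)).

Definition actcone : set (nat -> R^o) :=
  dom actsp `&` [set I | forall k, 0 <= (I k : R)].

Definition act_e (n : nat) : nat -> R^o := fun k => (k == n)%:R.

Definition actions (z : dist R) : nat -> R^o :=
  fun k => if k == 0%N then 0
           else (2 * pi * k%:R)^-1
                * complex.Re ((z k%:Z : R[i]) * (z (- k%:Z) : R[i])).

(** h^0_0 and L^2_0 have the same coordinate description, [Hs0 0]. *)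
Record birkhoff := Birkhoff {
  Psik : dist R -> dist R ;
  dPsik : dist R -> seq (dist R) -> dist R ;
  Phik : dist R -> dist R ;
  dPhik : dist R -> seq (dist R) -> dist R ;
  Ho : (nat -> R^o) -> R^o ;
  dHo : (nat -> R^o) -> seq (nat -> R^o) -> R^o ;
  Psik_analytic : analytic (Hs0 R 0) (Hs0 R 0) (dom (Hs0 R 0)) Psik dPsik ;
  Phik_analytic : analytic (Hs0 R 0) (Hs0 R 0) (dom (Hs0 R 0)) Phik dPhik ;
  PsikK : forall z, dom (Hs0 R 0) z -> Phik (Psik z) = z ;
  PhikK : forall u, dom (Hs0 R 0) u -> Psik (Phik u) = u ;
  Psik_symplectic : forall z z1 z2,
    dom (Hs0 R 0) z -> dom (Hs0 R 0) z1 -> dom (Hs0 R 0) z2 ->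
    WL2 (dPsik z [:: z1]) (dPsik z [:: z2]) = WL2 z1 z2 ;
  Psik0 : Psik 0 = 0 ;
  dPsik0 : forall z, dom (Hs0 R 0) z -> dPsik 0 [:: z] = z ;
  Ho_analytic : analytic actsp (Rsp R) actcone Ho dHo ;
  Ho_actions : forall z, dom (Hs0 R 0) z -> dom (Hs0 R 1) (Psik z) ->
    actcone (actions z) /\ Hkdv (Psik z) = Ho (actions z)
}.

End Birkhoff.

(** Maps on the torus T^{S_+} are represented by maps of theta in R^{S_+} that
    are 2 pi-periodic. *)
Section PhaseSpace.
Variables (R : realType) (S : {fset nat}).

Definition RS := {ffun S -> R^o}.
Definition RSsp : nspace RS :=
  NSpace setT (fun y : RS => Num.sqrt (\sum_(j : S) (y j : R) ^+ 2)).
Definition dotS (y z : RS) : R := \sum_(j : S) (y j : R) * (z j : R).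
Definition eS (i : S) : RS := [ffun j => (j == i)%:R].

Definition E := ((RS * RS) * dist R)%type.
Definition Esp (s : R) : nspace E :=
  prodsp (prodsp RSsp RSsp) (Hsperp R S s).

Definition xth (x : E) : RS := x.1.1.
Definition xy (x : E) : RS := x.1.2.
Definition xw (x : E) : dist R := x.2.

Definition dotE (x1 x2 : E) : R :=
  dotS (xth x1) (xth x2) + dotS (xy x1) (xy x2) + l2dot (xw x1) (xw x2).

(** (sum_j dy_j /\ dtheta_j) + W_{L^2_0} *)
Definition WE (x1 x2 : E) : R :=
  dotS (xy x1) (xth x2) - dotS (xy x2) (xth x1) + WL2 (xw x1) (xw x2).

Definition thshift (k : {ffun S -> int}) (x : E) : E :=
  ([ffun j => xth x j + 2 * pi * (k j)%:~R : R^o], xy x, xw x).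

(** the representative with theta in [0, 2 pi)^{S_+} *)
Definition threduce (x : E) : E :=
  thshift [ffun j => - Num.floor ((xth x j : R) / (2 * pi))] x.

(** the phase space variable x together with the parameter nu *)
Definition P := (E * RS)%type.
Definition Psp (s : R) : nspace P := prodsp (Esp s) RSsp.

(** V^s(delta), and V^s(delta) x Xi *)
Definition Vset (delta s : R) : set E :=
  [set x | nrm RSsp (xy x) < delta /\ nball (Hsperp R S s) 0 delta (xw x)].
Definition VXi (delta : R) (Xi : set RS) (s : R) : set P :=
  [set p | Vset delta s p.1 /\ Xi p.2].
(** (V^s(delta) \cap E_r) x Xi *)
Definition VXiE (delta : R) (Xi : set RS) (s r : R) : set P :=
  VXi delta Xi s `&` [set p | dom (Esp r) p.1].

Definition th_periodic (T : Type) (U : set P) (f : P -> T) :=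
  forall p k, U p -> f (thshift k p.1, p.2) = f p.

(** Directions such that D p (dirs alpha xs) is d_nu^alpha d^l f (p)[xs] for a
    jet D of f in the variables p = (x, nu), where d differentiates in x. *)
Definition dirx (x : E) : P := (x, 0).
Definition dirs (alpha : S -> nat) (xs : seq E) : seq P :=
  flatten [seq nseq (alpha i) ((0, eS i) : P) | i <- enum {: S}] ++ map dirx xs.

(** |d_nu^alpha f| <~ 1 and |d_nu^alpha d^l f[x_1..x_l]| <~ prod_j |x_j|_X *)
Definition unif_bounds (W : lmodType R) (U : set P) (X : nspace E)
    (Y : nspace W) (D : P -> seq P -> W) :=
  (forall alpha, exists C : R, forall p, U p ->
     nrm Y (D p (dirs alpha [::])) <= C) /\
  (forall alpha (l : nat), (1 <= l)%N -> exists C : R, forall p xs,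
     U p -> size xs = l -> all_in X xs ->
     nrm Y (D p (dirs alpha xs)) <= C * nprod X xs).

(** z_n = sqrt (2 pi n I_n) e^{- i theta_n}, z_{-n} = conj z_n for n in S_+ *)
Definition zfin (th I : RS) : dist R :=
  fun n => if (insub `|n|%N : option S) is Some j then
             let r := Num.sqrt (2 * pi * (`|n|%N)%:R * (I j : R)) in
             Complex (r * cos (th j)) (- ((sgz n)%:~R * (r * sin (th j))))
           else 0.

Definition act_ext (nu : RS) : nat -> R^o :=
  fun k => if (insub k : option S) is Some j then nu j else 0.

Variable K : birkhoff R.

(** omega^kdv_n (nu, 0) = d_{I_n} Ho, odd in the nonzero integer n *)
Definition omega (n : int) (nu : RS) : R :=
  (sgz n)%:~R * (dHo K (act_ext nu) [:: act_e R `|n|%N] : R).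

Definition OmegaD (nu : RS) (w : dist R) : dist R :=
  fun n => if Sperp S n then ((omega n nu / (2 * pi * n%:~R)) *: w n) else 0.

Definition OmegaS (nu : RS) (y : RS) : RS :=
  [ffun j : S => \sum_(k : S)
     (dHo K (act_ext nu) [:: act_e R (val j); act_e R (val k)] : R)
      * (y k : R) : R^o].

End PhaseSpace.

Arguments RSsp R S : clear implicits.
Arguments Esp {R} S s.
Arguments Psp {R} S s.

(** Normal form coordinates.  Expansions are indexed by k = 1, ..., M.  The coefficients a_{-k} and
    A_{-k} do not depend on the order M of the expansion; the remainders do.
    Each map comes with its jet (prefix d). *)
Record normal_form (R : realType) (S : {fset nat}) (K : birkhoff R)
    (delta : R) (Xi : set (RS R S)) := NormalForm {
  Psi : P R S -> dist R ;
  dPsi : P R S -> seq (P R S) -> dist R ;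
  Psi_periodic : th_periodic (VXi delta Xi 0) Psi ;
  Psi_smooth : is_jet (Psp S 0) (Hs0 R 0) (VXi delta Xi 0) Psi dPsi ;
  Psi_smooth_s : forall (nu : RS R S) (s : nat), Xi nu ->
    is_jet (Esp S s%:R) (Hs0 R s%:R)
      (Vset delta 0 `&` dom (Esp S s%:R))
      (fun x => Psi (x, nu))
      (fun x vs => dPsi (x, nu) (map (@dirx R S) vs)) ;
  Psi_inj : forall nu x x', Xi nu -> Vset delta 0 x -> Vset delta 0 x' ->
    Psi (x, nu) = Psi (x', nu) -> exists k, x' = thshift k x ;
  (* the inverse, lifted locally from the torus to R^{S_+}, is smooth *)
  Psi_inv_smooth : forall (nu : RS R S) (s : nat) (x : E R S), Xi nu ->
    Vset delta 0 x -> dom (Esp S s%:R) x ->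
    exists (r : R) (g : dist R -> E R S) (dg : dist R -> seq (dist R) -> E R S),
      [/\ 0 < r,
          is_jet (Hs0 R s%:R) (Esp S s%:R)
            (nball (Hs0 R s%:R) (Psi (x, nu)) r) g dg,
          g (Psi (x, nu)) = x &
          forall u, nball (Hs0 R s%:R) (Psi (x, nu)) r u ->
            [/\ Vset delta 0 (g u), dom (Esp S s%:R) (g u) &
                Psi (g u, nu) = u]] ;
  Psi_symplectic : forall p x1 x2, VXi delta Xi 0 p ->
    dom (Esp S 0) x1 -> dom (Esp S 0) x2 ->
    WL2 (dPsi p [:: dirx x1]) (dPsi p [:: dirx x2]) = WE x1 x2 ;
  Psi_kdv : forall th y nu, Vset delta 0 (th, y, 0) -> Xi nu ->
    Psi (th, y, 0, nu) = Psik K (zfin th (nu + y)) ;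

  (* d Psi_nu(x)^T : L^2_0 -> E *)
  dPsiT : P R S -> dist R -> E R S ;
  dPsiT_transpose : forall p q, VXi delta Xi 0 p -> dom (Hs0 R 0) q ->
    dom (Esp S 0) (dPsiT p q) /\
    forall x, dom (Esp S 0) x ->
      dotE (dPsiT p q) x = l2dot q (dPsi p [:: dirx x]) ;

  aPsi : nat -> P R S -> dist R ;
  daPsi : nat -> P R S -> seq (P R S) -> dist R ;
  RPsi : nat -> P R S -> dist R ;
  dRPsi : nat -> P R S -> seq (P R S) -> dist R ;
  aPsi_periodic : forall k, (1 <= k)%N ->
    th_periodic (VXi delta Xi 0) (aPsi k) ;
  RPsi_periodic : forall M, (1 <= M)%N ->
    th_periodic (VXi delta Xi 0) (RPsi M) ;
  Psi_expansion : forall M p, (1 <= M)%N -> VXi delta Xi 0 p ->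
    Psi p = Psik K (zfin (xth p.1) (p.2 + xy p.1)) + xw p.1
      + \sum_(1 <= k < M.+1) pmul (aPsi k p) (dx (- k%:Z) (xw p.1))
      + RPsi M p ;
  RPsi_w0 : forall M th y nu, (1 <= M)%N -> Vset delta 0 (th, y, 0) -> Xi nu ->
    RPsi M (th, y, 0, nu) = 0 ;
  aPsi_smooth : forall k (s : nat), (1 <= k)%N ->
    is_jet (Psp S 0) (Hs R s%:R) (VXi delta Xi 0) (aPsi k) (daPsi k) ;
  RPsi_smooth : forall M (s : nat), (1 <= M)%N ->
    is_jet (Psp S s%:R) (Hs R (s + M + 1)%:R) (VXiE delta Xi 0 s%:R)
      (RPsi M) (dRPsi M) ;
  aPsi_est : forall k (s : nat), (1 <= k)%N ->
    unif_bounds (VXi delta Xi 0) (Esp S 0) (Hs R s%:R) (daPsi k) ;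
  RPsi_est0 : forall M (s : nat) alpha, (1 <= M)%N -> exists C : R,
    forall p, VXiE delta Xi 0 s%:R p ->
      nrm (Hs R (s + M + 1)%:R) (dRPsi M p (dirs alpha [::]))
        <= C * nrm (Hs R s%:R) (xw p.1) ;
  RPsi_est : forall M (s : nat) alpha (l : nat), (1 <= M)%N -> (1 <= l)%N ->
    exists C : R, forall p xs, VXiE delta Xi 0 s%:R p ->
      size xs = l -> all_in (Esp S s%:R) xs ->
      nrm (Hs R (s + M + 1)%:R) (dRPsi M p (dirs alpha xs))
        <= C * (ntame (Esp S s%:R) (Esp S 0) xs
                + nrm (Hs R s%:R) (xw p.1) * nprod (Esp S 0) xs) ;

  aT : nat -> P R S -> dist R ;
  daT : nat -> P R S -> seq (P R S) -> dist R ;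
  AT : nat -> P R S -> dist R -> dist R ;
  dAT : nat -> P R S -> seq (P R S) -> dist R -> dist R ;
  RT : nat -> P R S -> dist R -> E R S ;
  dRT : nat -> P R S -> seq (P R S) -> dist R -> E R S ;
  aT_periodic : forall k, (1 <= k)%N ->
    th_periodic (VXi delta Xi 1) (aT k) ;
  AT_periodic : forall k q, (1 <= k)%N -> dom (Hs0 R 1) q ->
    th_periodic (VXi delta Xi 1) (fun p => AT k p q) ;
  RT_periodic : forall M q, (1 <= M)%N -> dom (Hs0 R 1) q ->
    th_periodic (VXi delta Xi 1) (fun p => RT M p q) ;
  dPsiT_bounded : forall p, VXi delta Xi 1 p ->
    dom (Bop (Hs0 R 1) (Esp S 1)) (dPsiT p) ;
  dPsiT_expansion : forall M p q, (1 <= M)%N -> VXi delta Xi 1 p ->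
    dom (Hs0 R 1) q ->
    dPsiT p q =
      (0, 0,
       Pperp S q
       + Pperp S (\sum_(1 <= k < M.+1) pmul (aT k p) (dx (- k%:Z) q))
       + Pperp S (\sum_(1 <= k < M.+1)
                    pmul (dx (- k%:Z) (xw p.1)) (AT k p q)))
      + RT M p q ;
  aT_smooth : forall k (s : R), (1 <= k)%N -> 1 <= s ->
    is_jet (Psp S 1) (Hs R s) (VXi delta Xi 1) (aT k) (daT k) ;
  AT_smooth : forall k (s : R), (1 <= k)%N -> 1 <= s ->
    is_jet (Psp S 1) (Bop (Hs0 R 1) (Hs R s)) (VXi delta Xi 1)
      (AT k) (dAT k) ;
  RT_smooth : forall M (s : R), (1 <= M)%N -> 1 <= s ->
    is_jet (Psp S s) (Bop (Hs0 R s) (Esp S (s + M%:R + 1)))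
      (VXiE delta Xi 1 s) (RT M) (dRT M) ;
  aT1 : forall p, VXi delta Xi 1 p -> aT 1%N p = - aPsi 1%N p ;
  aT_est : forall k (s : R), (1 <= k)%N -> 1 <= s ->
    unif_bounds (VXi delta Xi 1) (Esp S 1) (Hs R s) (daT k) ;
  AT_est : forall k (s : R), (1 <= k)%N -> 1 <= s ->
    unif_bounds (VXi delta Xi 1) (Esp S 1) (Bop (Hs0 R 1) (Hs R s)) (dAT k) ;
  RT_est0 : forall M (s : R) alpha, (1 <= M)%N -> 1 <= s -> exists C : R,
    forall p q, VXiE delta Xi 1 s p -> dom (Hs0 R s) q ->
      nrm (Esp S (s + M%:R + 1)) (dRT M p (dirs alpha [::]) q)
        <= C * (nrm (Hs R s) q + nrm (Hs R s) (xw p.1) * nrm (Hs R 1) q) ;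
  RT_est : forall M (s : R) alpha (l : nat), (1 <= M)%N -> 1 <= s ->
    (1 <= l)%N -> exists C : R,
    forall p xs q, VXiE delta Xi 1 s p -> size xs = l ->
      all_in (Esp S s) xs -> dom (Hs0 R s) q ->
      nrm (Esp S (s + M%:R + 1)) (dRT M p (dirs alpha xs) q)
        <= C * (nrm (Hs R s) q * nprod (Esp S 1) xs
                + nrm (Hs R 1) q * ntame (Esp S s) (Esp S 1) xs
                + nrm (Hs R 1) q * nrm (Hs R s) (xw p.1)
                  * nprod (Esp S 1) xs) ;

  (* ekdv nu is the value Ho(nu, 0) of the Hamiltonian on the torus y = 0,
     w = 0; without it the expansion would fail at y = 0, w = 0 *)
  ekdv : RS R S -> R ;
  Rkdv : P R S -> R^o ;
  dRkdv : P R S -> seq (P R S) -> R^o ;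
  gRkdv : P R S -> E R S ;
  dgRkdv : P R S -> seq (P R S) -> E R S ;
  Rkdv_periodic : th_periodic (VXi delta Xi 1) Rkdv ;
  Hkdv_expansion : forall th y w nu, VXi delta Xi 1 (th, y, w, nu) ->
    Hkdv (Psi (th, y, w, nu)) =
      ekdv nu
      + \sum_(j : S) omega K (val j)%:Z nu * (y j : R)
      + 2^-1 * l2dot (OmegaD K nu w) w
      + 2^-1 * dotS (OmegaS K nu y) y
      + (Rkdv (th, y, w, nu) : R) ;
  Rkdv_smooth : is_jet (Psp S 1) (Rsp R) (VXi delta Xi 1) Rkdv dRkdv ;
  Rkdv_cubic : exists C : R, forall p, VXi delta Xi 1 p ->
    `|Rkdv p : R|
      <= C * (nrm (RSsp R S) (xy p.1) + nrm (Hs R 1) (xw p.1)) ^+ 3 ;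
  gRkdv_gradient : forall p x, VXi delta Xi 1 p -> dom (Esp S 1) x ->
    (dRkdv p [:: dirx x] : R) = dotE (gRkdv p) x ;
  gRkdv_smooth : forall s : R, 1 <= s ->
    is_jet (Psp S s) (Esp S s) (VXiE delta Xi 1 s) gRkdv dgRkdv
}.

(* Main.v *)
Require Import Defs.
From HB Require Import structures.
From mathcomp Require Import all_boot all_order all_algebra.
From mathcomp Require Import finmap complex.
From mathcomp Require Import all_classical all_reals all_analysis.
From mathcomp Require Import ring lra zify.
Set Implicit Arguments.
Unset Strict Implicit.
Unset Printing Implicit Defensive.
Import Order.TTheory GRing.Theory Num.Theory.
Import numFieldNormedType.Exports.
Local Open Scope classical_set_scope.
Local Open Scope ring_scope.

(** The transpose is determined by its pairings with a real basis (e_c) of phase space: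
    (dPsi^T [q], e_c) = (q, dPsi [e_c]).  The right hand side makes sense as soon as the rows
    dPsi [e_c] decay fast enough, and it is taken as the definition of the extension
    ([of_rows], [dTransp]).  The coefficients a_{-k} are kept, and the remainder is defined as the
    difference ([dRem]).  All properties of the remainder are then estimates of rows and of
    their derivatives.

    On H^s, s >= 1.  There the given expansion of the transpose holds.  A smooth function on an
    open set has only one jet ([gjet_uniq]), so every derivative of (q, dPsi [e_c]) is the
    corresponding derivative of the expansion ([dPsi_pair]), and the remainder consists of the
    given smoothing terms ([dRem_expansion]).  The tame estimates follow from the given
    ones by the Leibniz rule ([dRem_ae_tame]), where only w can receive a direction in the high norm.

    On H^{-s}, s <= M + 1.  Let al = M + 3, and take the expansion to the much higher order
    m = 4 al.  The entry of the remainder in row c and column n has two bounds.  Applied to the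
    mode of frequency n, of H^1 norm <n>, the expansion gives <n> <c>^{-m-2}.  On the other hand
    Psi is symplectic, dPsi^T d_x^{-1} dPsi = J, so g = d_x^{-1} dPsi [e_c] solves
      g + sum_k a_{-k} d_x^{-k} g + (smoothing) g = J e_c   on the frequencies in S^perp,
    an elliptic equation of order 0.  A bootstrap that gains one derivative at each step shows
    that g has decay of any order L <= m, with a constant <c>^L ([elliptic_bootstrap],
    [dPsi_prim_decay]).
    For L = 2 al + 2 the geometric mean of the two bounds is <c>^{-al} <n>^{-al} ([rem_row_bd]), and
    such a matrix maps H^{-s} to E_{M+1-s} ([of_rows_ng]).  The terms of orders M < k <= m, which
    have to be added back, map H^{-s} to H^{M+1-s} because a product with a smooth function
    loses no derivative ([pmul_hsg], [mid_term_ng]).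

    Derivatives in (x, nu) are treated by differentiating the symplectic identity and by
    induction on the number of directions.  Smoothness of the whole matrix follows from
    smoothness of its entries and from locally uniform bounds on all derivatives
    ([gjet_weak]).  The uniform constants come from the same argument, applied on the whole
    neighbourhood with the directions of the estimates ([unif_est]). *)

(** * Complex coefficients, brackets and sums over the integers *)

Section Complex1.
Variable R : realType.
Implicit Types z w : R[i].

(** The l^1 norm of C = R^2.  It is equivalent to the modulus, submultiplicative, and
    piecewise linear in the real and imaginary parts. *)
Definition cabs z : R := `|complex.Re z| + `|complex.Im z|.

Lemma complexP z w : complex.Re z = complex.Re w ->
  complex.Im z = complex.Im w -> z = w.
Proof. by case: z w => [a b] [c d] /= -> ->. Qed.

Lemma cReD z w : complex.Re (z + w) = complex.Re z + complex.Re w.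
Proof. by case: z w => [a b] [c d]. Qed.
Lemma cImD z w : complex.Im (z + w) = complex.Im z + complex.Im w.
Proof. by case: z w => [a b] [c d]. Qed.
Lemma cReN z : complex.Re (- z) = - complex.Re z.
Proof. by case: z. Qed.
Lemma cImN z : complex.Im (- z) = - complex.Im z.
Proof. by case: z. Qed.
Lemma cReM z w : complex.Re (z * w) =
  complex.Re z * complex.Re w - complex.Im z * complex.Im w.
Proof. by case: z w => [a b] [c d]. Qed.
Lemma cImM z w : complex.Im (z * w) =
  complex.Re z * complex.Im w + complex.Im z * complex.Re w.
Proof. by case: z w => [a b] [c d]. Qed.
Lemma cReZ (a : R) (z : Rcomplex R) : complex.Re (a *: z) = a * complex.Re z.
Proof. by case: z. Qed.
Lemma cImZ (a : R) (z : Rcomplex R) : complex.Im (a *: z) = a * complex.Im z.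
Proof. by case: z. Qed.
Lemma cRe_sum I (s : seq I) (P : pred I) (F : I -> R[i]) :
  complex.Re (\sum_(i <- s | P i) F i) = \sum_(i <- s | P i) complex.Re (F i).
Proof. exact: (big_morph _ cReD erefl). Qed.
Lemma cIm_sum I (s : seq I) (P : pred I) (F : I -> R[i]) :
  complex.Im (\sum_(i <- s | P i) F i) = \sum_(i <- s | P i) complex.Im (F i).
Proof. exact: (big_morph _ cImD erefl). Qed.

Lemma cabs_ge0 z : 0 <= cabs z.
Proof. by rewrite addr_ge0. Qed.
Lemma cabs0 : cabs 0 = 0.
Proof. by rewrite /cabs /= normr0 addr0. Qed.
Lemma cabs_eq0 z : cabs z <= 0 -> z = 0.
Proof.
move=> h; have h1 := normr_ge0 (complex.Re z).
have h2 := normr_ge0 (complex.Im z); rewrite /cabs in h.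
by apply: complexP => /=; apply/normr0_eq0; lra.
Qed.
Lemma cabsD z w : cabs (z + w) <= cabs z + cabs w.
Proof.
rewrite /cabs cReD cImD.
have := ler_normD (complex.Re z) (complex.Re w).
have := ler_normD (complex.Im z) (complex.Im w); lra.
Qed.
Lemma cabsM z w : cabs (z * w) <= cabs z * cabs w.
Proof.
rewrite /cabs cReM cImM.
apply: le_trans (lerD (ler_normB _ _) (ler_normD _ _)) _.
by rewrite !normrM; lra.
Qed.
Lemma cabsZ a (z : Rcomplex R) : cabs (a *: z) = `|a| * cabs z.
Proof. by rewrite /cabs cReZ cImZ !normrM -mulrDr. Qed.
Lemma cabs_conj z : cabs (conjc z) = cabs z.
Proof. by case: z => a b; rewrite /cabs /= normrN. Qed.
Lemma cabs_sum I (s : seq I) (P : pred I) (F : I -> R[i]) :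
  cabs (\sum_(i <- s | P i) F i) <= \sum_(i <- s | P i) cabs (F i).
Proof.
elim/big_rec2: _ => [|i x y _ h]; first by rewrite cabs0.
by apply: le_trans (cabsD _ _) _; rewrite lerD2l.
Qed.
Lemma sq_le_cabs z : complex.Re z ^+ 2 + complex.Im z ^+ 2 <= cabs z ^+ 2.
Proof.
rewrite /cabs sqrrD !real_normK ?num_real //.
by rewrite addrAC lerDl mulrn_wge0// mulr_ge0.
Qed.
Lemma cabs_le_sq z : cabs z ^+ 2 <= 2 * (complex.Re z ^+ 2 + complex.Im z ^+ 2).
Proof.
rewrite -(real_normK (num_real (complex.Re z))).
rewrite -(real_normK (num_real (complex.Im z))) /cabs.
by have := sqr_ge0 (`|complex.Re z| - `|complex.Im z|); lra.
Qed.
Lemma Re_le_cabs z : `|complex.Re z| <= cabs z.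
Proof. by rewrite lerDl. Qed.
Lemma Im_le_cabs z : `|complex.Im z| <= cabs z.
Proof. by rewrite lerDr. Qed.

Lemma cconjD z w : conjc (z + w) = conjc z + conjc w.
Proof. by apply: complexP; case: z w => [a b] [c d] //=; rewrite opprD. Qed.
Lemma cconjM z w : conjc (z * w) = conjc z * conjc w.
Proof. by apply: complexP; case: z w => [a b] [c d] //=; ring. Qed.
Lemma cconjZ a (z : Rcomplex R) : conjc (a *: z) = a *: (conjc z : Rcomplex R).
Proof. by apply: complexP; case: z => [c d] //=; rewrite mulrN. Qed.
End Complex1.

Section Brackets.
Variable R : realType.
Implicit Types (n m : int) (r s : R).

Lemma jbr_ge1 n : 1 <= jbr R n.
Proof. by rewrite le_max lexx. Qed.
Lemma jbr_gt0 n : 0 < jbr R n.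
Proof. exact: lt_le_trans ltr01 (jbr_ge1 n). Qed.
Hint Resolve jbr_ge1 jbr_gt0 : core.
Lemma jbr_ge0 n : 0 <= jbr R n. Proof. exact: ltW. Qed.
Lemma jbr_neq0 n : jbr R n != 0. Proof. by rewrite gt_eqF. Qed.
Lemma jbrN n : jbr R (- n) = jbr R n.
Proof. by rewrite /jbr abszN. Qed.
Lemma jbrE n : n != 0 -> jbr R n = `|n|%N%:R.
Proof.
by move=> n0; rewrite /jbr max_r// ler1n absz_gt0.
Qed.
Lemma jbrD n m : jbr R (n + m) <= 2 * (jbr R n * jbr R m).
Proof.
have h1 := jbr_ge1 n; have h2 := jbr_ge1 m.
have h : jbr R n + jbr R m <= 2 * (jbr R n * jbr R m) by nra.
apply: le_trans h; rewrite {1}/jbr ge_max; apply/andP; split; first by lra.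
apply: (@le_trans _ _ (`|n|%N%:R + `|m|%N%:R)).
  by rewrite -natrD ler_nat; lia.
by apply: lerD; rewrite le_max lexx orbT.
Qed.

Definition jpow n r : R := jbr R n `^ r.
Lemma jpow_gt0 n r : 0 < jpow n r. Proof. exact: powR_gt0. Qed.
Lemma jpow_ge0 n r : 0 <= jpow n r. Proof. exact: powR_ge0. Qed.
Lemma jpowD n r s : jpow n (r + s) = jpow n r * jpow n s.
Proof. by rewrite /jpow powRD// jbr_neq0 implybT. Qed.
Lemma jpow0 n : jpow n 0 = 1. Proof. exact: powRr0. Qed.
Lemma jpowNK n r : jpow n r * jpow n (- r) = 1.
Proof. by rewrite -jpowD subrr jpow0. Qed.
Lemma jpowN n r : jpow n (- r) = (jpow n r)^-1.
Proof. exact: powRN. Qed.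
Lemma ler_jpow n r s : r <= s -> jpow n r <= jpow n s.
Proof. by move=> h; apply: ler_powR. Qed.
Lemma jpow_ge1 n r : 0 <= r -> 1 <= jpow n r.
Proof. by move=> /(ler_jpow n); rewrite jpow0. Qed.
Lemma jpow_nat n (k : nat) : jpow n k%:R = jbr R n ^+ k.
Proof. by rewrite /jpow powR_mulrn// jbr_ge0. Qed.
Lemma jpow_opp n r : jpow (- n) r = jpow n r.
Proof. by rewrite /jpow jbrN. Qed.
Lemma jpow_sq n r : jpow n (2 * r) = jpow n r ^+ 2.
Proof. by rewrite mulrDl mul1r jpowD. Qed.

(** Peetre's inequality.  For r >= 0 it is the r-th power of <n + m> <= 2 <n> <m>;
    the case r < 0 follows by applying this to - n and n + m. *)
Lemma peetre n m r : jpow (n + m) r <= 2 `^ `|r| * jpow n `|r| * jpow m r.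
Proof.
have aux (a b : int) t : 0 <= t -> jpow (a + b) t <= 2 `^ t * jpow a t * jpow b t.
  move=> t0; rewrite /jpow -!powRM ?mulr_ge0 ?jbr_ge0//.
  by apply: ge0_ler_powR; rewrite ?nnegrE ?mulr_ge0 ?jbr_ge0// -mulrA jbrD.
have [r0|r0] := ger0P r; first exact: aux.
have := aux (- n) (n + m) (- r); rewrite addKr jpow_opp oppr_ge0.
move=> /(_ (ltW r0)) h.
have -> : jpow (n + m) r = (jpow (n + m) r * jpow m r) * jpow m (- r).
  by rewrite -mulrA jpowNK mulr1.
apply: le_trans (ler_wpM2l _ h) _; first by rewrite mulr_ge0 ?jpow_ge0.
set x := 2 `^ _; have := jpowNK (n + m) r; set y := jpow (n + m) r.
set z := jpow (n + m) (- r) => yz; rewrite le_eqVlt; apply/orP; left; apply/eqP.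
transitivity ((y * z) * (x * jpow n (- r) * jpow m r)); first by ring.
by rewrite yz mul1r.
Qed.

Lemma peetre_le n m r rho : `|r| <= rho ->
  jpow (n + m) r <= 2 `^ rho * jpow n rho * jpow m r.
Proof.
move=> h; apply: le_trans (peetre n m r) _.
rewrite ler_wpM2r ?jpow_ge0//; apply: ler_pM; rewrite ?powR_ge0 ?ler_jpow//.
by apply: ler_powR => //; rewrite ler1n.
Qed.
End Brackets.

Section Sums.
Variable R : realType.
Implicit Types (f g : int -> R) (s : seq int) (C D : R).

Lemma ler_sum_sub (I : eqType) (f : I -> R) (s s' : seq I) :
  (forall n, 0 <= f n) -> uniq s -> uniq s' ->
  {subset s <= s'} -> \sum_(n <- s) f n <= \sum_(n <- s') f n.
Proof.
move=> f0 us us' ss'; rewrite [leRHS](bigID (mem s)) /=.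
rewrite -[X in _ <= X + _]big_filter [X in _ <= X + _](perm_big s) /=; last first.
  apply: uniq_perm; [by rewrite filter_uniq|by []|move=> x].
  by rewrite mem_filter andb_idr// => xs; exact: ss'.
by rewrite lerDl sumr_ge0.
Qed.

Lemma sum_inv_sq (N : nat) : \sum_(k < N) jpow k%:Z (-2) <= 3 :> R.
Proof.
suff h m : \sum_(k < m.+2) jpow k%:Z (-2) <= 3 - m.+1%:R^-1 :> R.
  case: N => [|[|N]]; first by rewrite big_ord0.
    rewrite big_ord_recr big_ord0 /= add0r jpowN jpow_nat /jbr absz_nat.
    by rewrite max_l ?ler01// expr1n invr1 ler1n.
  by apply: le_trans (h N) _; rewrite gerBl invr_ge0.
elim: m => [|m IH].
  rewrite 2!big_ord_recr big_ord0 /= add0r !jpowN !jpow_nat /jbr !absz_nat.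
  by rewrite !max_l ?ler01// expr1n invr1; lra.
rewrite big_ord_recr /=; apply: le_trans (lerD IH (lexx _)) _.
rewrite jpowN jpow_nat jbrE// absz_nat.
set x : R := m.+1%:R; have x0 : 0 < x by rewrite ltr0n.
have -> : m.+2%:R = x + 1 by rewrite /x natr1.
rewrite -addrA lerD2l -subr_ge0.
have -> : - (x + 1)^-1 - (- x^-1 + ((x + 1) ^+ 2)^-1)
   = (x * (x + 1) ^+ 2)^-1 by field; rewrite !gt_eqF//; lra.
by rewrite invr_ge0 mulr_ge0// sqr_ge0.
Qed.

Lemma sum_jbr_le s : uniq s -> \sum_(n <- s) jpow n (-2) <= 6 :> R.
Proof.
move=> us; pose N := (\max_(n <- s) `|n|%N).+1.
pose s' := [seq k%:Z | k <- iota 0 N] ++ [seq - k%:Z | k <- iota 0 N].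
have ss' : {subset s <= s'}.
  move=> n ns; have nN : (`|n| < N)%N.
    by rewrite ltnS; exact: (@leq_bigmax_seq _ s xpredT (fun n : int => `|n|%N)).
  rewrite mem_cat; case: (lerP 0 n) => n0; apply/orP; [left|right].
    apply/mapP; exists `|n|%N; first by rewrite mem_iota.
    by rewrite gez0_abs.
  apply/mapP; exists `|n|%N; first by rewrite mem_iota.
  by rewrite ltz0_abs// opprK.
apply: (@le_trans _ _ (\sum_(n <- undup s') jpow n (-2))).
  apply: ler_sum_sub => //; rewrite ?undup_uniq//; first by move=> n; exact: jpow_ge0.
  by move=> n /ss'; rewrite mem_undup.
apply: (@le_trans _ _ (\sum_(n <- s') jpow n (-2))).
  have : subseq (undup s') s' by exact: undup_subseq.
  elim: s' (undup s') {ss'} => [|a s1 IH] [|b s2] //=.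
  - by rewrite big_nil big_cons addr_ge0 ?jpow_ge0// sumr_ge0// => *; exact: jpow_ge0.
  - rewrite [leRHS]big_cons; case: eqP => [->|_] h.
      by rewrite big_cons lerD2l IH.
    by apply: (le_trans (IH _ h)); rewrite lerDr jpow_ge0.
have := sum_inv_sq N; rewrite -(big_mkord xpredT (fun k => jpow k%:Z (-2))).
rewrite /index_iota subn0 big_cat !big_map /=.
under [X in _ + X]eq_bigr do rewrite jpow_opp.
lra.
Qed.

(** Absolute summability with an explicit bound.  [zsum] is a limit over symmetric
    windows, so it is additive and can be reindexed only under such a hypothesis. *)
Definition abss f C := forall s, uniq s -> \sum_(n <- s) `|f n| <= C.

Definition win (N : nat) : seq int := [seq k%:Z - N%:Z | k <- iota 0 N.*2.+1].

Lemma win_uniq N : uniq (win N).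
Proof. by rewrite map_inj_uniq ?iota_uniq// => a b; lia. Qed.
Lemma mem_win N n : (n \in win N) = (`|n| <= N)%N.
Proof.
apply/mapP/idP => [[k]|h]; first by rewrite mem_iota => /= ? ->; lia.
exists (absz (n + N%:Z)); first by rewrite mem_iota; lia.
lia.
Qed.
Lemma win_sub N N' : (N <= N')%N -> {subset win N <= win N'}.
Proof. by move=> h n; rewrite !mem_win => /leq_trans; exact. Qed.
Lemma winE f N : \sum_(k < N.*2.+1) f (k%:Z - N%:Z) = \sum_(n <- win N) f n.
Proof.
rewrite big_map -(big_mkord xpredT (fun k => f (k%:Z - N%:Z))).
by rewrite /index_iota subn0.
Qed.
Lemma zsumE f : zsum f = lim ((fun N => \sum_(n <- win N) f n) @ \oo).
Proof. by rewrite /zsum; under eq_fun do rewrite winE. Qed.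

Lemma abss_pos_cvg f C : abss f C -> (forall n, 0 <= f n) ->
  cvgn (fun N => \sum_(n <- win N) f n).
Proof.
move=> h f0; apply: nondecreasing_is_cvgn.
  by move=> a b ab; apply: ler_sum_sub; rewrite ?win_uniq//; exact: win_sub.
exists C => _ [N _ <-]; apply: le_trans (h _ (win_uniq N)).
by apply: ler_sum => n _; exact: ler_norm.
Qed.

Lemma abss_cvg f C : abss f C -> cvgn (fun N => \sum_(n <- win N) f n).
Proof.
move=> h.
have aux (g : int -> R) : (forall n, 0 <= g n <= `|f n|) ->
    cvgn (fun N => \sum_(n <- win N) g n).
  move=> gf; apply: (@abss_pos_cvg g C) => [s us|n]; last by case/andP: (gf n).
  apply: le_trans (h s us); apply: ler_sum => n _.
  by case/andP: (gf n) => g0 ?; rewrite ger0_norm.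
have -> : (fun N => \sum_(n <- win N) f n) =
  (fun N => \sum_(n <- win N) (`|f n| + f n) / 2) -
  (fun N => \sum_(n <- win N) (`|f n| - f n) / 2).
  apply/funext => N; rewrite !fctE -sumrB; apply: eq_bigr => n _.
  by field.
by apply: is_cvgB; apply: aux => n; have := ler_norm (f n); have := ler_norm (- f n); rewrite normrN; lra.
Qed.

Lemma zsum_cvg f C : abss f C ->
  (fun N => \sum_(n <- win N) f n) @ \oo --> zsum f.
Proof. by move=> h; rewrite zsumE; exact: (abss_cvg h). Qed.

Lemma zsum_eq f l : (fun N => \sum_(n <- win N) f n) @ \oo --> l -> zsum f = l.
Proof. by move=> h; rewrite zsumE; apply/cvg_lim. Qed.

Lemma zsum_le f C : abss f C -> `|zsum f| <= C.
Proof.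
move=> h; have hc : (fun N => `|\sum_(n <- win N) f n|) @ \oo --> `|zsum f|.
  by apply: cvg_norm; exact: zsum_cvg h.
rewrite -(cvg_lim (@Rhausdorff R) hc); apply: limr_le.
  by apply/cvg_ex; exists `|zsum f|; exact: hc.
apply: nearW => N; apply: le_trans (ler_norm_sum _ _ _) _.
exact: h _ (win_uniq N).
Qed.

Lemma abssZ a f C : abss f C -> abss (fun n => a * f n) (`|a| * C).
Proof.
move=> h s us; under eq_bigr do rewrite normrM.
by rewrite -mulr_sumr ler_wpM2l// h.
Qed.
Lemma abss_le f g C : (forall n, `|f n| <= `|g n|) -> abss g C -> abss f C.
Proof. by move=> fg h s us; apply: le_trans (h s us); apply: ler_sum. Qed.

Lemma zsumZ a f C : abss f C -> zsum (fun n => a * f n) = a * zsum f.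
Proof.
move=> h; apply: zsum_eq; under eq_fun do rewrite -mulr_sumr.
by apply: cvgMr; exact: zsum_cvg h.
Qed.
Lemma zsumD f g C D : abss f C -> abss g D ->
  zsum (fun n => f n + g n) = zsum f + zsum g.
Proof.
move=> h1 h2; apply: zsum_eq; under eq_fun do rewrite big_split.
by apply: cvgD; [exact: zsum_cvg h1|exact: zsum_cvg h2].
Qed.

Lemma win_opp N : perm_eq [seq - n | n <- win N] (win N).
Proof.
apply: uniq_perm; rewrite ?win_uniq ?(map_inj_uniq oppr_inj) ?win_uniq// => n.
apply/mapP/idP => [[m]|]; first by rewrite mem_win => h ->; rewrite mem_win abszN.
by exists (- n); rewrite ?opprK// mem_win abszN -mem_win.
Qed.
Lemma zsum_opp f : zsum (fun n => f (- n)) = zsum f.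
Proof.
rewrite !zsumE; congr (lim (_ @ \oo)); apply/funext => N.
by rewrite -(big_map -%R xpredT f) (perm_big _ (win_opp N)).
Qed.
(** The limit is attained as soon as the window contains s. *)
Lemma zsum_fin f s : uniq s -> (forall n, n \notin s -> f n = 0) ->
  zsum f = \sum_(n <- s) f n.
Proof.
move=> us h; apply: zsum_eq; pose N0 := (\max_(n <- s) `|n|%N).
apply: cvg_near_cst; exists N0 => // N /= hN.
rewrite (bigID (mem s)) /= [X in _ + X]big1 ?addr0//.
rewrite -big_filter; apply: perm_big; apply: uniq_perm; rewrite ?filter_uniq ?win_uniq//.
move=> n; rewrite mem_filter andb_idr// => ns; rewrite mem_win.
apply: leq_trans hN; exact: (@leq_bigmax_seq _ s xpredT (fun n : int => `|n|%N)).
Qed.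
Lemma abss_fin f s : uniq s -> (forall n, n \notin s -> f n = 0) ->
  abss f (\sum_(n <- s) `|f n|).
Proof.
move=> us h s' us'; rewrite (bigID (mem s)) /= [X in _ + X]big1 ?addr0//.
  rewrite -big_filter; apply: ler_sum_sub; rewrite ?filter_uniq//.
  by move=> n; rewrite mem_filter => /andP[].
by move=> n /h ->; rewrite normr0.
Qed.

Lemma abss_jbr n : abss (fun m => jpow (n - m) (-2)) 6.
Proof.
move=> s us; under eq_bigr do rewrite ger0_norm ?jpow_ge0//.
rewrite -(big_map (fun m => n - m) xpredT (fun k => jpow k (-2))).
by apply: sum_jbr_le; rewrite map_inj_uniq// => a b; lia.
Qed.
Lemma abss_jbr0 : abss (fun m => jpow m (-2)) 6.
Proof.
by move=> s us; under eq_bigr do rewrite ger0_norm ?jpow_ge0//; exact: sum_jbr_le.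
Qed.
End Sums.

(** * Sobolev norms and weighted supremum norms *)

Arguments jpow {R}.
#[export] Hint Resolve jpow_ge0 jpow_gt0 jbr_ge1 jbr_gt0 jbr_ge0 cabs_ge0 : core.

Section Csum.
Variable R : realType.
Implicit Types (f g : int -> R[i]) (C D : R) (z : R[i]).

Lemma eq_zsum (h k : int -> R) : h =1 k -> zsum h = zsum k.
Proof. by move=> /funext ->. Qed.
Lemma eq_csum f g : f =1 g -> csum f = csum g.
Proof. by move=> /funext ->. Qed.

Definition cabss f C := abss (fun n => cabs (f n)) C.

Lemma cabss_Re f C : cabss f C -> abss (fun n => complex.Re (f n)) C.
Proof.
apply: (@abss_le _ _ (fun n => cabs (f n))) => n.
rewrite [leRHS]ger0_norm ?cabs_ge0//; exact: Re_le_cabs.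
Qed.
Lemma cabss_Im f C : cabss f C -> abss (fun n => complex.Im (f n)) C.
Proof.
apply: (@abss_le _ _ (fun n => cabs (f n))) => n.
rewrite [leRHS]ger0_norm ?cabs_ge0//; exact: Im_le_cabs.
Qed.
Lemma cabss_dom f (b : int -> R) C : (forall n, cabs (f n) <= b n) -> abss b C -> cabss f C.
Proof. by move=> h; apply: (@abss_le _ _ b) => n; rewrite ger0_norm ?cabs_ge0// (le_trans (h n))// ler_norm. Qed.
Lemma cabssM z f C : cabss f C -> cabss (fun n => z * f n) (cabs z * C).
Proof.
move=> h1; have := abssZ (cabs z) h1; rewrite ger0_norm ?cabs_ge0//.
by apply: cabss_dom => n; exact: cabsM.
Qed.
Lemma csum_le f C : cabss f C -> cabs (csum f) <= 2 * C.
Proof.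
move=> h; have := zsum_le (cabss_Re h); have := zsum_le (cabss_Im h).
by rewrite /csum /cabs /=; lra.
Qed.
Lemma csumD f g C D : cabss f C -> cabss g D ->
  csum (fun n => f n + g n) = csum f + csum g.
Proof.
move=> h1 h2; apply: complexP => /=.
  under eq_zsum do rewrite cReD.
  exact: zsumD (cabss_Re h1) (cabss_Re h2).
under eq_zsum do rewrite cImD.
exact: zsumD (cabss_Im h1) (cabss_Im h2).
Qed.
Lemma csumM z f C : cabss f C -> csum (fun n => z * f n) = z * csum f.
Proof.
move=> h; apply: complexP; rewrite ?cReM ?cImM /=.
  under eq_zsum do rewrite cReM -mulNr.
  rewrite (zsumD (abssZ _ (cabss_Re h)) (abssZ _ (cabss_Im h))).
  by rewrite (zsumZ _ (cabss_Re h)) (zsumZ _ (cabss_Im h)) mulNr.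
under eq_zsum do rewrite cImM.
rewrite (zsumD (abssZ _ (cabss_Im h)) (abssZ _ (cabss_Re h))).
by rewrite (zsumZ _ (cabss_Re h)) (zsumZ _ (cabss_Im h)).
Qed.
Lemma csum_opp f : csum (fun n => f (- n)) = csum f.
Proof.
by apply: complexP; rewrite /= ?(zsum_opp (fun n => complex.Re (f n)))
  ?(zsum_opp (fun n => complex.Im (f n))).
Qed.
Lemma csum_conj f C : cabss f C -> csum (fun n => conjc (f n)) = conjc (csum f).
Proof.
move=> h; apply: complexP => /=.
  by congr zsum; apply/funext => n; case: (f n).
rewrite -mulN1r -(zsumZ _ (cabss_Im h)).
by congr zsum; apply/funext => n; case: (f n) => a b /=; rewrite mulN1r.
Qed.
Lemma csum_fin f s : uniq s -> (forall n, n \notin s -> f n = 0) ->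
  csum f = \sum_(n <- s) f n.
Proof.
move=> us h; apply: complexP; rewrite ?cRe_sum ?cIm_sum /=;
  by apply: zsum_fin => // n /h ->.
Qed.
Lemma csum_cvg_re f C : cabss f C ->
  (fun N => complex.Re (\sum_(n <- win N) f n)) @ \oo --> complex.Re (csum f).
Proof. by move=> h; under eq_fun do rewrite cRe_sum; exact: zsum_cvg (cabss_Re h). Qed.
Lemma csum_cvg_im f C : cabss f C ->
  (fun N => complex.Im (\sum_(n <- win N) f n)) @ \oo --> complex.Im (csum f).
Proof. by move=> h; under eq_fun do rewrite cIm_sum; exact: zsum_cvg (cabss_Im h). Qed.
End Csum.

Section CauchySchwarz.
Variables (R : realType) (I : Type).
Implicit Types (s : seq I) (a b : I -> R).

Lemma sum_sq_eq0 s a : \sum_(i <- s) a i ^+ 2 <= 0 ->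
  forall b, \sum_(i <- s) a i * b i = 0.
Proof.
elim: s => [|x s IH]; first by move=> _ b; rewrite big_nil.
rewrite big_cons => h b; rewrite big_cons.
have h1 : 0 <= \sum_(i <- s) a i ^+ 2 by apply: sumr_ge0 => *; exact: sqr_ge0.
have h2 := sqr_ge0 (a x).
rewrite IH; last lra.
have /eqP : a x ^+ 2 = 0 by lra.
by rewrite sqrf_eq0 => /eqP ->; rewrite mul0r addr0.
Qed.

Lemma cauchy_schwarz s a b K1 K2 : 0 <= K1 -> 0 <= K2 ->
  \sum_(i <- s) a i ^+ 2 <= K1 ^+ 2 -> \sum_(i <- s) b i ^+ 2 <= K2 ^+ 2 ->
  \sum_(i <- s) a i * b i <= K1 * K2.
Proof.
move=> k1 k2 h1 h2.
have [K10|K10] := eqVneq K1 0.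
  by move: h1; rewrite K10 expr0n /= => /sum_sq_eq0 ->; rewrite mul0r.
have [K20|K20] := eqVneq K2 0.
  move: h2; rewrite K20 expr0n /= => /sum_sq_eq0 h.
  by under eq_bigr do rewrite mulrC; rewrite h mulr0.
have p1 : 0 < K1 by rewrite lt0r K10.
have p2 : 0 < K2 by rewrite lt0r K20.
apply: (@le_trans _ _ (\sum_(i <- s) ((K2 / K1 / 2) * a i ^+ 2 + (K1 / K2 / 2) * b i ^+ 2))).
  apply: ler_sum => i _; rewrite -subr_ge0.
  have -> : K2 / K1 / 2 * a i ^+ 2 + K1 / K2 / 2 * b i ^+ 2 - a i * b i
    = (K2 * a i - K1 * b i) ^+ 2 / (2 * (K1 * K2)) by field; rewrite ?K10 ?K20.
  by rewrite divr_ge0 ?sqr_ge0// mulr_ge0// mulr_ge0.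
rewrite big_split /= -!mulr_sumr.
have q1 : 0 <= K2 / K1 / 2 by rewrite !divr_ge0.
have q2 : 0 <= K1 / K2 / 2 by rewrite !divr_ge0.
apply: le_trans (lerD (ler_wpM2l q1 h1) (ler_wpM2l q2 h2)) _.
rewrite le_eqVlt; apply/orP; left; apply/eqP; field.
by rewrite ?K10 ?K20.
Qed.

(** The triangle inequality in H^s, on finite partial sums. *)
Lemma minkowski_sum s a b K1 K2 : 0 <= K1 -> 0 <= K2 ->
  \sum_(i <- s) a i ^+ 2 <= K1 ^+ 2 -> \sum_(i <- s) b i ^+ 2 <= K2 ^+ 2 ->
  \sum_(i <- s) (a i + b i) ^+ 2 <= (K1 + K2) ^+ 2.
Proof.
move=> k1 k2 h1 h2; have h3 := cauchy_schwarz k1 k2 h1 h2.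
have e x y : (x + y) ^+ 2 = x ^+ 2 + 2 * (x * y) + y ^+ 2 :> R by ring.
under eq_bigr do rewrite e.
by rewrite !big_split /= -mulr_sumr e; lra.
Qed.
End CauchySchwarz.

Section SobolevNorm.
Variable R : realType.
Implicit Types (u v : dist R) (s r : R) (C K : R).

(** The bound Hs_sum s u <= C, tested on finite partial sums ([Hs_sumP]). *)
Definition hsq s C u := forall t, uniq t ->
  \sum_(n <- t) jpow n (2 * s) * (complex.Re (u n) ^+ 2 + complex.Im (u n) ^+ 2) <= C.

Lemma Hs_sumP s u C : (Hs_sum s u <= C%:E)%E <-> hsq s C u.
Proof.
split=> h.
  move=> t ut; rewrite -lee_fin; apply: le_trans h; apply: esum_ge.
  exists [set` t]; last by rewrite -fsbig_seq// sumEFin.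
  by split=> //; exact: finite_seq.
rewrite /Hs_sum /esum; apply: ge_ereal_sup => _ [A [fA _] <-].
by rewrite fsbig_finite// sumEFin lee_fin; apply: h; exact: fset_uniq.
Qed.

Lemma Hs_sum_ge0 s u : (0 <= Hs_sum s u)%E.
Proof.
apply: esum_ge0 => n _; rewrite lee_fin mulr_ge0// ?powR_ge0//.
by rewrite addr_ge0 ?sqr_ge0.
Qed.

(** u lies in H^s and its norm is at most K ([hsgP]). *)
Definition hsg s K u := [/\ real_valued u, 0 <= K & hsq s (K ^+ 2) u].

Lemma hsgP s K u : hsg s K u <-> dom (Hs R s) u /\ nrm (Hs R s) u <= K.
Proof.
split=> [[ru K0 /Hs_sumP h]|[[ru fu] h]].
  have fin : Hs_sum s u \is a fin_num.
    by rewrite ge0_fin_numE ?Hs_sum_ge0//; apply: le_lt_trans h (ltry _).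
  split; first by split=> //; apply: le_lt_trans h (ltry _).
  rewrite /= -[leRHS](ger0_norm K0) -sqrtr_sqr ler_sqrt ?sqr_ge0//.
  by rewrite -lee_fin fineK.
have fin : Hs_sum s u \is a fin_num by rewrite ge0_fin_numE ?Hs_sum_ge0.
have K0 : 0 <= K by apply: le_trans h; exact: sqrtr_ge0.
split=> //; apply/Hs_sumP; rewrite -(fineK fin) lee_fin.
rewrite -(@sqr_sqrtr _ (fine (Hs_sum s u))) ?fine_ge0 ?Hs_sum_ge0//.
by rewrite ler_sqr ?nnegrE ?sqrtr_ge0.
Qed.

Lemma hsg_nrm s u : dom (Hs R s) u -> hsg s (nrm (Hs R s) u) u.
Proof. by move=> h; apply/hsgP. Qed.

Lemma hsq_le s r C u : r <= s -> hsq s C u -> hsq r C u.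
Proof.
move=> rs h t ut; apply: le_trans (h t ut); apply: ler_sum => n _.
by rewrite ler_wpM2r ?addr_ge0 ?sqr_ge0// ler_jpow// ler_pM2l.
Qed.
Lemma hsg_le s r K u : r <= s -> hsg s K u -> hsg r K u.
Proof. by move=> rs [h1 h2 /(hsq_le rs)]. Qed.
Lemma hsg_leK s K K' u : K <= K' -> hsg s K u -> hsg s K' u.
Proof.
by move=> KK /hsgP[h1 h2]; apply/hsgP; split => //; apply: le_trans KK.
Qed.
Lemma real_valuedD u v : real_valued u -> real_valued v -> real_valued (u + v).
Proof. by move=> h1 h2 n; rewrite [LHS]/(u (-n) + v (-n)) h1 h2 [RHS]cconjD. Qed.
Lemma real_valuedZ (a : R) u : real_valued u -> real_valued (a *: u).
Proof. by move=> h n; rewrite [LHS]/(a *: u (-n)) h [RHS]cconjZ. Qed.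
Lemma real_valued0 : real_valued (0 : dist R).
Proof. by move=> n; apply: complexP => //=; rewrite oppr0. Qed.

Lemma hsgD s K K' u v : hsg s K u -> hsg s K' v -> hsg s (K + K') (u + v).
Proof.
move=> [ru K0 hu] [rv K0' hv]; split; [exact: real_valuedD|exact: addr_ge0|].
move=> t ut.
pose a (w : dist R) (p : int * bool) : R :=
  jpow p.1 s * (if p.2 then complex.Re (w p.1) else complex.Im (w p.1)).
(* the squared norm as a sum of squares over real and imaginary parts *)
pose t2 := [seq (n, b) | n <- t, b <- [:: true; false]].
have e w : \sum_(n <- t) jpow n (2 * s) * (complex.Re (w n) ^+ 2 + complex.Im (w n) ^+ 2)
    = \sum_(p <- t2) a w p ^+ 2.
  rewrite big_allpairs_dep /=; apply: eq_bigr => n _.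
  by rewrite !big_cons big_nil /a /= addr0 jpow_sq; ring.
rewrite e.
under eq_bigr => p _.
  have -> : a (u + v) p = a u p + a v p.
    by rewrite /a; case: p.2; rewrite /GRing.add /= ?cReD ?cImD mulrDr.
  over.
by apply: minkowski_sum => //; rewrite -e; [exact: hu|exact: hv].
Qed.

Lemma hsgZ s K a u : hsg s K u -> hsg s (`|a| * K) (a *: u).
Proof.
move=> [ru K0 hu]; split; [exact: real_valuedZ|exact: mulr_ge0|].
move=> t ut; rewrite exprMn real_normK ?num_real//.
apply: le_trans (ler_wpM2l (sqr_ge0 a) (hu t ut)).
rewrite mulr_sumr; apply: ler_sum => n _.
rewrite [(a *: u) n]/(a *: u n) cReZ cImZ.
by rewrite (_ : _ * _ = a ^+ 2 * (jpow n (2 * s) *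
  (complex.Re (u n) ^+ 2 + complex.Im (u n) ^+ 2))) //; ring.
Qed.
Lemma hsg0 s : hsg s 0 (0 : dist R).
Proof.
split => //; first exact: real_valued0.
by move=> t ut; rewrite big1// => n _; rewrite /= !expr0n /= addr0 mulr0.
Qed.

(** Pointwise decay of the coefficients.  It is weaker than H^r and stronger than
    H^{r-1} ([hsg_supg], [supg_hsg]), and it can be tested on one coefficient at a time,
    which is how the rows of the differential are estimated. *)
Definition supg r K u := real_valued u /\ forall n, cabs (u n) <= K * jpow n (- r).

Lemma supg_ge0 r K u : supg r K u -> 0 <= K.
Proof.
move=> [_ /(_ 0)]; have := cabs_ge0 (u 0) => h1 h2.
by rewrite -(pmulr_lge0 K (jpow_gt0 0 (- r))); exact: le_trans h1 h2.
Qed.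
Lemma hsg_supg s K u : hsg s K u -> supg s (2 * K) u.
Proof.
move=> [ru K0 hu]; split=> // n.
have := hu [:: n] isT; rewrite big_seq1 jpow_sq => h.
rewrite jpowN ler_pdivlMr ?jpow_gt0//.
rewrite -ler_sqr ?nnegrE ?mulr_ge0 ?cabs_ge0 ?jpow_ge0// !exprMn.
have h2 := cabs_le_sq (u n); set j := jpow n s in h *.
apply: le_trans (ler_wpM2r (sqr_ge0 j) h2) _.
have := sqr_ge0 K; lra.
Qed.
(** The lost derivative makes sum_n <n>^{-2} converge. *)
Lemma supg_hsg r K u : supg r K u -> hsg (r - 1) (3 * K) u.
Proof.
move=> h; have K0 := supg_ge0 h; case: h => ru h; split=> //; first lra.
move=> t ut; apply: (@le_trans _ _ (\sum_(n <- t) K ^+ 2 * jpow n (-2))); last first.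
  by rewrite -mulr_sumr; have := sum_jbr_le R ut; have := sqr_ge0 K; nra.
apply: ler_sum => n _.
apply: le_trans (ler_wpM2l (jpow_ge0 _ _) (sq_le_cabs (u n))) _.
have : cabs (u n) ^+ 2 <= (K * jpow n (- r)) ^+ 2.
  by rewrite ler_sqr ?nnegrE ?mulr_ge0 ?cabs_ge0 ?jpow_ge0.
move=> /(ler_wpM2l (jpow_ge0 n (2 * (r - 1)))) /le_trans; apply.
rewrite exprMn mulrCA -jpow_sq -jpowD ler_wpM2l ?sqr_ge0//.
by apply: ler_jpow; lra.
Qed.
Lemma supg_le r r' K u : r' <= r -> supg r K u -> supg r' K u.
Proof.
move=> rr h; have K0 := supg_ge0 h; case: h => ru h; split=> // n.
apply: le_trans (h n) _; by rewrite ler_wpM2l// ler_jpow// lerN2.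
Qed.
Lemma supg_leK r K K' u : K <= K' -> supg r K u -> supg r K' u.
Proof. by move=> kk [ru h]; split=> // n; apply: le_trans (h n) _; rewrite ler_wpM2r ?jpow_ge0. Qed.
Lemma supgD r K K' u v : supg r K u -> supg r K' v -> supg r (K + K') (u + v).
Proof.
move=> [ru h] [rv h']; split; first exact: real_valuedD.
move=> n; apply: le_trans (cabsD (u n) (v n)) _.
by rewrite mulrDl lerD.
Qed.
Lemma supgZ r K a u : supg r K u -> supg r (`|a| * K) (a *: u).
Proof.
move=> [ru h]; split; first exact: real_valuedZ.
move=> n; rewrite [(a *: u) n]/(a *: u n) cabsZ -mulrA.
exact: ler_wpM2l.
Qed.
Lemma supg0 r : supg r 0 (0 : dist R).
Proof. by split=> [|n]; [exact: real_valued0|rewrite mul0r /= cabs0]. Qed.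
End SobolevNorm.

(** * Negative derivatives and products with smooth functions *)

Section Operations.
Variable R : realType.
Implicit Types (u v w : dist R) (s r : R) (C K : R) (a : R).

(** The symbol of d_x^{-k}. *)
Definition dcoef (k : nat) (n : int) : R[i] :=
  if n == 0 then 0 else (Complex 0 (2 * pi * n%:~R : R) : R[i]) ^ (- k%:Z).

Lemma dxE k u n : dx (- k%:Z) u n = dcoef k n * (u n : R[i]).
Proof. by rewrite /dx /dcoef; case: eqP => // _; rewrite mul0r. Qed.

Lemma cabsX (z : R[i]) k : cabs (z ^+ k) <= cabs z ^+ k.
Proof.
elim: k => [|k IH]; first by rewrite !expr0 /cabs /= normr1 normr0 addr0.
rewrite !exprS; apply: le_trans (cabsM _ _) _.
by rewrite ler_wpM2l// cabs_ge0.
Qed.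

Lemma dcoef_le k n : cabs (dcoef k n) <= jpow n (- k%:R).
Proof.
rewrite /dcoef; case: eqP => [_|/eqP n0]; first by rewrite cabs0 jpow_ge0.
rewrite -exprz_inv; apply: le_trans (cabsX _ _) _.
rewrite jpowN jpow_nat -exprVn; apply: lerXn2r; rewrite ?nnegrE ?cabs_ge0 ?invr_ge0 ?jbr_ge0//.
have pi0 := @pi_gt0 R.
rewrite /cabs /= expr0n /= add0r mul0r normr0 add0r normrN normrM normfV.
set y := 2 * pi * n%:~R.
have y0 : y != 0 by rewrite !mulf_eq0 !negb_or intr_eq0 n0 pnatr_eq0 (gt_eqF pi0).
rewrite normrX (_ : _ * _ = `|y|^-1); last by field; rewrite normr_eq0.
rewrite lef_pV2 ?posrE ?normr_gt0 ?jbr_gt0// jbrE//.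
rewrite /y normrM (ger0_norm (mulr_ge0 _ (ltW pi0)))// -intr_norm -abszE.
have h1 : 1 <= 2 * pi :> R by have := @pi_ge2 R; lra.
by rewrite ler_peMl.
Qed.

Lemma dcoefN k n : dcoef k (- n) = conjc (dcoef k n).
Proof.
rewrite /dcoef oppr_eq0; case: eqP => [_|_]; first by apply: complexP; rewrite /= ?oppr0.
rewrite -!exprz_inv /=.
have -> : (Complex 0 (2 * pi * (- n)%:~R : R)) = conjc (Complex 0 (2 * pi * n%:~R : R)).
  by apply: complexP => //=; rewrite rmorphN mulrN.
by rewrite -[conjc _]/(Num.conj _) -fmorphV rmorphXn.
Qed.

Lemma dx_real k u : real_valued u -> real_valued (dx (- k%:Z) u).
Proof. by move=> ru n; rewrite !dxE dcoefN ru cconjM. Qed.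

Lemma dx_supg k r K u : supg r K u -> supg (r + k%:R) K (dx (- k%:Z) u).
Proof.
move=> h; have K0 := supg_ge0 h; case: h => ru h; split; first exact: dx_real.
move=> n; rewrite dxE; apply: le_trans (cabsM _ _) _.
apply: le_trans (ler_pM (cabs_ge0 _) (cabs_ge0 _) (dcoef_le k n) (h n)) _.
by rewrite opprD jpowD mulrCA [X in _ <= _ * X]mulrC.
Qed.

Lemma dx_hsg k s K u : hsg s K u -> hsg (s + k%:R) K (dx (- k%:Z) u).
Proof.
move=> [ru K0 hu]; split=> //; first exact: dx_real.
move=> t ut; apply: le_trans (hu t ut); apply: ler_sum => n _.
rewrite dxE /dcoef; case: eqP => [_|/eqP n0].
  rewrite mul0r /= expr0n /= addr0 mulr0.
  by rewrite mulr_ge0 ?jpow_ge0// addr_ge0 ?sqr_ge0.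
set z := _ ^ _.
have -> : complex.Re (z * u n) ^+ 2 + complex.Im (z * u n) ^+ 2
  = (complex.Re z ^+ 2 + complex.Im z ^+ 2) * (complex.Re (u n) ^+ 2 + complex.Im (u n) ^+ 2).
  by rewrite cReM cImM; ring.
rewrite mulrA ler_wpM2r ?addr_ge0 ?sqr_ge0//.
have -> : 2 * (s + k%:R) = 2 * s + 2 * k%:R by ring.
rewrite jpowD -mulrA -[leRHS]mulr1 ler_wpM2l ?jpow_ge0//.
have hz := dcoef_le k n; rewrite /dcoef (negbTE n0) -/z in hz.
rewrite jpow_sq mulrC -ler_pdivlMr ?exprn_gt0 ?jpow_gt0// mul1r.
apply: le_trans (sq_le_cabs z) _; rewrite -exprVn -jpowN.
by rewrite ler_sqr ?nnegrE ?cabs_ge0 ?jpow_ge0.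
Qed.

Lemma dxD m u v : dx m (u + v) = dx m u + dx m v.
Proof.
apply/funext => n; rewrite /dx [in RHS]/GRing.add /=.
case: eqP => _; first by apply: complexP; rewrite /= addr0.
exact: mulrDr.
Qed.
Lemma dxZ m a u : dx m (a *: u) = a *: dx m u.
Proof.
apply/funext => n; rewrite [RHS]/(a *: dx m u n) /dx.
case: eqP => _; first by apply: complexP; rewrite /= ?mulr0.
rewrite [(a *: u) n]/(a *: u n); apply: complexP;
  by rewrite ?cReZ ?cImZ ?cReM ?cImM ?cReZ ?cImZ; ring.
Qed.

(** Absolute convergence of the convolution that defines each coefficient of the
    product; without it [pmul] need not be bilinear. *)
Definition pmul_conv u v := forall n, exists C, cabss (fun m => (u (n - m) : R[i]) * (v m : R[i])) C.

Lemma pmulDl a u u' v : pmul_conv u v -> pmul_conv u' v ->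
  pmul (a *: u + u') v = a *: pmul u v + pmul u' v.
Proof.
move=> h h'; apply/funext => n.
have [C hC] := h n; have [C' hC'] := h' n.
rewrite [RHS]/(a *: pmul u v n + pmul u' v n).
have -> : a *: (pmul u v n) = (Complex a 0) * (pmul u v n : R[i]) :> R[i].
  by apply: complexP; rewrite ?cReZ ?cImZ ?cReM ?cImM /= mul0r ?subr0 ?addr0.
rewrite /pmul -(csumM _ hC) -[RHS](csumD (cabssM _ hC) hC').
apply: eq_csum => m; rewrite [(a *: u + u') _]/(a *: u (n - m) + u' (n - m)).
by apply: complexP; rewrite ?cReD ?cImD ?cReM ?cImM ?cReD ?cImD ?cReM ?cImM ?cReZ ?cImZ /=; ring.
Qed.

Lemma pmulDr a u v v' : pmul_conv u v -> pmul_conv u v' ->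
  pmul u (a *: v + v') = a *: pmul u v + pmul u v'.
Proof.
move=> h h'; apply/funext => n.
have [C hC] := h n; have [C' hC'] := h' n.
rewrite [RHS]/(a *: pmul u v n + pmul u v' n).
have -> : a *: (pmul u v n) = (Complex a 0) * (pmul u v n : R[i]) :> R[i].
  by apply: complexP; rewrite ?cReZ ?cImZ ?cReM ?cImM /= mul0r ?subr0 ?addr0.
rewrite /pmul -(csumM _ hC) -[RHS](csumD (cabssM _ hC) hC').
apply: eq_csum => m; rewrite [(a *: v + v') _]/(a *: v m + v' m).
by apply: complexP; rewrite ?cReD ?cImD ?cReM ?cImM ?cReD ?cImD ?cReM ?cImM ?cReZ ?cImZ /=; ring.
Qed.

Lemma pmul_term_le r1 r2 rho K1 K2 u v n m : supg r1 K1 u -> supg r2 K2 v ->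
  `|r2| <= rho -> rho + 2 <= r1 ->
  cabs ((u (n - m) : R[i]) * (v m : R[i])) <=
    (K1 * K2 * 2 `^ rho * jpow n (- r2)) * jpow (n - m) (-2).
Proof.
move=> hu hv h1 h2; have K10 := supg_ge0 hu; have K20 := supg_ge0 hv.
apply: le_trans (cabsM _ _) _.
apply: le_trans (ler_pM (cabs_ge0 _) (cabs_ge0 _) (hu.2 (n - m)) (hv.2 m)) _.
have p : jpow m (- r2) <= 2 `^ rho * jpow (n - m) rho * jpow n (- r2).
  rewrite -(jpow_opp (n - m)); have {1}-> : m = - (n - m) + n by lia.
  by apply: peetre_le; rewrite normrN.
apply: le_trans (ler_wpM2l _ (ler_wpM2l K20 p)) _; first by rewrite mulr_ge0 ?jpow_ge0.
have q : jpow (n - m) (- r1) * jpow (n - m) rho <= jpow (n - m) (-2).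
  by rewrite -jpowD ler_jpow//; lra.
have c0 : 0 <= K1 * K2 * 2 `^ rho * jpow n (- r2) by rewrite !mulr_ge0 ?powR_ge0 ?jpow_ge0.
apply: le_trans (ler_wpM2l c0 q).
set x := 2 `^ rho; set y := jpow n _; set z := jpow _ rho; set w := jpow _ (- r1).
by rewrite [leLHS](_ : _ = K1 * K2 * x * y * (w * z))//; ring.
Qed.

Lemma pmul_conv_supg r1 r2 K1 K2 u v : supg r1 K1 u -> supg r2 K2 v ->
  `|r2| + 2 <= r1 -> pmul_conv u v.
Proof.
move=> hu hv h n; eexists.
apply: (@cabss_dom _ _ (fun m => _ * jpow (n - m) (-2))).
  by move=> m; exact: (pmul_term_le n m hu hv (lexx _) h).
exact: abssZ (abss_jbr R n).
Qed.

Lemma pmul_conj u v : real_valued u -> real_valued v -> pmul_conv u v ->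
  real_valued (pmul u v).
Proof.
move=> ru rv h n; have [C hC] := h n.
rewrite /pmul -[RHS](csum_conj hC) -[RHS]csum_opp; apply: eq_csum => m.
by rewrite cconjM -ru -rv; congr (_ * _); congr (_ _); lia.
Qed.

(** Peetre's inequality moves the weight of v through the convolution at the cost of
    rho derivatives of u; two more derivatives of u make the sum converge. *)
Lemma pmul_supg r1 r2 rho K1 K2 u v : supg r1 K1 u -> supg r2 K2 v ->
  `|r2| <= rho -> rho + 2 <= r1 ->
  supg r2 (12 * 2 `^ rho * (K1 * K2)) (pmul u v).
Proof.
move=> hu hv h1 h2; split.
  apply: pmul_conj; [exact: hu.1|exact: hv.1|apply: (pmul_conv_supg hu hv); lra].
move=> n.
have c0 : 0 <= K1 * K2 * 2 `^ rho * jpow n (- r2).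
  by rewrite !mulr_ge0 ?powR_ge0 ?jpow_ge0 ?(supg_ge0 hu) ?(supg_ge0 hv).
have hs := abssZ (K1 * K2 * 2 `^ rho * jpow n (- r2)) (abss_jbr R n).
have := csum_le (cabss_dom (fun m => pmul_term_le n m hu hv h1 h2) hs).
by rewrite ger0_norm// /pmul => /le_trans; apply; lra.
Qed.

(** Multiplication by a smooth function loses no derivative, unlike what [pmul_supg]
    and [supg_hsg] would give together.  Peetre's inequality reduces the claim to the
    convolution with <.>^{-2}, which is bounded on l^2 by the Cauchy-Schwarz inequality. *)
Lemma pmul_hsg r2 rho K1 K2 u v : supg (rho + 2) K1 u -> hsg r2 K2 v ->
  `|r2| <= rho -> hsg r2 (6 * 2 `^ rho * (2 * K1 * K2)) (pmul u v).
Proof.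
move=> hu hv h1; have K10 := supg_ge0 hu; have [rv K20 hv2] := hv.
have hv' := hsg_supg hv.
have ok : pmul_conv u v by apply: (pmul_conv_supg hu hv'); lra.
have c0 : 0 <= 2 `^ rho :> R by exact: powR_ge0.
split; [by apply: pmul_conj => //; exact: hu.1|by rewrite !mulr_ge0|].
move=> t ut; pose b m := jpow m r2 * cabs (v m).
have b0 m : 0 <= b m by rewrite mulr_ge0 ?jpow_ge0 ?cabs_ge0.
have hb (s' : seq int) : uniq s' -> \sum_(m <- s') b m ^+ 2 <= 2 * K2 ^+ 2.
  move=> us'; apply: le_trans (ler_wpM2l (ler0n _ 2) (hv2 s' us')).
  rewrite mulr_sumr; apply: ler_sum => m _.
  rewrite exprMn -jpow_sq [leRHS]mulrCA ler_wpM2l ?jpow_ge0//; exact: cabs_le_sq.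
pose S N n : R[i] := \sum_(m <- win N) (u (n - m) : R[i]) * (v m : R[i]).
have hS N n : jpow n r2 * cabs (S N n) <= K1 * 2 `^ rho *
    \sum_(m <- win N) jpow (n - m) (-1) * (jpow (n - m) (-1) * b m).
  apply: le_trans (ler_wpM2l (jpow_ge0 _ _) (cabs_sum _ _ _)) _.
  rewrite !mulr_sumr; apply: ler_sum => m _.
  apply: le_trans (ler_wpM2l (jpow_ge0 _ _) (cabsM _ _)) _.
  have p : jpow n r2 <= 2 `^ rho * jpow (n - m) rho * jpow m r2.
    have {1}-> : n = (n - m) + m by lia.
    exact: peetre_le.
  apply: le_trans (ler_wpM2r _ p) _; first by rewrite mulr_ge0 ?cabs_ge0.
  apply: le_trans (ler_wpM2l _ (ler_wpM2r (cabs_ge0 _) (hu.2 (n - m)))) _.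
    by rewrite !mulr_ge0 ?jpow_ge0 ?b0 ?cabs_ge0.
  have q : jpow (n - m) rho * jpow (n - m) (- (rho + 2)) = jpow (n - m) (-1) * jpow (n - m) (-1).
    by rewrite -!jpowD; congr (jpow _ _); lra.
  rewrite [leRHS](_ : _ = K1 * 2 `^ rho * (jpow (n - m) (-1) * jpow (n - m) (-1)) * b m); last by ring.
  rewrite -q /b; set x := 2 `^ rho; set y := jpow m _; set z := jpow _ rho; set w' := jpow _ (- (rho + 2)).
  by rewrite [leLHS](_ : _ = K1 * x * (z * w') * (y * cabs (v m)))//; ring.
have hS2 N n : jpow n (2 * r2) * (complex.Re (S N n) ^+ 2 + complex.Im (S N n) ^+ 2) <=
    (K1 * 2 `^ rho) ^+ 2 * (6 * \sum_(m <- win N) jpow (n - m) (-2) * b m ^+ 2).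
  apply: le_trans (ler_wpM2l (jpow_ge0 _ _) (sq_le_cabs _)) _.
  rewrite jpow_sq -exprMn.
  have : (jpow n r2 * cabs (S N n)) ^+ 2 <= (K1 * 2 `^ rho *
    \sum_(m <- win N) jpow (n - m) (-1) * (jpow (n - m) (-1) * b m)) ^+ 2.
    have B0 : 0 <= \sum_(m <- win N) jpow (n - m) (-1) * (jpow (n - m) (-1) * b m).
      by apply: sumr_ge0 => m _; rewrite !mulr_ge0 ?jpow_ge0 ?b0 ?cabs_ge0.
    apply: lerXn2r (hS N n); rewrite nnegrE.
      by rewrite mulr_ge0 ?jpow_ge0 ?cabs_ge0.
    by rewrite !mulr_ge0.
  move=> /le_trans; apply; rewrite exprMn ler_wpM2l ?sqr_ge0//.
  set B := \sum_(m <- win N) jpow (n - m) (-2) * _.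
  have B0 : 0 <= B by apply: sumr_ge0 => m _; rewrite mulr_ge0 ?jpow_ge0 ?sqr_ge0.
  have j6 : \sum_(m <- win N) jpow (n - m) (-2) <= 6 :> R.
    apply: le_trans (abss_jbr R n (win_uniq N)).
    by apply: ler_sum => m _; exact: ler_norm.
  have jj m : jpow (n - m) (-2) = jpow (n - m) (-1) ^+ 2 :> R.
    by rewrite -jpow_sq; congr jpow; ring.
  have cs := @cauchy_schwarz R _ (win N) (fun m => jpow (n - m) (-1))
    (fun m => jpow (n - m) (-1) * b m) (Num.sqrt 6) (Num.sqrt B)
    (sqrtr_ge0 _) (sqrtr_ge0 _).
  rewrite !sqr_sqrtr// in cs.
  have {}cs := cs _ _.
  rewrite -(@sqr_sqrtr _ 6)// -(@sqr_sqrtr _ B)// -exprMn.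
  rewrite ler_sqr ?nnegrE ?mulr_ge0 ?sqrtr_ge0//; last first.
    by apply: sumr_ge0 => m _; rewrite !mulr_ge0 ?jpow_ge0 ?b0 ?cabs_ge0.
  apply: cs.
    by apply: le_trans j6; apply: ler_sum => m _; rewrite jj.
  by apply: ler_sum => m _; rewrite jj exprMn.
have hfin N : \sum_(n <- t) jpow n (2 * r2) * (complex.Re (S N n) ^+ 2 + complex.Im (S N n) ^+ 2)
    <= (6 * 2 `^ rho * (2 * K1 * K2)) ^+ 2.
  apply: le_trans (ler_sum _ (fun n _ => hS2 N n)) _.
  rewrite -!mulr_sumr exchange_big /=.
  have : \sum_(m <- win N) \sum_(n <- t) jpow (n - m) (-2) * b m ^+ 2 <= 6 * (2 * K2 ^+ 2).
    apply: le_trans (ler_wpM2l (ler0n _ 6) (hb _ (win_uniq N))).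
    rewrite mulr_sumr; apply: ler_sum => m _; rewrite -mulr_suml ler_wpM2r ?sqr_ge0//.
    rewrite -(big_map (fun n => n - m) xpredT (fun k => jpow k (-2))).
    by apply: sum_jbr_le; rewrite map_inj_uniq// => x y; lia.
  move=> h; have k2 : 0 <= (K1 * 2 `^ rho) ^+ 2 by exact: sqr_ge0.
  have h6 : (6 : R) * (\sum_(m <- win N) \sum_(n <- t) jpow (n - m) (-2) * b m ^+ 2) <= 6 * (6 * (2 * K2 ^+ 2)).
    by rewrite ler_wpM2l.
  apply: le_trans (ler_wpM2l k2 h6) _.
  have := sqr_ge0 (K1 * 2 `^ rho * K2); rewrite !exprMn; lra.
have hl : (fun N => \sum_(n <- t) jpow n (2 * r2) * (complex.Re (S N n) ^+ 2 + complex.Im (S N n) ^+ 2)) @ \oo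
   --> \sum_(n <- t) jpow n (2 * r2) * (complex.Re (pmul u v n) ^+ 2 + complex.Im (pmul u v n) ^+ 2).
  elim: {ut hfin} t => [|n t IH].
    by under eq_fun do rewrite big_nil; rewrite big_nil; exact: cvg_cst.
  under eq_fun do rewrite big_cons; rewrite big_cons; apply: cvgD => //.
  have [C hC] := ok n.
  apply: cvgMr; apply: cvgD; rewrite expr2; under eq_fun do rewrite expr2.
    by apply: cvgM; exact: csum_cvg_re hC.
  by apply: cvgM; exact: csum_cvg_im hC.
rewrite -(cvg_lim (@Rhausdorff R) hl); apply: limr_le.
  by apply/cvg_ex; eexists; exact: hl.
exact: nearW.
Qed.
End Operations.

(** * Jets measured by gauges *)

Section Gauges.
Variable R : realType.

(** [nspace] carries no axioms; these are those of a seminormed space, on its domain. *)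
Record normed (V : lmodType R) (X : nspace V) : Prop := Normed {
  nd0 : dom X 0 ;
  ndL : forall (a : R) u v, dom X u -> dom X v -> dom X (a *: u + v) ;
  nrm_ge0 : forall u, dom X u -> 0 <= nrm X u ;
  nrmD : forall u v, dom X u -> dom X v -> nrm X (u + v) <= nrm X u + nrm X v ;
  nrmZ : forall a u, dom X u -> nrm X (a *: u) <= `|a| * nrm X u }.

Section NormedTheory.
Variables (V : lmodType R) (X : nspace V) (nX : normed X).
Lemma ndD u v : dom X u -> dom X v -> dom X (u + v).
Proof. by move=> hu hv; have := ndL nX 1 hu hv; rewrite scale1r. Qed.
Lemma ndZ a u : dom X u -> dom X (a *: u).
Proof. by move=> hu; have := ndL nX a hu (nd0 nX); rewrite addr0. Qed.
Lemma ndN u : dom X u -> dom X (- u).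
Proof. by move=> hu; rewrite -scaleN1r; exact: ndZ. Qed.
Lemma ndB u v : dom X u -> dom X v -> dom X (u - v).
Proof. by move=> hu hv; apply: ndD => //; exact: ndN. Qed.
Lemma nrm0 : nrm X 0 = 0.
Proof.
apply/eqP; rewrite eq_le (nrm_ge0 nX (nd0 nX)) andbT.
by have := nrmZ nX 0 (nd0 nX); rewrite scale0r normr0 mul0r.
Qed.
Lemma all_in_cons v vs : all_in X (v :: vs) <-> dom X v /\ all_in X vs.
Proof.
split=> [h|[h1 h2] w].
  split; first by apply: h; rewrite mem_head.
  by move=> w hw; apply: h; rewrite inE hw orbT.
by rewrite inE => /orP[/eqP ->//|/h2].
Qed.
Lemma nprod_cons v vs : nprod X (v :: vs) = nrm X v * nprod X vs.
Proof. by rewrite /nprod big_cons. Qed.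
Lemma nprod_ge0 vs : all_in X vs -> 0 <= nprod X vs.
Proof.
elim: vs => [|v vs IH]; first by rewrite /nprod big_nil.
by move=> /all_in_cons[h1 h2]; rewrite nprod_cons mulr_ge0 ?(nrm_ge0 nX h1) ?IH.
Qed.
End NormedTheory.

Section GaugeTheory.
Variable W : lmodType R.
Implicit Types (B : R -> W -> Prop).

(** [B K w] reads: w is bounded by K.  Norms, decay of coefficients, operator norms and
    weighted bounds on families are all of this form, so one calculus of jets serves for
    all of them.  Names of gauges end in g. *)
Record gauge B : Prop := Gauge {
  g0 : forall K, 0 <= K -> B K 0 ;
  gle : forall K K' w, K <= K' -> B K w -> B K' w ;
  gD : forall K K' w w', B K w -> B K' w' -> B (K + K') (w + w') ;
  gZ : forall a K w, B K w -> B (`|a| * K) (a *: w) }.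

Lemma gN B : gauge B -> forall K w, B K w -> B K (- w).
Proof. by move=> gB K w /(gZ gB (-1)); rewrite scaleN1r normrN1 mul1r. Qed.
Lemma gsub B : gauge B -> forall K K' w w', B K w -> B K' w' -> B (K + K') (w - w').
Proof. by move=> gB K K' w w' h h'; apply: gD => //; exact: gN. Qed.
Lemma gsum B : gauge B -> forall (I : eqType) (s : seq I) K (F : I -> W),
  (forall i, i \in s -> B K (F i)) -> B ((size s)%:R * K) (\sum_(i <- s) F i).
Proof.
move=> gB I; elim=> [|i s IH] K F h; first by rewrite big_nil mul0r; exact: g0.
rewrite big_cons /= -natr1 mulrDl mul1r [_ + K]addrC; apply: gD => //.
  by apply: h; rewrite mem_head.
by apply: IH => j js; apply: h; rewrite inE js orbT.
Qed.
End GaugeTheory.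

(** The index set of the Leibniz rule. *)
Fixpoint splits (T : Type) (vs : seq T) : seq (seq T * seq T) :=
  if vs is v :: vs' then
    [seq (v :: p.1, p.2) | p <- splits vs'] ++ [seq (p.1, v :: p.2) | p <- splits vs']
  else [:: ([::], [::])].

Lemma size_splits (T : Type) (vs : seq T) : size (splits vs) = (2 ^ size vs)%N.
Proof.
by elim: vs => //= v vs IH; rewrite size_cat !size_map IH expnS mul2n addnn.
Qed.

Lemma splits_ind (T : eqType) (Q : seq T -> seq T -> seq T -> Prop) :
  Q [::] [::] [::] ->
  (forall v vs a b, Q vs a b -> Q (v :: vs) (v :: a) b) ->
  (forall v vs a b, Q vs a b -> Q (v :: vs) a (v :: b)) ->
  forall vs ab, ab \in splits vs -> Q vs ab.1 ab.2.
Proof.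
move=> h0 h1 h2; elim=> [|v vs IH] ab /=; first by rewrite inE => /eqP ->.
rewrite mem_cat => /orP[] /mapP[q /IH hq ->] /=; [exact: h1|exact: h2].
Qed.

Lemma splits_all (T : eqType) (A : T -> Prop) (vs : seq T) ab : ab \in splits vs ->
  (forall v, v \in vs -> A v) ->
  (forall v, v \in ab.1 -> A v) /\ (forall v, v \in ab.2 -> A v).
Proof.
apply: (@splits_ind T (fun vs a b => (forall v, v \in vs -> A v) ->
  (forall v, v \in a -> A v) /\ (forall v, v \in b -> A v))) => {vs ab} //.
  move=> v vs a b IH h; have [|h1 h2] := IH.
    by move=> w hw; apply: h; rewrite inE hw orbT.
  split=> // w; rewrite inE => /orP[/eqP ->|]; last exact: h1.
  by apply: h; rewrite mem_head.
move=> v vs a b IH h; have [|h1 h2] := IH.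
  by move=> w hw; apply: h; rewrite inE hw orbT.
split=> // w; rewrite inE => /orP[/eqP ->|]; last exact: h2.
by apply: h; rewrite mem_head.
Qed.

Lemma splits_size (T : eqType) (vs : seq T) ab : ab \in splits vs ->
  (size ab.1 + size ab.2 = size vs)%N.
Proof.
by apply: (@splits_ind T (fun vs a b => (size a + size b)%N = size vs)) => {vs ab} //=;
  move=> v vs a b <-; rewrite ?addnS.
Qed.

Lemma splits_nprod (V : lmodType R) (X : nspace V) (vs : seq V) ab : ab \in splits vs ->
  nprod X ab.1 * nprod X ab.2 = nprod X vs.
Proof.
apply: (@splits_ind V (fun vs a b => nprod X a * nprod X b = nprod X vs)) => {vs ab}.
- by rewrite /nprod !big_nil mulr1.
- by move=> v vs a b h; rewrite !nprod_cons -h mulrA.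
- by move=> v vs a b h; rewrite !nprod_cons -h mulrCA.
Qed.

(** The jet of a bilinear expression, by the Leibniz rule. *)
Definition leibniz (V W1 W2 : Type) (W3 : nmodType) (op : W1 -> W2 -> W3)
    (D1 : V -> seq V -> W1) (D2 : V -> seq V -> W2) (p : V) (vs : seq V) : W3 :=
  \sum_(ab <- splits vs) op (D1 p ab.1) (D2 p ab.2).

Lemma leibniz_cons (V W1 W2 : Type) (W3 : nmodType) (op : W1 -> W2 -> W3)
    (D1 : V -> seq V -> W1) (D2 : V -> seq V -> W2) p v vs :
  leibniz op D1 D2 p (v :: vs) = \sum_(ab <- splits vs)
    (op (D1 p (v :: ab.1)) (D2 p ab.2) + op (D1 p ab.1) (D2 p (v :: ab.2))).
Proof. by rewrite /leibniz [splits (_ :: _)]/= big_cat !big_map big_split. Qed.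

Section Gjets.
Variables (V : lmodType R) (X : nspace V) (nX : normed X).

(** The analogue of [is_jet] with the target measured by a gauge.  Linearity is an
    equality, and the bounds cover all orders up to l at once, as the Leibniz rule needs. *)
Record gjet (W : lmodType R) (U : set V) (B : R -> W -> Prop)
    (D : V -> seq V -> W) : Prop := Gjet {
  gj_lin : forall p (a : R) h k vs, U p -> dom X h -> dom X k -> all_in X vs ->
     D p ((a *: h + k) :: vs) = a *: D p (h :: vs) + D p (k :: vs) ;
  gj_bd : forall p (l : nat), U p -> exists2 C : R, 0 <= C &
     forall vs, (size vs <= l)%N -> all_in X vs -> B (C * nprod X vs) (D p vs) ;
  gj_fr : forall p (l : nat) (e : R), U p -> 0 < e -> exists2 r : R, 0 < r &
     forall h, dom X h -> nrm X h < r -> U (p + h) ->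
     forall vs, (size vs <= l)%N -> all_in X vs ->
       B (e * nrm X h * nprod X vs) (D (p + h) vs - D p vs - D p (h :: vs)) }.

Section OneJet.
Variables (W : lmodType R) (U : set V) (B : R -> W -> Prop) (gB : gauge B).
Variables (D : V -> seq V -> W) (jD : gjet U B D).

Lemma gjet_lip p l : U p -> exists r C : R, [/\ 0 < r, 0 <= C &
  forall h, dom X h -> nrm X h < r -> U (p + h) ->
  forall vs, (size vs <= l)%N -> all_in X vs ->
    B (C * nrm X h * nprod X vs) (D (p + h) vs - D p vs)].
Proof.
move=> Up; have [C C0 hC] := gj_bd jD l.+1 Up.
have [r r0 hr] := gj_fr jD l Up ltr01.
exists r, (1 + C); split=> //; first by rewrite addr_ge0.
move=> h dh hh Uh vs svs avs.
rewrite -[X in B _ X](subrK (D p (h :: vs))) mulrDl mulrDl.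
apply: (gD gB); first exact: hr.
rewrite -mulrA -nprod_cons; apply: hC => //.
by apply/all_in_cons.
Qed.

Lemma gjet_loc p l : U p -> exists r C : R, [/\ 0 < r, 0 <= C &
  forall h, dom X h -> nrm X h < r -> U (p + h) ->
  forall vs, (size vs <= l)%N -> all_in X vs ->
    B (C * nprod X vs) (D (p + h) vs)].
Proof.
move=> Up; have [C C0 hC] := gj_bd jD l Up.
have [r [L [r0 L0 hL]]] := gjet_lip l Up.
exists r, (L * r + C); split=> //; first by rewrite addr_ge0 ?mulr_ge0 ?(ltW r0).
move=> h dh hh Uh vs svs avs.
rewrite -[X in B _ X](subrK (D p vs)) mulrDl; apply: (gD gB); last exact: hC.
apply: (gle gB) (hL h dh hh Uh vs svs avs).
by rewrite ler_wpM2r ?(nprod_ge0 nX)// ler_wpM2l// ltW.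
Qed.

Lemma gjet_lin0 p vs : U p -> all_in X vs -> D p (0 :: vs) = 0.
Proof.
move=> Up avs; have := gj_lin jD 1 Up (nd0 nX) (nd0 nX) avs.
by rewrite scale1r addr0 scale1r => /esym/eqP; rewrite -subr_eq0 addrK => /eqP.
Qed.
Lemma gjet_scale p a h vs : U p -> dom X h -> all_in X vs ->
  D p (a *: h :: vs) = a *: D p (h :: vs).
Proof.
move=> Up dh avs; have := gj_lin jD a Up dh (nd0 nX) avs.
by rewrite addr0 gjet_lin0// addr0.
Qed.
End OneJet.

(** Composition with a bounded linear map.  Linearity of f is only known on bounded
    elements, because f may be given by a series. *)
Lemma gjet_map (W W' : lmodType R) (U : set V) (B : R -> W -> Prop)
    (B' : R -> W' -> Prop) (f : W -> W') (c : R) (D : V -> seq V -> W) :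
  gauge B -> gauge B' -> 0 <= c ->
  (forall (a : R) K K' w w', B K w -> B K' w' -> f (a *: w + w') = a *: f w + f w') ->
  (forall K w, 0 <= K -> B K w -> B' (c * K) (f w)) ->
  gjet U B D -> gjet U B' (fun p vs => f (D p vs)).
Proof.
move=> gB gB' c0 fl fb jD.
have fB K K' w w' : B K w -> B K' w' -> f (w - w') = f w - f w'.
  by move=> h h'; rewrite -scaleN1r addrC (fl _ K' K)// scaleN1r addrC.
split=> [p a h k vs Up dh dk avs|p l Up|p l e Up e0].
- have [C C0 hC] := gj_bd jD (size vs).+1 Up.
  rewrite (gj_lin jD)//; apply: fl; apply: hC => //; exact/all_in_cons.
- have [C C0 hC] := gj_bd jD l Up; exists (c * C); first exact: mulr_ge0.
  move=> vs svs avs; rewrite -mulrA; apply: fb; last exact: hC.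
  by rewrite mulr_ge0// (nprod_ge0 nX).
- have [r r0 hr] := gj_fr jD l Up (divr_gt0 e0 (ltr_pwDl ltr01 c0)).
  have [r' [C [r'0 C0 hC]]] := gjet_loc gB jD l Up.
  have [C' C'0 hC'] := gj_bd jD l.+1 Up.
  exists (Num.min r r'); first by rewrite lt_min r0.
  move=> h dh; rewrite lt_min => /andP[hr1 hr2] Uh vs svs avs.
  have b1 := hC h dh hr2 Uh vs svs avs.
  have b2 := hC' vs (leqW svs) avs.
  have b3 : B (C' * nprod X (h :: vs)) (D p (h :: vs)) by apply: hC'; [rewrite ltnS|exact/all_in_cons].
  rewrite -(fB _ _ _ _ b1 b2) -(fB _ _ _ _ (gsub gB b1 b2) b3).
  have hn : 0 <= nrm X h * nprod X vs by rewrite mulr_ge0 ?(nrm_ge0 nX)// (nprod_ge0 nX).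
  apply: (gle gB') (fb _ _ _ (hr h dh hr1 Uh vs svs avs)).
    rewrite [leLHS](_ : _ = e * nrm X h * nprod X vs * (c / (1 + c))); last by ring.
    apply: ler_piMr; first by rewrite -mulrA mulr_ge0// ltW.
    by rewrite ler_pdivrMr ?mul1r ?lerDr// ltr_pwDl.
  by rewrite -mulrA mulr_ge0// divr_ge0 ?ltW// ltr_pwDl.
Qed.

Lemma gjet_add (W : lmodType R) (U : set V) (B : R -> W -> Prop) D D' :
  gauge B -> gjet U B D -> gjet U B D' -> gjet U B (fun p vs => D p vs + D' p vs).
Proof.
move=> gB jD jD'; split=> [p a h k vs Up dh dk avs|p l Up|p l e Up e0].
- by rewrite (gj_lin jD)// (gj_lin jD')// scalerDr addrACA.
- have [C C0 hC] := gj_bd jD l Up; have [C' C'0 hC'] := gj_bd jD' l Up.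
  exists (C + C'); first exact: addr_ge0.
  by move=> vs svs avs; rewrite mulrDl; apply: (gD gB); [exact: hC|exact: hC'].
- have e2 : 0 < e / 2 by rewrite divr_gt0.
  have [r r0 hr] := gj_fr jD l Up e2; have [r' r'0 hr'] := gj_fr jD' l Up e2.
  exists (Num.min r r'); first by rewrite lt_min r0.
  move=> h dh; rewrite lt_min => /andP[h1 h2] Uh vs svs avs.
  have -> : D (p + h) vs + D' (p + h) vs - (D p vs + D' p vs) - (D p (h :: vs) + D' p (h :: vs))
    = (D (p + h) vs - D p vs - D p (h :: vs)) + (D' (p + h) vs - D' p vs - D' p (h :: vs)).
    by rewrite !opprD !addrA [LHS](ACl (1*3*5*2*4*6)).
  have -> : e * nrm X h * nprod X vs = e / 2 * nrm X h * nprod X vs + e / 2 * nrm X h * nprod X vs by lra.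
  by apply: (gD gB); [exact: hr|exact: hr'].
Qed.

Section Bilin.
Variables (W1 W2 W3 : lmodType R) (U : set V).
Variables (B1 : R -> W1 -> Prop) (B2 : R -> W2 -> Prop) (B3 : R -> W3 -> Prop).
Variables (op : W1 -> W2 -> W3) (c : R).
Hypotheses (gB1 : gauge B1) (gB2 : gauge B2) (gB3 : gauge B3) (c0 : 0 <= c).
Hypothesis opl : forall (a : R) K K' L w w' x, B1 K w -> B1 K' w' -> B2 L x ->
  op (a *: w + w') x = a *: op w x + op w' x.
Hypothesis opr : forall (a : R) K K' L x w w', B1 L x -> B2 K w -> B2 K' w' ->
  op x (a *: w + w') = a *: op x w + op x w'.
Hypothesis opb : forall K L w x, 0 <= K -> 0 <= L -> B1 K w -> B2 L x -> B3 (c * (K * L)) (op w x).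

Let oplB K K' L w w' x : B1 K w -> B1 K' w' -> B2 L x -> op (w - w') x = op w x - op w' x.
Proof. by move=> h1 h2 h3; rewrite -scaleN1r addrC (opl _ h2 h1 h3) scaleN1r addrC. Qed.
Let oprB K K' L w w' x : B2 K w -> B2 K' w' -> B1 L x -> op x (w - w') = op x w - op x w'.
Proof. by move=> h1 h2 h3; rewrite -scaleN1r addrC (opr _ h3 h2 h1) scaleN1r addrC. Qed.

(** P restricts the lists of directions; it has to be stable under the splittings of
    the Leibniz rule. *)
Lemma leibniz_bd (P : seq V -> Prop) D1 D2 (l : nat) p C1 C2 : 0 <= C1 -> 0 <= C2 ->
  (forall vs ab, ab \in splits vs -> P vs -> P ab.1 /\ P ab.2) ->
  (forall vs, (size vs <= l)%N -> P vs -> all_in X vs /\ B1 (C1 * nprod X vs) (D1 p vs)) ->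
  (forall vs, (size vs <= l)%N -> P vs -> B2 (C2 * nprod X vs) (D2 p vs)) ->
  forall vs, (size vs <= l)%N -> P vs ->
    B3 ((2 ^ l)%:R * (c * (C1 * C2)) * nprod X vs) (leibniz op D1 D2 p vs).
Proof.
move=> C10 C20 Psp h1 h2 vs svs Pvs.
have n0 : 0 <= nprod X vs by apply: (nprod_ge0 nX); case: (h1 vs svs Pvs).
have k0 : 0 <= c * (C1 * C2) * nprod X vs by rewrite !mulr_ge0.
apply: (@gle _ _ gB3 ((size (splits vs))%:R * (c * (C1 * C2) * nprod X vs))).
  by rewrite size_splits -[leRHS]mulrA ler_wpM2r// ler_nat leq_exp2l.
apply: (gsum gB3) => ab abs; have [P1 P2] := Psp _ _ abs Pvs.
have sz := splits_size abs.
have s1 : (size ab.1 <= l)%N by apply: leq_trans svs; rewrite -sz leq_addr.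
have s2 : (size ab.2 <= l)%N by apply: leq_trans svs; rewrite -sz leq_addl.
have [a1 b1] := h1 _ s1 P1; have [a2 _] := h1 _ s2 P2.
have b2 := h2 _ s2 P2.
rewrite -(splits_nprod X abs).
rewrite (_ : c * _ * _ = c * (C1 * nprod X ab.1 * (C2 * nprod X ab.2))); last by ring.
by apply: opb b1 b2; rewrite mulr_ge0// (nprod_ge0 nX).
Qed.

(** The increment of a product, minus its linear part, is the sum of the two first
    order remainders and of the product of the two increments, which is quadratic in h. *)
Lemma gjet_bilin D1 D2 : gjet U B1 D1 -> gjet U B2 D2 -> gjet U B3 (leibniz op D1 D2).
Proof.
move=> j1 j2; split=> [p a h k vs Up dh dk avs|p l Up|p l e Up e0].
- rewrite !leibniz_cons scaler_sumr -big_split; apply: eq_big_seq => ab abs.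
  have [a1 a2] := splits_all abs avs.
  have [C1 _ hC1] := gj_bd j1 (size ab.1).+1 Up.
  have [C2 _ hC2] := gj_bd j2 (size ab.2).+1 Up.
  rewrite (gj_lin j1)// (gj_lin j2)//.
  rewrite (opl _ (hC1 (h :: ab.1) _ _) (hC1 (k :: ab.1) _ _) (hC2 ab.2 _ _))//; try exact/all_in_cons.
  rewrite (opr _ (hC1 ab.1 _ _) (hC2 (h :: ab.2) _ _) (hC2 (k :: ab.2) _ _))//; try exact/all_in_cons.
  by rewrite /= scalerDr addrACA.
- have [C1 C10 hC1] := gj_bd j1 l Up; have [C2 C20 hC2] := gj_bd j2 l Up.
  exists ((2 ^ l)%:R * (c * (C1 * C2))); first by rewrite !mulr_ge0.
  apply: (@leibniz_bd (all_in X)) => //.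
  + by move=> vs ab /splits_all; apply.
  + by move=> vs svs avs; split => //; exact: hC1.
- have [C1 C10 hC1] := gj_bd j1 l.+1 Up; have [C2 C20 hC2] := gj_bd j2 l.+1 Up.
  have [r1 [L1 [r10 L10 hL1]]] := gjet_lip gB1 j1 l Up.
  have [r2 [L2 [r20 L20 hL2]]] := gjet_lip gB2 j2 l Up.
  pose c' := (2 ^ l)%:R * (c * (C1 + C2)) + 1.
  have c'0 : 0 < c' by rewrite ltr_wpDl// !mulr_ge0// addr_ge0.
  pose e' := e / 2 / c'.
  have e'0 : 0 < e' by rewrite !divr_gt0.
  have [q1 q10 hq1] := gj_fr j1 l Up e'0.
  have [q2 q20 hq2] := gj_fr j2 l Up e'0.
  pose d := (2 ^ l)%:R * (c * (L1 * L2)) + 1.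
  have d0 : 0 < d by rewrite ltr_wpDl// !mulr_ge0.
  pose q3 := e / 2 / d.
  have q30 : 0 < q3 by rewrite !divr_gt0.
  exists (Num.min (Num.min r1 r2) (Num.min (Num.min q1 q2) q3)).
    by rewrite !lt_min r10 r20 q10 q20 q30.
  move=> h dh; rewrite !lt_min => /andP[/andP[hr1 hr2] /andP[/andP[hh1 hh2] hh3]].
  move=> Uh vs svs avs; rewrite leibniz_cons /leibniz -!sumrB.
  have n0 := nprod_ge0 nX avs; have h0 := nrm_ge0 nX dh.
  pose k := c * (e' * C2 * (nrm X h) * nprod X vs) + c * (L1 * L2 * nrm X h ^+ 2 * nprod X vs)
     + c * (C1 * e' * (nrm X h) * nprod X vs).
  have e'1 := ltW e'0; have hh := sqr_ge0 (nrm X h).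
  have k0 : 0 <= k.
    by rewrite /k; move: (e') e'1 => x x0; rewrite !addr_ge0// !mulr_ge0.
  apply: (@gle _ _ gB3 ((size (splits vs))%:R * k)).
    apply: (@le_trans _ _ ((2 ^ l)%:R * k)).
      by rewrite ler_wpM2r// size_splits ler_nat leq_exp2l.
    have t1 : (c' - 1) * e' <= e / 2.
      rewrite [leLHS](_ : _ = e / 2 * ((c' - 1) / c')); last by rewrite /e'; ring.
      apply: ler_piMr; first by rewrite divr_ge0// ltW.
      by rewrite ler_pdivrMr// mul1r gerBl.
    have t2 : (d - 1) * nrm X h <= e / 2.
      apply: (@le_trans _ _ ((d - 1) * q3)).
        by rewrite ler_wpM2l ?(ltW hh3)// addrK !mulr_ge0.
      rewrite [leLHS](_ : _ = e / 2 * ((d - 1) / d)); last by rewrite /q3; ring.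
      apply: ler_piMr; first by rewrite divr_ge0// ltW.
      by rewrite ler_pdivrMr// mul1r gerBl.
    rewrite [leLHS](_ : _ = ((c' - 1) * e' + (d - 1) * nrm X h) * (nrm X h * nprod X vs)); last first.
      by rewrite /k /c' /d; ring.
    rewrite -[leRHS]mulrA ler_wpM2r ?mulr_ge0//; lra.
  apply: (gsum gB3) => ab abs.
  have [a1 a2] := splits_all abs avs.
  have sz := splits_size abs.
  have s1 : (size ab.1 <= l)%N by apply: leq_trans svs; rewrite -sz leq_addr.
  have s2 : (size ab.2 <= l)%N by apply: leq_trans svs; rewrite -sz leq_addl.
  have n1 := nprod_ge0 nX a1; have n2 := nprod_ge0 nX a2.
  have b1 := hC1 _ (leqW s1) a1; have b2 := hC2 _ (leqW s2) a2.
  have b1h : B1 (C1 * nprod X (h :: ab.1)) (D1 p (h :: ab.1)) by apply: hC1 => //; exact/all_in_cons.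
  have b2h : B2 (C2 * nprod X (h :: ab.2)) (D2 p (h :: ab.2)) by apply: hC2 => //; exact/all_in_cons.
  have l1 := hL1 h dh hr1 Uh _ s1 a1; have l2 := hL2 h dh hr2 Uh _ s2 a2.
  have f1 := hq1 h dh hh1 Uh _ s1 a1; have f2 := hq2 h dh hh2 Uh _ s2 a2.
  have b1' := gD gB1 l1 b1; have b2' := gD gB2 l2 b2; rewrite !subrK in b1' b2'.
  set X1 := D1 (p + h) ab.1 in l1 f1 b1' *; set X2 := D2 (p + h) ab.2 in l2 f2 b2' *.
  set Y1 := D1 p ab.1 in b1 l1 f1 *; set Y2 := D2 p ab.2 in b2 l2 f2 *.
  set Z1 := D1 p (h :: _) in b1h f1 *; set Z2 := D2 p (h :: _) in b2h f2 *.
  have -> : op X1 X2 - op Y1 Y2 - (op Z1 Y2 + op Y1 Z2) =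
     op (X1 - Y1 - Z1) Y2 + op (X1 - Y1) (X2 - Y2) + op Y1 (X2 - Y2 - Z2).
    rewrite (oplB l1 b1h b2) (oplB b1' b1 b2) (oprB l2 b2h b1) (oprB b2' b2 b1).
    rewrite (oplB b1' b1 l2) (oprB b2' b2 b1') (oprB b2' b2 b1).
    move: (op X1 X2) (op X1 Y2) (op Y1 X2) (op Y1 Y2) (op Z1 Y2) (op Y1 Z2).
    move=> x1 x2 x3 x4 x5 x6; rewrite !opprD !opprK !addrA.
    by rewrite [RHS](ACl ((4*2*3*10)*(1*5)*(8*6)*(7*9))) /= !subrr !addr0 ?addrA.
  have e'n : 0 <= e' * nrm X h by rewrite mulr_ge0// ltW.
  have -> : k = c * ((e' * nrm X h * nprod X ab.1) * (C2 * nprod X ab.2))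
    + c * ((L1 * nrm X h * nprod X ab.1) * (L2 * nrm X h * nprod X ab.2))
    + c * ((C1 * nprod X ab.1) * (e' * nrm X h * nprod X ab.2)).
    by rewrite /k -(splits_nprod X abs); ring.
  apply: (gD gB3); first apply: (gD gB3); apply: opb => //; rewrite ?mulr_ge0//.
  all: by rewrite ?invr_ge0 ltW.
Qed.
End Bilin.
End Gjets.
End Gauges.

(** * Uniqueness and Taylor's formula for jets *)

Section Jets2.
Variables (R : realType) (V : lmodType R) (X : nspace V) (nX : normed X).

Lemma gjet_restr (X' : nspace V) (W : lmodType R) (U U' : set V)
    (B : R -> W -> Prop) D :
  gauge B -> (forall v, dom X' v -> dom X v /\ nrm X v <= nrm X' v) -> U' `<=` U ->
  gjet X U B D -> gjet X' U' B D.
Proof.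
move=> gB XX UU jD.
have ain vs : all_in X' vs -> all_in X vs by move=> h v /h /XX[].
have ple vs : all_in X' vs -> 0 <= nprod X vs <= nprod X' vs.
  elim: vs => [|v vs IH]; first by rewrite /nprod !big_nil ler01 lexx.
  move=> /all_in_cons[h1 h2]; rewrite !nprod_cons; have [d1 n1] := XX v h1.
  have /andP[p0 p1] := IH h2; have v0 := nrm_ge0 nX d1.
  by rewrite mulr_ge0// ler_pM.
split=> [p a h k vs Up dh dk avs|p l Up|p l e Up e0].
- apply: (gj_lin jD); [exact: UU|by case: (XX h)|by case: (XX k)|exact: ain].
- have [C C0 hC] := gj_bd jD l (UU _ Up); exists C => // vs svs avs.
  apply: (gle gB) (hC vs svs (ain _ avs)).
  by rewrite ler_wpM2l//; case/andP: (ple _ avs).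
- have [r r0 hr] := gj_fr jD l (UU _ Up) e0; exists r => // h dh hh Uh vs svs avs.
  have [d1 n1] := XX h dh; have /andP[p0 p1] := ple _ avs.
  apply: (gle gB) (hr h d1 (le_lt_trans n1 hh) (UU _ Uh) vs svs (ain _ avs)).
  have h0 := nrm_ge0 nX d1.
  by apply: ler_pM => //; rewrite ?mulr_ge0 ?ler_wpM2l// ltW.
Qed.

Lemma gjet_sum (W : lmodType R) (U : set V) (B : R -> W -> Prop) (I : eqType)
    (s : seq I) (D : I -> V -> seq V -> W) : gauge B ->
  (forall i, i \in s -> gjet X U B (D i)) ->
  gjet X U B (fun p vs => \sum_(i <- s) D i p vs).
Proof.
move=> gB; elim: s => [|i s IH] h.
  split=> [p a u k vs Up du dk avs|p l Up|p l e Up e0].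
  - by rewrite !big_nil scaler0 addr0.
  - by exists 0 => // vs _ _; rewrite mul0r big_nil; exact: (g0 gB).
  - exists 1 => // u du _ _ vs _ avs; rewrite !big_nil !subr0.
    apply: (g0 gB); rewrite !mulr_ge0 ?(ltW e0) ?(nrm_ge0 nX du)//.
    exact: nprod_ge0 nX _ avs.
have -> : (fun p vs => \sum_(j <- i :: s) D j p vs) =
    (fun p vs => D i p vs + \sum_(j <- s) D j p vs).
  by apply/funext => p; apply/funext => vs; rewrite big_cons.
apply: (gjet_add gB); first by apply: h; rewrite mem_head.
by apply: IH => j js; apply: h; rewrite inE js orbT.
Qed.

Definition absg (K : R) (x : R^o) : Prop := `|x : R| <= K.
Lemma gauge_abs : gauge absg.
Proof.
rewrite /absg; split => [K K0|K K' w KK h|K K' w w' h h'|a K w h].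
- by rewrite normr0.
- exact: le_trans KK.
- by apply: le_trans (ler_normD _ _) _; exact: lerD.
- by rewrite normrM ler_wpM2l.
Qed.

Variable U : set V.
Hypothesis oU : nopen X U.

Lemma open_ray p h : U p -> dom X h ->
  exists2 r : R, 0 < r & forall t : R, `|t| < r -> U (p + t *: h).
Proof.
move=> Up dh; have [dU /(_ p Up)[r r0 hr]] := oU.
have N0 := nrm_ge0 nX dh.
have N1 : 0 < nrm X h + 1 by rewrite ltr_wpDl.
exists (r / (nrm X h + 1)); first by rewrite divr_gt0.
move=> t ht; apply: hr; split.
  by apply: (ndD nX) (ndZ nX _ dh); exact: dU.
rewrite [p + _]addrC addrK; apply: le_lt_trans (nrmZ nX t dh) _.
move: ht; rewrite ltr_pdivlMr// => ht.
by apply: le_lt_trans ht; rewrite ler_wpM2l// lerDl.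
Qed.

(** Induction on the number of directions: the derivative along h is a limit of
    difference quotients along a ray, and a short ray stays in the open set U. *)
Lemma gjet_uniq0 D : gjet X U absg D -> (forall p, U p -> D p [::] = 0) ->
  forall vs p, all_in X vs -> U p -> D p vs = 0.
Proof.
move=> jD D0; elim=> [|h vs IH] p; first by move=> _; exact: D0.
move=> /all_in_cons[dh avs] Up.
have N0 := nrm_ge0 nX dh; have n0 := nprod_ge0 nX avs.
apply/normr0_eq0/eqP; rewrite eq_le normr_ge0 andbT.
apply/ler_addgt0Pl => e e0; rewrite addr0.
pose N := nrm X h * nprod X vs + 1.
have NN : 0 < N by rewrite ltr_wpDl// mulr_ge0.
have e1 : 0 < e / N by rewrite divr_gt0.
have [r r0 hr] := gj_fr jD (size vs) Up e1.
have [r' r'0 hU] := open_ray Up dh.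
pose t := Num.min (r' / 2) (r / (nrm X h + 1) / 2).
have N1 : 0 < nrm X h + 1 by rewrite ltr_wpDl.
have t0 : 0 < t by rewrite lt_min !divr_gt0.
have tr' : `|t| < r'.
  by rewrite gtr0_norm// gt_min; apply/orP; left; lra.
have tr : nrm X (t *: h) < r.
  apply: le_lt_trans (nrmZ nX t dh) _; rewrite gtr0_norm//.
  apply: (@le_lt_trans _ _ (r / (nrm X h + 1) / 2 * nrm X h)).
    by rewrite ler_wpM2r// ge_min lexx orbT.
  rewrite (_ : _ * _ = r * (nrm X h / (nrm X h + 1) / 2)); last by ring.
  rewrite gtr_pMr// ltr_pdivrMr// mul1r.
  by rewrite ltr_pdivrMr//; lra.
have := hr (t *: h) (ndZ nX t dh) tr (hU _ tr') vs (leqnn _) avs.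
rewrite (IH _ avs Up) (IH _ avs (hU _ tr')) !sub0r oppr0 add0r.
rewrite (gjet_scale nX jD t Up dh avs) /absg normrN normrM (gtr0_norm t0) => le.
have := ler_wpM2r n0 (ler_wpM2l (ltW e1) (nrmZ nX t dh)).
rewrite (gtr0_norm t0) => le2; have := le_trans le le2.
rewrite (_ : e / N * _ * _ = t * (e / N * (nrm X h * nprod X vs))); last by ring.
rewrite ler_pM2l// => /le_trans; apply.
rewrite (_ : _ * _ = e * (nrm X h * nprod X vs / N)); last by ring.
rewrite ger_pMr// ler_pdivrMr// mul1r /N; lra.
Qed.

(** Two formulas for one function on an open set have the same derivatives.  In this way
    the expansion of the transpose and the symplectic identity can be differentiated. *)
Lemma gjet_uniq D D' : gjet X U absg D -> gjet X U absg D' ->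
  (forall p, U p -> D p [::] = D' p [::]) ->
  forall vs p, all_in X vs -> U p -> D p vs = D' p vs.
Proof.
move=> jD jD' h vs p avs Up; apply/eqP; rewrite -subr_eq0; apply/eqP.
have jN : gjet X U absg (fun p vs => - D' p vs).
  apply: (gjet_map (c := 1) nX gauge_abs gauge_abs) jD' => //.
    by move=> a K K' w w' _ _; rewrite opprD scalerN.
  by move=> K w _; rewrite /absg mul1r normrN.
apply: (gjet_uniq0 (gjet_add gauge_abs jD jN)) => // q Uq.
by rewrite h// subrr.
Qed.

Lemma gjet_is_derive D p h vs (t : R) : gjet X U absg D -> dom X h -> all_in X vs ->
  U (p + t *: h) ->
  is_derive t 1 (fun s : R => D (p + s *: h) vs : R) (D (p + t *: h) (h :: vs)).
Proof.
move=> jD dh avs Ut; set q := p + t *: h in Ut *.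
have N0 := nrm_ge0 nX dh; have n0 := nprod_ge0 nX avs.
have N1 : 0 < nrm X h + 1 by rewrite ltr_wpDl.
have [r' r'0 hU] := open_ray Ut dh.
have lim : (fun s : R => s^-1 *: ((D (p + (s *: 1 + t) *: h) vs : R^o) - D q vs)) @ 0^'
    --> (D q (h :: vs) : R^o).
  apply/cvgrPdist_le => e e0.
  pose N := nrm X h * nprod X vs + 1.
  have NN : 0 < N by rewrite ltr_wpDl// mulr_ge0.
  have e1 : 0 < e / N by rewrite divr_gt0.
  have [r r0 hr] := gj_fr jD (size vs) Ut e1.
  near=> s.
  have s0 : s != 0 by near: s; exact: nbhs_dnbhs_neq.
  have sr' : `|s| < r'.
    near: s; apply: dnbhs0_lt; exact: r'0.
  have sr : `|s| < r / (nrm X h + 1).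
    near: s; apply: dnbhs0_lt; exact: divr_gt0.
  have trs : nrm X (s *: h) < r.
    apply: le_lt_trans (nrmZ nX s dh) _.
    move: sr; rewrite ltr_pdivlMr//; apply: le_lt_trans.
    by rewrite ler_wpM2l// lerDl.
  have := hr (s *: h) (ndZ nX s dh) trs (hU _ sr') vs (leqnn _) avs.
  have -> : p + (s *: 1 + t) *: h = q + s *: h.
    have -> : s *: 1 = s :> R by exact: mulr1.
    by rewrite /q -addrA -scalerDl [s + t]addrC.
  rewrite (gjet_scale nX jD s Ut dh avs) /absg => le.
  have := ler_wpM2r n0 (ler_wpM2l (ltW e1) (nrmZ nX s dh)) => le2.
  have {le le2} := le_trans le le2.
  set x := D _ vs; set y := D q vs; set z := D q _.
  have s1 : 0 < `|s| by rewrite normr_gt0.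
  have -> : (x - y - s *: z : R^o) = - (s * (z - s^-1 *: (x - y))).
    by rewrite /GRing.scale /= mulrBr mulrA mulfV// mul1r opprB.
  rewrite normrN normrM.
  rewrite (_ : e / N * _ * _ = `|s| * (e / N * (nrm X h * nprod X vs))); last by ring.
  rewrite ler_pM2l// => /le_trans; apply.
  rewrite (_ : _ * _ = e * (nrm X h * nprod X vs / N)); last by ring.
  by rewrite ger_pMr// ler_pdivrMr// mul1r /N; lra.
split; first by apply/cvg_ex; eexists; exact: lim.
by apply: cvg_lim; [exact: Rhausdorff|exact: lim].
Unshelve. all: by end_near. Qed.

Lemma gjet_mvt D p h vs K : gjet X U absg D -> dom X h -> all_in X vs ->
  (forall t : R, 0 <= t <= 1 -> U (p + t *: h)) ->
  (forall t : R, 0 <= t <= 1 -> `|D (p + t *: h) (h :: vs) : R| <= K) ->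
  forall t : R, 0 <= t <= 1 -> `|(D (p + t *: h) vs : R) - D p vs| <= K.
Proof.
move=> jD dh avs hU hK t /andP[t0 t1].
have der (s : R) : 0 <= s <= 1 ->
    is_derive s 1 (fun s : R => D (p + s *: h) vs : R) (D (p + s *: h) (h :: vs)).
  by move=> /hU; exact: gjet_is_derive.
have [||c] := @MVT_segment R (fun s : R => D (p + s *: h) vs : R)
    (fun s : R => D (p + s *: h) (h :: vs) : R) 0 t t0.
- move=> x; rewrite in_itv /= => /andP[x0 xt]; apply: der.
  by rewrite (ltW x0) (le_trans (ltW xt)).
- apply: continuous_in_subspaceT => x; rewrite inE /= in_itv /= => /andP[x0 xt].
  have hd : is_derive x 1 (fun s : R => D (p + s *: h) vs : R) (D (p + x *: h) (h :: vs)).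
    by apply: der; rewrite x0 (le_trans xt).
  by apply: differentiable_continuous; apply/derivable1_diffP; exact: ex_derive.
rewrite in_itv /= => /andP[c0 ct]; rewrite scale0r addr0 subr0 => ->.
rewrite normrM (ger0_norm t0).
have h1 := hK c; have {h1} := h1 _; rewrite c0 (le_trans ct)// => /(_ isT) h1.
by apply: le_trans (ler_wpM2l (normr_ge0 _) t1) _; rewrite mulr1.
Qed.

(** The mean value theorem applied twice, first to the derivative along h. *)
Lemma gjet_taylor D p h vs K : gjet X U absg D -> dom X h -> all_in X vs ->
  (forall t : R, 0 <= t <= 1 -> U (p + t *: h)) ->
  (forall t : R, 0 <= t <= 1 -> `|D (p + t *: h) (h :: h :: vs) : R| <= K) ->
  `|(D (p + h) vs : R) - D p vs - D p (h :: vs)| <= K.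
Proof.
move=> jD dh avs hU hK.
have hv : all_in X (h :: vs) by exact/all_in_cons.
have b1 := gjet_mvt jD dh hv hU hK.
pose L (s : R) := (D (p + s *: h) vs : R) - s * (D p (h :: vs) : R).
have der (s : R) : 0 <= s <= 1 ->
    is_derive s 1 L ((D (p + s *: h) (h :: vs) : R) - D p (h :: vs)).
  move=> /hU us; have d1 := gjet_is_derive jD dh avs us.
  rewrite /L; have d2 : is_derive s 1 (fun s : R => s * (D p (h :: vs) : R)) (D p (h :: vs) : R).
    by apply: is_derive_eq; rewrite scaler0 add0r; exact: mulr1.
  exact: is_deriveB.
have [||c] := @MVT_segment R L
    (fun s : R => (D (p + s *: h) (h :: vs) : R) - D p (h :: vs)) 0 1 ler01.
- move=> x; rewrite in_itv /= => /andP[x0 xt]; apply: der.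
  by rewrite (ltW x0) (ltW xt).
- apply: continuous_in_subspaceT => x; rewrite inE /= in_itv /= => xx.
  by apply: differentiable_continuous; apply/derivable1_diffP; have [] := der _ xx.
rewrite in_itv /= => cc; rewrite /L scale1r mul1r scale0r addr0 mul0r !subr0 mulr1.
rewrite addrAC => ->; exact: b1.
Qed.
End Jets2.

(** * Jets of families and of bounded operators *)

Section Conversions.
Variable R : realType.

Section Family.
Variables (V : lmodType R) (X : nspace V) (nX : normed X).
Variables (I : Type) (om : I -> R).
Hypothesis om0 : forall i, 0 <= om i.

Definition famg (K : R) (f : I -> R^o) := forall i, `|f i : R| <= K * om i.

(** Smoothness of each member of a family, together with locally uniform bounds of all
    orders, implies smoothness of the family: by [gjet_taylor] the first order remainder of
    each member is bounded by the second derivative, uniformly over the family. *)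
Lemma gjet_weak (U : set V) (D : V -> seq V -> I -> R^o) : nopen X U ->
  (forall i, gjet X U (@absg R) (fun p vs => D p vs i)) ->
  (forall p (l : nat), U p -> exists r C : R, [/\ 0 < r, 0 <= C &
    forall h, dom X h -> nrm X h < r -> U (p + h) ->
    forall vs, (size vs <= l)%N -> all_in X vs -> famg (C * nprod X vs) (D (p + h) vs)]) ->
  gjet X U famg D.
Proof.
move=> oU jD lD; have dU := oU.1; split=> [p a h k vs Up dh dk avs|p l Up|p l e Up e0].
- by apply/funext => i; exact: (gj_lin (jD i)).
- have [r [C [r0 C0 hC]]] := lD p l Up; exists C => // vs svs avs.
  have := hC 0 (nd0 nX); rewrite (nrm0 nX) addr0; exact.
- have [r [C [r0 C0 hC]]] := lD p l.+2 Up.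
  have [r' r'0 hr'] := oU.2 p Up.
  exists (Num.min (Num.min r r') (e / (C + 1))).
    by rewrite !lt_min r0 r'0 divr_gt0// ltr_wpDl.
  move=> h dh; rewrite !lt_min => /andP[/andP[h1 h2] h3] Uh vs svs avs i.
  have n0 := nprod_ge0 nX avs; have N0 := nrm_ge0 nX dh.
  have small (t : R) : 0 <= t <= 1 -> nrm X (t *: h) <= nrm X h.
    move=> /andP[t0 t1]; apply: le_trans (nrmZ nX t dh) _.
    by rewrite ger0_norm// ler_piMl.
  have Ut (t : R) : 0 <= t <= 1 -> U (p + t *: h).
    move=> tt; apply: hr'; split.
      by apply: (ndD nX) (ndZ nX _ dh); exact: dU.
    by rewrite [p + _]addrC addrK; apply: le_lt_trans (small t tt) h2.
  have := @gjet_taylor R V X nX U oU (fun p vs => D p vs i) p h vs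
     (C * nrm X h ^+ 2 * nprod X vs * om i) (jD i) dh avs Ut.
  move=> /(_ _)/le_trans; apply.
    move=> t tt; have := hC (t *: h) (ndZ nX t dh) (le_lt_trans (small t tt) h1) (Ut t tt)
      [:: h, h & vs] _ _ i.
    rewrite !nprod_cons [nrm X h * _]mulrA -expr2 mulrA; apply; first by rewrite !ltnS.
    by apply/all_in_cons; split=> //; exact/all_in_cons.
  rewrite ler_wpM2r// ler_wpM2r// expr2 mulrA ler_wpM2r//.
  move: h3; rewrite ltr_pdivlMr ?ltr_wpDl// => h3.
  by have := ltW h3; rewrite mulrDr mulr1 mulrC => /(le_trans _); apply; rewrite lerDl.
Qed.
End Family.

Section NormGauge.
Variables (W : lmodType R) (Y : nspace W) (nY : normed Y).

Definition ng (K : R) (w : W) := dom Y w /\ nrm Y w <= K.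
(** [is_jet] states linearity up to distance 0; for a separated target this is equality. *)
Definition sep := forall w, dom Y w -> nrm Y w = 0 -> w = 0.

Lemma gauge_ng : gauge ng.
Proof.
split => [K K0|K K' w KK [d h]|K K' w w' [d h] [d' h']|a K w [d h]].
- by split; [exact: (nd0 nY)|rewrite (nrm0 nY)].
- by split=> //; exact: le_trans KK.
- by split; [exact: (ndD nY)|apply: le_trans (nrmD nY d d') _; exact: lerD].
- by split; [exact: (ndZ nY)|apply: le_trans (nrmZ nY a d) _; rewrite ler_wpM2l].
Qed.

Variables (V : lmodType R) (X : nspace V) (nX : normed X).

Lemma sizes_bd (Q : R -> seq V -> Prop) :
  (forall K K' vs, K <= K' -> all_in X vs -> Q K vs -> Q K' vs) ->
  (forall l : nat, exists C : R, forall vs, size vs = l -> all_in X vs -> Q C vs) ->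
  forall l : nat, exists2 C : R, 0 <= C & forall vs, (size vs <= l)%N -> all_in X vs -> Q C vs.
Proof.
move=> Qm h; elim=> [|l [C C0 hC]].
  have [C hC] := h 0%N; exists `|C| => // vs; rewrite leqn0 => /eqP svs avs.
  by apply: Qm (hC vs svs avs) => //; exact: ler_norm.
have [C' hC'] := h l.+1; exists (C + `|C'|); first exact: addr_ge0.
move=> vs svs avs; have [/eqP s|s] := boolP (size vs == l.+1).
  apply: Qm (hC' vs s avs) => //; apply: le_trans (ler_norm _) _.
  by rewrite lerDr.
apply: Qm (hC vs _ avs) => //; first by rewrite lerDl.
by rewrite -ltnS ltn_neqAle s.
Qed.

Lemma sizes_fr (Q : nat -> R -> Prop) :
  (forall (l : nat) r r', 0 < r' <= r -> Q l r -> Q l r') ->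
  (forall l : nat, exists2 r : R, 0 < r & Q l r) ->
  forall l : nat, exists2 r : R, 0 < r & forall k, (k <= l)%N -> Q k r.
Proof.
move=> Qm h; elim=> [|l [r r0 hr]].
  by have [r r0 hr] := h 0%N; exists r => // k; rewrite leqn0 => /eqP ->.
have [r' r'0 hr'] := h l.+1; exists (Num.min r r'); first by rewrite lt_min r0.
have m0 : 0 < Num.min r r' by rewrite lt_min r0.
move=> k kl; have [->|kl'] := eqVneq k l.+1.
  by apply: Qm hr'; rewrite m0 ge_min lexx orbT.
apply: Qm (hr k _); first by rewrite m0 ge_min lexx.
by rewrite -ltnS ltn_neqAle kl'.
Qed.

Lemma is_jet_gjet U f D : sep -> is_jet X Y U f D -> gjet X U ng D.
Proof.
move=> sY [j0 jd jl jb jf]; split=> [p a h k vs Up dh dk avs|p l Up|p l e Up e0].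
- apply/eqP; rewrite -subr_eq0; apply/eqP; apply: sY; last exact: jl.
  have d (v : V) : dom X v -> all_in X (v :: vs) by move=> dv; apply/all_in_cons.
  apply: (ndB nY); first by apply: jd => //; apply: d; exact: (ndL nX).
  by apply: (ndL nY); apply: jd => //; exact: d.
- have [] := @sizes_bd (fun C vs => nrm Y (D p vs) <= C * nprod X vs) _ _ l.
  + move=> K K' vs KK avs /le_trans; apply.
    by rewrite ler_wpM2r// (nprod_ge0 nX).
  + by move=> l'; exact: jb.
  by move=> C C0 hC; exists C => // vs svs avs; split; [exact: jd|exact: hC].
- have [] := @sizes_fr (fun l r => forall h, dom X h -> nrm X h < r -> U (p + h) ->
      forall vs, size vs = l -> all_in X vs ->
      nrm Y (D (p + h) vs - D p vs - D p (h :: vs)) <= e * nrm X h * nprod X vs) _ _ l.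
  + move=> l' r r' /andP[_ rr] H h dh hh; apply: H => //; exact: lt_le_trans rr.
  + by move=> l'; exact: jf.
  move=> r r0 hr; exists r => // h dh hh Uh vs svs avs; split; last exact: (hr (size vs)).
  apply: (ndB nY); last by apply: jd => //; exact/all_in_cons.
  by apply: (ndB nY); exact: jd.
Qed.

Lemma gjet_is_jet U f D : gjet X U ng D -> (forall p, U p -> D p [::] = f p) ->
  is_jet X Y U f D.
Proof.
move=> jD D0; split=> //.
- by move=> p vs Up avs; have [C C0 /(_ vs (leqnn _) avs)[]] := gj_bd jD (size vs) Up.
- by move=> p a h k vs Up dh dk avs; rewrite (gj_lin jD)// subrr (nrm0 nY).
- move=> p l Up; have [C C0 hC] := gj_bd jD l Up; exists C => vs svs avs.
  by have [] := hC vs _ avs; rewrite ?svs.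
- move=> p l e Up e0; have [r r0 hr] := gj_fr jD l Up e0; exists r => // h dh hh Uh vs svs avs.
  by have [] := hr h dh hh Uh vs _ avs; rewrite ?svs.
Qed.
End NormGauge.

Section Operators.
Variables (A W : lmodType R) (XA : nspace A) (Y : nspace W).
Hypotheses (nA : normed XA) (nY : normed Y).

Let Q := {q : A | dom XA q}.

Definition opg (K : R) (T : Q -> W) := forall q, ng Y (K * nrm XA (sval q)) (T q).

Lemma gauge_opg : gauge opg.
Proof.
have gY := gauge_ng nY.
have q0 (q : Q) : 0 <= nrm XA (sval q) by exact: (nrm_ge0 nA (svalP q)).
split => [K K0 q|K K' w KK h q|K K' w w' h h' q|a K w h q].
- by apply: (g0 gY); rewrite mulr_ge0.
- by apply: (gle gY) (h q); rewrite ler_wpM2r.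
- by rewrite mulrDl; exact: (gD gY).
- by rewrite -mulrA; exact: (gZ gY).
Qed.

Lemma Bop_has_sup T : dom (Bop XA Y) T ->
  has_sup [set nrm Y (T v) | v in [set v | dom XA v /\ nrm XA v <= 1]].
Proof.
move=> [d _ [C hC]]; split.
  by exists (nrm Y (T 0)); exists 0 => //; split; [exact: (nd0 nA)|rewrite (nrm0 nA)].
exists `|C| => _ [v [dv v1] <-]; apply: le_trans (hC v dv) _.
have v0 := nrm_ge0 nA dv.
apply: (@le_trans _ _ (`|C| * nrm XA v)); first by rewrite ler_wpM2r// ler_norm.
by rewrite ler_piMr.
Qed.

Lemma Bop_app T q : dom (Bop XA Y) T -> dom XA q ->
  nrm Y (T q) <= nrm (Bop XA Y) T * nrm XA q.
Proof.
move=> dT dq; have [d l [C hC]] := dT; have q0 := nrm_ge0 nA dq.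
have [qz|qz] := eqVneq (nrm XA q) 0.
  by have := hC q dq; rewrite qz !mulr0.
have qp : 0 < nrm XA q by rewrite lt0r qz.
pose v := (nrm XA q)^-1 *: q.
have dv : dom XA v by exact: (ndZ nA).
have v1 : nrm XA v <= 1.
  apply: le_trans (nrmZ nA _ dq) _; rewrite ger0_norm ?invr_ge0//.
  by rewrite mulVf.
have T0 : T 0 = 0.
  have := l 1 0 0 (nd0 nA) (nd0 nA); rewrite scale1r addr0 scale1r => /esym/eqP.
  by rewrite -subr_eq0 addrK => /eqP.
have eq : T q = nrm XA q *: T v.
  have := l (nrm XA q) v 0 dv (nd0 nA); rewrite T0 !addr0 => <-.
  by rewrite /v scalerA mulfV// scale1r.
rewrite eq; apply: le_trans (nrmZ nY _ (d v dv)) _.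
rewrite ger0_norm// mulrC ler_wpM2r//.
by apply: ub_le_sup; [exact: (Bop_has_sup dT).2|exists v].
Qed.

Lemma Bop_nrm_ge0 T : dom (Bop XA Y) T -> 0 <= nrm (Bop XA Y) T.
Proof.
move=> dT; have [d _ _] := dT.
apply: le_trans (nrm_ge0 nY (d 0 (nd0 nA))) _.
apply: ub_le_sup; first exact: (Bop_has_sup dT).2.
by exists 0 => //; split; [exact: (nd0 nA)|rewrite (nrm0 nA)].
Qed.

Lemma Bop_le T K : 0 <= K -> (forall q, dom XA q -> nrm Y (T q) <= K * nrm XA q) ->
  nrm (Bop XA Y) T <= K.
Proof.
move=> K0 h; apply: ge_sup.
  by exists (nrm Y (T 0)); exists 0 => //; split; [exact: (nd0 nA)|rewrite (nrm0 nA)].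
by move=> _ [v [dv v1] <-]; apply: le_trans (h v dv) _; rewrite ler_piMr.
Qed.

Lemma normed_Bop_closed (a b : R) S T : dom (Bop XA Y) S -> dom (Bop XA Y) T ->
  dom (Bop XA Y) (fun q => a *: S q + b *: T q).
Proof.
move=> dS dT; have [d1 l1 _] := dS; have [d2 l2 _] := dT.
have n1 := Bop_nrm_ge0 dS; have n2 := Bop_nrm_ge0 dT.
split=> [v dv|c u v du dv|].
- by apply: (ndL nY); [exact: d1|apply: (ndZ nY); exact: d2].
- rewrite l1// l2// !scalerDr !scalerA (mulrC a c) (mulrC b c) -!scalerA.
  by rewrite addrACA.
- exists (`|a| * nrm (Bop XA Y) S + `|b| * nrm (Bop XA Y) T) => v dv.
  have e1 := d1 v dv; have e2 := d2 v dv.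
  apply: le_trans (nrmD nY (ndZ nY a e1) (ndZ nY b e2)) _.
  rewrite mulrDl -!mulrA; apply: lerD.
    apply: le_trans (nrmZ nY a e1) _; rewrite ler_wpM2l//; exact: Bop_app.
  apply: le_trans (nrmZ nY b e2) _; rewrite ler_wpM2l//; exact: Bop_app.
Qed.

Variables (V : lmodType R) (X : nspace V) (nX : normed X).

(** Operators in [Bop] are only meaningful on the domain; after restriction to it, two
    operators at distance 0 are equal. *)
Definition onQ (T : A -> W) : Q -> W := fun q => T (sval q).

Lemma is_jet_opg U f D : sep Y -> is_jet X (Bop XA Y) U f D ->
  gjet X U opg (fun p vs => onQ (D p vs)).
Proof.
move=> sY [j0 jd jl jb jf].
have dL p vs q : U p -> all_in X vs -> dom XA q -> dom Y (D p vs q).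
  by move=> Up avs dq; have [d _ _] := jd p vs Up avs; exact: d.
have d3 S T Z : dom (Bop XA Y) S -> dom (Bop XA Y) T -> dom (Bop XA Y) Z ->
    dom (Bop XA Y) (S - T - Z).
  move=> hS hT hZ; have := normed_Bop_closed 1 (-1) (normed_Bop_closed 1 (-1) hS hT) hZ.
  by congr dom; apply/funext => q; rewrite !scale1r !scaleN1r.
split=> [p a h k vs Up dh dk avs|p l Up|p l e Up e0].
- apply/funext => -[q dq]; rewrite /onQ /=.
  have d (v : V) : dom X v -> all_in X (v :: vs) by move=> dv; apply/all_in_cons.
  apply/eqP; rewrite -subr_eq0; apply/eqP; apply: sY.
    apply: (ndB nY); first by apply: dL => //; apply: d; exact: (ndL nX).
    by apply: (ndL nY); apply: dL => //; exact: d.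
  set T := D p ((a *: h + k) :: vs); set T1 := D p (h :: vs); set T2 := D p (k :: vs).
  have dT : dom (Bop XA Y) T by apply: jd => //; apply: d; exact: (ndL nX).
  have dT1 : dom (Bop XA Y) T1 by apply: jd => //; exact: d.
  have dT2 : dom (Bop XA Y) T2 by apply: jd => //; exact: d.
  have dd : dom (Bop XA Y) (T - (a *: T1 + T2)).
    have := normed_Bop_closed 1 (-1) dT (normed_Bop_closed a 1 dT1 dT2).
    by congr dom; apply/funext => v; rewrite !scale1r !scaleN1r.
  apply/eqP; rewrite eq_le; apply/andP; split.
    by have := Bop_app dd dq; rewrite jl// mul0r.
  by apply: (nrm_ge0 nY); have [d' _ _] := dd; exact: (d' q dq).
- have [] := @sizes_bd V X (fun C vs => nrm (Bop XA Y) (D p vs) <= C * nprod X vs) _ _ l.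
  + move=> K K' vs KK avs /le_trans; apply.
    by rewrite ler_wpM2r// (nprod_ge0 nX).
  + by move=> l'; exact: jb.
  move=> C C0 hC; exists C => // vs svs avs [q dq]; split; first exact: dL.
  apply: le_trans (Bop_app (jd p vs Up avs) dq) _.
  by rewrite ler_wpM2r ?(nrm_ge0 nA)// hC.
- have [] := @sizes_fr (fun l r => forall h, dom X h -> nrm X h < r -> U (p + h) ->
      forall vs, size vs = l -> all_in X vs ->
      nrm (Bop XA Y) (D (p + h) vs - D p vs - D p (h :: vs)) <= e * nrm X h * nprod X vs) _ _ l.
  + move=> l' r r' /andP[_ rr] H h dh hh; apply: H => //; exact: lt_le_trans rr.
  + by move=> l'; exact: jf.
  move=> r r0 hr; exists r => // h dh hh Uh vs svs avs [q dq].
  have ah : all_in X (h :: vs) by apply/all_in_cons.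
  have dd := d3 _ _ _ (jd _ _ Uh avs) (jd _ _ Up avs) (jd _ _ Up ah).
  split; first by have [d _ _] := dd; exact: (d q dq).
  apply: le_trans (Bop_app dd dq) _.
  by rewrite ler_wpM2r ?(nrm_ge0 nA)// (hr (size vs)).
Qed.

(** A jet measured by [opg] does not say that each D p vs is linear in the argument of
    the operator, so this is a separate hypothesis. *)
Lemma gjet_is_jet_Bop U f (D : V -> seq V -> A -> W) :
  gjet X U opg (fun p vs => onQ (D p vs)) ->
  (forall p vs, U p -> all_in X vs -> forall (a : R) u v, dom XA u -> dom XA v ->
     D p vs (a *: u + v) = a *: D p vs u + D p vs v) ->
  (forall p, U p -> D p [::] = f p) ->
  is_jet X (Bop XA Y) U f D.
Proof.
move=> jD lD D0; split=> //.
- move=> p vs Up avs; have [C C0 /(_ vs (leqnn _) avs) hC] := gj_bd jD (size vs) Up.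
  split=> [v dv|a u v du dv|]; first by case: (hC (exist _ v dv)).
    exact: lD.
  by exists (C * nprod X vs) => v dv; case: (hC (exist _ v dv)).
- move=> p a h k vs Up dh dk avs.
  have e q : dom XA q -> D p ((a *: h + k) :: vs) q = a *: D p (h :: vs) q + D p (k :: vs) q.
    by move=> dq; have := congr1 (@^~ (exist _ q dq)) (gj_lin jD a Up dh dk avs).
  have E : [set nrm Y ((D p ((a *: h + k) :: vs) - (a *: D p (h :: vs) + D p (k :: vs))) v)
     | v in [set v | dom XA v /\ nrm XA v <= 1]] = [set 0].
    apply/seteqP; split=> [_ [v [dv _] <-]|_ ->] /=.
      by rewrite -[RHS](nrm0 nY); congr nrm; rewrite -(subrr (D p ((a *: h + k) :: vs) v)) {2}e.
    exists 0; first by split; [exact: (nd0 nA)|rewrite (nrm0 nA)].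
    rewrite -[RHS](nrm0 nY); congr nrm.
    by rewrite -(subrr (D p ((a *: h + k) :: vs) 0)) {2}e//; exact: (nd0 nA).
  by rewrite /= E sup1.
- move=> p l Up; have [C C0 hC] := gj_bd jD l Up; exists C => vs svs avs.
  apply: Bop_le; first by rewrite mulr_ge0// (nprod_ge0 nX).
  by move=> q dq; have [|_] := hC vs _ avs (exist _ q dq); rewrite ?svs.
- move=> p l e Up e0; have [r r0 hr] := gj_fr jD l Up e0; exists r => // h dh hh Uh vs svs avs.
  apply: Bop_le; first by rewrite !mulr_ge0 ?(nprod_ge0 nX) ?(nrm_ge0 nX dh)// ltW.
  by move=> q dq; have [|_] := hr h dh hh Uh vs _ avs (exist _ q dq); rewrite ?svs.
Qed.
End Operators.
End Conversions.

(** * The spaces of the scale, the pairing and trigonometric modes *)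

Section Constructions.
Variable R : realType.
Lemma normed_subsp (V : lmodType R) (X : nspace V) (A : set V) : normed X -> A 0 ->
  (forall (a : R) u v, A u -> A v -> A (a *: u + v)) -> normed (subsp X A).
Proof.
move=> nX A0 AL; split=> /=.
- by split => //; exact: (nd0 nX).
- by move=> a u v [du Au] [dv Av]; split; [exact: (ndL nX)|exact: AL].
- by move=> u [du _]; exact: (nrm_ge0 nX).
- by move=> u v [du _] [dv _]; exact: (nrmD nX).
- by move=> a u [du _]; exact: (nrmZ nX).
Qed.
Lemma sep_subsp (V : lmodType R) (X : nspace V) (A : set V) : sep X -> sep (subsp X A).
Proof. by move=> sX u [du _]; exact: sX. Qed.

Lemma normed_prodsp (V W : lmodType R) (X : nspace V) (Y : nspace W) :
  normed X -> normed Y -> normed (prodsp X Y).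
Proof.
move=> nX nY; split=> /=.
- by split; [exact: (nd0 nX)|exact: (nd0 nY)].
- by move=> a u v [d1 d2] [d1' d2']; split; [exact: (ndL nX)|exact: (ndL nY)].
- by move=> u [d1 d2]; rewrite addr_ge0 ?(nrm_ge0 nX)// (nrm_ge0 nY).
- move=> u v [d1 d2] [d1' d2']; rewrite addrACA; apply: lerD.
    exact: (nrmD nX).
  exact: (nrmD nY).
- move=> a u [d1 d2]; rewrite mulrDr; apply: lerD; [exact: (nrmZ nX)|exact: (nrmZ nY)].
Qed.
Lemma sep_prodsp (V W : lmodType R) (X : nspace V) (Y : nspace W) :
  normed X -> normed Y -> sep X -> sep Y -> sep (prodsp X Y).
Proof.
move=> nX nY sX sY [u v] [/= du dv] h.
have h1 := nrm_ge0 nX du; have h2 := nrm_ge0 nY dv.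
by congr pair; [apply: sX => //|apply: sY => //]; lra.
Qed.

End Constructions.

Section NormedInstances.
Variable R : realType.
Implicit Types (u v : dist R) (s r K : R).

Lemma normed_Hs s : normed (Hs R s).
Proof.
split.
- by have /hsgP[] := hsg0 s.
- by move=> a u v /hsg_nrm hu /hsg_nrm hv; have /hsgP[] := hsgD (hsgZ a hu) hv.
- by move=> u _; exact: sqrtr_ge0.
- by move=> u v /hsg_nrm hu /hsg_nrm hv; have /hsgP[] := hsgD hu hv.
- by move=> a u /hsg_nrm hu; have /hsgP[] := hsgZ a hu.
Qed.

Lemma sep_Hs s : sep (Hs R s).
Proof.
move=> u du n0; have := hsg_nrm du; rewrite n0 => /hsg_supg[_ h].
apply/funext => n; apply: cabs_eq0.
by have := h n; rewrite mulr0 mul0r.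
Qed.

Lemma normed_Hs0 s : normed (Hs0 R s).
Proof.
apply: normed_subsp; first exact: normed_Hs.
  by [].
move=> a u v /= u0 v0; rewrite [LHS]/(a *: u 0 + v 0) u0 v0.
by apply: complexP; rewrite ?cReD ?cImD ?cReZ ?cImZ /= mulr0 addr0.
Qed.
Lemma sep_Hs0 s : sep (Hs0 R s).
Proof. by apply: sep_subsp; exact: sep_Hs. Qed.
Lemma normed_Hsperp (S : {fset nat}) s : normed (Hsperp R S s).
Proof.
apply: normed_subsp; first exact: normed_Hs.
  by [].
move=> a u v /= u0 v0 n nS; rewrite [LHS]/(a *: u n + v n) u0// v0//.
by apply: complexP; rewrite ?cReD ?cImD ?cReZ ?cImZ /= mulr0 addr0.
Qed.
Lemma sep_Hsperp (S : {fset nat}) s : sep (Hsperp R S s).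
Proof. by apply: sep_subsp; exact: sep_Hs. Qed.

Lemma normed_RSsp (S : {fset nat}) : normed (RSsp R S).
Proof.
have sq (y : RS R S) : \sum_(j : S) (y j : R) ^+ 2 <= (Num.sqrt (\sum_(j : S) (y j : R) ^+ 2)) ^+ 2.
  by rewrite sqr_sqrtr// sumr_ge0// => j _; exact: sqr_ge0.
have sle (A B : R) : 0 <= B -> A <= B ^+ 2 -> Num.sqrt A <= B.
  by move=> B0 h; rewrite -(ger0_norm B0) -sqrtr_sqr ler_sqrt// sqr_ge0.
split=> //.
- by move=> u _; exact: sqrtr_ge0.
- move=> u v _ _; apply: sle; first by rewrite addr_ge0 ?sqrtr_ge0.
  under eq_bigr do rewrite ffunE.
  by apply: minkowski_sum; rewrite ?sqrtr_ge0 ?sq.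
- move=> a u _; apply: sle; first by rewrite mulr_ge0 ?sqrtr_ge0.
  rewrite exprMn real_normK ?num_real//.
  apply: le_trans (ler_wpM2l (sqr_ge0 a) (sq u)).
  by rewrite mulr_sumr; apply: ler_sum => j _; rewrite ffunE -exprMn.
Qed.
Lemma RSsp_coord (S : {fset nat}) (y : RS R S) j : `|y j : R| <= nrm (RSsp R S) y.
Proof.
rewrite /= -sqrtr_sqr ler_sqrt; last by apply: sumr_ge0 => i _; exact: sqr_ge0.
by rewrite (bigD1 j)//= lerDl sumr_ge0// => i _; exact: sqr_ge0.
Qed.
Lemma RSsp_le (S : {fset nat}) (y : RS R S) K : 0 <= K -> (forall j, `|y j : R| <= K) ->
  nrm (RSsp R S) y <= #|{: S}|%:R * K.
Proof.
move=> K0 h.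
have B0 : 0 <= #|{: S}|%:R * K by rewrite mulr_ge0.
rewrite -[leRHS](ger0_norm B0) -sqrtr_sqr ler_sqrt ?sqr_ge0//.
apply: (@le_trans _ _ (\sum_(j : S) K ^+ 2)).
  by apply: ler_sum => j _; rewrite -real_normK ?num_real// ler_sqr ?nnegrE.
rewrite sumr_const -[leLHS]mulr_natl exprMn ler_wpM2r ?sqr_ge0//.
by rewrite -natrX ler_nat; case: #|_| => // n; rewrite expnS leq_pmulr.
Qed.
Lemma sep_RSsp (S : {fset nat}) : sep (RSsp R S).
Proof.
move=> y _ h; apply/ffunP => j; rewrite ffunE; apply/normr0_eq0/eqP.
by rewrite eq_le normr_ge0 andbT -h RSsp_coord.
Qed.

Lemma normed_Esp (S : {fset nat}) s : normed (Esp S s).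
Proof.
have n := normed_RSsp S.
exact: (normed_prodsp (normed_prodsp n n) (normed_Hsperp S s)).
Qed.
Lemma sep_Esp (S : {fset nat}) s : sep (@Esp R S s).
Proof.
have n := normed_RSsp S; have h := sep_RSsp (S := S).
exact: (sep_prodsp (normed_prodsp n n) (normed_Hsperp S s)
  (sep_prodsp n n h h) (@sep_Hsperp S s)).
Qed.
Lemma normed_Psp (S : {fset nat}) s : normed (@Psp R S s).
Proof. exact: (normed_prodsp (normed_Esp S s) (normed_RSsp S)). Qed.

Lemma Hs_mono s r u : r <= s -> dom (Hs R s) u -> dom (Hs R r) u /\ nrm (Hs R r) u <= nrm (Hs R s) u.
Proof. by move=> rs /hsg_nrm/(hsg_le rs)/hsgP. Qed.
Lemma Hsperp_mono (S : {fset nat}) s r u : r <= s -> dom (Hsperp R S s) u ->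
  dom (Hsperp R S r) u /\ nrm (Hsperp R S r) u <= nrm (Hsperp R S s) u.
Proof. by move=> rs [/(Hs_mono rs)[h1 h2] h]. Qed.
Lemma Esp_mono (S : {fset nat}) s r (x : E R S) : r <= s -> dom (Esp S s) x ->
  dom (Esp S r) x /\ nrm (Esp S r) x <= nrm (Esp S s) x.
Proof. by move=> rs [h1 /(Hsperp_mono rs)[h2 h3]]; split=> //; rewrite lerD2l. Qed.
Lemma Psp_mono (S : {fset nat}) s r (x : P R S) : r <= s -> dom (Psp S s) x ->
  dom (Psp S r) x /\ nrm (Psp S r) x <= nrm (Psp S s) x.
Proof. by move=> rs [/(Esp_mono rs)[h2 h3] h1]; split=> //; rewrite lerD2r. Qed.
Lemma Hs0_mono s r u : r <= s -> dom (Hs0 R s) u -> dom (Hs0 R r) u /\ nrm (Hs0 R r) u <= nrm (Hs0 R s) u.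
Proof. by move=> rs [/(Hs_mono rs)[h1 h2] h]. Qed.
End NormedInstances.

Section Pairing.
Variable R : realType.
Implicit Types (u v q : dist R) (s r K C : R).

Definition l2abs u v C := abss (fun n => cabs (u n) * cabs (v (- n))) C.

Lemma l2abs_cabss u v C : l2abs u v C -> cabss (fun n => (u n : R[i]) * (v (- n) : R[i])) C.
Proof. by move=> h; apply: (cabss_dom _ h) => n; exact: cabsM. Qed.
Lemma l2dotE u v : l2dot u v = complex.Re (csum (fun n => (u n : R[i]) * (v (- n) : R[i]))).
Proof. by []. Qed.
Lemma l2dot_le u v C : l2abs u v C -> `|l2dot u v| <= C.
Proof. by move=> /l2abs_cabss h; exact: zsum_le (cabss_Re h). Qed.
Lemma l2dotPl a u u' v C C' : l2abs u v C -> l2abs u' v C' ->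
  l2dot (a *: u + u') v = a * l2dot u v + l2dot u' v.
Proof.
move=> /l2abs_cabss/cabss_Re h /l2abs_cabss/cabss_Re h'.
rewrite /l2dot -(zsumZ a h) -(zsumD (abssZ a h) h'); apply: eq_zsum => n.
by rewrite [(a *: u + u') n]/(a *: u n + u' n) !cReM !cReD !cImD !cReZ !cImZ; ring.
Qed.
Lemma l2dotPr a u v v' C C' : l2abs u v C -> l2abs u v' C' ->
  l2dot u (a *: v + v') = a * l2dot u v + l2dot u v'.
Proof.
move=> /l2abs_cabss/cabss_Re h /l2abs_cabss/cabss_Re h'.
rewrite /l2dot -(zsumZ a h) -(zsumD (abssZ a h) h'); apply: eq_zsum => n.
by rewrite [(a *: v + v') _]/(a *: v (-n) + v' (-n)) !cReM !cReD !cImD !cReZ !cImZ; ring.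
Qed.
Lemma l2dotC u v : l2dot u v = l2dot v u.
Proof.
rewrite /l2dot -zsum_opp; apply: eq_zsum => n.
by rewrite opprK !cReM; ring.
Qed.
Lemma l2abs_supg r1 r2 K1 K2 u v : supg r1 K1 u -> supg r2 K2 v -> 2 <= r1 + r2 ->
  l2abs u v (K1 * K2 * 6).
Proof.
move=> hu hv h; have k1 := supg_ge0 hu; have k2 := supg_ge0 hv.
have := abssZ (K1 * K2) (abss_jbr0 R); rewrite ger0_norm ?mulr_ge0//.
apply: abss_le => n; rewrite !normrM !(ger0_norm (cabs_ge0 _)) (ger0_norm k1).
rewrite (ger0_norm k2) (ger0_norm (jpow_ge0 _ _)).
apply: le_trans (ler_pM (cabs_ge0 _) (cabs_ge0 _) (hu.2 n) (hv.2 (-n))) _.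
rewrite jpow_opp mulrACA ler_wpM2l ?mulr_ge0// -jpowD ler_jpow//; lra.
Qed.
Lemma l2abs_hsg K1 K2 u v : hsg 0 K1 u -> hsg 0 K2 v -> l2abs u v (2 * (K1 * K2)).
Proof.
move=> hu hv s us.
have [ru k1 h1] := hu; have [rv k2 h2] := hv.
have e (w : dist R) K t : hsq 0 (K ^+ 2) w -> uniq t -> \sum_(n <- t) cabs (w n) ^+ 2 <= (Num.sqrt 2 * K) ^+ 2.
  move=> h ut; rewrite exprMn sqr_sqrtr//; apply: le_trans (ler_wpM2l (ler0n _ 2) (h t ut)).
  rewrite mulr_sumr; apply: ler_sum => n _.
  by rewrite mulr0 jpow0 mul1r; exact: cabs_le_sq.
have e2 : \sum_(n <- s) cabs (v (- n)) ^+ 2 <= (Num.sqrt 2 * K2) ^+ 2.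
  rewrite -(big_map -%R xpredT (fun n => cabs (v n) ^+ 2)); apply: e => //.
  by rewrite map_inj_uniq//; exact: oppr_inj.
have := cauchy_schwarz _ _ (e u K1 s h1 us) e2.
rewrite !mulr_ge0 ?sqrtr_ge0// => /(_ isT isT).
rewrite mulrACA -expr2 sqr_sqrtr//.
by under [leLHS]eq_bigr do rewrite -(ger0_norm (mulr_ge0 (cabs_ge0 _) (cabs_ge0 _))).
Qed.

Definition trig (m : int) (z : R[i]) : dist R :=
  fun n => (if n == m then z else 0) + (if n == - m then conjc z else 0).

Lemma trig_real m z : real_valued (trig m z).
Proof.
move=> n; rewrite /trig cconjD eqr_opp eqr_oppLR addrC; congr (_ + _).
  by case: eqP => // _; apply: complexP => //=; rewrite oppr0.
case: eqP => _; [by case: z => a b /=; rewrite opprK|].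
by apply: complexP => //=; rewrite oppr0.
Qed.
Lemma trig_out m z n : n \notin [:: m; - m] -> trig m z n = 0.
Proof.
rewrite !inE negb_or /trig => /andP[/negbTE -> /negbTE ->].
by apply: complexP; rewrite /= addr0.
Qed.
Lemma trig_uniq (m : int) : m != 0 -> uniq [:: m; - m].
Proof. by move=> m0; rewrite /= inE andbT; apply: contra m0 => /eqP; lia. Qed.
Lemma trig_at m z : m != 0 -> trig m z m = z.
Proof.
move=> m0; rewrite /trig eqxx ifF; last by apply/negbTE; have := trig_uniq m0; rewrite /= inE andbT.
by apply: complexP; rewrite ?cReD ?cImD /= addr0.
Qed.
Lemma trig_atN m z : m != 0 -> trig m z (- m) = conjc z.
Proof. by move=> m0; rewrite trig_real trig_at. Qed.
Lemma trig_neg m z : trig (- m) z = trig m (conjc z).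
Proof.
apply/funext => n; rewrite /trig opprK addrC; congr (_ + _).
by case: eqP => //; case: z => a b /=; rewrite opprK.
Qed.
Lemma trigZ m (a : R) z : trig m (a *: (z : Rcomplex R)) = a *: trig m z.
Proof.
apply/funext => n; rewrite [RHS]/(a *: trig m z n) /trig.
by case: eqP => _; case: eqP => _; apply: complexP; rewrite ?cReD ?cImD ?cReZ ?cImZ ?cReD ?cImD //=; case: z => b c /=; ring.
Qed.

Lemma trig_csum (f : int -> R[i]) m z : m != 0 ->
  csum (fun n => f n * (trig m z (- n) : R[i])) = f m * conjc z + f (- m) * z.
Proof.
move=> m0; rewrite (csum_fin (trig_uniq m0)).
  by rewrite !big_cons big_nil addr0 opprK trig_atN// trig_at.
move=> n; rewrite !inE => h; rewrite trig_out ?mulr0// !inE.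
by rewrite eqr_oppLR eqr_opp orbC.
Qed.

Lemma l2dot_trig u m z : m != 0 -> real_valued u ->
  l2dot u (trig m z) = 2 * complex.Re ((u m : R[i]) * conjc z).
Proof.
move=> m0 ru; rewrite l2dotE (trig_csum (fun n => u n)) // ru.
by rewrite cReD !cReM; case: z (u m) => [a b] [c d] /=; ring.
Qed.

Lemma trig_hsg s m z : m != 0 -> cabs z <= 2^-1 -> hsg s (jpow m s) (trig m z).
Proof.
move=> m0 hz; split; [exact: trig_real|exact: jpow_ge0|move=> t ut].
have := @abss_fin R (fun n => jpow n (2 * s) * (complex.Re (trig m z n) ^+ 2 + complex.Im (trig m z n) ^+ 2)) _ (trig_uniq m0).
move=> /(_ _ t ut) h.
apply: le_trans (ler_sum _ (fun n _ => ler_norm _)) _; apply: le_trans (h _) _.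
  by move=> n /trig_out ->; rewrite /= !expr0n /= addr0 mulr0.
rewrite !big_cons big_nil addr0 jpow_opp trig_atN// trig_at//.
have hh : complex.Re z ^+ 2 + complex.Im z ^+ 2 <= 2^-1.
  apply: le_trans (sq_le_cabs z) _; have := cabs_ge0 z; nra.
have -> : complex.Re (conjc z) ^+ 2 + complex.Im (conjc z) ^+ 2 = complex.Re z ^+ 2 + complex.Im z ^+ 2.
  by case: z {hz h hh} => a b /=; rewrite sqrrN.
rewrite ger0_norm ?mulr_ge0 ?jpow_ge0 ?addr_ge0 ?sqr_ge0// jpow_sq.
have := ler_wpM2l (sqr_ge0 (jpow m s)) hh; lra.
Qed.
Lemma trig_supg r m z : m != 0 -> cabs z <= 2^-1 -> supg r (jpow m r) (trig m z).
Proof.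
move=> m0 hz; split; first exact: trig_real.
move=> n; have [h|h] := boolP (n \in [:: m; - m]); last first.
  by rewrite trig_out// cabs0 mulr_ge0 ?jpow_ge0.
have -> : jpow n (- r) = jpow m (- r) :> R.
  by move: h; rewrite !inE => /orP[] /eqP -> //; rewrite jpow_opp.
rewrite jpowNK; apply: (@le_trans _ _ 2^-1); last lra.
by move: h; rewrite !inE => /orP[] /eqP ->; rewrite ?trig_at ?trig_atN ?cabs_conj.
Qed.
End Pairing.

(** * Coordinates on phase space *)

Section Probes.
Variables (R : realType) (S : {fset nat}).
Implicit Types (u v q : dist R) (s r K C : R) (e : E R S).

(** The real basis of phase space against which transposes are tested: unit vectors in
    theta and y, and for each frequency two real trigonometric modes. *)
Inductive probe := Pth of S | Py of S | Pw of int & bool.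

(** With this normalization, pairing with a mode returns exactly the real or the
    imaginary part of the coefficient ([dotE_probe]). *)
Definition half_unit (b : bool) : R[i] := if b then Complex 0 2^-1 else Complex 2^-1 0.

Lemma cabs_half_unit b : cabs (half_unit b) <= 2^-1.
Proof. by case: b; rewrite /cabs /= normr0 ?addr0 ?add0r ger0_norm ?invr_ge0. Qed.

Definition probe_vec (c : probe) : E R S :=
  match c with
  | Pth j => (eS R j, 0, 0)
  | Py j => (0, eS R j, 0)
  | Pw m b => (0, 0, trig m (half_unit b))
  end.

Definition pcoord e (c : probe) : R :=
  match c with
  | Pth j => e.1.1 j
  | Py j => e.1.2 j
  | Pw m b => if b then complex.Im (e.2 m) else complex.Re (e.2 m)
  end.

(** Only the frequencies in S^perp occur in the third component. *)
Definition probe_ok (c : probe) := if c is Pw m _ then Sperp S m else true.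
(** The theta and y directions are finite in number and count as bounded frequencies. *)
Definition probe_pow (c : probe) r : R := if c is Pw m _ then jpow m r else 1.

Lemma probe_pow_ge0 c r : 0 <= probe_pow c r.
Proof. by case: c => *; rewrite /= ?jpow_ge0. Qed.

Lemma Sperp_neq0 m : Sperp S m -> m != 0. Proof. by case/andP. Qed.
Lemma SperpN m : Sperp S (- m) = Sperp S m.
Proof. by rewrite /Sperp oppr_eq0 abszN. Qed.

Lemma Esp_nrmE s e : nrm (Esp S s) e =
  nrm (RSsp R S) e.1.1 + nrm (RSsp R S) e.1.2 + nrm (Hs R s) e.2.
Proof. by []. Qed.

Lemma Esp_nrm_mk s (th y : RS R S) (w : dist R) : nrm (Esp S s) ((th, y, w) : E R S) =
  nrm (RSsp R S) th + nrm (RSsp R S) y + nrm (Hs R s) w.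
Proof. by []. Qed.

Lemma Esp0w s (u : dist R) K : hsg s K u -> (forall n, ~~ Sperp S n -> u n = 0) ->
  ng (Esp S s) K ((0, 0, u) : E R S).
Proof.
move=> hu u0; have /hsgP[d h] := hu; split; first by split=> //; split.
by rewrite Esp_nrm_mk !(nrm0 (normed_RSsp R S)) !add0r.
Qed.

Lemma probe_vec_dom s c : probe_ok c -> dom (Esp S s) (probe_vec c).
Proof.
case: c => [j|j|m b] ok; rewrite /probe_vec.
- by split=> //; have := nd0 (normed_Hsperp S s).
- by split=> //; have := nd0 (normed_Hsperp S s).
- have m0 := Sperp_neq0 ok.
  have [] // := Esp0w (trig_hsg s m0 (cabs_half_unit b)).
  move=> n nS; apply: trig_out; rewrite !inE.
  by apply: contra nS => /orP[] /eqP ->; rewrite ?SperpN.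
Qed.

Lemma pcoord_ext e e' : (forall n, ~~ Sperp S n -> e.2 n = e'.2 n) ->
  (forall c, probe_ok c -> pcoord e c = pcoord e' c) -> e = e'.
Proof.
case: e e' => [[th y] w] [[th' y'] w'] /= h0 h.
have -> : th = th' by apply/ffunP => j; exact: (h (Pth j)).
have -> : y = y' by apply/ffunP => j; exact: (h (Py j)).
congr pair; apply/funext => n; have [nS|nS] := boolP (Sperp S n); last exact: h0.
by apply: complexP; [exact: (h (Pw n false))|exact: (h (Pw n true))].
Qed.

Lemma pcoordL (a : R) e e' c : pcoord (a *: e + e') c = a * pcoord e c + pcoord e' c.
Proof.
case: c => [j|j|m b]; rewrite /pcoord /=; try by rewrite !ffunE.
by rewrite [(a *: e.2 + e'.2) m]/(a *: e.2 m + e'.2 m) cReD cImD cReZ cImZ; case: b.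
Qed.
Lemma pcoordD e e' c : pcoord (e + e') c = pcoord e c + pcoord e' c.
Proof. by rewrite -[e in LHS]scale1r pcoordL mul1r. Qed.
Lemma pcoordN e c : pcoord (- e) c = - pcoord e c.
Proof.
have -> : - e = (-1) *: e + 0 by rewrite scaleN1r addr0.
rewrite pcoordL mulN1r; case: c => [j|j|m b] /=; rewrite ?ffunE ?addr0//.
by case: b; rewrite addr0.
Qed.
Lemma pcoordB e e' c : pcoord (e - e') c = pcoord e c - pcoord e' c.
Proof. by rewrite pcoordD pcoordN. Qed.

Lemma dotS_eS (y : RS R S) j : dotS y (eS R j) = y j.
Proof.
rewrite /dotS (bigD1 j)//= ffunE eqxx mulr1 big1 ?addr0// => i /negbTE ij.
by rewrite ffunE ij mulr0.
Qed.
Lemma dotS0 (y : RS R S) : dotS y 0 = 0.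
Proof. by rewrite /dotS big1// => i _; rewrite ffunE mulr0. Qed.
Lemma l2dot0r u : l2dot u 0 = 0.
Proof.
rewrite l2dotE (_ : (fun n => _) = (fun=> 0)); last by apply/funext => n; rewrite mulr0.
by rewrite (csum_fin (s := [::])) ?big_nil.
Qed.

Lemma dotE_probe e c : real_valued e.2 -> probe_ok c -> dotE e (probe_vec c) = pcoord e c.
Proof.
move=> re ok; rewrite /dotE /xth /xy /xw; case: c ok => [j|j|m b] /= ok.
- by rewrite dotS_eS dotS0 l2dot0r !addr0.
- by rewrite dotS_eS dotS0 l2dot0r addr0 add0r.
- rewrite !dotS0 !add0r l2dot_trig ?(Sperp_neq0 ok)// cReM.
  by case: b => /=; lra.
Qed.

Lemma WE_probe e m b : WE e (probe_vec (Pw m b)) = WL2 e.2 (trig m (half_unit b)).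
Proof.
rewrite /WE /xth /xy /xw /= dotS0 (_ : dotS 0 _ = 0) ?subr0 ?add0r//.
by rewrite /dotS big1// => i _; rewrite ffunE mul0r.
Qed.

Lemma Esp_pcoord s K e c : ng (Esp S s) K e -> probe_ok c -> `|pcoord e c| <= 2 * K * probe_pow c (- s).
Proof.
move=> [[[_ _] [dw hw]] h] ok.
rewrite Esp_nrmE in h.
have h1 := nrm_ge0 (normed_RSsp R S) (u := e.1.1) I.
have h2 := nrm_ge0 (normed_RSsp R S) (u := e.1.2) I.
have h3 := nrm_ge0 (normed_Hs s) dw.
case: c ok => [j|j|m b] /= ok.
- by rewrite mulr1; have := RSsp_coord e.1.1 j; lra.
- by rewrite mulr1; have := RSsp_coord e.1.2 j; lra.
- have hK : nrm (Hs R s) e.2 <= K by lra.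
  have /(hsg_leK hK)/hsg_supg[_ /(_ m)] := hsg_nrm dw.
  by case: b; apply: le_trans; [exact: Im_le_cabs|exact: Re_le_cabs].
Qed.

(** A converse of [Esp_pcoord], one derivative below. *)
Lemma pcoord_Esp r K e : 0 <= K -> real_valued e.2 -> (forall n, ~~ Sperp S n -> e.2 n = 0) ->
  (forall c, probe_ok c -> `|pcoord e c| <= K * probe_pow c (- r)) ->
  ng (Esp S (r - 1)) ((2 * #|{: S}|%:R + 6) * K) e.
Proof.
move=> K0 re e0 h.
have hw : supg r (2 * K) e.2.
  split=> // n; have [nS|nS] := boolP (Sperp S n); last first.
    by rewrite e0// cabs0 !mulr_ge0 ?jpow_ge0.
  have := h (Pw n true) nS; have := h (Pw n false) nS; rewrite /cabs /=; lra.
have /supg_hsg/hsgP[dw nw] := hw.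
split; first by split=> //; split.
have h1 : nrm (RSsp R S) e.1.1 <= #|{: S}|%:R * K.
  by apply: RSsp_le => // j; have := h (Pth j) isT; rewrite mulr1.
have h2 : nrm (RSsp R S) e.1.2 <= #|{: S}|%:R * K.
  by apply: RSsp_le => // j; have := h (Py j) isT; rewrite mulr1.
rewrite Esp_nrmE; lra.
Qed.

Lemma PperpD u v : Pperp S (u + v) = Pperp S u + Pperp S v.
Proof.
apply/funext => n; rewrite [RHS]/(Pperp S u n + Pperp S v n) /Pperp.
by case: ifP => // _; apply: complexP; rewrite /= addr0.
Qed.
Lemma PperpZ (a : R) u : Pperp S (a *: u) = a *: Pperp S u.
Proof.
apply/funext => n; rewrite [RHS]/(a *: Pperp S u n) /Pperp.
by case: ifP => // _; apply: complexP; rewrite /= mulr0.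
Qed.
Lemma Pperp0 : Pperp S (0 : dist R) = 0.
Proof. by apply/funext => n; rewrite /Pperp; case: ifP. Qed.
Lemma Pperp_real u : real_valued u -> real_valued (Pperp S u).
Proof.
move=> ru n; rewrite /Pperp SperpN; case: ifP => _; first exact: ru.
by apply: complexP; rewrite //= oppr0.
Qed.
Lemma Pperp_out u n : ~~ Sperp S n -> Pperp S u n = 0.
Proof. by rewrite /Pperp => /negbTE ->. Qed.
Lemma Pperp_hsg s K u : hsg s K u -> hsg s K (Pperp S u).
Proof.
move=> [ru K0 hu]; split=> //; first exact: Pperp_real.
move=> t ut; apply: le_trans (hu t ut); apply: ler_sum => n _.
rewrite /Pperp; case: ifP => // _; rewrite /= !expr0n /= addr0 mulr0.
by rewrite mulr_ge0 ?jpow_ge0// addr_ge0 ?sqr_ge0.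
Qed.

Definition in_w u : E R S := (0, 0, Pperp S u).
Lemma in_wL (a : R) u v : in_w (a *: u + v) = a *: in_w u + in_w v.
Proof.
transitivity ((a *: 0 + 0, a *: 0 + 0, a *: Pperp S u + Pperp S v) : E R S) => //.
by rewrite scaler0 addr0 -PperpZ -PperpD.
Qed.
Lemma in_wD u v : in_w (u + v) = in_w u + in_w v.
Proof. by rewrite -[u in LHS]scale1r in_wL scale1r. Qed.
Lemma in_w0 : in_w 0 = 0. Proof. by rewrite /in_w Pperp0. Qed.
Lemma in_w_sum (I : Type) (s : seq I) (F : I -> dist R) :
  in_w (\sum_(i <- s) F i) = \sum_(i <- s) in_w (F i).
Proof. exact: (big_morph _ in_wD in_w0). Qed.
Lemma in_w_ng s K u : hsg s K u -> ng (Esp S s) K (in_w u).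
Proof. by move=> /Pperp_hsg h; apply: Esp0w h _ => n; exact: Pperp_out. Qed.
Lemma pcoord_in_w u c : probe_ok c -> pcoord (in_w u) c =
  if c is Pw m b then (if b then complex.Im (u m) else complex.Re (u m)) else 0.
Proof.
case: c => [j|j|m b] /= ok; rewrite ?ffunE//.
by rewrite /Pperp ok.
Qed.

Lemma probe_vec_neg m b : probe_vec (Pw (- m) b) = (if b then -1 else 1) *: probe_vec (Pw m b).
Proof.
set a : R := if b then -1 else 1.
transitivity ((a *: 0, a *: 0, a *: trig m (half_unit b)) : E R S) => //.
rewrite !scaler0 /probe_vec trig_neg -trigZ; congr (_, _, trig _ _).
by rewrite {}/a; case: b; apply: complexP => /=; ring.
Qed.

End Probes.

(** * Jets of the normal form coordinates and of the expansion of the transpose *)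

Arguments opg {R A W} XA Y K T.

Section GaugeInstances.
Variable R : realType.
Lemma gauge_hsg (s : R) : gauge (hsg s).
Proof.
split=> [K K0|K K' w h|K K' w w'|a K w].
- by apply: hsg_leK (hsg0 s).
- exact: hsg_leK.
- exact: hsgD.
- exact: hsgZ.
Qed.
Lemma gauge_supg (s : R) : gauge (supg s).
Proof.
split=> [K K0|K K' w h|K K' w w'|a K w].
- by apply: supg_leK (supg0 s).
- exact: supg_leK.
- exact: supgD.
- exact: supgZ.
Qed.

Variables (V : lmodType R) (X : nspace V) (nX : normed X).

(** The last direction is frozen: the derivative of p |-> D p [x]. *)
Lemma gjet_rcons (W : lmodType R) (U : set V) (B : R -> W -> Prop) D x :
  gauge B -> gjet X U B D -> dom X x -> gjet X U B (fun p vs => D p (rcons vs x)).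
Proof.
move=> gB jD dx.
have arc vs : all_in X vs -> all_in X (rcons vs x).
  by move=> avs v; rewrite mem_rcons inE => /orP[/eqP ->|/avs].
have nrc vs : nprod X (rcons vs x) = nprod X vs * nrm X x.
  by rewrite /nprod -cats1 big_cat big_seq1.
have x0 := nrm_ge0 nX dx.
split=> [p a h k vs Up dh dk avs|p l Up|p l e Up e0].
- by rewrite !rcons_cons; apply: (gj_lin jD) => //; exact: arc.
- have [C C0 hC] := gj_bd jD l.+1 Up; exists (C * nrm X x); first exact: mulr_ge0.
  move=> vs svs avs; have := hC (rcons vs x); rewrite size_rcons ltnS nrc => /(_ svs (arc _ avs)).
  by rewrite [X in B X _](_ : _ = C * nrm X x * nprod X vs) //; ring.
- have x1 : 0 < nrm X x + 1 by rewrite ltr_wpDl.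
  have [r r0 hr] := gj_fr jD l.+1 Up (divr_gt0 e0 x1); exists r => // h dh hh Uh vs svs avs.
  have := hr h dh hh Uh (rcons vs x); rewrite size_rcons ltnS nrc => /(_ svs (arc _ avs)).
  apply: (gle gB).
  rewrite [leLHS](_ : _ = (e * nrm X h * nprod X vs) * (nrm X x / (nrm X x + 1))); last by ring.
  apply: ler_piMr; last by rewrite ler_pdivrMr// mul1r lerDl.
  by rewrite !mulr_ge0 ?(nrm_ge0 nX dh) ?(nprod_ge0 nX avs)// ltW.
Qed.

Lemma gjet_const (W : lmodType R) (U : set V) (B : R -> W -> Prop) K (w : W) :
  gauge B -> 0 <= K -> B K w -> gjet X U B (fun _ vs => if vs is [::] then w else 0).
Proof.
move=> gB K0 hw; split=> [p a h k vs Up dh dk avs|p l Up|p l e Up e0].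
- by rewrite scaler0 addr0.
- exists K => // -[|v vs] _ avs; first by rewrite /nprod big_nil mulr1.
  by apply: (g0 gB); rewrite mulr_ge0// (nprod_ge0 nX).
- exists 1 => // h dh _ _ vs _ avs.
  have -> : (if vs is [::] then w else 0) - (if vs is [::] then w else 0) - 0 = 0 by rewrite subrr subr0.
  by apply: (g0 gB); rewrite !mulr_ge0 ?(nrm_ge0 nX dh) ?(nprod_ge0 nX avs)// ltW.
Qed.
End GaugeInstances.

Lemma lt_of_sum4 (R : realType) (a b c d e : R) : 0 <= a -> 0 <= b -> 0 <= c -> 0 <= d ->
  a + b + c + d < e -> [/\ b < e, c < e & d < e].
Proof. by move=> *; split; lra. Qed.

Section Application.
Variables (R : realType) (S : {fset nat}) (K : birkhoff R) (delta : R) (Xi : set (RS R S)).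
Hypothesis oXi : nopen (RSsp R S) Xi.
Variable F : normal_form K delta Xi.
Implicit Types (p : P R S) (vs : seq (P R S)) (q : dist R) (s r : R) (k m : nat).

Local Notation VXi := (VXi delta Xi).
Local Notation VXiE := (VXiE delta Xi).

Lemma VXi_le r s : r <= s -> VXi s `<=` VXi r.
Proof.
move=> rs p [[hy [dw nw]] hx]; have [d n] := Hsperp_mono rs dw.
split; [split; [exact: hy|split; [exact: d|]]|exact: hx].
by apply: le_lt_trans nw; rewrite subr0; exact: n.
Qed.
Lemma VXi_dom s p : VXi s p -> dom (Psp S s) p.
Proof. by move=> [[_ [dw _]] _]; split=> //; split. Qed.
Lemma VXi_VXiE s : 1 <= s -> VXi s `<=` VXiE 1 s.
Proof. by move=> s1 p h; split; [exact: VXi_le h|have [] := VXi_dom h]. Qed.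

Lemma Psp_nrmE s p : nrm (Psp S s) p =
  nrm (RSsp R S) (xth p.1) + nrm (RSsp R S) (xy p.1) + nrm (Hs R s) (xw p.1) + nrm (RSsp R S) p.2.
Proof. by []. Qed.

Lemma VXi_open s : nopen (Psp S s) (VXi s).
Proof.
split; first exact: VXi_dom.
move=> p Up; have [[hy [dw nw]] hx] := Up.
have [r r0 hr] := oXi.2 _ hx.
have nR := normed_RSsp R S; have nH := normed_Hs s.
pose e1 := delta - nrm (RSsp R S) (xy p.1); pose e2 := delta - nrm (Hs R s) (xw p.1).
have e10 : 0 < e1 by rewrite subr_gt0.
rewrite subr0 in nw; have e20 : 0 < e2 by rewrite subr_gt0.
exists (Num.min r (Num.min e1 e2)); first by rewrite !lt_min r0 e10 e20.
move=> p' [dp']; rewrite !lt_min Psp_nrmE => /andP[h1 /andP[h2 h3]].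
have dp := VXi_dom Up; have dd := ndB (normed_Psp S s) dp' dp.
have [[[_ _] [dH dz]] _] := dd; have [[_ [dH' dz']] _] := dp'.
have a1 := nrm_ge0 nR (u := xth (p' - p).1) I.
have a2 := nrm_ge0 nR (u := xy (p' - p).1) I.
have a3 := nrm_ge0 nH dH.
have a4 := nrm_ge0 nR (u := (p' - p).2) I.
have aux := @lt_of_sum4 R.
have [dw1 _] := dw.
split; last first.
  apply: hr; split=> //; apply: le_lt_trans (lexx _) _.
  by have [_ _] := aux _ _ _ _ _ a1 a2 a3 a4 h1.
split.
  have -> : xy p'.1 = xy (p' - p).1 + xy p.1 by rewrite [xy (p' - p).1]/(xy p'.1 - xy p.1) subrK.
  have [h _ _] := aux _ _ _ _ _ a1 a2 a3 a4 h2.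
  have := nrmD nR (u := xy (p' - p).1) (v := xy p.1) I I.
  move=> /le_lt_trans; apply; rewrite -ltrBrDr; exact: h.
split; first by split.
rewrite subr0.
have -> : xw p'.1 = xw (p' - p).1 + xw p.1 by rewrite [xw (p' - p).1]/(xw p'.1 - xw p.1) subrK.
have [_ h _] := aux _ _ _ _ _ a1 a2 a3 a4 h3.
have := nrmD nH dH dw1.
move=> /le_lt_trans; apply; rewrite -ltrBrDr; exact: h.
Qed.

Lemma dirx_dom s x : dom (Esp S s) x -> dom (Psp S s) (dirx x).
Proof. by []. Qed.

(** The third component is a linear function of p, so its jet stops at order one. *)
Definition dw p vs : dist R :=
  match vs with [::] => xw p.1 | [:: v] => xw v.1 | _ => 0 end.

Lemma Psp_w s p : dom (Psp S s) p -> hsg s (nrm (Psp S s) p) (xw p.1).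
Proof.
move=> [[[_ _] [d _]] _]; apply: hsg_leK (hsg_nrm d); rewrite Psp_nrmE.
have nR := normed_RSsp R S.
have := nrm_ge0 nR (u := xth p.1) I; have := nrm_ge0 nR (u := xy p.1) I.
have := nrm_ge0 nR (u := p.2) I; lra.
Qed.

Lemma dw_hsg s (C : R) p vs : 1 <= C -> hsg s C (xw p.1) -> all_in (Psp S s) vs ->
  hsg s (C * nprod (Psp S s) vs) (dw p vs).
Proof.
move=> C1 hp; have nP := normed_Psp S s; have C0 : 0 <= C by lra.
case: vs => [|v [|v' vs]] avs.
- by rewrite /nprod big_nil mulr1.
- have dv : dom (Psp S s) v by apply: avs; rewrite mem_head.
  apply: hsg_leK (Psp_w dv); rewrite /nprod big_seq1.
  have := nrm_ge0 nP dv; nra.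
- apply: hsg_leK (hsg0 s); by rewrite mulr_ge0// (nprod_ge0 nP).
Qed.

Lemma gjet_dw s U : U `<=` [set p | dom (Psp S s) p] -> gjet (Psp S s) U (hsg s) dw.
Proof.
move=> Ud; have nP := normed_Psp S s.
split=> [p a h k vs Up dh dk avs|p l Up|p l e Up e0].
- by case: vs {avs} => [|v vs] //=; rewrite scaler0 addr0.
- exists (1 + nrm (Psp S s) p).
    by rewrite addr_ge0// (nrm_ge0 nP)//; exact: Ud.
  move=> vs _ avs; apply: dw_hsg => //.
    by rewrite lerDl (nrm_ge0 nP)//; exact: Ud.
  by apply: hsg_leK (Psp_w (Ud _ Up)); rewrite lerDr.
- exists 1 => // h dh _ Uh vs _ avs.
  have -> : dw (p + h) vs - dw p vs - dw p (h :: vs) = 0.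
    case: vs {avs} => [|v [|v' vs]]; last by rewrite /= !subr0.
      rewrite -[LHS]/(xw p.1 + xw h.1 - xw p.1 - xw h.1) -addrA -opprD.
      by rewrite subrr.
    by rewrite /= subrr subr0.
  apply: hsg_leK (hsg0 s); rewrite !mulr_ge0 ?(nrm_ge0 nP dh) ?(nprod_ge0 nP avs)//.
  exact: ltW.
Qed.

Lemma gjet_dPsi : gjet (Psp S 0) (VXi 0) (ng (Hs0 R 0)) (dPsi F).
Proof.
exact: (is_jet_gjet (normed_Hs0 0) (normed_Psp S 0) (@sep_Hs0 R 0) (Psi_smooth F)).
Qed.

Lemma gjet_dPsi_s s : 0 <= s -> gjet (Psp S s) (VXi s) (ng (Hs0 R 0)) (dPsi F).
Proof.
move=> s0; apply: (gjet_restr (normed_Psp S 0) (gauge_ng (normed_Hs0 0)) _ _ gjet_dPsi).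
  by move=> v; exact: Psp_mono.
exact: VXi_le.
Qed.

Lemma gjet_daT k (N : R) : (1 <= k)%N -> gjet (Psp S 1) (VXi 1) (supg N) (daT F k).
Proof.
move=> k1; pose N' := Num.max 1 N.
have N1 : 1 <= N' by rewrite le_max lexx.
have := is_jet_gjet (normed_Hs N') (normed_Psp S 1) (@sep_Hs R N') (aT_smooth F k1 N1).
apply: (gjet_map (f := id) (c := 2) (normed_Psp S 1) (gauge_ng (normed_Hs N')) (gauge_supg N)) => //.
move=> C u C0 /hsgP/hsg_supg h; apply: supg_le h; by rewrite le_max lexx orbT.
Qed.

Lemma gjet_daT_s k (N s : R) : (1 <= k)%N -> 1 <= s -> gjet (Psp S s) (VXi s) (supg N) (daT F k).
Proof.
move=> k1 s1; apply: (gjet_restr (normed_Psp S 1) (gauge_supg N) _ _ (gjet_daT N k1)).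
  by move=> v; exact: Psp_mono.
exact: VXi_le.
Qed.

Lemma gjet_dAT k (N : R) : (1 <= k)%N -> 1 <= N ->
  gjet (Psp S 1) (VXi 1) (opg (Hs0 R 1) (Hs R N)) (fun p vs => onQ (dAT F k p vs)).
Proof.
move=> k1 N1.
exact: (is_jet_opg (normed_Hs0 1) (normed_Hs N) (normed_Psp S 1) (@sep_Hs R N) (AT_smooth F k1 N1)).
Qed.

Definition incl s (s1 : 1 <= s) (q : {q | dom (Hs0 R s) q}) : {q | dom (Hs0 R 1) q} :=
  exist _ (sval q) (proj1 (Hs0_mono s1 (svalP q))).

Definition opT (Q : Type) k (w : dist R) (T : Q -> dist R) : Q -> E R S :=
  fun x : Q => in_w S (pmul (dx (- k%:Z) w) (T x)).

Lemma pmul_conv_hsg (u v : dist R) s1 s2 K1 K2 : hsg s1 K1 u -> hsg s2 K2 v ->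
  `|s2| + 2 <= s1 -> pmul_conv u v.
Proof. by move=> /hsg_supg h1 /hsg_supg h2; exact: pmul_conv_supg h1 h2. Qed.

Lemma pmul_dx_hsg k s r K1 K2 (w v : dist R) : 0 <= s -> s + 3 <= r ->
  hsg r K1 w -> hsg (s + 1) K2 v ->
  hsg s (3 * (12 * 2 `^ (s + 1) * (2 * K1 * (2 * K2)))) (pmul (dx (- k%:Z) w) v).
Proof.
move=> s0 sr /hsg_supg hw /hsg_supg hv.
have hd : supg r (2 * K1) (dx (- k%:Z) w).
  by apply: supg_le (dx_supg k hw); rewrite lerDl.
have := @pmul_supg R r (s + 1) (s + 1) _ _ _ _ hd hv.
rewrite ger0_norm ?addr_ge0// => /(_ (lexx _)) h.
by rewrite -[X in hsg X](addrK 1 s); apply: supg_hsg; apply: h; lra.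
Qed.

Lemma pmul_conv_dx k s r K1 K2 (w v : dist R) : 0 <= s -> s + 2 <= r ->
  hsg r K1 w -> hsg s K2 v -> pmul_conv (dx (- k%:Z) w) v.
Proof.
move=> s0 sr hw hv; apply: pmul_conv_hsg (dx_hsg k hw) hv _.
by rewrite ger0_norm//; have := ler0n R k; lra.
Qed.

(** w has r derivatives, of which s + m + 4 suffice for its product with the smooth
    function A_{-k}[q] to lie in H^{s + m + 1}. *)
Lemma gjet_leibniz_AT k m s r U : (1 <= k)%N -> 1 <= s -> s + m%:R + 4 <= r -> U `<=` VXiE 1 r ->
  gjet (Psp S r) U (opg (Hs0 R s) (Esp S (s + m%:R + 1)))
    (leibniz (@opT {q | dom (Hs0 R s) q} k) dw (fun p vs => onQ (dAT F k p vs))).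
Proof.
move=> k1 s1 sr Ur; have m0 := ler0n R m; have r1 : 1 <= r by lra.
pose N := s + m%:R + 2; have N1 : 1 <= N by rewrite /N; lra.
have nA := normed_Hs0 s; have nY := normed_Hs N; have nE := normed_Esp S (s + m%:R + 1).
have jA : gjet (Psp S r) U (opg (Hs0 R s) (Hs R N)) (fun p vs => onQ (dAT F k p vs)).
  have j1 := gjet_restr (X' := Psp S r) (U' := U) (normed_Psp S 1)
    (gauge_opg (normed_Hs0 1) nY) (fun v => Psp_mono r1 (x := v)) (fun p h => (Ur p h).1) (gjet_dAT k1 N1).
  pose rest (T : {q | dom (Hs0 R 1) q} -> dist R) : {q | dom (Hs0 R s) q} -> dist R :=
    fun x => T (incl s1 x).
  suff : gjet (Psp S r) U (opg (Hs0 R s) (Hs R N)) (fun p vs => rest (onQ (dAT F k p vs))) by [].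
  apply: (gjet_map (c := 1) (f := rest) (normed_Psp S r)
     (gauge_opg (normed_Hs0 1) nY) (gauge_opg nA nY)) j1 => //.
  move=> C T C0 hT x; have [d h] := hT (incl s1 x); split=> //; apply: le_trans h _.
  rewrite mul1r ler_wpM2l//; exact: (Hs0_mono s1 (svalP x)).2.
have jw : gjet (Psp S r) U (hsg r) dw.
  by apply: gjet_dw => p /Ur[[_ hx] hd]; split.
have N0 : 0 <= N by apply: le_trans N1.
have Nr : N + 2 <= r by rewrite /N; lra.
pose c := 3 * (12 * 2 `^ N * 4) : R.
have c0 : 0 <= c by rewrite /c !mulr_ge0// powR_ge0.
apply: (gjet_bilin (normed_Psp S r) (gauge_hsg r) (gauge_opg nA nY) (gauge_opg nA nE) c0) jw jA.
- move=> a C C' L w w' T hw hw' hT; apply/funext => q; rewrite /opT.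
  have /hsgP hTq := hT q.
  rewrite dxD dxZ pmulDl ?in_wL//; [exact: (pmul_conv_dx k N0 Nr hw hTq)|exact: (pmul_conv_dx k N0 Nr hw' hTq)].
- move=> a C C' L w T T' hw hT hT'; apply/funext => q; rewrite /opT.
  have /hsgP hTq := hT q; have /hsgP hTq' := hT' q.
  rewrite [(a *: T + T') q]/(a *: T q + T' q) pmulDr ?in_wL//.
    exact: (pmul_conv_dx k N0 Nr hw hTq).
  exact: (pmul_conv_dx k N0 Nr hw hTq').
- move=> C L w T C0 L0 hw hT q; have /hsgP hTq := hT q.
  have := @pmul_dx_hsg k (s + m%:R + 1) r C (L * nrm (Hs0 R s) (sval q)) w (T q).
  rewrite (_ : s + m%:R + 1 + 1 = N); last by rewrite /N -addrA.
  move=> /(_ _ _ hw hTq) h; apply: in_w_ng.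
  apply: hsg_leK (h _ _); [|lra|lra].
  rewrite le_eqVlt /c; apply/orP; left; apply/eqP; ring.
Qed.

(** What the given expansion of the transpose contains beyond
    q + sum_k a_{-k} d_x^{-k} q: all these terms gain m + 1 derivatives on H^s, s >= 1. *)
Definition dRem_ae m p vs q : E R S :=
  \sum_(1 <= k < m.+1) leibniz (fun w (T : dist R -> dist R) => opT k w T q) dw (dAT F k) p vs
  + dRT F m p vs q.

Lemma onQ_dRem_ae m s p vs : onQ (XA := Hs0 R s) (dRem_ae m p vs) =
  \sum_(1 <= k < m.+1) leibniz (@opT {q | dom (Hs0 R s) q} k) dw (fun p vs => onQ (dAT F k p vs)) p vs
  + onQ (dRT F m p vs).
Proof.
apply/funext => q; rewrite /onQ /dRem_ae [RHS]/(_ q + _); congr (_ + _).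
rewrite fct_sumE; apply: eq_bigr => k _; rewrite /leibniz fct_sumE.
by apply: eq_bigr => ab _.
Qed.

Lemma gjet_dRem_ae m s r U : (1 <= m)%N -> 1 <= s -> s + m%:R + 4 <= r -> U `<=` VXiE 1 r ->
  gjet (Psp S r) U (opg (Hs0 R s) (Esp S (s + m%:R + 1))) (fun p vs => onQ (dRem_ae m p vs)).
Proof.
move=> m1 s1 sr Ur; have m0 := ler0n R m.
have nA := normed_Hs0 s; have nE := normed_Esp S (s + m%:R + 1).
have gE := gauge_opg nA nE; have nP := normed_Psp S r.
have -> : (fun p vs => onQ (XA := Hs0 R s) (dRem_ae m p vs)) = (fun p vs =>
   \sum_(1 <= k < m.+1) leibniz (@opT {q | dom (Hs0 R s) q} k) dw (fun p vs => onQ (dAT F k p vs)) p vs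
   + onQ (dRT F m p vs)).
  by apply/funext => p; apply/funext => vs; exact: onQ_dRem_ae.
apply: (gjet_add gE).
  apply: (gjet_sum nP gE) => k; rewrite mem_index_iota => /andP[k1 _].
  exact: gjet_leibniz_AT.
have sr' : s <= r by lra.
have j := is_jet_opg nA nE (normed_Psp S s) (@sep_Esp R S _) (RT_smooth F m1 s1).
apply: (gjet_restr (normed_Psp S s) gE _ _ j).
  by move=> v; exact: Psp_mono.
by move=> p /Ur[h1 h2]; split; [exact: h1|exact: (proj1 (Esp_mono sr' h2))].
Qed.

Definition dTransp_ae m p vs q : E R S :=
  in_w S ((if vs is [::] then q else 0) + \sum_(1 <= k < m.+1) pmul (daT F k p vs) (dx (- k%:Z) q))
  + dRem_ae m p vs q.

Lemma dTransp_ae_base m p q : (1 <= m)%N -> VXi 1 p -> dom (Hs0 R 1) q ->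
  dTransp_ae m p [::] q = dPsiT F p q.
Proof.
move=> m1 Up dq; rewrite (dPsiT_expansion F m1 Up dq) /dTransp_ae /dRem_ae.
have [RT0 _ _ _ _] := RT_smooth F m1 (lexx 1).
rewrite RT0; last by split=> //; have [] := VXi_dom Up.
rewrite addrA; congr (_ + _).
have e1 : \sum_(1 <= k < m.+1) pmul (daT F k p [::]) (dx (- k%:Z) q) =
          \sum_(1 <= k < m.+1) pmul (aT F k p) (dx (- k%:Z) q).
  apply: eq_big_seq => k; rewrite mem_index_iota => /andP[k1 _].
  by have [-> // _ _ _ _] := aT_smooth F k1 (lexx 1).
have e2 : \sum_(1 <= k < m.+1) leibniz (fun w (T : dist R -> dist R) => opT k w T q) dw (dAT F k) p [::]
  = in_w S (\sum_(1 <= k < m.+1) pmul (dx (- k%:Z) (xw p.1)) (AT F k p q)).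
  rewrite in_w_sum; apply: eq_big_seq => k; rewrite mem_index_iota => /andP[k1 _].
  rewrite /leibniz /= big_seq1 /opT /=.
  by have [-> // _ _ _ _] := AT_smooth F k1 (lexx 1).
by rewrite e1 e2 -in_wD /in_w !PperpD.
Qed.

(** For q in H^1 both sides are jets of the function (x, nu) |-> (q, dPsi [e_c]), the
    right one by the expansion of the transpose.  Hence all the derivatives of dPsi are
    described by those of the expansion. *)
Lemma dPsi_pair m sigma p vs q c : (1 <= m)%N -> m%:R + 5 <= sigma -> VXi sigma p ->
  all_in (Psp S sigma) vs -> dom (Hs0 R 1) q -> probe_ok c ->
  l2dot q (dPsi F p (rcons vs (dirx (probe_vec R c)))) = pcoord (dTransp_ae m p vs q) c.
Proof.
move=> m1 ms Up avs dq ok; have m0 := ler0n R m.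
have s1 : 1 <= sigma by lra.
have nP := normed_Psp S sigma.
have hq1 : hsg 1 (nrm (Hs R 1) q) q by have [dq1 _] := dq; exact: hsg_nrm.
have hq0 := hsg_le ler01 hq1.
apply: (gjet_uniq nP (VXi_open sigma) (U := VXi sigma)
   (D := fun p vs => l2dot q (dPsi F p (rcons vs (dirx (probe_vec R c)))))
   (D' := fun p vs => pcoord (dTransp_ae m p vs q) c)) => //.
- have j := gjet_rcons nP (gauge_ng (normed_Hs0 0)) (gjet_dPsi_s (s := sigma) _) (x := dirx (probe_vec R c)) _.
  have {j} := j _ _; rewrite (le_trans ler01 s1) => /(_ isT (dirx_dom (probe_vec_dom _ ok))).
  apply: (gjet_map (c := 2 * nrm (Hs R 1) q) nP (gauge_ng (normed_Hs0 0)) (gauge_abs R)).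
  + by rewrite mulr_ge0//; case: hq1.
  + move=> a C C' u u' [[du _] nu] [[du' _] nu'].
    exact: l2dotPr (l2abs_hsg hq0 (hsg_nrm du)) (l2abs_hsg hq0 (hsg_nrm du')).
  + move=> C u C0 [[du _] nu]; rewrite /absg.
    have := l2dot_le (l2abs_hsg hq0 (hsg_leK nu (hsg_nrm du))).
    by rewrite mulrA.
- have e p' vs' : pcoord (dTransp_ae m p' vs' q) c =
    (if vs' is [::] then pcoord (in_w S q) c else 0) +
    (\sum_(1 <= k < m.+1) pcoord (in_w S (pmul (daT F k p' vs') (dx (- k%:Z) q))) c
    + pcoord (onQ (XA := Hs0 R 1) (dRem_ae m p' vs') (exist _ q dq)) c) :> R^o.
    rewrite /dTransp_ae pcoordD in_wD pcoordD in_w_sum addrA; congr (_ + _ + _).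
      case: vs' => // *; rewrite in_w0; by case: (c) => [j|j|m' b] /=; rewrite ?ffunE//; case: b.
    apply: (big_morph (fun e => pcoord e c)); first by move=> x y; exact: pcoordD.
    by case: (c) => [j|j|m' b] /=; rewrite ?ffunE//; case: b.
  have -> : (fun p vs => pcoord (dTransp_ae m p vs q) c) = (fun p' vs' =>
    (if vs' is [::] then pcoord (in_w S q) c else 0) +
    (\sum_(1 <= k < m.+1) pcoord (in_w S (pmul (daT F k p' vs') (dx (- k%:Z) q))) c
    + pcoord (onQ (XA := Hs0 R 1) (dRem_ae m p' vs') (exist _ q dq)) c) : R^o).
    by apply/funext => p'; apply/funext => vs'; exact: e.
  apply: (gjet_add (gauge_abs R)).
    exact: (gjet_const nP (K := `|pcoord (in_w S q) c|) _ (gauge_abs R) _ (lexx _)).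
  apply: (gjet_add (gauge_abs R)).
    apply: (gjet_sum nP (gauge_abs R)) => k; rewrite mem_index_iota => /andP[k1 _].
    have := gjet_daT_s 5 k1 s1.
    have hdx := hsg_supg (hsg_le (s := 1 + k%:R) (r := 1) _ (dx_hsg k hq1)).
    have {}hdx := hdx _; rewrite lerDl ler0n in hdx; have {}hdx := hdx isT.
    pose cc := 2 * (3 * (12 * 2 `^ 1 * (2 * nrm (Hs R 1) q))) * probe_pow c 0.
    have q0 : 0 <= nrm (Hs R 1) q by case: hq1.
    apply: (gjet_map (c := cc) (f := fun u => pcoord (in_w S (pmul u (dx (- k%:Z) q))) c) nP (gauge_supg 5) (gauge_abs R)).
    + by rewrite /cc !mulr_ge0 ?powR_ge0 ?probe_pow_ge0.
    + move=> a C C' u u' hu hu'; rewrite pmulDl ?in_wL ?pcoordL//.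
        by apply: (pmul_conv_supg hu hdx); rewrite normr1; lra.
      by apply: (pmul_conv_supg hu' hdx); rewrite normr1; lra.
    + move=> C u C0 hu; have := @pmul_supg R 5 1 1 _ _ _ _ hu hdx.
      rewrite normr1 => /(_ (lexx 1)) h.
      have /supg_hsg/(in_w_ng S) h1 := h ltac:(lra).
      rewrite subrr in h1; have := Esp_pcoord h1 ok; rewrite oppr0 /absg.
      by rewrite [leRHS](_ : _ = cc * C)// /cc; ring.
  have j := @gjet_dRem_ae m 1 sigma (VXi sigma) m1 (lexx 1) _ (VXi_VXiE s1).
  have {}j := j ltac:(lra).
  apply: (gjet_map (c := 2 * nrm (Hs R 1) q * probe_pow c 0) (f := fun T => pcoord (T (exist _ q dq)) c) nP
    (gauge_opg (normed_Hs0 1) (normed_Esp S _)) (gauge_abs R)) j.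
  + by rewrite !mulr_ge0 ?probe_pow_ge0//; case: hq1.
  + by move=> a C C' T T' _ _; exact: pcoordL.
  + move=> C T C0 hT; have [dE nE] := hT (exist _ q dq).
    have le0 : 0 <= 1 + m%:R + 1 :> R by rewrite !addr_ge0.
    have [d1 n1] := Esp_mono le0 dE.
    have := Esp_pcoord (conj d1 (le_trans n1 nE)) ok; rewrite oppr0 /absg.
    rewrite -[nrm (Hs0 R 1) _]/(nrm (Hs R 1) q); set x := nrm _ q.
    by rewrite [leRHS](_ : _ = 2 * x * probe_pow c 0 * C)//; ring.
- move=> p' Up'; have U0 := VXi_le (le_trans ler01 s1) Up'.
  have U1 := VXi_le s1 Up'.
  have [d0 _] := Hs0_mono ler01 dq.
  have [dT hT] := dPsiT_transpose F U0 d0.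
  rewrite dTransp_ae_base// -[rcons _ _]/[:: dirx (probe_vec R c)] -hT; last exact: probe_vec_dom.
  by apply: dotE_probe => //; have [_ [[]]] := dT.
Qed.
End Application.

(** * An elliptic bootstrap on Fourier coefficients *)

Lemma splits_head (T : eqType) (vs : seq T) : exists rest,
  splits vs = (vs, [::]) :: rest /\ forall ab, ab \in rest -> (size ab.1 < size vs)%N.
Proof.
elim: vs => [|v vs [rest [e h]]]; first by exists [::].
exists ([seq (v :: p.1, p.2) | p <- rest] ++ [seq (p.1, v :: p.2) | p <- splits vs]).
rewrite /= e; split=> // ab; rewrite mem_cat => /orP[] /mapP[q hq ->] /=.
  by rewrite ltnS h.
move: hq; rewrite inE => /orP[/eqP -> //|/h]; exact: ltnW.
Qed.

Section EllipticRegularity.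
Variables (R : realType) (S : {fset nat}).

Lemma arith1 (A1 A2 B JS b H : R) : 0 <= A1 -> 0 <= A2 -> 0 <= B -> 0 <= JS -> 0 <= b -> 0 <= H ->
  A1 * (B * (b + H)) + (A2 * H + b) <= (A1 * B + A2 + 1 + JS) * (b + H).
Proof.
move=> *; have t1 : 0 <= A2 * b by rewrite mulr_ge0.
have t2 : 0 <= JS * (b + H) by rewrite mulr_ge0// addr_ge0.
lra.
Qed.
Lemma arith2 (A1 A2 B JS b H : R) : 0 <= A1 -> 0 <= A2 -> 0 <= B -> 0 <= JS -> 0 <= b -> 0 <= H ->
  b * JS <= (A1 * B + A2 + 1 + JS) * (b + H).
Proof.
move=> *; have t1 : 0 <= (A1 * B + A2 + 1) * (b + H).
  by rewrite mulr_ge0 ?addr_ge0 ?mulr_ge0.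
have t2 : 0 <= JS * H by rewrite mulr_ge0.
lra.
Qed.
Lemma arith3 (B3 b H T : R) : 0 <= B3 -> 0 <= b -> 0 <= H -> T = 6 * B3 + 1 ->
  H <= 3 * (T ^+ 2 * b + B3 * (b + H) / T) -> H <= (1 + 6 * T ^+ 2) * b.
Proof.
move=> B0 b0 H0 eT hH; have T0 : 0 < T by rewrite eT ltr_wpDl// mulr_ge0.
have t3 : 3 * (B3 * (b + H) / T) <= (b + H) / 2.
  rewrite (_ : 3 * _ = (b + H) * (3 * B3 / T)); last by ring.
  by rewrite ler_wpM2l ?addr_ge0// ler_pdivrMr// eT; lra.
lra.
Qed.

(** The hypothesis on g says that decay of order j < L improves to order j + 1.  After L
    steps g has decay of order L, with a constant that involves the H^1 norm of g.  This
    norm is then absorbed: the bound b controls the frequencies up to a threshold T, and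
    decay of order 3 controls the others with a factor 1 / T. *)
Lemma elliptic_bootstrap (A1 A2 JS : R) (L : nat) : 0 <= A1 -> 0 <= A2 -> 0 <= JS -> (3 <= L)%N ->
  (forall n : int, ~~ Sperp S n -> jpow n L%:R <= JS) ->
  exists2 C : R, 0 <= C & forall (g : dist R) (b : R), 0 <= b -> dom (Hs R 1) g -> supg 0 b g ->
   (forall (j : nat) G, (j < L)%N -> supg j%:R G g -> forall n, Sperp S n ->
      cabs (g n) <= A1 * G * jpow n (- j.+1%:R) + (A2 * nrm (Hs R 1) g + b) * jpow n (- L%:R)) ->
   supg L%:R (C * b) g.
Proof.
move=> A10 A20 JS0 L3 hJ.
have step (j : nat) : (j <= L)%N -> exists2 B : R, 0 <= B &
  forall (g : dist R) (b : R), 0 <= b -> dom (Hs R 1) g -> supg 0 b g ->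
   (forall (j : nat) G, (j < L)%N -> supg j%:R G g -> forall n, Sperp S n ->
      cabs (g n) <= A1 * G * jpow n (- j.+1%:R) + (A2 * nrm (Hs R 1) g + b) * jpow n (- L%:R)) ->
   supg j%:R (B * (b + nrm (Hs R 1) g)) g.
  elim: j => [_|j IH jL].
    exists 1 => // g b b0 dg hg _; apply: supg_leK hg.
    by rewrite mul1r lerDl (nrm_ge0 (normed_Hs 1) dg).
  have [B B0 hB] := IH (ltnW jL).
  exists (A1 * B + A2 + 1 + JS); first by rewrite !addr_ge0 ?mulr_ge0.
  move=> g b b0 dg hg h; have H0 := nrm_ge0 (normed_Hs 1) dg.
  split; first by case: hg.
  move=> n; have jL' : jpow n (- L%:R) <= jpow n (- j.+1%:R) :> R.
    by apply: ler_jpow; rewrite lerN2 ler_nat.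
  have hG := hB g b b0 dg hg h.
  have jj : 0 <= jpow n (- j.+1%:R) :> R by exact: jpow_ge0.
  have [nS|nS] := boolP (Sperp S n).
    apply: le_trans (h j _ jL hG n nS) _.
    move: (nrm (Hs R 1) g) H0 => H H0.
    apply: le_trans (ler_wpM2r jj (arith1 A10 A20 B0 JS0 b0 H0)).
    rewrite [leRHS]mulrDl lerD2l ler_wpM2l// addr_ge0// mulr_ge0//.
  have [_ /(_ n)] := hg; rewrite oppr0 jpow0 mulr1 => /le_trans; apply.
  move: (nrm (Hs R 1) g) H0 => H H0.
  apply: le_trans (ler_wpM2r jj (arith2 A10 A20 B0 JS0 b0 H0)).
  rewrite -mulrA ler_peMr//.
  have h2 : 1 <= JS * jpow n (- L%:R).
    apply: (@le_trans _ _ (jpow n L%:R * jpow n (- L%:R))); first by rewrite jpowNK.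
    by apply: ler_wpM2r; [exact: jpow_ge0|exact: hJ].
  by apply: le_trans h2 _; rewrite ler_wpM2l.
have [B3 B30 hB3] := step 3%N L3; have [BL BL0 hBL] := step L (leqnn _).
(* beyond frequency T the decay of order 3 beats <n>^{-2} by a factor 1 / T; with this T the
   coefficient of the H^1 norm becomes 1/2 *)
pose T := 6 * B3 + 1; have T0 : 0 < T by rewrite ltr_wpDl// mulr_ge0.
exists (BL * (2 + 6 * T ^+ 2)); first by rewrite mulr_ge0// addr_ge0// mulr_ge0// sqr_ge0.
move=> g b b0 dg hg h; have H0 := nrm_ge0 (normed_Hs 1) dg.
have h3 := hB3 g b b0 dg hg h; have hL := hBL g b b0 dg hg h.
have h2 : supg 2 (T ^+ 2 * b + B3 * (b + nrm (Hs R 1) g) / T) g.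
  have k0 : 0 <= B3 * (b + nrm (Hs R 1) g) by rewrite mulr_ge0// addr_ge0.
  split; first by case: hg.
  move=> n; have [nT|nT] := leP (jbr R n) T.
    have [_ /(_ n)] := hg; rewrite oppr0 jpow0 mulr1 => /le_trans; apply.
    have e2 : jpow n 2 = jbr R n ^+ 2 :> R by rewrite -(jpow_nat R n 2).
    have t2 : jpow n 2 <= T ^+ 2 by rewrite e2; apply: lerXn2r => //; rewrite nnegrE ?jbr_ge0// ltW.
    apply: (@le_trans _ _ (T ^+ 2 * b * jpow n (-2))); last first.
      by rewrite ler_wpM2r ?jpow_ge0// lerDl divr_ge0// ltW.
    by rewrite jpowN ler_pdivlMr ?jpow_gt0// mulrC ler_wpM2r.
  have [_ /(_ n)] := h3; move/le_trans; apply.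
  rewrite (_ : - 3 = -1 + -2 :> R); last by ring.
  rewrite jpowD mulrA ler_wpM2r ?jpow_ge0//.
  apply: (@le_trans _ _ (B3 * (b + nrm (Hs R 1) g) / T)); last by rewrite lerDr mulr_ge0// sqr_ge0.
  rewrite ler_wpM2l// jpowN /jpow powRr1 ?jbr_ge0//.
  by rewrite lef_pV2 ?posrE ?jbr_gt0// ltW.
have h1 := supg_hsg h2; rewrite (_ : 2 - 1 = 1 :> R) in h1; last by ring.
have /hsgP[_ hH] := h1.
apply: supg_leK hL; rewrite -mulrA ler_wpM2l//.
move: (nrm (Hs R 1) g) H0 hH => H H0 hH.
have hH' := arith3 B30 b0 H0 (erefl T) hH.
by move: (T ^+ 2) hH' => t hH'; lra.
Qed.
End EllipticRegularity.

(** * Decay of the rows of the differential *)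

Lemma WL2E (R : realType) (u v : dist R) : WL2 u v = l2dot (dx (- 1%:Z) u) v.
Proof. by []. Qed.

Lemma arith_step (R : realType) (A G x C H y v z u : R) : 0 <= u -> 0 <= z -> 0 <= y ->
  2 * (A * G * x + 2 * C * H * y + (v + 1) * z * y)
  <= 2 * A * G * x + (4 * C * H + (u + 2 * (v + 1)) * z) * y.
Proof.
move=> u0 z0 y0; have : 0 <= u * z * y by rewrite !mulr_ge0.
lra.
Qed.

Section DerivativeRows.
Variables (R : realType) (S : {fset nat}) (K : birkhoff R) (delta : R) (Xi : set (RS R S)).
Variable F : normal_form K delta Xi.
Implicit Types (p : P R S) (vs : seq (P R S)) (c : probe S).
Variable sigma : R.
Hypothesis sig0 : 0 <= sigma.
Local Notation U := (VXi delta Xi sigma).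
Local Notation X := (Psp S sigma).

(** The function dPsi(p) [e_c], differentiated in the directions vs: one row of the
    matrix of the transpose. *)
Definition dPsi_row p vs c : dist R := dPsi F p (rcons vs (dirx (probe_vec R c))).
(** The unknown of the elliptic equation [sympl_pcoord]. *)
Definition dPsi_prim p vs c : dist R := dx (- 1%:Z) (dPsi_row p vs c).

Lemma rcons_all vs c : probe_ok c -> all_in X vs -> all_in X (rcons vs (dirx (probe_vec R c))).
Proof.
move=> ok avs v; rewrite mem_rcons inE => /orP[/eqP ->|/avs//].
exact/dirx_dom/probe_vec_dom.
Qed.

Lemma dPsi_row_dom p vs c : U p -> all_in X vs -> probe_ok c -> dom (Hs0 R 0) (dPsi_row p vs c).
Proof.
move=> Up avs ok; have [C C0 hC] := gj_bd (gjet_dPsi_s F sig0) (size vs).+1 Up.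
have [] // := hC (rcons vs (dirx (probe_vec R c))).
  by rewrite size_rcons.
exact: rcons_all.
Qed.
Lemma dPsi_prim_dom p vs c : U p -> all_in X vs -> probe_ok c -> dom (Hs0 R 1) (dPsi_prim p vs c).
Proof.
move=> Up avs ok; have [d d0] := dPsi_row_dom Up avs ok.
by have := dx_hsg 1 (hsg_nrm d); rewrite add0r => /hsgP[d1 _]; split.
Qed.
End DerivativeRows.

Section Elliptic.
Variables (R : realType) (S : {fset nat}) (K : birkhoff R) (delta : R) (Xi : set (RS R S)).
Hypothesis oXi : nopen (RSsp R S) Xi.
Variable F : normal_form K delta Xi.
Implicit Types (p : P R S) (vs : seq (P R S)) (q : dist R) (s r : R) (k : nat) (c : probe S).

Variables (m : nat) (sigma : R).
Hypotheses (m1 : (1 <= m)%N) (hsig : m%:R + 5 <= sigma).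

Local Notation U := (VXi delta Xi sigma).
Local Notation X := (Psp S sigma).

Let sig1 : 1 <= sigma. Proof. by have h := hsig; have := ler0n R m; lra. Qed.
Let sig0 : 0 <= sigma. Proof. by apply: le_trans sig1. Qed.

Local Notation dPsi_row := (dPsi_row F).
Local Notation dPsi_prim := (dPsi_prim F).
Local Notation dPsi_row_dom := (@dPsi_row_dom _ _ _ _ _ F sigma sig0 _ _ _).
Local Notation dPsi_prim_dom := (@dPsi_prim_dom _ _ _ _ _ F sigma sig0 _ _ _).

(** The Leibniz rule applied to W(dPsi [e_1], dPsi [e_2]) = W(e_1, e_2), whose right hand
    side does not depend on the point. *)
Lemma sympl_jet p vs c1 c2 : U p -> all_in X vs -> probe_ok c1 -> probe_ok c2 ->
  \sum_(ab <- splits vs) l2dot (dPsi_prim p ab.1 c1) (dPsi_row p ab.2 c2) =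
  if vs is [::] then WE (probe_vec R c1) (probe_vec R c2) else 0.
Proof.
move=> Up avs ok1 ok2; have nP := normed_Psp S sigma.
have gH := gauge_ng (normed_Hs0 (R := R) 0).
have jD c : probe_ok c -> gjet X U (ng (Hs0 R 0)) (fun p vs => dPsi_row p vs c).
  by move=> ok; apply: (gjet_rcons nP gH (gjet_dPsi_s F sig0)); exact/dirx_dom/probe_vec_dom.
have hg K1 (u : dist R) : ng (Hs0 R 0) K1 u -> hsg 0 K1 u by move=> [[d _] n]; exact/hsgP.
have hd K1 (u : dist R) : ng (Hs0 R 0) K1 u -> hsg 0 K1 (dx (- 1%:Z) u).
  by move=> /hg/(dx_hsg 1)/hsg_le; apply; rewrite add0r.
pose D : P R S -> seq (P R S) -> R^o :=
  leibniz (@WL2 R : dist R -> dist R -> R^o) (fun p vs => dPsi_row p vs c1) (fun p vs => dPsi_row p vs c2).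
pose D' : P R S -> seq (P R S) -> R^o :=
  fun _ vs => if vs is [::] then WE (probe_vec R c1) (probe_vec R c2) else 0.
suff : D p vs = D' p vs by [].
apply: (gjet_uniq nP (VXi_open delta oXi sigma) (U := U) (D := D) (D' := D') _ _ _ avs Up).
- apply: (gjet_bilin (c := 2) nP gH gH (gauge_abs R)) (jD _ ok1) (jD _ ok2) => //.
  + move=> a C C' L u u' v hu hu' hv; rewrite /WL2.
    have -> : dx (-1) (a *: u + u') = a *: dx (-1) u + dx (-1) u' by rewrite dxD dxZ.
    exact: l2dotPl (l2abs_hsg (hd _ _ hu) (hg _ _ hv)) (l2abs_hsg (hd _ _ hu') (hg _ _ hv)).
  + move=> a C C' L v u u' hv hu hu'.
    exact: l2dotPr (l2abs_hsg (hd _ _ hv) (hg _ _ hu)) (l2abs_hsg (hd _ _ hv) (hg _ _ hu')).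
  + move=> C L u v C0 L0 hu hv; exact: l2dot_le (l2abs_hsg (hd _ _ hu) (hg _ _ hv)).
- exact: (gjet_const nP (K := `|WE (probe_vec R c1) (probe_vec R c2)|) _ (gauge_abs R) _ (lexx _)).
- move=> p' Up'; rewrite /D /D' /leibniz /= big_seq1.
  have U0 := VXi_le sig0 Up'.
  exact: (Psi_symplectic F U0 (probe_vec_dom 0 ok1) (probe_vec_dom 0 ok2)).
Qed.

(** Symplecticity in operator form, dPsi^T d_x^{-1} dPsi [e_c] = J e_c, differentiated.
    By [dPsi_pair] the transpose can be replaced by its expansion.  The term of the
    splitting (vs, [::]) is q + sum_k a_{-k} d_x^{-k} q plus a smoothing term, evaluated at
    q = dPsi_prim p vs c; the other terms differentiate dPsi_prim fewer times. *)
Lemma sympl_pcoord p vs c n b : U p -> all_in X vs -> probe_ok c -> Sperp S n ->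
  \sum_(ab <- splits vs) pcoord (dTransp_ae F m p ab.2 (dPsi_prim p ab.1 c)) (Pw S n b) =
  if vs is [::] then l2dot (dx (- 1%:Z) (xw (probe_vec R c))) (trig n (half_unit R b)) else 0.
Proof.
move=> Up avs ok nS; have ok2 : probe_ok (Pw S n b) by [].
have := sympl_jet Up avs ok ok2; rewrite WE_probe WL2E => <-.
apply: eq_big_seq => ab abs; have [a1 a2] := splits_all abs avs.
exact: (esym (dPsi_pair oXi F m1 hsig Up a2 (dPsi_prim_dom Up a1 ok) ok2)).
Qed.

Variables (L : nat) (U' : set (P R S)) (LL : seq (P R S) -> Prop) (n0 : nat) (Ca CR : R).
Hypotheses (L3 : (3 <= L)%N) (Lm : (L <= m)%N) (UU : U' `<=` U).
Hypothesis LLs : forall vs ab, ab \in splits vs -> LL vs -> LL ab.1 /\ LL ab.2.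
Hypothesis LLa : forall vs, LL vs -> all_in X vs.
Hypotheses (Ca0 : 0 <= Ca) (CR0 : 0 <= CR).
Hypothesis hCa : forall k p vs, (1 <= k <= m)%N -> U' p -> LL vs -> (size vs <= n0)%N ->
  supg (L%:R + 3) (Ca * nprod X vs) (daT F k p vs).
Hypothesis hCR : forall p vs q, U' p -> LL vs -> (size vs <= n0)%N -> dom (Hs0 R 1) q ->
  ng (Esp S (m%:R + 2)) (CR * nprod X vs * nrm (Hs R 1) q) (dRem_ae F m p vs q).

Let nP := normed_Psp (R := R) S sigma.
Let A := m%:R * (12 * 2 `^ (L%:R + 1) * Ca).
Let A0 : 0 <= A. Proof. by rewrite !mulr_ge0 ?powR_ge0. Qed.

Lemma sum_pmul_supg p vs (g : dist R) (r G : R) : 0 <= r -> r <= L%:R -> U' p -> LL vs ->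
  (size vs <= n0)%N -> supg r G g ->
  supg (r + 1) (A * nprod X vs * G)
   (\sum_(1 <= k < m.+1) pmul (daT F k p vs) (dx (- k%:Z) g)).
Proof.
move=> r0 rL Up lvs svs hg.
have e : A * nprod X vs * G = (size (index_iota 1 m.+1))%:R * (12 * 2 `^ (L%:R + 1) * (Ca * nprod X vs * G)).
  by rewrite size_iota subSS subn0 /A; ring.
rewrite e; apply: (gsum (gauge_supg (r + 1))) => k; rewrite mem_index_iota ltnS => kk.
have /andP[k1 km] := kk.
have hk : supg (r + 1) G (dx (- k%:Z) g).
  by apply: supg_le (dx_supg k hg); rewrite lerD2l ler1n.
apply: (pmul_supg (hCa kk Up lvs svs) hk).
  by rewrite ger0_norm ?addr_ge0// lerD2r.
by rewrite -addrA lerD2l; lra.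
Qed.

Lemma pcoord_supg_w r G (u : dist R) n b : supg r G u -> Sperp S n ->
  `|pcoord (in_w S u) (Pw S n b)| <= G * jpow n (- r).
Proof.
move=> [_ h] nS; rewrite pcoord_in_w//; apply: le_trans (h n).
by case: b; [exact: Im_le_cabs|exact: Re_le_cabs].
Qed.
Lemma pcoord_supg0 G (u : dist R) c : supg 0 G u -> probe_ok c -> `|pcoord (in_w S u) c| <= G.
Proof.
move=> h; have G0 := supg_ge0 h; case: c => [j|j|n b] ok; last first.
  by have := pcoord_supg_w b h ok; rewrite oppr0 jpow0 mulr1.
all: by rewrite pcoord_in_w// normr0.
Qed.

Lemma cabs_pcoord (u : dist R) n B : Sperp S n ->
  (forall b, `|pcoord (in_w S u) (Pw S n b)| <= B) -> cabs (u n) <= 2 * B.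
Proof.
move=> nS h; have := h true; have := h false; rewrite !pcoord_in_w//= /cabs => h1 h2.
by rewrite mulrDl mul1r; apply: lerD.
Qed.

Lemma arith_base (N j A' C : R) : 0 <= N -> 0 <= A' -> 1 <= j ->
  N + A' * N * 1 + 2 * (C * N * j) <= (1 + A' + 2 * C) * N * j.
Proof.
move=> n0' a0 j1; have k1 : N * 1 <= N * j by rewrite ler_wpM2l.
have k2 : A' * N * 1 <= A' * N * j by rewrite ler_wpM2l// mulr_ge0.
lra.
Qed.

Lemma pcoord0 c : pcoord (0 : E R S) c = 0.
Proof. by case: c => [j|j|n' b'] /=; rewrite ?ffunE//; case: b'. Qed.

(** A bound without decay.  The coefficient n of dPsi [e_c] is obtained by pairing with a
    mode whose H^1 norm is <n>, and d_x^{-1} divides it by <n>. *)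
Lemma dPsi_prim_base p vs c : U' p -> LL vs -> (size vs <= n0)%N ->
  probe_ok c -> supg 0 (2 * (1 + A + 2 * CR) * nprod X vs) (dPsi_prim p vs c).
Proof.
move=> Up lvs svs ok; have Up' := UU Up; have avs := LLa lvs.
have N0 := nprod_ge0 nP avs; set N := nprod X vs in N0 *.
have [[rd _] d0] := dPsi_row_dom Up' avs ok.
have C0 : 0 <= 1 + A + 2 * CR by rewrite !addr_ge0// mulr_ge0.
have main n b : n != 0 -> `|2 * complex.Re ((dPsi_row p vs c n : R[i]) * conjc (half_unit R b))| <= (1 + A + 2 * CR) * N * jpow n 1.
  move=> nn; have hq := trig_hsg 1 nn (cabs_half_unit R b).
  have dq : dom (Hs0 R 1) (trig n (half_unit R b)).
    split; first by have /hsgP[] := hq.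
    rewrite /= /trig ![0 == _]eq_sym oppr_eq0 (negbTE nn).
    by apply: complexP; rewrite /= addr0.
  rewrite -l2dot_trig// l2dotC (dPsi_pair oXi F m1 hsig Up' avs dq ok).
  have j1 : 1 <= jpow n 1 :> R by exact: jpow_ge1.
  have h0 : supg 0 1 (trig n (half_unit R b)) by have := trig_supg 0 nn (cabs_half_unit R b); rewrite jpow0.
  rewrite /dTransp_ae pcoordD in_wD pcoordD.
  have t1 : `|pcoord (in_w S (if vs is [::] then trig n (half_unit R b) else 0)) c| <= N.
    move: N0; rewrite /N; case: (vs) => [|v vs'] N0.
      by rewrite /nprod big_nil; exact: pcoord_supg0 h0 ok.
    by rewrite in_w0 pcoord0 normr0.
  have hs := sum_pmul_supg (lexx 0) (ler0n _ _) Up lvs svs h0.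
  have {}hs := supg_le (ler_wpDl (lexx _) ler01) hs.
  have t2 := pcoord_supg0 hs ok; rewrite -/N in t2.
  have t3 := Esp_pcoord (hCR Up lvs svs dq) ok.
  have /hsgP[_ n1] := hq.
  have jc : probe_pow c (- (m%:R + 2)) <= 1 :> R.
    case: (c) => [j|j|n' b'] /=; [exact: lexx|exact: lexx|].
    have h0' : - (m%:R + 2) <= 0 :> R by rewrite lerNl oppr0 addr_ge0.
    by have := ler_jpow n' h0'; rewrite jpow0.
  have t3' : `|pcoord (dRem_ae F m p vs (trig n (half_unit R b))) c| <= 2 * (CR * N * jpow n 1).
    apply: le_trans t3 _; rewrite -[leRHS]mulr1; apply: ler_pM => //.
    - apply: mulr_ge0 => //; apply: mulr_ge0; first exact: mulr_ge0.
      by apply: (nrm_ge0 (normed_Hs 1)); case: dq.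
    - exact: probe_pow_ge0.
    - by rewrite ler_wpM2l// ler_wpM2l// mulr_ge0.
  apply: le_trans (ler_normD _ _) _; apply: le_trans (lerD (ler_normD _ _) t3') _.
  apply: le_trans (lerD (lerD t1 t2) (lexx _)) _.
  exact: arith_base.
have rg := dx_real 1 rd.
split=> // n; rewrite oppr0 jpow0 mulr1 /dPsi_prim dxE.
have [->|nn] := eqVneq n 0.
  by rewrite /dcoef eqxx mul0r cabs0 mulr_ge0// mulr_ge0.
apply: le_trans (cabsM _ _) _.
have hc : cabs (dPsi_row p vs c n) <= 2 * ((1 + A + 2 * CR) * N * jpow n 1).
  have := main n true nn; have := main n false nn; rewrite /cabs.
  case: (dPsi_row p vs c n) => x y; rewrite !cReM /=.
  move: (_ * jpow n 1) => B.
  rewrite (_ : 2 * (x * 2^-1 - y * - 0) = x); last by field.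
  rewrite (_ : 2 * (x * 0 - y * - 2^-1) = y); last by field.
  by move=> h1 h2; lra.
apply: le_trans (ler_pM (cabs_ge0 _) (cabs_ge0 _) (dcoef_le R 1 n) hc) _.
have yx : jpow n 1 * jpow n (- 1%:R) = 1 :> R := jpowNK n 1.
rewrite [leLHS](_ : _ = 2 * (1 + A + 2 * CR) * N * (jpow n 1 * jpow n (- 1%:R))).
  by rewrite yx mulr1.
by move: (jpow n _) (jpow n _) => x y; ring.
Qed.

(** The size of J e_c in the norm of decay L. *)
Definition rhs_weight c : R := probe_pow c L%:R.
Lemma rhs_weight_ge1 c : 1 <= rhs_weight c.
Proof. by case: c => [j|j|n b]; [exact: lexx|exact: lexx|exact: jpow_ge1]. Qed.

Lemma rhs_bd c n b : probe_ok c -> Sperp S n ->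
  `|l2dot (dx (- 1%:Z) (xw (probe_vec R c))) (trig n (half_unit R b))| <= rhs_weight c * jpow n (- L%:R).
Proof.
move=> ok nS.
have hw : supg L%:R (rhs_weight c) (xw (probe_vec R c)).
  case: c ok => [j|j|n' b'] ok.
  - by apply: supg_leK (supg0 _).
  - by apply: supg_leK (supg0 _).
  - exact: trig_supg (Sperp_neq0 ok) (cabs_half_unit R b').
have [rw h] := supg_le (ler_wpDr (ler01) (lexx _)) (dx_supg 1 hw).
rewrite l2dot_trig ?(Sperp_neq0 nS)//.
apply: le_trans (h n); rewrite normrM ger0_norm//.
apply: le_trans (ler_wpM2l (ler0n _ 2) (Re_le_cabs _)) _.
apply: le_trans (ler_wpM2l (ler0n _ 2) (cabsM _ _)) _.
have := ler_wpM2l (cabs_ge0 (dx (- 1%:Z) (xw (probe_vec R c)) n)) (cabs_half_unit R b).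
by rewrite cabs_conj; move: (_ * cabs (half_unit R b)) => B; lra.
Qed.

(** Only finitely many frequencies lie outside S^perp. *)
Lemma outside_Sperp_bd : exists2 JS : R, 0 <= JS & forall n : int, ~~ Sperp S n -> jpow n L%:R <= JS.
Proof.
pose N := \max_(j : S) (val j).
exists (N.+1%:R ^+ L) => [|n]; first by rewrite exprn_ge0.
rewrite negb_and negbK => h; rewrite jpow_nat.
apply: lerXn2r; rewrite ?nnegrE ?jbr_ge0// /jbr ge_max ler1n /= ler_nat.
have [->//|n0'] := eqVneq n 0.
move: h; rewrite (negbTE n0') /= negbK => nS.
by apply: leqW; exact: (@leq_bigmax _ (fun j : S => val j) (FSetSub nS)).
Qed.

(** The terms of [sympl_pcoord] in which dPsi_prim is differentiated fewer times than vs are known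
    by induction to have decay L. *)
Lemma dTransp_ae_rest p vs ab c n b C : U' p -> LL vs -> (size vs <= n0)%N -> probe_ok c -> Sperp S n ->
  ab \in splits vs -> (size ab.1 < size vs)%N -> 0 <= C ->
  supg L%:R (C * (nprod X ab.1 * rhs_weight c)) (dPsi_prim p ab.1 c) ->
  `|pcoord (dTransp_ae F m p ab.2 (dPsi_prim p ab.1 c)) (Pw S n b)| <=
    (A + 6 * CR) * C * (nprod X vs * rhs_weight c) * jpow n (- L%:R).
Proof.
move=> Up lvs svs ok nS abs sab C0 hg.
have [l1 l2] := LLs abs lvs; have sz := splits_size abs.
have s1 : (size ab.1 <= n0)%N by apply: leq_trans svs; rewrite -sz leq_addr.
have s2 : (size ab.2 <= n0)%N by apply: leq_trans svs; rewrite -sz leq_addl.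
have avs := LLa lvs.
have a1 := LLa l1; have a2 := LLa l2.
have N1 := nprod_ge0 nP a1; have N2 := nprod_ge0 nP a2; have w0 := le_trans ler01 (rhs_weight_ge1 c).
have dg := dPsi_prim_dom (UU Up) a1 ok.
rewrite /dTransp_ae pcoordD.
(* the leading term q is absent, as ab.2 is not empty *)
have ne : (if ab.2 is [::] then dPsi_prim p ab.1 c else 0) = 0.
  case: ab.2 sz => // /eqP; rewrite addn0 => /eqP e; by rewrite e ltnn in sab.
rewrite ne add0r.
have hs := sum_pmul_supg (ler0n R L) (lexx _) Up l2 s2 hg.
have t1 := pcoord_supg_w b (supg_le (ler_wpDr ler01 (lexx _)) hs) nS.
have t2 := Esp_pcoord (hCR Up l2 s2 dg) (c := Pw S n b) nS.
have h1 : nrm (Hs R 1) (dPsi_prim p ab.1 c) <= 3 * (C * (nprod X ab.1 * rhs_weight c)).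
  have L2 : 2 <= L%:R :> R by rewrite ler_nat ltnW.
  by have := supg_hsg (supg_le L2 hg); rewrite (_ : 2 - 1 = 1 :> R); [move=> /hsgP[]|ring].
have j2 : jpow n (- (m%:R + 2)) <= jpow n (- L%:R) :> R.
  by apply: ler_jpow; rewrite lerN2 -natrD ler_nat (leq_trans Lm)// leq_addr.
have h0 : 0 <= nrm (Hs R 1) (dPsi_prim p ab.1 c) by apply: (nrm_ge0 (normed_Hs 1)); case: dg.
have t2' : `|pcoord (dRem_ae F m p ab.2 (dPsi_prim p ab.1 c)) (Pw S n b)| <=
   2 * (CR * nprod X ab.2 * (3 * (C * (nprod X ab.1 * rhs_weight c)))) * jpow n (- L%:R).
  apply: le_trans t2 _; apply: ler_pM => //=; rewrite ?jpow_ge0 ?mulr_ge0//.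
  by rewrite ler_wpM2l// ler_wpM2l// mulr_ge0.
apply: le_trans (ler_normD _ _) _; apply: le_trans (lerD t1 t2') _.
rewrite -(splits_nprod X abs).
move: (nprod X ab.1) (nprod X ab.2) (rhs_weight c) (jpow n _) => x y z w.
by rewrite [leLHS](_ : _ = (A + 6 * CR) * C * (x * y * z) * w)//; ring.
Qed.

(** Induction on the number of directions.  At each stage [sympl_pcoord] is an equation
    g + sum_k a_{-k} d_x^{-k} g + smoothing = known for g = dPsi_prim p vs c, so knowing decay j of g
    improves it to j + 1 on S^perp, and [elliptic_bootstrap] applies. *)
Lemma dPsi_prim_decay (l : nat) : (l <= n0)%N -> exists2 C : R, 0 <= C &
  forall p vs c, U' p -> LL vs -> (size vs <= l)%N -> probe_ok c ->
    supg L%:R (C * (nprod X vs * rhs_weight c)) (dPsi_prim p vs c).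
Proof.
have [JS JS0 hJS] := outside_Sperp_bd.
have [CE CE0 hCE] := @elliptic_bootstrap R S (2 * A) (4 * CR) JS L (mulr_ge0 (ler0n _ 2) A0)
  (mulr_ge0 (ler0n _ 4) CR0) JS0 L3 hJS.
have main l' C : (l' <= n0)%N -> 0 <= C ->
  (forall p vs c, U' p -> LL vs -> (size vs < l')%N -> probe_ok c ->
    supg L%:R (C * (nprod X vs * rhs_weight c)) (dPsi_prim p vs c)) ->
  exists2 C' : R, 0 <= C' & forall p vs c, U' p -> LL vs -> (size vs <= l')%N -> probe_ok c ->
    supg L%:R (C' * (nprod X vs * rhs_weight c)) (dPsi_prim p vs c).
  move=> ln C0 hC.
  (* the bound without decay plus the right hand side and the at most 2^n0 known terms *)
  pose D := 2 * (1 + A + 2 * CR) + 2 * ((2 ^ n0)%:R * ((A + 6 * CR) * C) + 1).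
  have q0 : 0 <= (2 ^ n0)%:R * ((A + 6 * CR) * C).
    by rewrite mulr_ge0// mulr_ge0// addr_ge0// mulr_ge0.
  have q1 : 0 <= 2 * (1 + A + 2 * CR) by rewrite mulr_ge0// !addr_ge0// mulr_ge0.
  have D0 : 0 <= D by rewrite /D addr_ge0// mulr_ge0// addr_ge0.
  exists (CE * D); first by rewrite mulr_ge0.
  move=> p vs c Up lvs svs ok; have avs := LLa lvs; have N0 := nprod_ge0 nP avs.
  have svs' := leq_trans svs ln.
  have w1 := rhs_weight_ge1 c; have w0 := le_trans ler01 w1.
  have NW0 : 0 <= nprod X vs * rhs_weight c by rewrite mulr_ge0.
  rewrite -mulrA; apply: hCE; first by rewrite mulr_ge0.
  - by have [] := dPsi_prim_dom (UU Up) avs ok.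
  - apply: supg_leK (dPsi_prim_base Up lvs svs' ok).
    apply: (@le_trans _ _ (2 * (1 + A + 2 * CR) * (nprod X vs * rhs_weight c))).
      by rewrite ler_wpM2l// ler_peMr.
    by rewrite ler_wpM2r// /D lerDl mulr_ge0// addr_ge0.
  move=> j G jL hG n nS.
  have G0 := supg_ge0 hG.
  have j0 : 0 <= jpow n (- L%:R) :> R by exact: jpow_ge0.
  have dg := dPsi_prim_dom (UU Up) avs ok.
  pose H := nrm (Hs R 1) (dPsi_prim p vs c).
  have H0 : 0 <= H by apply: (nrm_ge0 (normed_Hs 1)); case: dg.
  have [e0 hn] : nprod X [::] = 1 /\ LL [::].
    split; first by rewrite /nprod big_nil.
    by have [rest [er _]] := splits_head vs; have [] := LLs (vs := vs) (ab := (vs, [::])) _ lvs; rewrite ?er ?mem_head.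
  apply: (@le_trans _ _ (2 * (A * G * jpow n (- j.+1%:R) + 2 * CR * H * jpow n (- L%:R)
     + ((2 ^ n0)%:R * ((A + 6 * CR) * C) + 1) * (nprod X vs * rhs_weight c) * jpow n (- L%:R)))); last first.
    by rewrite -/H /D; apply: arith_step => //; rewrite mulr_ge0.
  apply: (cabs_pcoord nS) => b.
  have := sympl_pcoord b (UU Up) avs ok nS.
  have [rest [er hr]] := splits_head vs; rewrite er big_cons [(vs, [::]).1]/= [(vs, [::]).2]/=.
  set RHS := (X in _ = X -> _) => hsum.
  have hR : `|RHS| <= nprod X vs * rhs_weight c * jpow n (- L%:R).
    rewrite /RHS; move: NW0; case: (vs) => [|v vs'] NW0; last by rewrite normr0 mulr_ge0.
    by rewrite e0 mul1r; exact: rhs_bd.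
  have hrest : `|\sum_(ab <- rest) pcoord (dTransp_ae F m p ab.2 (dPsi_prim p ab.1 c)) (Pw S n b)| <=
     (2 ^ n0)%:R * ((A + 6 * CR) * C * (nprod X vs * rhs_weight c) * jpow n (- L%:R)).
    set B := _ * jpow n _; have B0 : 0 <= B by rewrite /B mulr_ge0// mulr_ge0// mulr_ge0// addr_ge0// mulr_ge0.
    apply: le_trans (ler_norm_sum _ _ _) _.
    apply: (@le_trans _ _ (\sum_(ab <- rest) B)).
      rewrite big_seq [leRHS]big_seq; apply: ler_sum => ab abr.
      have abs : ab \in splits vs by rewrite er inE abr orbT.
      apply: dTransp_ae_rest => //; first exact: hr.
      apply: hC => //; first by have [] := LLs abs lvs.
      exact: leq_trans (hr _ abr) svs.
    rewrite big_const_seq count_predT iter_addr_0 -[leLHS]mulr_natl ler_wpM2r// ler_nat.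
    apply: (@leq_trans (size (splits vs))); first by rewrite er /=.
    by rewrite size_splits leq_exp2l.
  have hs := sum_pmul_supg (ler0n R j) _ Up hn (leq0n _) hG.
  have {}hs := hs _; rewrite ler_nat (ltnW jL) e0 mulr1 natr1 in hs.
  have t1 := pcoord_supg_w b (hs isT) nS.
  have t2 := Esp_pcoord (hCR Up hn (leq0n _) dg) (c := Pw S n b) nS.
  rewrite e0 mulr1 -/H in t2.
  have j2 : jpow n (- (m%:R + 2)) <= jpow n (- L%:R) :> R.
    by apply: ler_jpow; rewrite lerN2 -natrD ler_nat (leq_trans Lm)// leq_addr.
  have t2' : `|pcoord (dRem_ae F m p [::] (dPsi_prim p vs c)) (Pw S n b)| <= 2 * (CR * H) * jpow n (- L%:R).
    by apply: le_trans t2 _; rewrite ler_wpM2l// !mulr_ge0.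
  have -> : pcoord (in_w S (dPsi_prim p vs c)) (Pw S n b) = RHS
      - \sum_(ab <- rest) pcoord (dTransp_ae F m p ab.2 (dPsi_prim p ab.1 c)) (Pw S n b)
      - pcoord (in_w S (\sum_(1 <= k < m.+1) pmul (daT F k p [::]) (dx (- k%:Z) (dPsi_prim p vs c)))) (Pw S n b)
      - pcoord (dRem_ae F m p [::] (dPsi_prim p vs c)) (Pw S n b).
    rewrite -hsum /dTransp_ae pcoordD in_wD pcoordD.
    by move: (pcoord _ _) (pcoord _ _) (pcoord _ _) (\sum_(ab <- rest) _) => x y z w; ring.
  move: hR hrest t1 t2'.
  move: (pcoord _ _) (pcoord _ _) (\sum_(ab <- rest) _) RHS {hsum} => x y z w hR hrest t1 t2'.
  apply: le_trans (ler_normB _ _) _; apply: le_trans (lerD (ler_normB _ _) t2') _.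
  apply: le_trans (lerD (lerD (ler_normB _ _) t1) (lexx _)) _.
  apply: le_trans (lerD (lerD (lerD hR hrest) (lexx _)) (lexx _)) _.
  rewrite le_eqVlt; apply/orP; left; apply/eqP; ring.
elim: l => [|l IH] ln.
  by have [C C0 hC] := main 0%N 0 ln (lexx 0) (fun p vs c _ _ h => False_ind _ (notF h)); exists C.
have [C C0 hC] := IH (ltnW ln).
have [C' C'0 hC'] := main l.+1 C ln C0 (fun p vs c Up lvs svs ok => hC p vs c Up lvs svs ok).
by exists C'.
Qed.
End Elliptic.

(** * Operators given by their rows *)

Section Rows.
Variables (R : realType) (S : {fset nat}).
Implicit Types (a u v q : dist R) (s r C : R) (k : nat) (mu n : int) (z : R[i]) (f : probe S -> dist R).

(** The element of phase space whose pairing with e_c is (q, f c).  For f = dPsi [.] this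
    is the transpose, and it makes sense for every q for which the pairings converge. *)
Definition of_rows f q : E R S :=
  ([ffun j => l2dot q (f (Pth j)) : R^o], [ffun j => l2dot q (f (Py j)) : R^o],
   fun m => if Sperp S m then
     Complex (l2dot q (f (Pw S m false))) (l2dot q (f (Pw S m true))) else 0).

(** The modes of frequencies m and - m are proportional; rows that respect this relation
    produce real valued functions. *)
Definition psym f := forall m b, Sperp S m ->
  f (Pw S (- m) b) = (if b then -1 else 1 : R) *: f (Pw S m b).

Lemma psymL (x : R) f g : psym f -> psym g -> psym (x *: f + g).
Proof.
move=> hf hg m b nS; rewrite [LHS]/(x *: f _ + g _) hf// hg//.
by rewrite [(x *: f + g) _]/(x *: f _ + g _) scalerDr !scalerA mulrC.
Qed.

Lemma pcoord_of_rows f q c : probe_ok c -> pcoord (of_rows f q) c = l2dot q (f c).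
Proof. by case: c => [j|j|n b] /= ok; rewrite ?ffunE// ok; case: b. Qed.
Lemma of_rows_w f q m : (of_rows f q).2 m = if Sperp S m then
  Complex (l2dot q (f (Pw S m false))) (l2dot q (f (Pw S m true))) else 0.
Proof. by []. Qed.
Lemma of_rows_out f q n : ~~ Sperp S n -> (of_rows f q).2 n = 0.
Proof. by rewrite of_rows_w => /negbTE ->. Qed.
Lemma l2abs0 q : l2abs q 0 0.
Proof.
move=> s us; rewrite big1// => i _; rewrite [cabs ((0 : dist R) _)]cabs0 mulr0.
exact: normr0.
Qed.
Lemma l2dotZr (x : R) q v C : l2abs q v C -> l2dot q (x *: v) = x * l2dot q v.
Proof. by move=> h; have := l2dotPr x h (l2abs0 q); rewrite addr0 l2dot0r addr0. Qed.

Lemma of_rows_real f q : psym f -> (forall m, Sperp S m -> exists C, l2abs q (f (Pw S m true)) C) ->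
  real_valued (of_rows f q).2.
Proof.
move=> hf hl n; rewrite !of_rows_w SperpN; case: ifP => nS; last first.
  by apply: complexP; rewrite //= oppr0.
rewrite !hf// scale1r; have [C hC] := hl n nS.
by rewrite (l2dotZr _ hC) mulN1r.
Qed.

(** The transpose of q |-> a d_x^{-k} q, applied to a trigonometric mode ([l2dot_mul_dx_tr]). *)
Definition mul_dx_tr k a mu z : dist R :=
  fun n => dcoef R k (- n) * ((a (n + mu) : R[i]) * conjc z + (a (n - mu) : R[i]) * z).

Lemma mul_dx_tr_real k a mu z : real_valued a -> real_valued (mul_dx_tr k a mu z).
Proof.
move=> ra n; rewrite /mul_dx_tr opprK cconjM -dcoefN opprK; congr (_ * _).
rewrite cconjD !cconjM -!ra addrC; congr (_ * _ + _ * _).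
- by congr (a _); lia.
- by case: z => x y /=; rewrite opprK.
- by congr (a _); lia.
Qed.
Lemma mul_dx_tr_neg k a mu z : mul_dx_tr k a (- mu) z = mul_dx_tr k a mu (conjc z).
Proof.
apply/funext => n; rewrite /mul_dx_tr opprK addrC; congr (_ * (_ + _)).
by case: z => x y /=; rewrite opprK.
Qed.
Lemma mul_dx_trZ k a mu (x : R) z : mul_dx_tr k a mu (x *: (z : Rcomplex R)) = x *: mul_dx_tr k a mu z.
Proof.
apply/funext => n; rewrite [RHS]/(x *: mul_dx_tr k a mu z n) /mul_dx_tr.
rewrite cconjZ; apply: complexP;
  rewrite ?cReZ ?cImZ !(cReM, cImM, cReD, cImD) ?cReZ ?cImZ; ring.
Qed.
Lemma conj_half_unit b : conjc (half_unit R b) = (if b then -1 else 1 : R) *: (half_unit R b : Rcomplex R).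
Proof. by case: b; apply: complexP => /=; ring. Qed.
Lemma mul_dx_trL k (x : R) a a' mu z : mul_dx_tr k (x *: a + a') mu z = x *: mul_dx_tr k a mu z + mul_dx_tr k a' mu z.
Proof.
apply/funext => n; rewrite [RHS]/(x *: mul_dx_tr k a mu z n + mul_dx_tr k a' mu z n) /mul_dx_tr.
rewrite ![(x *: a + a') _]/(x *: a _ + a' _); apply: complexP;
  rewrite ?cReD ?cImD ?cReZ ?cImZ !(cReM, cImM, cReD, cImD) ?cReZ ?cImZ; ring.
Qed.

Lemma dcoef_le1 k n : cabs (dcoef R k n) <= 1.
Proof.
apply: le_trans (dcoef_le R k n) _.
have h0 : - k%:R <= 0 :> R by rewrite lerNl oppr0.
by have := ler_jpow n h0; rewrite jpow0.
Qed.

Lemma mul_dx_tr_supg k a mu z r C : 0 <= r -> supg r C a -> cabs z <= 2^-1 ->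
  supg r (2 `^ r * C * jpow mu r) (mul_dx_tr k a mu z).
Proof.
move=> r0 ha hz; have C0 := supg_ge0 ha; case: ha => ra h; split; first exact: mul_dx_tr_real.
move=> n; apply: le_trans (cabsM _ _) _.
apply: le_trans (ler_wpM2r (cabs_ge0 _) (dcoef_le1 k (- n))) _; rewrite mul1r.
have p (nu : int) : jpow nu r = jpow mu r :> R -> cabs (a (n + nu)) <= C * (2 `^ r * jpow mu r * jpow n (- r)).
  move=> e; apply: le_trans (h _) _; rewrite ler_wpM2l// -e [n + nu]addrC.
  by apply: peetre_le; rewrite normrN ger0_norm.
have h1 := p mu erefl; have h2 := p (- mu) (jpow_opp mu r).
apply: le_trans (cabsD _ _) _.
have hz' : cabs (conjc z) <= 2^-1 by rewrite cabs_conj.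
apply: le_trans (lerD (cabsM _ _) (cabsM _ _)) _.
apply: le_trans (lerD (ler_pM (cabs_ge0 _) (cabs_ge0 _) h1 hz')
   (ler_pM (cabs_ge0 _) (cabs_ge0 _) h2 hz)) _.
move: (2 `^ r) (jpow mu r) (jpow n (- r)) => x y w.
by rewrite [leLHS](_ : _ = x * C * y * w)//; field.
Qed.

Lemma l2dot_mul_dx_tr k a mu z q : real_valued a -> real_valued q -> pmul_conv a (dx (- k%:Z) q) ->
  l2dot q (mul_dx_tr k a mu z) = 2 * complex.Re ((pmul a (dx (- k%:Z) q) mu : R[i]) * conjc z).
Proof.
move=> ra rq ok; have rp := pmul_conj ra (dx_real k rq) ok.
have [C1 h1] := ok mu; have [C2 h2] := ok (- mu).
rewrite l2dotE.
have -> : csum (fun n => (q n : R[i]) * (mul_dx_tr k a mu z (- n) : R[i])) =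
   conjc z * (pmul a (dx (- k%:Z) q) mu : R[i]) + z * (pmul a (dx (- k%:Z) q) (- mu) : R[i]).
  rewrite /pmul -(csumM (conjc z) h1) -(csumM z h2) -(csumD (cabssM _ h1) (cabssM _ h2)).
  apply: eq_csum => n; rewrite /mul_dx_tr opprK dxE [- n + mu]addrC [- n - mu]addrC.
  by apply: complexP; rewrite !(cReM, cImM, cReD, cImD); ring.
rewrite rp cReD !cReM; case: z (pmul _ _ mu) => [x y] [x' y'] /=; ring.
Qed.

Lemma pcoord_in_w_re u mu b : Sperp S mu ->
  pcoord (in_w S u) (Pw S mu b) = 2 * complex.Re ((u mu : R[i]) * conjc (half_unit R b)).
Proof.
by move=> nS; rewrite pcoord_in_w// cReM; case: b => /=; case: (u mu) => x y /=; field.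
Qed.

(** Matrices whose entry in row c and column n is O(<c>^{-al} <n>^{-al}). *)
Definition rowg (al K : R) (f : probe S -> dist R) :=
  [/\ 0 <= K, psym f & forall c, probe_ok c -> supg al (K * probe_pow c (- al)) (f c)].

Lemma gauge_rowg al : gauge (rowg al).
Proof.
split=> [K K0|K K' f h [K0 s hf]|K K' f g [K0 s hf] [K0' s' hg]|x K f [K0 s hf]].
- split=> //; first by move=> m b _; rewrite scaler0.
  by move=> c _; apply: supg_leK (supg0 _); rewrite mulr_ge0 ?probe_pow_ge0.
- split=> //; first exact: le_trans h.
  by move=> c ok; apply: supg_leK (hf c ok); rewrite ler_wpM2r ?probe_pow_ge0.
- split; first exact: addr_ge0.
    by have := psymL 1 s s'; rewrite scale1r.
  by move=> c ok; rewrite mulrDl; apply: supgD; [exact: hf|exact: hg].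
- split; first exact: mulr_ge0.
    have := psymL x s (g := 0); rewrite addr0; apply.
    by move=> m b _; rewrite scaler0.
  by move=> c ok; rewrite -mulrA; apply: supgZ; exact: hf.
Qed.

(** Decay in n bounds the pairing with q in H^{-s} if s + 2 <= al; decay in c puts the
    result in E_t if t + 1 <= al. *)
Lemma of_rows_ng al s t K f q : 2 + s <= al -> t + 1 <= al -> rowg al K f -> dom (Hs0 R (- s)) q ->
  ng (Esp S t) ((2 * #|{: S}|%:R + 6) * 12 * K * nrm (Hs R (- s)) q) (of_rows f q).
Proof.
move=> hs ht [K0 sf hf] [dq q0].
have hq := hsg_supg (hsg_nrm dq); set Q := nrm _ q in hq *.
have Q0 : 0 <= Q by exact: (nrm_ge0 (normed_Hs _) dq).
have ss : 2 <= - s + al by rewrite -lerBlDl opprK.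
have l2 c : probe_ok c -> l2abs q (f c) (2 * Q * (K * probe_pow c (- al)) * 6).
  by move=> ok; exact: l2abs_supg hq (hf c ok) ss.
have hE := @pcoord_Esp R S al (12 * K * Q) (of_rows f q).
have [] := hE.
- by rewrite !mulr_ge0.
- by apply: of_rows_real => // m nS; eexists; exact: (l2 (Pw S m true)).
- exact: of_rows_out.
- move=> c ok; rewrite pcoord_of_rows//; apply: le_trans (l2dot_le (l2 c ok)) _.
  by move: (probe_pow c _) => j; rewrite [leLHS](_ : _ = 12 * K * Q * j)//; ring.
move=> d h; have ht' : t <= al - 1 by rewrite lerBrDr.
have [d' n'] := Esp_mono ht' d; split=> //; apply: le_trans n' _.
by rewrite -mulrA (mulrA 12) -(mulrA _ 12 K) in h *; rewrite -!mulrA in h *.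
Qed.

Lemma of_rows_conv al s K f q c : 2 + s <= al -> rowg al K f -> dom (Hs0 R (- s)) q -> probe_ok c ->
  exists C, l2abs q (f c) C.
Proof.
move=> hs [K0 sf hf] [dq q0] ok; eexists; apply: (l2abs_supg (hsg_supg (hsg_nrm dq)) (hf c ok)).
by rewrite -lerBlDl opprK.
Qed.

Lemma of_rowsL al s K K' f g q (x : R) : 2 + s <= al -> rowg al K f -> rowg al K' g ->
  dom (Hs0 R (- s)) q -> of_rows (x *: f + g) q = x *: of_rows f q + of_rows g q.
Proof.
move=> hs hf hg dq; apply: pcoord_ext => [n nS|c ok].
  rewrite of_rows_out// [RHS]/(x *: (of_rows f q).2 n + (of_rows g q).2 n) !of_rows_out//.
  by apply: complexP; rewrite /= mulr0 addr0.
rewrite pcoordL !pcoord_of_rows//.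
have [C hC] := of_rows_conv hs hf dq ok; have [C' hC'] := of_rows_conv hs hg dq ok.
exact: l2dotPr hC hC'.
Qed.

Lemma of_rows_lin al s K f (x : R) q q' : 2 + s <= al -> rowg al K f ->
  dom (Hs0 R (- s)) q -> dom (Hs0 R (- s)) q' ->
  of_rows f (x *: q + q') = x *: of_rows f q + of_rows f q'.
Proof.
move=> hs hf dq dq'; apply: pcoord_ext => [n nS|c ok].
  rewrite of_rows_out// [RHS]/(x *: (of_rows f q).2 n + (of_rows f q').2 n) !of_rows_out//.
  by apply: complexP; rewrite /= mulr0 addr0.
rewrite pcoordL !pcoord_of_rows//.
have [C hC] := of_rows_conv hs hf dq ok; have [C' hC'] := of_rows_conv hs hf dq' ok.
exact: l2dotPl hC hC'.
Qed.
End Rows.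

(** * The extended transpose and its remainder *)

Section CoefGauge.
Variable R : realType.
Definition re_im (b : bool) (z : R[i]) : R := if b then complex.Im z else complex.Re z.
Definition coefg (n : int) (C : R) (u : dist R) := cabs (u n) <= C.
Lemma gauge_coefg n : gauge (coefg n).
Proof.
rewrite /coefg; split=> [K K0|K K' w h h'|K K' w w' h h'|a K w h].
- by rewrite [cabs _]cabs0.
- exact: le_trans h.
- by apply: le_trans (cabsD (w n) (w' n)) _; exact: lerD.
- by rewrite [(a *: w) n]/(a *: w n) cabsZ ler_wpM2l.
Qed.
Lemma prt_le b (z : R[i]) : `|re_im b z| <= cabs z.
Proof. by case: b; [exact: Im_le_cabs|exact: Re_le_cabs]. Qed.
Lemma prtL b (x : R) (u v : dist R) n : re_im b ((x *: u + v) n) = x * re_im b (u n) + re_im b (v n).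
Proof. by rewrite [(x *: u + v) n]/(x *: u n + v n) /re_im; case: b; rewrite ?cReD ?cImD ?cReZ ?cImZ. Qed.
Lemma cabs_prt (z : R[i]) : cabs z = `|re_im false z| + `|re_im true z|.
Proof. by []. Qed.
Lemma prt_ext (z w : R[i]) : (forall b, re_im b z = re_im b w) -> z = w.
Proof. by move=> h; apply: complexP; [exact: (h false)|exact: (h true)]. Qed.

Lemma supg_coefg r n C u : supg r C u -> coefg n (C * jpow n (- r)) u.
Proof. by move=> [_]; exact. Qed.

Variables (V : lmodType R) (X : nspace V) (nX : normed X).
Lemma gjet_prt U n b (D : V -> seq V -> dist R) : gjet X U (coefg n) D ->
  gjet X U (@absg R) (fun p vs => re_im b (D p vs n) : R^o).
Proof.
apply: (gjet_map (c := 1) (f := fun u : dist R => re_im b (u n) : R^o) nX (gauge_coefg n) (gauge_abs R)) => //.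
  by move=> a K K' w w' _ _; exact: prtL.
by move=> K w K0 h; rewrite /absg mul1r; apply: le_trans (prt_le b _) h.
Qed.
Lemma gjet_coef_Hs0 U n (D : V -> seq V -> dist R) : gjet X U (ng (Hs0 R 0)) D -> gjet X U (coefg n) D.
Proof.
apply: (gjet_map (c := 2) (f := id) nX (gauge_ng (normed_Hs0 0)) (gauge_coefg n)) => //.
move=> K u K0 [[du _] h]; have /hsgP/hsg_supg[_ /(_ n)] := conj du h.
by rewrite oppr0 jpow0 mulr1.
Qed.
End CoefGauge.

Section FinChoice.
Variable R : realType.
Lemma finite_radius_bound (I : eqType) (s : seq I) (Q : I -> R -> R -> Prop) :
  (forall i r r' C C', 0 < r' <= r -> C <= C' -> Q i r C -> Q i r' C') ->
  (forall i, i \in s -> exists r C, [/\ 0 < r, 0 <= C & Q i r C]) ->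
  exists r C, [/\ 0 < r, 0 <= C & forall i, i \in s -> Q i r C].
Proof.
move=> mono; elim: s => [|i s IH] h; first by exists 1, 0; split.
have [|r [C [r0 C0 hC]]] := IH; first by move=> j js; apply: h; rewrite inE js orbT.
have [r' [C' [r0' C0' hC']]] := h i (mem_head _ _).
exists (Num.min r r'), (C + C'); split; [by rewrite lt_min r0|by rewrite addr_ge0|].
move=> j; rewrite inE => /orP[/eqP ->|js].
  by apply: mono hC'; rewrite ?lt_min ?r0 ?r0' ?ge_min ?lexx ?orbT ?lerDr.
by apply: mono (hC j js); rewrite ?lt_min ?r0 ?r0' ?ge_min ?lexx ?orbT ?lerDl.
Qed.
End FinChoice.

Section Remainder.
Variables (R : realType) (S : {fset nat}) (K : birkhoff R) (delta : R) (Xi : set (RS R S)).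
Hypothesis oXi : nopen (RSsp R S) Xi.
Variable F : normal_form K delta Xi.
Implicit Types (p : P R S) (vs : seq (P R S)) (q : dist R) (s r : R) (k : nat) (c : probe S).
Variable sigma : R.
Hypothesis sig1 : 1 <= sigma.

Local Notation U := (VXi delta Xi sigma).
Local Notation X := (Psp S sigma).
Let nP := normed_Psp (R := R) S sigma.
Let sig0 : 0 <= sigma. Proof. by apply: le_trans sig1. Qed.

Lemma dPsi_last p vs (x : P R S) (a : R) : U p -> all_in X vs -> dom X x ->
  dPsi F p (rcons vs (a *: x)) = a *: dPsi F p (rcons vs x).
Proof.
move=> Up avs dx; have gH := gauge_ng (normed_Hs0 (R := R) 0).
have jx (y : P R S) : dom X y -> gjet X U (ng (Hs0 R 0)) (fun p vs => dPsi F p (rcons vs y)).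
  by move=> dy; apply: (gjet_rcons nP gH (gjet_dPsi_s F sig0)).
have dax : dom X (a *: x) by exact: (ndZ nP).
apply/funext => n; apply: prt_ext => b.
pose D p' vs' : R^o := re_im b (dPsi F p' (rcons vs' (a *: x)) n).
pose D' p' vs' : R^o := re_im b ((a *: dPsi F p' (rcons vs' x)) n).
suff : D p vs = D' p vs by [].
apply: (gjet_uniq nP (VXi_open delta oXi sigma) (D := D) (D' := D') _ _ _ avs Up).
- exact: (gjet_prt nP b (gjet_coef_Hs0 nP n (jx _ dax))).
- have j : gjet X U (ng (Hs0 R 0)) (fun p vs => a *: dPsi F p (rcons vs x)).
    apply: (gjet_map (c := `|a|) (f := fun u : dist R => a *: u) nP gH gH) (jx _ dx) => //.
      by move=> e C C' w w' _ _; rewrite scalerDr !scalerA mulrC.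
    by move=> C w C0; exact: (gZ gH).
  exact: (gjet_prt nP b (gjet_coef_Hs0 nP n j)).
- move=> p' Up'; rewrite /D /D' -[rcons _ _]/[:: a *: x] -[rcons [::] x]/[:: x].
  by rewrite (gjet_scale nP (gjet_dPsi_s F sig0) a Up' dx).
Qed.

Lemma dPsi_row_psym p vs : U p -> all_in X vs -> psym (dPsi_row F p vs).
Proof.
move=> Up avs m b nS; rewrite /dPsi_row probe_vec_neg.
have -> (a : R) (x : E R S) : dirx (a *: x) = a *: dirx x.
  by transitivity ((a *: x, a *: 0) : P R S) => //; rewrite scaler0.
by rewrite -dPsi_last//; exact/dirx_dom/probe_vec_dom.
Qed.

(** The extended transpose and its derivatives.  It does not depend on the order of the
    expansion, which only enters in [dRem]. *)
Definition dTransp p vs q : E R S := of_rows (dPsi_row F p vs) q.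
(** The leading term q does not depend on the point, so only the value of the transpose
    contains it. *)
Definition dRem m p vs q : E R S :=
  dTransp p vs q - in_w S ((if vs is [::] then q else 0) +
    \sum_(1 <= k < m.+1) pmul (daT F k p vs) (dx (- k%:Z) q)).
Definition expn_row m p vs c : dist R :=
  if c is Pw mu b then (if vs is [::] then trig mu (half_unit R b) else 0)
    + \sum_(1 <= k < m.+1) mul_dx_tr k (daT F k p vs) mu (half_unit R b) else 0.
(** Defined to vanish at the frequencies outside S^perp, which [of_rows] ignores, so that
    equalities of families of rows hold everywhere. *)
Definition rem_row m p vs c : dist R := if probe_ok c then dPsi_row F p vs c - expn_row m p vs c else 0.

Lemma daT_at k p vs (N : R) : (1 <= k)%N -> U p -> all_in X vs -> exists C, supg N C (daT F k p vs).
Proof.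
move=> k1 Up avs; have [C _ /(_ vs (leqnn _) avs) h] := gj_bd (gjet_daT_s F N k1 sig1) (size vs) Up.
by eexists; exact: h.
Qed.

Lemma expn_row_psym m p vs : psym (expn_row m p vs).
Proof.
move=> mu b nS; rewrite /expn_row scalerDr; congr (_ + _).
  by case: vs => [|v vs]; rewrite ?scaler0// trig_neg conj_half_unit trigZ.
rewrite scaler_sumr; apply: eq_bigr => k _.
by rewrite mul_dx_tr_neg conj_half_unit mul_dx_trZ.
Qed.

Lemma rem_row_psym m p vs : U p -> all_in X vs -> psym (rem_row m p vs).
Proof.
move=> Up avs mu b nS; rewrite /rem_row /probe_ok SperpN nS.
by rewrite (dPsi_row_psym Up avs b nS) (expn_row_psym m p vs b nS) scalerBr.
Qed.

Lemma expn_row_real m p vs c : U p -> all_in X vs -> real_valued (expn_row m p vs c).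
Proof.
move=> Up avs; rewrite /expn_row; case: c => [j|j|mu b]; try exact: real_valued0.
apply: real_valuedD; first by case: vs {avs} => [|v vs]; [exact: trig_real|exact: real_valued0].
rewrite big_seq; elim/big_ind: _ => [|u v|k]; [exact: real_valued0|exact: real_valuedD|].
rewrite mem_index_iota => /andP[k1 _]; apply: mul_dx_tr_real.
by have [C []] := daT_at 0 k1 Up avs.
Qed.
Lemma rem_row_real m p vs c : U p -> all_in X vs -> probe_ok c -> real_valued (rem_row m p vs c).
Proof.
move=> Up avs ok; rewrite /rem_row ok -scaleN1r; apply: real_valuedD.
  by have [[]] := dPsi_row_dom F sig0 Up avs ok.
by apply: real_valuedZ; exact: expn_row_real.
Qed.

(** The explicit terms, too, act through their rows, once the pairings converge. *)
Lemma dRem_rows m p vs q (al s : R) : U p -> all_in X vs -> 0 <= al -> 2 + s <= al -> -al <= s ->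
  dom (Hs0 R (- s)) q -> (forall c, probe_ok c -> exists C, supg al C (dPsi_row F p vs c)) ->
  dRem m p vs q = of_rows (rem_row m p vs) q.
Proof.
move=> Up avs al0 hs hs' [dq q0] hP.
have hq := hsg_supg (hsg_nrm dq); have [rq _] := hq.
have ss : 2 <= - s + al by rewrite -lerBlDl opprK.
have sal : `|s| <= al by rewrite ler_norml hs' /=; apply: le_trans hs; rewrite lerDr.
apply: pcoord_ext => [n nS|c ok].
  rewrite of_rows_out// [LHS]/((of_rows _ q).2 n - Pperp S _ n) of_rows_out// Pperp_out//.
  by apply: complexP; rewrite /= subr0.
rewrite /dRem pcoordB !pcoord_of_rows// /rem_row ok.
have [C1 h1] := hP c ok; have l1 := l2abs_supg hq h1 ss.
suff [C2 [h2 e2]] : exists C2, l2abs q (expn_row m p vs c) C2 /\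
   pcoord (in_w S ((if vs is [::] then q else 0) + \sum_(1 <= k < m.+1) pmul (daT F k p vs) (dx (- k%:Z) q))) c
   = l2dot q (expn_row m p vs c).
  rewrite e2 -(scaleN1r (expn_row _ _ _ _)) [_ + -1 *: _]addrC (l2dotPr (-1) h2 l1).
  by rewrite mulN1r addrC.
case: c ok {h1 l1 hP} => [j|j|mu b] ok.
- by exists 0; split; [exact: l2abs0|rewrite pcoord_in_w// l2dot0r].
- by exists 0; split; [exact: l2abs0|rewrite pcoord_in_w// l2dot0r].
rewrite in_wD pcoordD in_w_sum.
have mu0 := Sperp_neq0 ok.
have [C3 [h3 e3]] : exists C3, l2abs q (if vs is [::] then trig mu (half_unit R b) else 0) C3 /\
    pcoord (in_w S (if vs is [::] then q else 0)) (Pw S mu b) = l2dot q (if vs is [::] then trig mu (half_unit R b) else 0).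
  case: (vs) => [|v vs'].
    eexists; split; first exact: (l2abs_supg hq (trig_supg al mu0 (cabs_half_unit R b)) ss).
    by rewrite pcoord_in_w_re// l2dot_trig.
  by exists 0; split; [exact: l2abs0|rewrite l2dot0r in_w0 pcoord0].
suff [C4 [h4 e4]] : exists C4, l2abs q (\sum_(1 <= k < m.+1) mul_dx_tr k (daT F k p vs) mu (half_unit R b)) C4 /\
    pcoord (\sum_(1 <= k < m.+1) in_w S (pmul (daT F k p vs) (dx (- k%:Z) q))) (Pw S mu b) =
    l2dot q (\sum_(1 <= k < m.+1) mul_dx_tr k (daT F k p vs) mu (half_unit R b)).
  exists (C3 + C4); rewrite e3 e4 /expn_row.
  set u := (if vs is [::] then _ else _) in h3 *; split.
    move=> t ut; apply: le_trans (lerD (h3 t ut) (h4 t ut)); rewrite -big_split.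
    apply: ler_sum => n _ /=; rewrite !ger0_norm ?mulr_ge0 ?cabs_ge0// -mulrDr.
    by rewrite ler_wpM2l ?cabs_ge0//; exact: cabsD.
  by rewrite -[u in RHS]scale1r (l2dotPr 1 h3 h4) mul1r.
have : all (fun k => (1 <= k)%N) (index_iota 1 m.+1).
  by apply/allP => k; rewrite mem_index_iota => /andP[].
elim: (index_iota 1 m.+1) => [|k ks IH]; rewrite ?big_nil.
  by move=> _; exists 0; split; [exact: l2abs0|rewrite l2dot0r pcoord0].
rewrite [all _ _]/= => /andP[k1 /IH[C4 [h4 e4]]]; rewrite !big_cons.
have [Ca ha] := daT_at (al + 2) k1 Up avs.
have ha' := supg_le (r' := al) (ler_wpDr (ler0n _ 2) (lexx _)) ha.
have hk : supg (- s) (2 * nrm (Hs R (- s)) q) (dx (- k%:Z) q).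
  by apply: supg_le (dx_supg k hq); rewrite lerDl.
have okk : pmul_conv (daT F k p vs) (dx (- k%:Z) q).
  by apply: (pmul_conv_supg ha hk); rewrite normrN lerD2r.
have h5 := l2abs_supg hq (mul_dx_tr_supg k mu al0 ha' (cabs_half_unit R b)) ss.
eexists; split.
  move=> t ut; apply: le_trans (_ : _ <= _); last exact: (lerD (h5 t ut) (h4 t ut)).
  rewrite -big_split.
  apply: ler_sum => n _ /=; rewrite !ger0_norm ?mulr_ge0 ?cabs_ge0// -mulrDr.
  by rewrite ler_wpM2l ?cabs_ge0//; exact: cabsD.
rewrite pcoordD e4 pcoord_in_w_re//; have ra := proj1 ha.
rewrite -(l2dot_mul_dx_tr _ _ ra rq okk).
by rewrite -[mul_dx_tr k _ _ _ in RHS]scale1r (l2dotPr 1 h5 h4) mul1r.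
Qed.

Lemma dRem_ae_dom m p vs q : (1 <= m)%N -> m%:R + 5 <= sigma -> U p -> all_in X vs -> dom (Hs0 R 1) q ->
  dom (Esp S 0) (dRem_ae F m p vs q).
Proof.
move=> m1 ms Up avs dq.
have ms' : 1 + m%:R + 4 <= sigma by rewrite (_ : 1 + m%:R + 4 = m%:R + 5)//; ring.
have j := gjet_dRem_ae F m1 (lexx 1) ms' (VXi_VXiE sig1).
have [C C0 hC] := gj_bd j (size vs) Up.
have [d _] := hC vs (leqnn _) avs (exist _ q dq).
by have [] := Esp_mono (r := 0) _ d; rewrite ?addr_ge0.
Qed.

(** By [dPsi_pair], on H^1 nothing but the given smoothing terms is left. *)
Lemma dRem_expansion m p vs q : (1 <= m)%N -> m%:R + 5 <= sigma -> U p -> all_in X vs -> dom (Hs0 R 1) q ->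
  dRem m p vs q = dRem_ae F m p vs q.
Proof.
move=> m1 ms Up avs dq.
apply: pcoord_ext => [n nS|c ok].
  have [_ [_ ->//]] := dRem_ae_dom m1 ms Up avs dq.
  rewrite [LHS]/((of_rows _ q).2 n - Pperp S _ n) of_rows_out// Pperp_out//.
  by apply: complexP; rewrite /= subr0.
rewrite /dRem pcoordB pcoord_of_rows// (dPsi_pair oXi F m1 ms Up avs dq ok) /dTransp_ae pcoordD.
by rewrite addrC addKr.
Qed.
End Remainder.

(** * Decay of the rows of the remainder *)

Section Packs.
Variable R : realType.
Lemma gjet_ext (V W : lmodType R) (X : nspace V) (U : set V) (B : R -> W -> Prop) D D' :
  normed X -> U `<=` dom X ->
  (forall p vs, U p -> all_in X vs -> D' p vs = D p vs) -> gjet X U B D -> gjet X U B D'.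
Proof.
move=> nX Ud e jD; split=> [p a h k vs Up dh dk avs|p l Up|p l d Up d0].
- have al (v : V) : dom X v -> all_in X (v :: vs) by move=> dv; apply/all_in_cons.
  rewrite !e//; [exact: (gj_lin jD)|exact: al|exact: al|apply: al; exact: (ndL nX)].
- have [C C0 hC] := gj_bd jD l Up; exists C => // vs svs avs; rewrite e//; exact: hC.
- have [r r0 hr] := gj_fr jD l Up d0; exists r => // h dh hh Uh vs svs avs.
  rewrite !e//; first exact: hr.
  exact/all_in_cons.
Qed.

Lemma supg_dx1 (r C : R) (u : dist R) : real_valued u -> u 0 = 0 -> supg r C (dx (- 1%:Z) u) ->
  supg (r - 1) (2 * pi * C) u.
Proof.
move=> ru u0 h; have C0 := supg_ge0 h; case: h => _ h; split=> // n.
have pi0 := @pi_ge0 R.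
have [->|n0] := eqVneq n 0; first by rewrite u0 cabs0 !mulr_ge0 ?jpow_ge0.
pose w : R[i] := Complex 0 (2 * pi * n%:~R).
have y0 : 2 * pi * n%:~R != 0 :> R.
  by rewrite !mulf_eq0 !negb_or intr_eq0 n0 pnatr_eq0 (gt_eqF (@pi_gt0 R)).
have w0 : w != 0 by apply: contra y0 => /eqP/(congr1 (@complex.Im R)) /= ->.
have e : u n = w * (dx (- 1%:Z) u n : R[i]).
  rewrite /dx (negbTE n0) -/w mulrA -[X in X * w ^ _]expr1z -expfzDr//.
  by rewrite subrr expr0z mul1r.
rewrite e; apply: le_trans (cabsM _ _) _.
apply: le_trans (ler_wpM2l (cabs_ge0 _) (h n)) _.
have ew : cabs w = 2 * pi * jbr R n.
  rewrite /cabs /= normr0 add0r normrM (ger0_norm (mulr_ge0 _ pi0))// jbrE// -intr_norm.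
  by rewrite -abszE.
rewrite ew (_ : - (r - 1) = 1 + - r); last by ring.
rewrite jpowD (_ : jpow n 1 = jbr R n); last by rewrite /jpow powRr1 ?jbr_ge0.
by rewrite le_eqVlt; apply/orP; left; apply/eqP; ring.
Qed.

Lemma sq_le_mul (x X Y Z : R) : 0 <= x -> 0 <= Z -> x <= X -> x <= Y -> X * Y <= Z ^+ 2 -> x <= Z.
Proof.
move=> x0 Z0 hX hY h; rewrite -ler_sqr ?nnegrE//; apply: le_trans h.
by rewrite expr2; exact: ler_pM.
Qed.
Lemma mul_le_sqD (x y : R) : 0 <= x -> 0 <= y -> x * y <= (x + y) ^+ 2.
Proof. by move=> x0 y0; have := mulr_ge0 x0 y0; have := sqr_ge0 x; have := sqr_ge0 y; lra. Qed.
End Packs.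

Section RowBounds.
Variables (R : realType) (S : {fset nat}) (K : birkhoff R) (delta : R) (Xi : set (RS R S)).
Hypothesis oXi : nopen (RSsp R S) Xi.
Variable F : normal_form K delta Xi.
Implicit Types (p : P R S) (vs : seq (P R S)) (q : dist R) (s r : R) (k : nat) (c : probe S).
Variable sigma : R.
Local Notation U := (VXi delta Xi sigma).
Local Notation X := (Psp S sigma).

(** Points and lists of directions on which the coefficients and the smoothing part of the
    expansion are uniformly bounded.  It is used twice: on a small ball with all directions,
    to prove smoothness, and on the whole neighbourhood with the directions of the
    estimates, to obtain uniform constants. *)
Definition unif_est m (N : R) (U' : set (P R S)) (LL : seq (P R S) -> Prop) (n0 : nat) :=
  [/\ U' `<=` U,
      forall vs ab, ab \in splits vs -> LL vs -> LL ab.1 /\ LL ab.2,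
      forall vs, LL vs -> all_in X vs &
      exists Ca CR : R, [/\ 0 <= Ca, 0 <= CR,
        forall k p vs, (1 <= k <= m)%N -> U' p -> LL vs -> (size vs <= n0)%N ->
          supg N (Ca * nprod X vs) (daT F k p vs) &
        forall p vs q, U' p -> LL vs -> (size vs <= n0)%N -> dom (Hs0 R 1) q ->
          ng (Esp S (m%:R + 2)) (CR * nprod X vs * nrm (Hs R 1) q) (dRem_ae F m p vs q)]].

Variables (m L al : nat).
Hypotheses (al1 : (1 <= al)%N) (eL : L = (2 * al + 2)%N) (em : m = (4 * al)%N).
Hypothesis hsig : m%:R + 5 <= sigma.
Let sig1 : 1 <= sigma. Proof. by have h := hsig; have := ler0n R m; lra. Qed.
Let sig0 : 0 <= sigma. Proof. by apply: le_trans sig1. Qed.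
Let m1 : (1 <= m)%N. Proof. by rewrite em; lia. Qed.
Let nP := normed_Psp (R := R) S sigma.

Lemma unif_est_local p n0 : U p -> exists2 r : R, 0 < r &
  unif_est m (L%:R + 3) [set p' | exists h, [/\ dom X h, nrm X h < r, U (p + h) & p' = p + h]] (all_in X) n0.
Proof.
move=> Up.
have ms' : 1 + m%:R + 4 <= sigma by rewrite (_ : 1 + m%:R + 4 = m%:R + 5)//; ring.
have jR := gjet_dRem_ae F m1 (lexx 1) ms' (VXi_VXiE sig1).
have gR := gauge_opg (normed_Hs0 (R := R) 1) (normed_Esp S (1 + m%:R + 1)).
have [r1 [CR [r10 CR0 hR]]] := gjet_loc nP gR jR n0 Up.
have [] := @finite_radius_bound R nat (index_iota 1 m.+1) (fun k r C => forall h, dom X h -> nrm X h < r -> U (p + h) ->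
    forall vs, (size vs <= n0)%N -> all_in X vs -> supg (L%:R + 3) (C * nprod X vs) (daT F k (p + h) vs)).
- move=> k r r' C C' /andP[_ rr] CC h h' dh hh Uh vs svs avs.
  apply: supg_leK (h h' dh (lt_le_trans hh rr) Uh vs svs avs).
  by rewrite ler_wpM2r// (nprod_ge0 nP).
- move=> k; rewrite mem_index_iota => /andP[k1 _].
  exact: (gjet_loc nP (gauge_supg _) (gjet_daT_s F (L%:R + 3) k1 sig1) n0 Up).
move=> r2 [Ca [r20 Ca0 ha]].
exists (Num.min r1 r2); first by rewrite lt_min r10.
split=> [p' [h [_ _ Uh ->]] //|vs ab /splits_all|//|]; first by apply.
exists Ca, CR; split=> //.
- move=> k p' vs kk [h [dh]]; rewrite lt_min => /andP[_ h2] Uh -> avs svs.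
  by apply: ha => //; rewrite mem_index_iota ltnS.
- move=> p' vs q [h [dh]]; rewrite lt_min => /andP[h1 _] Uh -> avs svs dq.
  have := hR h dh h1 Uh vs svs avs (exist _ q dq).
  by rewrite (_ : 1 + m%:R + 1 = m%:R + 2)//; ring.
Qed.

Lemma expn_row_supg p vs c Ca : U p -> all_in X vs -> probe_ok c -> 0 <= Ca ->
  (forall k, (1 <= k <= m)%N -> supg (L%:R + 3) (Ca * nprod X vs) (daT F k p vs)) ->
  supg L%:R ((1 + m%:R * (2 `^ L%:R * Ca)) * (nprod X vs * rhs_weight R L c)) (expn_row F m p vs c).
Proof.
move=> Up avs ok Ca0 ha; have N0 := nprod_ge0 nP avs.
have q0 : 0 <= m%:R * (2 `^ L%:R * Ca) by rewrite mulr_ge0// mulr_ge0// powR_ge0.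
rewrite /expn_row; case: c ok => [j|j|mu b] ok.
- by apply: supg_leK (supg0 _); rewrite !mulr_ge0 ?addr_ge0.
- by apply: supg_leK (supg0 _); rewrite !mulr_ge0 ?addr_ge0.
rewrite mulrDl mul1r /rhs_weight /=; apply: supgD.
  case: vs N0 avs {ha} => [|v vs] N0 avs.
    by rewrite /nprod big_nil mul1r; exact: trig_supg (Sperp_neq0 ok) (cabs_half_unit R b).
  by apply: supg_leK (supg0 _); rewrite mulr_ge0// jpow_ge0.
have e : m%:R * (2 `^ L%:R * Ca) * (nprod X vs * jpow mu L%:R) =
  (size (index_iota 1 m.+1))%:R * (2 `^ L%:R * (Ca * nprod X vs) * jpow mu L%:R).
  by rewrite size_iota subSS subn0; ring.
rewrite e; apply: (gsum (gauge_supg _)) => k; rewrite mem_index_iota ltnS => kk.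
apply: mul_dx_tr_supg => //; last exact: cabs_half_unit.
by apply: supg_le (ha k kk); rewrite lerDl.
Qed.

Lemma rem_row_real_le p vs c n (B : R) : U p -> all_in X vs -> probe_ok c -> n != 0 -> 0 <= B ->
  (forall b, `|l2dot (trig n (half_unit R b)) (rem_row F m p vs c)| <= B) -> cabs (rem_row F m p vs c n) <= 2 * B.
Proof.
move=> Up avs ok n0 B0 h; have rr := rem_row_real F sig1 m Up avs ok.
have := h true; have := h false; rewrite ![l2dot (trig _ _) _]l2dotC !l2dot_trig//.
rewrite !cReM cabs_prt /re_im; case: (rem_row _ _ _ _ _ n) => x y /=.
rewrite (_ : 2 * (x * 2^-1 - y * - 0) = x); last by field.
rewrite (_ : 2 * (x * 0 - y * - 2^-1) = y); last by field.
by move=> h1 h2; rewrite mulrDl mul1r; exact: lerD.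
Qed.

Let L3 : (3 <= L)%N. Proof. by rewrite eL; lia. Qed.
Let Lm : (L <= m)%N. Proof. by rewrite eL em; lia. Qed.

Lemma dPsi_row_bd U' LL n0 : unif_est m (L%:R + 3) U' LL n0 -> exists2 C : R, 0 <= C &
  forall p vs c, U' p -> LL vs -> (size vs <= n0)%N -> probe_ok c ->
    supg (L%:R - 1) (C * (nprod X vs * rhs_weight R L c)) (dPsi_row F p vs c).
Proof.
move=> [UU LLs LLa [Ca [CR [Ca0 CR0 ha hR]]]].
have [C C0 hC] := dPsi_prim_decay oXi m1 hsig L3 Lm UU LLs LLa Ca0 CR0 ha hR (leqnn n0).
exists (2 * pi * C); first by rewrite !mulr_ge0// pi_ge0.
move=> p vs c Up lvs svs ok.
have [[rd _] d0] := dPsi_row_dom F sig0 (UU _ Up) (LLa _ lvs) ok.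
by rewrite -mulrA; apply: supg_dx1 => //; exact: hC.
Qed.

(** The entry (c, n) has two bounds: the expansion applied to the mode n gives
    <n> <c>^{-m-2}, and the decay of dPsi [e_c] gives <c>^L <n>^{1-L}.  Neither suffices,
    but with L = 2 al + 2 and m = 4 al their geometric mean is <c>^{-al} <n>^{-al}. *)
Lemma rem_row_bd U' LL n0 : unif_est m (L%:R + 3) U' LL n0 -> exists2 C : R, 0 <= C &
  forall p vs, U' p -> LL vs -> (size vs <= n0)%N -> rowg al%:R (C * nprod X vs) (rem_row F m p vs).
Proof.
move=> ts; have [Cd Cd0 hd] := dPsi_row_bd ts.
have [UU LLs LLa [Ca [CR [Ca0 CR0 ha hR]]]] := ts.
pose C2 := Cd + (1 + m%:R * (2 `^ L%:R * Ca)).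
have q0 : 0 <= m%:R * (2 `^ L%:R * Ca) by rewrite mulr_ge0// mulr_ge0// powR_ge0.
have C20 : 0 <= C2 by rewrite !addr_ge0.
pose C1 := 4 * CR; have C10 : 0 <= C1 by rewrite mulr_ge0.
exists (C1 + C2); first exact: addr_ge0.
move=> p vs Up lvs svs; have Up' := UU _ Up; have avs := LLa _ lvs.
have N0 := nprod_ge0 nP avs.
split; [by rewrite mulr_ge0// addr_ge0|exact: (rem_row_psym oXi F sig1 m Up' avs)|move=> c ok].
have b2 : supg (L%:R - 1) (C2 * (nprod X vs * rhs_weight R L c)) (rem_row F m p vs c).
  rewrite /rem_row ok -(scaleN1r (expn_row F m p vs c)) /C2 [(_ + (_ + _)) * _]mulrDl; apply: supgD; first exact: hd.
  have := expn_row_supg Up' avs ok Ca0 (fun k kk => ha k p vs kk Up lvs svs).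
  have le1 : L%:R - 1 <= L%:R :> R by rewrite gerBl.
  by move=> /(supg_le le1)/(supgZ (-1)); rewrite normrN1 mul1r.
have [rr h2] := b2; split=> // n.
have jc0 : 0 <= probe_pow c (- al%:R) :> R by exact: probe_pow_ge0.
have [->|n0'] := eqVneq n 0.
  suff -> : rem_row F m p vs c 0 = 0 by rewrite cabs0 !mulr_ge0 ?jpow_ge0 ?addr_ge0.
  rewrite /rem_row ok [LHS]/(dPsi_row F p vs c 0 - expn_row F m p vs c 0).
  have [_ ->] := dPsi_row_dom F sig0 Up' avs ok.
  suff -> : expn_row F m p vs c 0 = 0 by apply: complexP; rewrite /= subr0.
  case: c ok {b2 rr h2 jc0} => [j|j|mu b] ok //.
  rewrite /expn_row [LHS]/((if vs is [::] then trig mu (half_unit R b) else 0) 0 + (\sum_(1 <= k < m.+1) mul_dx_tr k (daT F k p vs) mu (half_unit R b)) 0).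
  rewrite fct_sumE big1; last by move=> k _; rewrite /mul_dx_tr oppr0 /dcoef eqxx mul0r.
  case: (vs) => [|v vs']; last by apply: complexP; rewrite /= addr0.
  rewrite trig_out; first by apply: complexP; rewrite /= addr0.
  by rewrite !inE ![0 == _]eq_sym oppr_eq0 (negbTE (Sperp_neq0 ok)).
(* the geometric mean of the two bounds: x <= X and x <= Y give x^2 <= X Y *)
apply: (@sq_le_mul R _ (C1 * nprod X vs * (jpow n 1 * probe_pow c (- (m%:R + 2))))
   (C2 * (nprod X vs * rhs_weight R L c) * jpow n (- (L%:R - 1)))).
- exact: cabs_ge0.
- by rewrite !mulr_ge0 ?jpow_ge0 ?addr_ge0.
- have -> : C1 * nprod X vs * (jpow n 1 * probe_pow c (- (m%:R + 2))) =
     2 * (2 * (CR * nprod X vs * jpow n 1) * probe_pow c (- (m%:R + 2))) by rewrite /C1; ring.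
  have B0 : 0 <= 2 * (CR * nprod X vs * jpow n 1) * probe_pow c (- (m%:R + 2)).
    by rewrite mulr_ge0 ?probe_pow_ge0// mulr_ge0// mulr_ge0 ?jpow_ge0// mulr_ge0.
  apply: rem_row_real_le => // b.
  have hq := trig_hsg 1 n0' (cabs_half_unit R b).
  have /hsgP[dq1 nq] := hq.
  have dq : dom (Hs0 R 1) (trig n (half_unit R b)).
    split=> //; rewrite /= trig_out// !inE ![0 == _]eq_sym oppr_eq0.
    by rewrite (negbTE n0').
  have Lr : (3 : R) <= L%:R by rewrite ler_nat.
  have e : dRem F m p vs (trig n (half_unit R b)) = of_rows (rem_row F m p vs) (trig n (half_unit R b)).
    apply: (dRem_rows sig1 m (al := L%:R - 1) (s := -1)) => //; rewrite ?opprK//; try lra.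
    by move=> c' ok'; eexists; exact: hd.
  have := congr1 (fun e => pcoord e c) e; rewrite pcoord_of_rows// => <-.
  rewrite (dRem_expansion oXi F sig1 m1 hsig Up' avs dq).
  apply: le_trans (Esp_pcoord (hR _ _ _ Up lvs svs dq) ok) _.
  by rewrite ler_wpM2r ?probe_pow_ge0// ler_wpM2l// ler_wpM2l// mulr_ge0.
- exact: h2.
have eLr : L%:R = 2 * al%:R + 2 :> R by rewrite eL natrD natrM.
have emr : m%:R = 4 * al%:R :> R by rewrite em natrM.
have e1 : jpow n 1 * jpow n (- (L%:R - 1)) = jpow n (- al%:R) ^+ 2 :> R.
  by rewrite -jpow_sq -jpowD eLr; congr (jpow n _); ring.
have e2 : probe_pow c (- (m%:R + 2)) * rhs_weight R L c = probe_pow c (- al%:R) ^+ 2.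
  rewrite /rhs_weight; case: (c) => [j|j|mu b] /=; rewrite ?expr1n ?mulr1//.
  by rewrite -jpow_sq -jpowD eLr emr; congr (jpow mu _); ring.
rewrite [leLHS](_ : _ = (C1 * C2) * nprod X vs ^+ 2 * ((probe_pow c (- (m%:R + 2)) * rhs_weight R L c) * (jpow n 1 * jpow n (- (L%:R - 1))))); last by ring.
rewrite e1 e2 [leRHS](_ : _ = (C1 + C2) ^+ 2 * nprod X vs ^+ 2 * (probe_pow c (- al%:R) ^+ 2 * jpow n (- al%:R) ^+ 2)); last by ring.
apply: ler_wpM2r; first by rewrite mulr_ge0 ?sqr_ge0.
apply: ler_wpM2r; first exact: sqr_ge0.
exact: mul_le_sqD.
Qed.

Lemma rem_row_at p vs : U p -> all_in X vs -> (forall c, probe_ok c -> exists C, supg (L%:R - 1) C (dPsi_row F p vs c)) /\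
  exists C, rowg al%:R C (rem_row F m p vs).
Proof.
move=> Up avs; have [r r0 ts] := unif_est_local (size vs) Up.
have U0 : exists h, [/\ dom X h, nrm X h < r, U (p + h) & p = p + h].
  by exists 0; split; rewrite ?addr0 ?(nrm0 nP)//; exact: (nd0 nP).
split.
  by have [C C0 hC] := dPsi_row_bd ts; move=> c ok; eexists; exact: hC.
by have [C C0 hC] := rem_row_bd ts; eexists; exact: hC.
Qed.
End RowBounds.

(** * The remainder on negative Sobolev spaces *)

Lemma neg_range (R : realType) (x s : R) : 0 <= x -> -1 <= s <= x + 1 ->
  [/\ `|- s| + 2 <= x + 4, `|x + 1 - s| <= x + 2, 0 <= x + 1 - s &
    forall y, x + 3 <= y -> [/\ 2 + s <= y, x + 1 - s + 1 <= y & - y <= s]].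
Proof.
move=> x0 /andP[s1 s2]; split; [rewrite -lerBrDr ler_norml; apply/andP|rewrite ler_norml; apply/andP| |move=> y h]; try split; lra.
Qed.

Section RowJets.
Variables (R : realType) (S : {fset nat}) (K : birkhoff R) (delta : R) (Xi : set (RS R S)).
Hypothesis oXi : nopen (RSsp R S) Xi.
Variable F : normal_form K delta Xi.
Implicit Types (p : P R S) (vs : seq (P R S)) (q : dist R) (s r t : R) (k : nat) (c : probe S).
Variable sigma : R.
Local Notation U := (VXi delta Xi sigma).
Local Notation X := (Psp S sigma).
Variables (m L al : nat).
Hypotheses (al1 : (1 <= al)%N) (eL : L = (2 * al + 2)%N) (em : m = (4 * al)%N).
Hypothesis hsig : m%:R + 5 <= sigma.
Let sig1 : 1 <= sigma. Proof. by have h := hsig; have := ler0n R m; lra. Qed.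
Let sig0 : 0 <= sigma. Proof. by apply: le_trans sig1. Qed.
Let m1 : (1 <= m)%N. Proof. by rewrite em; lia. Qed.
Let nP := normed_Psp (R := R) S sigma.
Let oU : nopen X U := VXi_open delta oXi sigma.

Lemma gjet_rem_row_coef c n : probe_ok c -> gjet X U (coefg n) (fun p vs => rem_row F m p vs c).
Proof.
move=> ok; have gc := @gauge_coefg R n; have gH := gauge_ng (normed_Hs0 (R := R) 0).
have Ud : U `<=` dom X by exact: oU.1.
have j1 : gjet X U (coefg n) (fun p vs => dPsi_row F p vs c).
  apply: (gjet_coef_Hs0 nP n); apply: (gjet_rcons nP gH (gjet_dPsi_s F sig0)).
  exact/dirx_dom/probe_vec_dom.
have j0 : gjet X U (coefg n) (fun (p : P R S) (vs : seq (P R S)) => (0 : dist R)).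
  apply: (gjet_ext nP Ud _ (gjet_const nP (K := 0) U gc (lexx _) (g0 gc (lexx 0)))).
  by move=> p [|v vs].
have j2 : gjet X U (coefg n) (fun p vs => expn_row F m p vs c).
  case: c ok {j1} => [j|j|mu b] ok //.
  apply: (gjet_add gc).
    have hw : coefg n (cabs (trig mu (half_unit R b) n)) (trig mu (half_unit R b)) by exact: lexx.
    exact: (gjet_const nP U gc (cabs_ge0 _) hw).
  apply: (gjet_sum nP gc) => k; rewrite mem_index_iota => /andP[k1 _].
  apply: (gjet_map (c := 2 `^ 0 * jpow mu 0 * jpow n (- 0)) (f := fun a => mul_dx_tr k a mu (half_unit R b)) nP (gauge_supg 0) gc) (gjet_daT_s F 0 k1 sig1).
  - by rewrite !mulr_ge0 ?powR_ge0 ?jpow_ge0.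
  - by move=> a C C' w w' _ _; exact: mul_dx_trL.
  - move=> C w C0 hw.
    have := supg_coefg n (mul_dx_tr_supg k mu (lexx 0) hw (cabs_half_unit R b)).
    by congr coefg; ring.
have j3 : gjet X U (coefg n) (fun p vs => - expn_row F m p vs c).
  apply: (gjet_map (c := 1) nP gc gc) j2 => //.
    by move=> a C C' w w' _ _; rewrite opprD scalerN.
  by move=> C w C0; rewrite mul1r; exact: (gN gc).
apply: (gjet_ext nP Ud _ (gjet_add gc j1 j3)).
by move=> p vs _ _; rewrite /rem_row ok.
Qed.

(** An entry of the matrix of rows: basis vector, frequency, real or imaginary part. *)
Definition row_index := ({c : probe S | probe_ok c} * int * bool)%type.
Definition row_weight (i : row_index) : R := probe_pow (sval i.1.1) (- al%:R) * jpow i.1.2 (- al%:R).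
Definition coefs (f : probe S -> dist R) (i : row_index) : R^o := re_im i.2 (f (sval i.1.1) i.1.2).

Lemma row_weight_ge0 i : 0 <= row_weight i.
Proof. by rewrite mulr_ge0 ?probe_pow_ge0 ?jpow_ge0. Qed.

Lemma rowg_fam C f : rowg al%:R C f -> famg row_weight C (coefs f).
Proof.
move=> [C0 _ h] [[[c ok] n] b]; rewrite /coefs /row_weight /=.
apply: le_trans (prt_le b _) _; rewrite mulrA; exact: (h c ok).2.
Qed.

Definition rowok (f : probe S -> dist R) := psym f /\ forall c, probe_ok c -> real_valued (f c).

Lemma rowokB f g : rowok f -> rowok g -> rowok (f - g).
Proof.
move=> [sf rf] [sg rg]; split.
  have := psymL (-1) sg sf; have -> : (-1) *: g + f = f - g by rewrite scaleN1r addrC.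
  by [].
move=> c ok; rewrite [(f - g) c]/(f c - g c) -scaleN1r.
by apply: real_valuedD; [exact: rf|apply: real_valuedZ; exact: rg].
Qed.

Lemma fam_rowg C f : 0 <= C -> rowok f -> famg row_weight C (coefs f) -> rowg al%:R (2 * C) f.
Proof.
move=> C0 [sf rf] h; split=> //; first by rewrite mulr_ge0.
move=> c ok; split; first exact: rf.
move=> n; rewrite cabs_prt.
have h1 := h (exist _ c ok, n, false); have h2 := h (exist _ c ok, n, true).
rewrite /coefs /row_weight /= in h1 h2.
by apply: le_trans (lerD h1 h2) _; rewrite [leRHS](_ : _ = C * (probe_pow c (- al%:R) * jpow n (- al%:R)) + C * (probe_pow c (- al%:R) * jpow n (- al%:R)))//; ring.
Qed.

Lemma rem_row_ok p vs : U p -> all_in X vs -> rowok (rem_row F m p vs).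
Proof.
by move=> Up avs; split; [exact: (rem_row_psym oXi F sig1 m Up avs)|move=> c ok; exact: (rem_row_real F sig1 m Up avs ok)].
Qed.

Lemma coefsB f g : coefs (f - g) = coefs f - coefs g.
Proof.
apply/funext => -[[[c ok] n] b].
by rewrite [RHS]/(re_im b (f c n) - re_im b (g c n)) /coefs /= /re_im; case: b; rewrite ?cReD ?cImD ?cReN ?cImN.
Qed.

(** Each entry is smooth because Psi is smooth with values in L^2; [gjet_weak] and the
    bounds of [rem_row_bd] upgrade this to all entries together. *)
Lemma gjet_rem_row_fam : gjet X U (famg row_weight) (fun p vs => coefs (rem_row F m p vs)).
Proof.
apply: (gjet_weak nP row_weight_ge0 oU).
  by move=> [[[c ok] n] b]; exact: (gjet_prt nP b (gjet_rem_row_coef n ok)).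
move=> p l Up; have [r r0 ts] := unif_est_local F al1 eL em hsig l Up.
have [C C0 hC] := rem_row_bd oXi al1 eL em hsig ts.
exists r, C; split=> // h dh hh Uh vs svs avs; apply: rowg_fam; apply: hC => //.
by exists h.
Qed.

Lemma gjet_rem_row : gjet X U (rowg al%:R) (rem_row F m).
Proof.
have Ud : U `<=` dom X by exact: oU.1.
split=> [p a h k vs Up dh dk avs|p l Up|p l e Up e0].
- apply/funext => c; rewrite [RHS]/(a *: rem_row F m p (h :: vs) c + rem_row F m p (k :: vs) c).
  have [ok|/negbTE ok] := boolP (probe_ok c); last by rewrite /rem_row ok; change ((0 : dist R) = a *: 0 + 0); rewrite scaler0 addr0.
  apply/funext => n; apply: prt_ext => b; rewrite prtL.
  exact: (congr1 (fun T => T (exist _ c ok, n, b)) (gj_lin gjet_rem_row_fam a Up dh dk avs)).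
- have [C C0 hC] := gj_bd gjet_rem_row_fam l Up; exists (2 * C); first by rewrite mulr_ge0.
  move=> vs svs avs; rewrite -mulrA; apply: fam_rowg (hC vs svs avs).
    by rewrite mulr_ge0// (nprod_ge0 nP).
  exact: rem_row_ok.
- have e2 : 0 < e / 2 by rewrite divr_gt0.
  have [r r0 hr] := gj_fr gjet_rem_row_fam l Up e2; exists r => // h dh hh Uh vs svs avs.
  have := hr h dh hh Uh vs svs avs; rewrite -!coefsB => hf.
  have ah : all_in X (h :: vs) by apply/all_in_cons.
  have -> : e * nrm X h * nprod X vs = 2 * (e / 2 * nrm X h * nprod X vs) by field.
  apply: fam_rowg hf; first by rewrite !mulr_ge0 ?(nrm_ge0 nP dh) ?(nprod_ge0 nP avs)// ltW.
  by apply: rowokB; [apply: rowokB|]; exact: rem_row_ok.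
Qed.

Let L1 : al%:R <= L%:R - 1 :> R.
Proof. by rewrite lerBrDr natr1 ler_nat eL; lia. Qed.

Definition schur_const : R := (2 * #|{: S}|%:R + 6) * 12.
Lemma schur_const_ge0 : 0 <= schur_const. Proof. by rewrite mulr_ge0// addr_ge0// mulr_ge0. Qed.

Lemma dRem_of_rows p vs q s : U p -> all_in X vs -> 2 + s <= al%:R -> - al%:R <= s ->
  dom (Hs0 R (- s)) q -> dRem F m p vs q = of_rows (rem_row F m p vs) q.
Proof.
move=> Up avs s1 s2 dq.
apply: (dRem_rows sig1 m (al := L%:R - 1) (s := s)) => //.
- by apply: le_trans L1; exact: ler0n.
- exact: le_trans L1.
- by apply: le_trans s2; rewrite lerN2.
- by have [hd _] := rem_row_at oXi F al1 eL em hsig Up avs.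
Qed.

Lemma gjet_dRem s t : 2 + s <= al%:R -> t + 1 <= al%:R -> - al%:R <= s ->
  gjet X U (opg (Hs0 R (- s)) (Esp S t)) (fun p vs => onQ (dRem F m p vs)).
Proof.
move=> hs ht hs'; have nA := normed_Hs0 (R := R) (- s); have nE := normed_Esp (R := R) S t.
pose f (T : probe S -> dist R) (x : {q | dom (Hs0 R (- s)) q}) : E R S := of_rows T (sval x).
have Ud : U `<=` dom X by exact: oU.1.
have j : gjet X U (opg (Hs0 R (- s)) (Esp S t)) (fun p vs => f (rem_row F m p vs)).
  apply: (gjet_map (c := schur_const) (f := f) nP (gauge_rowg S al%:R) (gauge_opg nA nE) schur_const_ge0) gjet_rem_row.
    move=> a C C' w w' hw hw'; apply/funext => x; exact: (of_rowsL a hs hw hw' (svalP x)).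
  by move=> C w C0 hw x; exact: (of_rows_ng hs ht hw (svalP x)).
apply: (gjet_ext nP Ud _ j) => p vs Up avs; apply/funext => x.
exact: (dRem_of_rows Up avs hs hs' (svalP x)).
Qed.

(** One constant serves all s and t. *)
Lemma dRem_bd U' LL n0 : unif_est F sigma m (L%:R + 3) U' LL n0 -> exists2 C : R, 0 <= C &
  forall p vs s t q, U' p -> LL vs -> (size vs <= n0)%N ->
    2 + s <= al%:R -> t + 1 <= al%:R -> - al%:R <= s -> dom (Hs0 R (- s)) q ->
    ng (Esp S t) (C * nprod X vs * nrm (Hs R (- s)) q) (dRem F m p vs q).
Proof.
move=> ts; have [C C0 hC] := rem_row_bd oXi al1 eL em hsig ts.
have [UU LLs LLa _] := ts.
exists (schur_const * C) => [|p vs s t q Up lvs svs hs ht hs' dq]; first by rewrite mulr_ge0// schur_const_ge0.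
rewrite (dRem_of_rows (UU _ Up) (LLa _ lvs) hs hs' dq).
by have := of_rows_ng hs ht (hC p vs Up lvs svs) dq; rewrite -/schur_const !mulrA.
Qed.

Lemma dRem_lin p vs s (x : R) q q' : U p -> all_in X vs -> 2 + s <= al%:R -> - al%:R <= s ->
  dom (Hs0 R (- s)) q -> dom (Hs0 R (- s)) q' ->
  dRem F m p vs (x *: q + q') = x *: dRem F m p vs q + dRem F m p vs q'.
Proof.
move=> Up avs hs hs' dq dq'.
have [_ [C hC]] := rem_row_at oXi F al1 eL em hsig Up avs.
rewrite !(dRem_of_rows Up avs hs hs')//; first exact: (of_rows_lin x hs hC dq dq').
exact: (ndL (normed_Hs0 (- s))).
Qed.

Section Middle.
Variable M : nat.
Hypotheses (Mm : (M <= m)%N) (Mal : (M + 3 <= al)%N).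

(** The terms that belong to the remainder of order M but not to that of order m. *)
Definition mid_terms p vs q : E R S :=
  \sum_(M.+1 <= k < m.+1) in_w S (pmul (daT F k p vs) (dx (- k%:Z) q)).

Lemma dRem_mid p vs q : dRem F M p vs q = dRem F m p vs q + mid_terms p vs q.
Proof.
have e : mid_terms p vs q = in_w S (\sum_(M.+1 <= k < m.+1) pmul (daT F k p vs) (dx (- k%:Z) q)).
  by rewrite in_w_sum.
rewrite {}e /dRem [in RHS](big_cat_nat (n := M.+1))//= [in RHS]addrA.
set A := (_ + \sum_(1 <= k < M.+1) _); set B := \sum_(_ <= k < m.+1) _.
by rewrite (in_wD S A B) opprD addrA subrK.
Qed.

Lemma mid_terms_conv k (s Ca : R) a q : -1 <= s <= M%:R + 1 -> supg (M%:R + 4) Ca a ->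
  dom (Hs0 R (- s)) q -> pmul_conv a (dx (- k%:Z) q).
Proof.
move=> hs ha [dq _]; have hq := hsg_supg (hsg_nrm dq).
have [h _ _ _] := neg_range (ler0n R M) hs.
have hd : supg (- s) (2 * nrm (Hs R (- s)) q) (dx (- k%:Z) q).
  by apply: supg_le (dx_supg k hq); rewrite lerDl.
exact: pmul_conv_supg ha hd h.
Qed.

(** Here the loss-free product [pmul_hsg] is essential: H^{-s} is mapped to H^{k-s} with
    k >= M + 1. *)
Lemma mid_term_ng k (s Ca : R) a q : (M < k)%N -> -1 <= s <= M%:R + 1 -> supg (M%:R + 4) Ca a ->
  dom (Hs0 R (- s)) q ->
  ng (Esp S (M%:R + 1 - s)) (12 * 2 `^ (M%:R + 2) * Ca * nrm (Hs R (- s)) q) (in_w S (pmul a (dx (- k%:Z) q))).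
Proof.
move=> Mk hs ha [dq _]; have [_ h _ _] := neg_range (ler0n R M) hs.
have hk : M%:R + 1 - s <= - s + k%:R.
  by rewrite addrC lerD2l natr1 ler_nat.
have hd := hsg_le hk (dx_hsg k (hsg_nrm dq)).
have e : M%:R + 4 = M%:R + 2 + 2 :> R by rewrite -addrA; congr (_ + _); rewrite -natrD.
rewrite e in ha; apply: in_w_ng; apply: hsg_leK (pmul_hsg ha hd h).
by rewrite le_eqVlt; apply/orP; left; apply/eqP; ring.
Qed.

Lemma gjet_mid_terms (s : R) : -1 <= s <= M%:R + 1 ->
  gjet X U (opg (Hs0 R (- s)) (Esp S (M%:R + 1 - s))) (fun p vs => onQ (mid_terms p vs)).
Proof.
move=> hs; have nA := normed_Hs0 (R := R) (- s); have nE := normed_Esp (R := R) S (M%:R + 1 - s).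
have gE := gauge_opg nA nE.
have Ud : U `<=` dom X by exact: oU.1.
pose f k a (x : {q | dom (Hs0 R (- s)) q}) : E R S := in_w S (pmul a (dx (- k%:Z) (sval x))).
suff j : gjet X U (opg (Hs0 R (- s)) (Esp S (M%:R + 1 - s)))
    (fun p vs => \sum_(M.+1 <= k < m.+1) f k (daT F k p vs)).
  by apply: (gjet_ext nP Ud _ j) => p vs _ _; apply/funext => x; rewrite fct_sumE.
apply: (gjet_sum nP gE) => k; rewrite mem_index_iota => /andP[Mk _].
have k1 : (1 <= k)%N by apply: leq_ltn_trans Mk.
apply: (gjet_map (c := 12 * 2 `^ (M%:R + 2)) (f := f k) nP (gauge_supg (M%:R + 4)) gE) (gjet_daT_s F _ k1 sig1).
- by rewrite mulr_ge0 ?powR_ge0.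
- move=> a C C' w w' hw hw'; apply/funext => x; rewrite [RHS]/(a *: f k w x + f k w' x) /f.
  rewrite pmulDl ?in_wL//; [exact: (mid_terms_conv k hs hw (svalP x))|exact: (mid_terms_conv k hs hw' (svalP x))].
- by move=> C w C0 hw x; exact: (mid_term_ng Mk hs hw (svalP x)).
Qed.

Lemma mid_terms_bd U' LL n0 : unif_est F sigma m (L%:R + 3) U' LL n0 -> exists2 C : R, 0 <= C &
  forall p vs (s : R) q, U' p -> LL vs -> (size vs <= n0)%N -> -1 <= s <= M%:R + 1 ->
    dom (Hs0 R (- s)) q ->
    ng (Esp S (M%:R + 1 - s)) (C * nprod X vs * nrm (Hs R (- s)) q) (mid_terms p vs q).
Proof.
move=> [UU LLs LLa [Ca [CR [Ca0 CR0 ha hR]]]].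
exists ((size (index_iota M.+1 m.+1))%:R * (12 * 2 `^ (M%:R + 2) * Ca)).
  by rewrite mulr_ge0// !mulr_ge0// powR_ge0.
move=> p vs s q Up lvs svs hs dq.
rewrite -!mulrA [12 * _]mulrA; rewrite (mulrA Ca) (mulrA (12 * _)).
apply: (gsum (gauge_ng (normed_Esp S _))) => k; rewrite mem_index_iota ltnS => /andP[Mk km].
apply: mid_term_ng => //.
have kk : (1 <= k <= m)%N by rewrite (leq_ltn_trans _ Mk).
have e : M%:R + 4 <= L%:R + 3 :> R by rewrite -!natrD ler_nat eL; lia.
exact: supg_le e (ha k p vs kk Up lvs svs).
Qed.

Lemma mid_terms_lin p vs (s x : R) q q' : U p -> all_in X vs -> -1 <= s <= M%:R + 1 ->
  dom (Hs0 R (- s)) q -> dom (Hs0 R (- s)) q' ->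
  mid_terms p vs (x *: q + q') = x *: mid_terms p vs q + mid_terms p vs q'.
Proof.
move=> Up avs hs dq dq'; rewrite /mid_terms scaler_sumr -big_split.
apply: eq_big_seq => k; rewrite mem_index_iota => /andP[Mk _].
have k1 : (1 <= k)%N by apply: leq_ltn_trans Mk.
have [C ha] := daT_at F sig1 (M%:R + 4) k1 Up avs.
rewrite dxD dxZ pmulDr ?in_wL//; [exact: (mid_terms_conv k hs ha dq)|exact: (mid_terms_conv k hs ha dq')].
Qed.

Let sal (s : R) : -1 <= s <= M%:R + 1 ->
  [/\ 2 + s <= al%:R, M%:R + 1 - s + 1 <= al%:R & - al%:R <= s].
Proof.
move=> hs; have [_ _ _ h] := neg_range (ler0n R M) hs; apply: h.
by rewrite -natrD ler_nat.
Qed.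

Lemma Rext_neg_jet (s : R) : -1 <= s <= M%:R + 1 ->
  is_jet X (Bop (Hs0 R (- s)) (Esp S (M%:R + 1 - s))) U (fun p => dRem F M p [::]) (dRem F M).
Proof.
move=> hs; have [h1 h2 h3] := sal hs; have Ud : U `<=` dom X by exact: oU.1.
have nA := normed_Hs0 (R := R) (- s); have nE := normed_Esp (R := R) S (M%:R + 1 - s).
apply: (gjet_is_jet_Bop nA nE nP) => //.
  apply: (gjet_ext nP Ud _ (gjet_add (gauge_opg nA nE) (gjet_dRem h1 h2 h3) (gjet_mid_terms hs))).
  by move=> p vs _ _; apply/funext => x; exact: dRem_mid.
move=> p vs Up avs a u v du dv; rewrite !dRem_mid.
rewrite (dRem_lin a Up avs h1 h3 du dv) (mid_terms_lin a Up avs hs du dv).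
by rewrite (scalerDr a (dRem F m p vs u) (mid_terms p vs u)) addrACA.
Qed.

Lemma Rext_neg_unif U' LL n0 : unif_est F sigma m (L%:R + 3) U' LL n0 -> exists2 C : R, 0 <= C &
  forall p vs (s : R) q, U' p -> LL vs -> (size vs <= n0)%N -> -1 <= s <= M%:R + 1 ->
    dom (Hs0 R (- s)) q ->
    ng (Esp S (M%:R + 1 - s)) (C * nprod X vs * nrm (Hs R (- s)) q) (dRem F M p vs q).
Proof.
move=> ts; have [C1 C10 hC1] := dRem_bd ts; have [C2 C20 hC2] := mid_terms_bd ts.
exists (C1 + C2) => [|p vs s q Up lvs svs hs dq]; first exact: addr_ge0.
have [h1 h2 h3] := sal hs; rewrite dRem_mid !mulrDl.
apply: (gD (gauge_ng (normed_Esp S _))); first exact: hC1.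
exact: hC2.
Qed.
End Middle.
End RowJets.

(** * Tame sums and the directions of the estimates *)

Section TameSums.
Variables (R : realType) (V : lmodType R).
Implicit Types (X Y : nspace V) (v : V) (vs : seq V).

Lemma ntame_nil X Y : ntame X Y [::] = 0.
Proof. by rewrite /ntame big_ord0. Qed.

Lemma nprod_nth X vs : \prod_(i < size vs) nrm X vs`_i = nprod X vs.
Proof. by rewrite /nprod (big_nth 0) big_mkord. Qed.

(** The tame sum obeys a product rule, which is the recursion used below. *)
Lemma ntame_cons X Y v vs :
  ntame X Y (v :: vs) = nrm X v * nprod Y vs + nrm Y v * ntame X Y vs.
Proof.
rewrite /ntame /= big_ord_recl; congr (_ + _).
  rewrite big_mkcond big_ord_recl /= mul1r -nprod_nth; congr (_ * _).
rewrite mulr_sumr; apply: eq_bigr => j _ /=; rewrite mulrCA; congr (_ * _).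
rewrite big_mkcond big_ord_recl /=; congr (_ * _).
by rewrite [in RHS]big_mkcond; apply: eq_bigr => i _ /=; rewrite (inj_eq lift_inj).
Qed.

Lemma nprod_le X Y vs : normed X -> (forall v, dom Y v -> dom X v /\ nrm X v <= nrm Y v) ->
  all_in Y vs -> nprod X vs <= nprod Y vs.
Proof.
move=> nX h; elim: vs => [|v vs IH]; first by rewrite /nprod !big_nil.
move=> /all_in_cons[/h[dv lv] avs]; rewrite !nprod_cons.
by apply: ler_pM (IH avs) => //; [exact: (nrm_ge0 nX)|apply: (nprod_ge0 nX) => w /avs/h[]].
Qed.

Lemma ntame_ge0 X Y vs : normed X -> normed Y -> all_in X vs -> all_in Y vs -> 0 <= ntame X Y vs.
Proof.
move=> nX nY; elim: vs => [|v vs IH]; first by rewrite ntame_nil.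
move=> /all_in_cons[dx ax] /all_in_cons[dy ay]; rewrite ntame_cons addr_ge0// mulr_ge0//.
- exact: (nrm_ge0 nX).
- exact: (nprod_ge0 nY).
- exact: (nrm_ge0 nY).
- exact: IH.
Qed.

Lemma ntame_le X X' Y Y' vs : normed X -> normed Y ->
  (forall v, dom X' v -> dom X v /\ nrm X v <= nrm X' v) ->
  (forall v, dom Y' v -> dom Y v /\ nrm Y v <= nrm Y' v) ->
  all_in X' vs -> all_in Y' vs -> ntame X Y vs <= ntame X' Y' vs.
Proof.
move=> nX nY hX hY; elim: vs => [|v vs IH]; first by rewrite !ntame_nil.
move=> /all_in_cons[/hX[dx lx] ax] /all_in_cons[/hY[dy ly] ay]; rewrite !ntame_cons.
have ax1 : all_in X vs by move=> w /ax/hX[].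
have ay1 : all_in Y vs by move=> w /ay/hY[].
apply: lerD; apply: ler_pM => //.
- exact: (nrm_ge0 nX).
- exact: (nprod_ge0 nY).
- exact: nprod_le.
- exact: (nrm_ge0 nY).
- exact: ntame_ge0.
- exact: IH.
Qed.

Lemma ntame_diag X vs : ntame X X vs = (size vs)%:R * nprod X vs.
Proof.
elim: vs => [|v vs IH]; first by rewrite ntame_nil mul0r.
by rewrite ntame_cons IH nprod_cons /= -natr1; ring.
Qed.

Lemma nprod_unit X ns vs : (forall v, v \in ns -> nrm X v = 1) -> nprod X (ns ++ vs) = nprod X vs.
Proof.
elim: ns => //= v ns IH h; rewrite nprod_cons h ?mem_head// mul1r IH// => w hw.
by apply: h; rewrite inE hw orbT.
Qed.

Lemma ntame_unit X Y ns vs : (forall v, v \in ns -> nrm X v = 1) -> (forall v, v \in ns -> nrm Y v = 1) ->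
  ntame X Y (ns ++ vs) = ntame X Y vs + (size ns)%:R * nprod Y vs.
Proof.
elim: ns => [|v ns IH] h h' /=; first by rewrite mul0r addr0.
have hw w : w \in ns -> w \in v :: ns by move=> hw; rewrite inE hw orbT.
rewrite ntame_cons h ?mem_head// h' ?mem_head// nprod_unit; last by move=> w /hw/h'.
rewrite IH; [|by move=> w /hw/h|by move=> w /hw/h'].
by rewrite -natr1; ring.
Qed.

(** A factor that receives no or one direction produces a term of the tame sum. *)
Lemma splits_tame X Y vs ab : normed X -> normed Y -> ab \in splits vs -> all_in X vs -> all_in Y vs ->
  (ab.1 = [::] -> ab.2 = vs) /\
  (forall u, ab.1 = [:: u] -> nrm X u * nprod Y ab.2 <= ntame X Y vs).
Proof.
move=> nX nY abs.
apply: (@splits_ind V (fun vs a b => all_in X vs -> all_in Y vs ->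
  (a = [::] -> b = vs) /\ (forall u, a = [:: u] -> nrm X u * nprod Y b <= ntame X Y vs))) abs => //.
- move=> v {}vs a b IH /all_in_cons[dx ax] /all_in_cons[dy ay]; split=> // u [<- a0].
  rewrite ((IH ax ay).1 a0) ntame_cons lerDl mulr_ge0//; first exact: (nrm_ge0 nY).
  exact: ntame_ge0.
- move=> v {}vs a b IH /all_in_cons[dx ax] /all_in_cons[dy ay]; split=> [a0|u au].
    by rewrite ((IH ax ay).1 a0).
  rewrite nprod_cons ntame_cons mulrCA; apply: ler_wpDl.
    by rewrite mulr_ge0//; [exact: (nrm_ge0 nX)|exact: (nprod_ge0 nY)].
  by rewrite ler_wpM2l//; [exact: (nrm_ge0 nY)|exact: (IH ax ay).2].
Qed.
End TameSums.

Section SplitDirs.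
Variables (T I A : eqType) (g : I -> T) (f : A -> T).

Lemma splits_nseq k v (ys : seq T) ab : ab \in splits (nseq k v ++ ys) ->
  exists k1 k2 cd, [/\ cd \in splits ys, ab.1 = nseq k1 v ++ cd.1 & ab.2 = nseq k2 v ++ cd.2].
Proof.
elim: k ab => [|k IH] ab /=; first by move=> h; exists 0%N, 0%N, ab; split.
rewrite mem_cat => /orP[] /mapP[q /IH[k1 [k2 [cd [h e1 e2]]]] ->] /=.
  by exists k1.+1, k2, cd; split; rewrite //= e1.
by exists k1, k2.+1, cd; split; rewrite //= e2.
Qed.

Definition reps (s : seq I) (alpha : I -> nat) := flatten [seq nseq (alpha i) (g i) | i <- s].

(** Splitting distributes the repetitions of each index over the two lists.  Only the
    values on s matter, so the two functions can be modified one index at a time. *)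
Lemma splits_reps s alpha (ys : seq T) ab : uniq s -> ab \in splits (reps s alpha ++ ys) ->
  exists b1 b2 cd, [/\ cd \in splits ys, ab.1 = reps s b1 ++ cd.1 & ab.2 = reps s b2 ++ cd.2].
Proof.
elim: s ab => [|i s IH] ab /=; first by move=> _ h; exists alpha, alpha, ab; split.
move=> /andP[is_ us]; rewrite /reps /= -catA => /splits_nseq[k1 [k2 [cd [h -> ->]]]].
have [b1 [b2 [ef [h' -> ->]]]] := IH _ us h.
have e k b : reps s b = reps s (fun j => if j == i then k else b j).
  congr flatten; apply/eq_in_map => j js; case: eqP => // ji.
  by rewrite ji (negbTE is_) in js.
exists (fun j => if j == i then k1 else b1 j), (fun j => if j == i then k2 else b2 j), ef.
by split=> //; rewrite (e k1 b1, e k2 b2) /reps /= eqxx -catA.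
Qed.

Lemma splits_map (Q : A -> Prop) xs ab : (forall x, x \in xs -> Q x) -> ab \in splits (map f xs) ->
  exists a b, [/\ forall x, x \in a -> Q x, forall x, x \in b -> Q x & ab = (map f a, map f b)].
Proof.
elim: xs ab => [|x xs IH] ab h /=; first by rewrite inE => /eqP ->; exists [::], [::]; split.
have h1 y : y \in xs -> Q y by move=> hy; apply: h; rewrite inE hy orbT.
have h2 c : (forall y, y \in c -> Q y) -> forall y, y \in x :: c -> Q y.
  by move=> hc y; rewrite inE => /orP[/eqP ->|/hc//]; apply: h; rewrite mem_head.
rewrite mem_cat => /orP[] /mapP[q /(IH _ h1)[a [b [ha hb ->]]] ->] /=.
  by exists (x :: a), b; split=> //; exact: h2.
by exists a, (x :: b); split=> //; exact: h2.
Qed.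
End SplitDirs.

Section Dirs.
Variables (R : realType) (S : {fset nat}).
Implicit Types (alpha : S -> nat) (xs : seq (E R S)) (vs : seq (P R S)) (s : R).
Local Notation nu := (fun i : S => ((0, eS R i) : P R S)).

Lemma dirsE alpha xs : dirs alpha xs = reps nu (enum {: S}) alpha ++ map (@dirx R S) xs.
Proof. by []. Qed.

Definition isdirs s vs := exists alpha xs, all_in (Esp S s) xs /\ vs = dirs alpha xs.

Lemma nrm_eS (i : S) : nrm (RSsp R S) (eS R i) = 1.
Proof.
rewrite /= (bigD1 i)//= ffunE eqxx expr1n big1 ?addr0 ?sqrtr1// => j /negbTE ij.
by rewrite ffunE ij expr0n.
Qed.

Lemma nrm_nu s (i : S) : nrm (Psp S s) (nu i) = 1.
Proof.
transitivity (0 + 1 : R); last by rewrite add0r.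
by congr (_ + _); [exact: (nrm0 (normed_Esp S s))|exact: nrm_eS].
Qed.

Lemma reps_nrm s alpha (e : seq S) v : v \in reps nu e alpha -> nrm (Psp S s) v = 1.
Proof. by move=> /flattenP[l /mapP[i _ ->]] /nseqP[-> _]; exact: nrm_nu. Qed.

Lemma dirx_nrm s (x : E R S) : nrm (Psp S s) (dirx x) = nrm (Esp S s) x.
Proof.
transitivity (nrm (Esp S s) x + 0); last by rewrite addr0.
by congr (_ + _); exact: (nrm0 (normed_RSsp R S)).
Qed.

Lemma nprod_dirx s xs : nprod (Psp S s) (map (@dirx R S) xs) = nprod (Esp S s) xs.
Proof. by rewrite /nprod big_map; apply: eq_bigr => x _; exact: dirx_nrm. Qed.

Lemma ntame_dirx r s xs : ntame (Psp S r) (Psp S s) (map (@dirx R S) xs) = ntame (Esp S r) (Esp S s) xs.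
Proof.
by elim: xs => [|x xs IH]; rewrite /= ?ntame_nil// !ntame_cons IH nprod_dirx !dirx_nrm.
Qed.

Lemma nprod_dirs s alpha xs : nprod (Psp S s) (dirs alpha xs) = nprod (Esp S s) xs.
Proof. by rewrite dirsE nprod_unit ?nprod_dirx//; exact: reps_nrm. Qed.

Lemma ntame_dirs r s alpha xs : ntame (Psp S r) (Psp S s) (dirs alpha xs) =
  ntame (Esp S r) (Esp S s) xs + (size (reps nu (enum {: S}) alpha))%:R * nprod (Esp S s) xs.
Proof. by rewrite dirsE ntame_unit ?nprod_dirx ?ntame_dirx//; exact: reps_nrm. Qed.

Lemma dirs_dom s alpha xs : all_in (Esp S s) xs -> all_in (Psp S s) (dirs alpha xs).
Proof.
move=> ax v; rewrite dirsE mem_cat => /orP[/flattenP[l /mapP[i _ ->]] /nseqP[-> _]|/mapP[x /ax dx ->]].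
  by split=> //; exact: (nd0 (normed_Esp S s)).
exact: dirx_dom.
Qed.

Lemma dirs_size n alpha xs : (size (dirs alpha xs) <= n)%N ->
  (forall i, (alpha i <= n)%N) /\ (size xs <= n)%N.
Proof.
rewrite dirsE size_cat size_map => h; split=> [i|]; last by apply: leq_trans h; exact: leq_addl.
apply: leq_trans (leq_trans (leq_addr _ _) h).
rewrite size_flatten /shape -map_comp sumnE big_map big_enum (bigD1 i)//= size_nseq.
exact: leq_addr.
Qed.

(** Splitting [dirs alpha xs] preserves the order of the nu-derivatives. *)
Lemma isdirs_split s vs ab : ab \in splits vs -> isdirs s vs -> isdirs s ab.1 /\ isdirs s ab.2.
Proof.
move=> abs [alpha [xs [ax ev]]]; move: abs; rewrite {}ev dirsE => abs.
have [b1 [b2 [cd [h -> ->]]]] := splits_reps (enum_uniq {: S}) abs.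
have [a [b [ha hb ->]]] := splits_map ax h.
by split; [exists b1, a|exists b2, b]; split.
Qed.

Lemma isdirs_all s vs : isdirs s vs -> all_in (Psp S s) vs.
Proof. by move=> [alpha [xs [ax ->]]]; exact: dirs_dom. Qed.

(** Only finitely many multi-indices are bounded by n. *)
Lemma dirs_unif n (Q : (S -> nat) -> nat -> R -> Prop) :
  (forall alpha l C C', C <= C' -> Q alpha l C -> Q alpha l C') ->
  (forall alpha l, exists2 C : R, 0 <= C & Q alpha l C) ->
  exists2 C : R, 0 <= C & forall alpha l, (forall i, (alpha i <= n)%N) -> (l <= n)%N -> Q alpha l C.
Proof.
move=> mono h.
have [||r [C [_ C0 hC]]] := @finite_radius_bound R _ (enum {: {ffun S -> 'I_n.+1} * 'I_n.+1})
    (fun i _ C => Q (fun j => i.1 j : nat) i.2 C).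
- by move=> i r r' C C' _; exact: mono.
- by move=> i _; have [C C0 hC] := h (fun j => i.1 j : nat) i.2; exists 1, C.
exists C => // alpha l ha hl.
have := hC ([ffun j => inord (alpha j)], inord l) (mem_enum _ _).
rewrite /= inordK//; set b := fun j => _; rewrite (_ : b = alpha)//.
by apply/funext => j; rewrite /b ffunE inordK// ltnS.
Qed.

Lemma unif_bd (W : lmodType R) (U : set (P R S)) (Y : nspace W) s (D : P R S -> seq (P R S) -> W) alpha l :
  unif_bounds U (Esp S s) Y D -> exists2 C : R, 0 <= C & forall p xs, U p -> size xs = l ->
    all_in (Esp S s) xs -> nrm Y (D p (dirs alpha xs)) <= C * nprod (Esp S s) xs.
Proof.
move=> [h0 h1]; case: l => [|l].
  have [C hC] := h0 alpha; exists `|C| => // p xs Up /size0nil -> _.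
  by rewrite /nprod big_nil mulr1; apply: le_trans (hC p Up) _; exact: ler_norm.
have [C hC] := h1 alpha l.+1 isT; exists `|C| => // p xs Up sx ax.
apply: le_trans (hC p xs Up sx ax) _; rewrite ler_wpM2r ?ler_norm//.
exact: (nprod_ge0 (normed_Esp S s)).
Qed.
End Dirs.

(** * Bounds on the whole neighbourhood *)

Lemma tame_arith (R : realType) (a b pr nt W nn : R) : 0 <= b -> b <= a -> 0 <= pr -> 0 <= nt ->
  0 <= W -> 0 <= nn -> b * (W * pr + (nt + nn * pr)) <= (1 + nn) * (a * pr + b * (nt + W * pr)).
Proof.
move=> b0 ba p0 n0 W0 nn0.
have h1 : nn * (b * pr) <= nn * (a * pr) by rewrite ler_wpM2l// ler_wpM2r.
have h2 : 0 <= a * pr by rewrite mulr_ge0// (le_trans b0).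
have h3 : 0 <= nn * (b * (nt + W * pr)) by rewrite mulr_ge0// mulr_ge0// addr_ge0// mulr_ge0.
lra.
Qed.

Lemma gsum_unif (R : realType) (W : lmodType R) (B : R -> W -> Prop) (gB : gauge B)
    (Y : Type) (Q : Y -> Prop) (b : Y -> R) (I : eqType) (s : seq I) (T : I -> Y -> W) :
  (forall k, k \in s -> exists2 C, 0 <= C & forall x, Q x -> B (C * b x) (T k x)) ->
  exists2 C, 0 <= C & forall x, Q x -> B (C * b x) (\sum_(k <- s) T k x).
Proof.
elim: s => [|k s IH] h.
  by exists 0 => // x _; rewrite big_nil mul0r; exact: (g0 gB).
have [C C0 hC] := h k (mem_head _ _).
have [|C' C'0 hC'] := IH; first by move=> j js; apply: h; rewrite inE js orbT.
exists (C + C') => [|x Qx]; first exact: addr_ge0.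
by rewrite big_cons mulrDl; apply: (gD gB); [exact: hC|exact: hC'].
Qed.

Section Uniform.
Variables (R : realType) (S : {fset nat}) (K : birkhoff R) (delta : R) (Xi : set (RS R S)).
Variable F : normal_form K delta Xi.
Implicit Types (p : P R S) (xs : seq (E R S)) (q : dist R) (s r N : R) (k m l : nat) (alpha : S -> nat).
Local Notation VXi := (VXi delta Xi).
Local Notation VXiE := (VXiE delta Xi).

Lemma aT_unif k N alpha l : (1 <= k)%N -> exists2 C : R, 0 <= C & forall p xs, VXi 1 p ->
  size xs = l -> all_in (Esp S 1) xs -> supg N (C * nprod (Esp S 1) xs) (daT F k p (dirs alpha xs)).
Proof.
move=> k1; pose N' := Num.max 1 N.
have N1 : 1 <= N' by rewrite le_max lexx.
have NN : N <= N' by rewrite le_max lexx orbT.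
have [C C0 hC] := unif_bd alpha l (aT_est F k1 N1).
exists (2 * C) => [|p xs Up sx ax]; first by rewrite mulr_ge0.
have [_ hd _ _ _] := aT_smooth F k1 N1.
have d := hd p (dirs alpha xs) Up (dirs_dom (alpha := alpha) ax).
rewrite -mulrA; apply: supg_le NN _; apply: hsg_supg.
exact: hsg_leK (hC p xs Up sx ax) (hsg_nrm d).
Qed.

Lemma AT_unif k N alpha l : (1 <= k)%N -> 1 <= N -> exists2 C : R, 0 <= C & forall p xs q, VXi 1 p ->
  size xs = l -> all_in (Esp S 1) xs -> dom (Hs0 R 1) q ->
  hsg N (C * nprod (Esp S 1) xs * nrm (Hs R 1) q) (dAT F k p (dirs alpha xs) q).
Proof.
move=> k1 N1; have [C C0 hC] := unif_bd alpha l (AT_est F k1 N1).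
exists C => // p xs q Up sx ax dq.
have [_ hd _ _ _] := AT_smooth F k1 N1.
have d := hd p (dirs alpha xs) Up (dirs_dom (alpha := alpha) ax).
have [dN _ _] := d; apply: hsg_leK (hsg_nrm (dN q dq)).
apply: le_trans (Bop_app (normed_Hs0 1) (normed_Hs N) d dq) _.
by apply: ler_wpM2r (hC p xs Up sx ax); exact: (nrm_ge0 (normed_Hs0 1) dq).
Qed.

Lemma RT_unif m s alpha l : (1 <= m)%N -> 1 <= s -> exists2 C : R, 0 <= C & forall p xs q, VXiE 1 s p ->
  size xs = l -> all_in (Esp S s) xs -> dom (Hs0 R s) q ->
  ng (Esp S (s + m%:R + 1)) (C * (nrm (Hs R s) q * nprod (Esp S 1) xs
    + nrm (Hs R 1) q * (ntame (Esp S s) (Esp S 1) xs + nrm (Hs R s) (xw p.1) * nprod (Esp S 1) xs)))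
    (dRT F m p (dirs alpha xs) q).
Proof.
move=> m1 s1; have [_ hd _ _ _] := RT_smooth F m1 s1.
have dT p xs q : VXiE 1 s p -> all_in (Esp S s) xs -> dom (Hs0 R s) q ->
    dom (Esp S (s + m%:R + 1)) (dRT F m p (dirs alpha xs) q).
  by move=> Up ax dq; have [d _ _] := hd p (dirs alpha xs) Up (dirs_dom (alpha := alpha) ax); exact: d.
have nP1 := normed_Esp (R := R) S 1; have nPs := normed_Esp (R := R) S s.
have q0 (q : dist R) : dom (Hs0 R s) q -> 0 <= nrm (Hs R s) q /\ 0 <= nrm (Hs R 1) q.
  move=> dq; split; first exact: (nrm_ge0 (normed_Hs0 s) dq).
  by have [dq1 _] := Hs0_mono s1 dq; exact: (nrm_ge0 (normed_Hs0 1) dq1).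
have w0 p : VXiE 1 s p -> 0 <= nrm (Hs R s) (xw p.1).
  by move=> [_ [_ [dw _]]]; exact: (nrm_ge0 (normed_Hs s) dw).
case: l => [|l].
  have [C hC] := RT_est0 F alpha m1 s1; exists `|C| => // p xs q Up /size0nil -> ax dq.
  split; first exact: dT.
  apply: le_trans (hC p q Up dq) _; rewrite ntame_nil /nprod big_nil !mulr1 add0r.
  have [h1 h2] := q0 q dq; rewrite [_ * nrm (Hs R 1) q]mulrC.
  by apply: ler_wpM2r (ler_norm _); rewrite addr_ge0// mulr_ge0// w0.
have [C hC] := RT_est F alpha m1 s1 (ltn0Sn l); exists `|C| => // p xs q Up sx ax dq.
split; first exact: dT.
apply: le_trans (hC p xs q Up sx ax dq) _.
have [h1 h2] := q0 q dq.
have ax1 : all_in (Esp S 1) xs by move=> x /ax/(Esp_mono s1)[].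
rewrite -addrA -mulrA -mulrDr; apply: ler_wpM2r (ler_norm _).
have np := nprod_ge0 nP1 ax1.
rewrite addr_ge0 ?mulr_ge0// addr_ge0 ?mulr_ge0 ?w0//; exact: ntame_ge0.
Qed.

(** The size of [dw p vs]: w bounds the value, and each direction bounds its own
    contribution. *)
Definition isol_bound r (vs : seq (P R S)) (w : R) : R := match vs with
  | [::] => w | [:: v] => nrm (Psp S r) v | _ => 0 end.

Lemma dw_isol_bound r p vs : dom (Psp S r) p -> all_in (Psp S r) vs ->
  hsg r (isol_bound r vs (nrm (Hs R r) (xw p.1))) (dw p vs).
Proof.
case: vs => [|v [|v' vs]] dp avs; last exact: hsg0.
  by have [[_ [dw _]] _] := dp; exact: hsg_nrm.
by apply: Psp_w; apply: avs; rewrite mem_head.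
Qed.

(** The operator A_{-k} is infinitely smoothing and differentiated in E_1, so only the
    directions that fall on w, at most one in each term, are measured in E_r. *)
Lemma leibniz_tame k m s r alpha l : (1 <= k)%N -> 1 <= s -> s + m%:R + 4 <= r ->
  exists2 C : R, 0 <= C & forall p xs q, VXiE 1 r p -> size xs = l -> all_in (Esp S r) xs ->
  dom (Hs0 R s) q ->
  ng (Esp S (s + m%:R + 1)) (C * (nrm (Hs R 1) q *
    (nrm (Hs R r) (xw p.1) * nprod (Esp S 1) xs + ntame (Psp S r) (Psp S 1) (dirs alpha xs))))
    (leibniz (fun w (T : dist R -> dist R) => opT S k w T q) (@dw R S) (dAT F k) p (dirs alpha xs)).
Proof.
move=> k1 s1 sr; have m0 := ler0n R m; have r1 : 1 <= r by apply: le_trans s1 (le_trans _ sr); rewrite -addrA lerDl addr_ge0.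
pose N := s + m%:R + 2; have N1 : 1 <= N by rewrite /N -addrA; apply: ler_wpDr s1; rewrite addr_ge0.
pose nus := reps (fun i : S => ((0, eS R i) : P R S)) (enum {: S}) alpha.
pose n0 := (size nus + l)%N.
pose Q (beta : S -> nat) j (C : R) := forall p xs q, VXi 1 p ->
  size xs = j -> all_in (Esp S 1) xs -> dom (Hs0 R 1) q ->
  hsg N (C * nprod (Esp S 1) xs * nrm (Hs R 1) q) (dAT F k p (dirs beta xs) q).
have [] := @dirs_unif R S n0 Q.
- move=> beta j C C' CC h p xs q Up sx ax dq; apply: hsg_leK (h p xs q Up sx ax dq).
  rewrite ler_wpM2r ?(nrm_ge0 (normed_Hs0 1) dq)// ler_wpM2r//.
  exact: (nprod_ge0 (normed_Esp S 1)).
- by move=> beta j; exact: AT_unif.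
move=> C C0 hC; pose c := 3 * (12 * 2 `^ N * 4) : R.
have c0 : 0 <= c by rewrite /c !mulr_ge0// powR_ge0.
exists ((2 ^ n0)%:R * (c * C)); first by rewrite !mulr_ge0.
move=> p xs q [Up dp] sx ax dq.
have dpP : dom (Psp S r) p by split.
have [dq1 _] := Hs0_mono s1 dq; have q0 := nrm_ge0 (normed_Hs0 1) dq1.
have aP := dirs_dom (alpha := alpha) ax.
have sv : size (dirs alpha xs) = n0 by rewrite dirsE size_cat size_map sx.
rewrite /leibniz -[in (2 ^ n0)%N]sv -size_splits -!mulrA.
have W0 : 0 <= nrm (Hs R r) (xw p.1) by have [_ [dw _]] := dp; exact: (nrm_ge0 (normed_Hs r) dw).
apply: (gsum (gauge_ng (normed_Esp S _))) => ab abs.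
have nr := normed_Psp (R := R) S r; have n1 := normed_Psp (R := R) S 1.
have mr (v : P R S) : dom (Psp S r) v -> dom (Psp S 1) v /\ nrm (Psp S 1) v <= nrm (Psp S r) v by exact: Psp_mono.
have aP1 : all_in (Psp S 1) (dirs alpha xs) by move=> v /aP/mr[].
have [t1 t2] := splits_tame nr n1 abs aP aP1.
have [iA iB] : isdirs r ab.1 /\ isdirs r ab.2 by apply: isdirs_split abs _; exists alpha, xs.
have sz := splits_size abs.
have hw := dw_isol_bound dpP (isdirs_all iA).
have [beta [ys [ay eB]]] := iB.
have ay1 : all_in (Esp S 1) ys by move=> y /ay/(Esp_mono r1)[].
have sB : (size (dirs beta ys) <= n0)%N by rewrite -eB -sv -sz leq_addl.
have [hb hy] := dirs_size sB.
have hT : hsg N (C * nprod (Psp S 1) ab.2 * nrm (Hs R 1) q) (dAT F k p ab.2 q).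
  by rewrite eB nprod_dirs; exact: (hC beta (size ys) hb hy).
rewrite /opT; apply: in_w_ng.
have := @pmul_dx_hsg R k (s + m%:R + 1) r _ _ _ _ _ _ hw.
rewrite (_ : s + m%:R + 1 + 1 = N); last by rewrite /N -addrA.
move=> h; have {}h := h _ _ _ _ hT.
apply: hsg_leK (h _ _).
- have key : isol_bound r ab.1 (nrm (Hs R r) (xw p.1)) * nprod (Psp S 1) ab.2 <=
      nrm (Hs R r) (xw p.1) * nprod (Esp S 1) xs + ntame (Psp S r) (Psp S 1) (dirs alpha xs).
    have nt := ntame_ge0 nr n1 aP aP1.
    have np : 0 <= nprod (Esp S 1) xs by rewrite -(nprod_dirs 1 alpha); exact: (nprod_ge0 n1).
    case e : ab.1 t1 t2 => [|u [|u' us]] t1 t2 /=.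
    + by rewrite t1// nprod_dirs lerDl.
    + by apply: le_trans (t2 u erefl) _; rewrite lerDr mulr_ge0.
    + by rewrite mul0r addr_ge0// mulr_ge0.
  move: key; set A := isol_bound _ _ _; set B := nprod _ _; set D := (_ + _ : R); set q1 := nrm _ q => key.
  rewrite [leLHS](_ : _ = c * C * q1 * (A * B)); last by rewrite /c; ring.
  rewrite [leRHS](_ : _ = c * C * q1 * D); last by rewrite /c; ring.
  by rewrite ler_wpM2l// !mulr_ge0.
- by rewrite !addr_ge0// (le_trans ler01).
- by rewrite (_ : _ + 3 = s + m%:R + 4)// -addrA; congr (_ + _); rewrite -natrD.
Qed.

(** With s = 1 this gives the uniform bounds of [unif_est_dirs], with s >= 1 the tame
    estimates of the remainder. *)
Lemma dRem_ae_tame m s r alpha l : (1 <= m)%N -> 1 <= s -> s + m%:R + 4 <= r ->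
  exists2 C : R, 0 <= C & forall p xs q, VXiE 1 r p -> size xs = l -> all_in (Esp S r) xs ->
  dom (Hs0 R s) q ->
  ng (Esp S (s + m%:R + 1)) (C * (nrm (Hs R s) q * nprod (Esp S 1) xs
    + nrm (Hs R 1) q * (ntame (Esp S r) (Esp S 1) xs + nrm (Hs R r) (xw p.1) * nprod (Esp S 1) xs)))
    (dRem_ae F m p (dirs alpha xs) q).
Proof.
move=> m1 s1 sr; have m0 := ler0n R m.
have srr : s <= r by apply: le_trans sr; rewrite -addrA lerDl addr_ge0.
have r1 : 1 <= r by apply: le_trans srr.
have [C1 C10 h1] := RT_unif alpha l m1 s1.
pose bb (x : P R S * seq (E R S) * dist R) := nrm (Hs R 1) x.2 *
    (nrm (Hs R r) (xw x.1.1.1) * nprod (Esp S 1) x.1.2 + ntame (Psp S r) (Psp S 1) (dirs alpha x.1.2)).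
pose Q (x : P R S * seq (E R S) * dist R) :=
  [/\ VXiE 1 r x.1.1, size x.1.2 = l, all_in (Esp S r) x.1.2 & dom (Hs0 R s) x.2].
pose T k (x : P R S * seq (E R S) * dist R) :=
  leibniz (fun w (T : dist R -> dist R) => opT S k w T x.2) (@dw R S) (dAT F k) x.1.1 (dirs alpha x.1.2).
have [k|C2 C20 h2] := gsum_unif (gauge_ng (normed_Esp S (s + m%:R + 1))) (Q := Q) (b := bb)
    (s := index_iota 1 m.+1) (T := T).
  rewrite mem_index_iota => /andP[k1 _]; have [C C0 hC] := leibniz_tame alpha l k1 s1 sr.
  exists C; first exact: C0.
  by move=> [[p xs] q] [h h' h'' h''']; exact: (hC p xs q h h' h'' h''').
pose nn := (size (reps (fun i : S => ((0, eS R i) : P R S)) (enum {: S}) alpha))%:R : R.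
have nn0 : 0 <= nn by exact: ler0n.
exists (C2 * (1 + nn) + C1); first by rewrite addr_ge0// mulr_ge0// addr_ge0.
move=> p xs q Up sx ax dq.
have [dqs dq1] := (nrm_ge0 (normed_Hs0 s) dq, proj1 (Hs0_mono s1 dq)).
have q0 := nrm_ge0 (normed_Hs0 1) dq1; have q1 := (Hs0_mono s1 dq).2.
have W0 : 0 <= nrm (Hs R r) (xw p.1).
  by have [_ [_ [dw _]]] := Up; exact: (nrm_ge0 (normed_Hs r) dw).
have axm t : t <= r -> all_in (Esp S t) xs by move=> tr x /ax/(Esp_mono tr)[].
have n1 := normed_Esp (R := R) S 1; have nr := normed_Esp (R := R) S r; have ns := normed_Esp (R := R) S s.
have np := nprod_ge0 n1 (axm 1 r1); have nt := ntame_ge0 nr n1 ax (axm 1 r1).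
rewrite /dRem_ae mulrDl; apply: (gD (gauge_ng (normed_Esp S _))).
- have hQ : Q (p, xs, q) by split.
  apply: (gle (gauge_ng (normed_Esp S _)) _ (h2 (p, xs, q) hQ)).
  rewrite -[leRHS]mulrA; apply: (ler_wpM2l C20); rewrite /bb /= ntame_dirs.
  exact: tame_arith.
- have Us : VXiE 1 s p by have [U1 d] := Up; exact: (conj U1 (proj1 (Esp_mono srr d))).
  apply: (gle (gauge_ng (normed_Esp S _)) _ (h1 p xs q Us sx (axm s srr) dq)).
  apply: (ler_wpM2l C10); rewrite lerD2l; apply: (ler_wpM2l q0); apply: lerD.
    exact: (ntame_le ns n1 (fun v => @Esp_mono R S _ _ v srr) (fun v => @Esp_mono R S _ _ v (lexx 1)) ax (axm 1 r1)).
  apply: (ler_wpM2r np); have [_ [_ [dw _]]] := Up.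
  exact: (Hs_mono srr dw).2.
Qed.

Lemma unif_est_dirs m N (sigma : R) n0 : (1 <= m)%N -> m%:R + 5 <= sigma ->
  unif_est F sigma m N (VXi sigma) (isdirs sigma) n0.
Proof.
move=> m1 hs; have m0 := ler0n R m.
have sig1 : 1 <= sigma by apply: le_trans hs; apply: ler_wpDl; rewrite ?ler1n.
have n1 := normed_Esp (R := R) S 1; have nS := normed_Esp (R := R) S sigma.
have mono (v : E R S) : dom (Esp S sigma) v -> dom (Esp S 1) v /\ nrm (Esp S 1) v <= nrm (Esp S sigma) v by exact: Esp_mono.
split=> //; [exact: isdirs_split|exact: isdirs_all|].
have a1 xs : all_in (Esp S sigma) xs -> all_in (Esp S 1) xs by move=> ax v /ax/mono[].
have [||Ca Ca0 ha] := @dirs_unif R S n0 (fun alpha l C => forall k p xs, (1 <= k <= m)%N -> VXi sigma p ->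
  size xs = l -> all_in (Esp S sigma) xs -> supg N (C * nprod (Esp S sigma) xs) (daT F k p (dirs alpha xs))).
- move=> alpha l C C' CC h k p xs kk Up sx ax; apply: supg_leK (h k p xs kk Up sx ax).
  by apply: ler_wpM2r CC; exact: (nprod_ge0 nS).
- move=> alpha l.
  have [||d [C [_ C0 h]]] := @finite_radius_bound R _ (index_iota 1 m.+1) (fun k _ C => forall p xs,
      VXi 1 p -> size xs = l -> all_in (Esp S 1) xs -> supg N (C * nprod (Esp S 1) xs) (daT F k p (dirs alpha xs))).
  + move=> k d d' C C' _ CC h p xs Up sx ax; apply: supg_leK (h p xs Up sx ax).
    by apply: ler_wpM2r CC; exact: (nprod_ge0 n1).
  + move=> k; rewrite mem_index_iota => /andP[k1 _]; have [C C0 hC] := aT_unif N alpha l k1.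
    by exists 1, C; split.
  exists C => // k p xs kk Up sx ax; apply: supg_leK (h k _ p xs (VXi_le sig1 Up) sx (a1 _ ax)).
    by apply: (ler_wpM2l C0); exact: (nprod_le n1 mono ax).
  by rewrite mem_index_iota ltnS.
have ms : 1 + m%:R + 4 <= sigma by rewrite (_ : 1 + m%:R + 4 = m%:R + 5)//; ring.
have [||CR CR0 hR] := @dirs_unif R S n0 (fun alpha l C => forall p xs q, VXi sigma p ->
  size xs = l -> all_in (Esp S sigma) xs -> dom (Hs0 R 1) q ->
  ng (Esp S (m%:R + 2)) (C * nprod (Esp S sigma) xs * nrm (Hs R 1) q) (dRem_ae F m p (dirs alpha xs) q)).
- move=> alpha l C C' CC h p xs q Up sx ax dq.
  apply: (gle (gauge_ng (normed_Esp S _)) _ (h p xs q Up sx ax dq)).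
  apply: ler_wpM2r; first exact: (nrm_ge0 (normed_Hs0 1) dq).
  by apply: ler_wpM2r CC; exact: (nprod_ge0 nS).
- move=> alpha l; have [C C0 hC] := dRem_ae_tame alpha l m1 (lexx 1) ms.
  exists (C * (1 + l%:R + `|delta|)); first by rewrite mulr_ge0// !addr_ge0.
  move=> p xs q Up sx ax dq.
  have := hC p xs q (VXi_VXiE sig1 Up) sx ax dq.
  rewrite (_ : 1 + m%:R + 1 = m%:R + 2); last by ring.
  apply: (gle (gauge_ng (normed_Esp S _))).
  have q0 := nrm_ge0 (normed_Hs0 1) dq.
  have np := nprod_ge0 nS ax.
  have l1 := nprod_le n1 mono ax.
  have l2 : ntame (Esp S sigma) (Esp S 1) xs <= l%:R * nprod (Esp S sigma) xs.
    rewrite -sx -ntame_diag; exact: (ntame_le nS n1 (fun v dv => conj dv (lexx _)) mono ax ax).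
  have W : nrm (Hs R sigma) (xw p.1) <= `|delta|.
    have [[_ [_ lt]] _] := Up; rewrite subr0 in lt; exact: le_trans (ltW lt) (ler_norm _).
  have l3 : nrm (Hs R sigma) (xw p.1) * nprod (Esp S 1) xs <= `|delta| * nprod (Esp S sigma) xs.
    have w0 : 0 <= nrm (Hs R sigma) (xw p.1).
      by have [[_ [[dw _] _]] _] := Up; exact: (nrm_ge0 (normed_Hs sigma) dw).
    exact: (ler_pM w0 (nprod_ge0 n1 (a1 _ ax)) W l1).
  rewrite -!mulrA; apply: (ler_wpM2l C0).
  rewrite mulrA [leRHS]mulrC -mulrDr; apply: (ler_wpM2l q0).
  by rewrite !mulrDl mul1r -addrA; apply: lerD l1 (lerD l2 l3).
exists Ca, CR; split=> //.
- move=> k p vs kk Up [alpha [xs [ax ->]]] sz; have [h1 h2] := dirs_size sz.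
  by rewrite nprod_dirs; exact: (ha alpha (size xs) h1 h2).
- move=> p vs q Up [alpha [xs [ax ->]]] sz dq; have [h1 h2] := dirs_size sz.
  by rewrite nprod_dirs; exact: (hR alpha (size xs) h1 h2).
Qed.
End Uniform.

(** * The extension theorem *)

Section Periodicity.
Variables (R : realType) (S : {fset nat}).
Definition pshift (k : {ffun S -> int}) (p : P R S) : P R S := (thshift k p.1, p.2).

Lemma pshiftD k p h : pshift k (p + h) = pshift k p + h.
Proof.
case: p h => [[[th y] w] nu] [[[th' y'] w'] nu'].
congr (_, _, _, _); apply/ffunP => j.
by rewrite !ffunE [LHS]addrAC.
Qed.

(** Translations in theta commute with adding increments. *)
Lemma gjet_shift (W : lmodType R) (X : nspace (P R S)) (U : set (P R S)) (B : R -> W -> Prop) D k :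
  (forall p, U p -> U (pshift k p)) -> gjet X U B D -> gjet X U B (fun p vs => D (pshift k p) vs).
Proof.
move=> Us jD; split=> [p a h h' vs Up dh dh' avs|p l Up|p l e Up e0].
- exact: (gj_lin jD a (Us p Up) dh dh' avs).
- exact: (gj_bd jD l (Us p Up)).
- have [r r0 hr] := gj_fr jD l (Us p Up) e0; exists r; first exact: r0.
  move=> h dh hh Uh vs svs avs; rewrite pshiftD; apply: (hr h dh hh _ vs svs avs).
  by rewrite -pshiftD; exact: Us.
Qed.
End Periodicity.

Section Final.
Variables (R : realType) (S : {fset nat}) (K : birkhoff R) (delta : R) (Xi : set (RS R S)).
Hypothesis oXi : nopen (RSsp R S) Xi.
Variable F : normal_form K delta Xi.
Implicit Types (p : P R S) (vs : seq (P R S)) (q : dist R) (s r : R) (k : nat) (c : probe S).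
Local Notation VXi := (VXi delta Xi).
Local Notation VXiE := (VXiE delta Xi).

(** The derivatives of a periodic map are periodic, by uniqueness of jets. *)
Lemma dPsi_shift p (v : P R S) (k : {ffun S -> int}) : VXi 0 p -> dom (Psp S 0) v -> dPsi F (pshift k p) [:: v] = dPsi F p [:: v].
Proof.
move=> Up dv; apply/funext => n; apply: prt_ext => b.
have nP := normed_Psp (R := R) S 0.
have j := gjet_prt nP b (gjet_coef_Hs0 nP n (gjet_dPsi F)).
have Us p' : VXi 0 p' -> VXi 0 (pshift k p') by [].
have av : all_in (Psp S 0) [:: v] by move=> u; rewrite inE => /eqP ->.
apply: (gjet_uniq nP (VXi_open delta oXi 0) (gjet_shift Us j) j _ av Up) => p' Up'.
have [D0 _ _ _ _] := Psi_smooth F.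
by rewrite (D0 _ (Us _ Up')) (D0 _ Up') /pshift (Psi_periodic F k Up').
Qed.

Variables (M : nat) (sigma : R).
Hypotheses (M1 : (1 <= M)%N).
Let al := (M + 3)%N.
Let L := (2 * al + 2)%N.
Let m := (4 * al)%N.
Hypothesis hsig : m%:R + 5 <= sigma.
Let al1 : (1 <= al)%N. Proof. by rewrite /al; lia. Qed.
Let m1 : (1 <= m)%N. Proof. by rewrite /m; lia. Qed.
Let Mm : (M <= m)%N. Proof. by rewrite /m /al; lia. Qed.
Let Mal : (M + 3 <= al)%N. Proof. by []. Qed.
Let sig1 : 1 <= sigma. Proof. by apply: le_trans hsig; apply: ler_wpDl; rewrite ?ler1n. Qed.
Let sig0 : 0 <= sigma. Proof. by apply: le_trans sig1. Qed.
Let Msig : M%:R + 5 <= sigma. Proof. by apply: le_trans hsig; rewrite lerD2r ler_nat. Qed.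
Local Notation U := (VXi sigma).
Local Notation X := (Psp S sigma).

(** Both the transpose and the coefficients are periodic. *)
Lemma Rext_periodic q : th_periodic U (fun p => dRem F M p [::] q).
Proof.
move=> p k Up; have U0 := VXi_le sig0 Up; have U1 := VXi_le sig1 Up.
rewrite -/(pshift k p) /dRem; congr (_ - in_w S (_ + _)).
  rewrite /dTransp; apply: pcoord_ext => [n nS|c ok]; first by rewrite !of_rows_out.
  rewrite !pcoord_of_rows//; congr (l2dot _ _).
  exact: (dPsi_shift k U0 (dirx_dom (probe_vec_dom 0 ok))).
apply: eq_big_seq => j; rewrite mem_index_iota => /andP[j1 _].
have [D0 _ _ _ _] := aT_smooth F j1 (lexx 1).
by congr pmul; rewrite !D0//; exact: (aT_periodic F j1 k U1).
Qed.

Lemma daT0 k p : (1 <= k)%N -> U p -> daT F k p [::] = aT F k p.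
Proof. by move=> k1 Up; have [D0 _ _ _ _] := aT_smooth F k1 (lexx 1); apply: D0; exact: VXi_le Up. Qed.

Lemma Text_expansion p q : U p -> dTransp F p [::] q =
  (0, 0, Pperp S q + Pperp S (\sum_(1 <= k < M.+1) pmul (aT F k p) (dx (- k%:Z) q))) + dRem F M p [::] q.
Proof.
move=> Up; rewrite -PperpD -/(in_w S _) /dRem.
have -> : \sum_(1 <= k < M.+1) pmul (daT F k p [::]) (dx (- k%:Z) q) =
          \sum_(1 <= k < M.+1) pmul (aT F k p) (dx (- k%:Z) q).
  by apply: eq_big_seq => k; rewrite mem_index_iota => /andP[k1 _]; rewrite daT0.
by rewrite addrC subrK.
Qed.

Lemma Text_dPsiT p q : U p -> dom (Hs0 R 0) q -> dTransp F p [::] q = dPsiT F p q.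
Proof.
move=> Up dq; have U0 := VXi_le sig0 Up.
have [dT hT] := dPsiT_transpose F U0 dq.
have [_ [[rT _] oT]] := dT.
apply: pcoord_ext => [n nS|c ok]; first by rewrite of_rows_out// oT.
rewrite pcoord_of_rows// -dotE_probe// hT//; exact: probe_vec_dom.
Qed.

(** Boundedness is read off from the expansion: the explicit terms map H^{-M-1} to
    itself, and the remainder maps it to E_0. *)
Lemma Text_dom p : U p -> dom (Bop (Hs0 R (- M.+1%:R)) (Esp S (- M.+1%:R))) (dTransp F p [::]).
Proof.
move=> Up; pose t : R := - M.+1%:R.
have nA := normed_Hs0 (R := R) t; have nE := normed_Esp (R := R) S t.
have M0 := ler0n R M.
have hs : (-1 : R) <= (M.+1%:R : R) <= (M%:R + 1 : R).
  by rewrite -[M.+1%:R]natr1 lexx andbT; apply: (le_trans (lerN10 R)); rewrite addr_ge0.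
have [_ hd _ _ _] := Rext_neg_jet oXi F al1 erefl erefl hsig Mm Mal hs.
have av : all_in X [::] by [].
have [dR lR [C hC]] := hd p [::] Up av.
have le0 : t <= (M%:R + 1 - M.+1%:R : R) by rewrite natr1 subrr oppr_le0.
have t1 : `|t| <= M.+1%:R by rewrite normrN ger0_norm.
pose A q := in_w S (q + \sum_(1 <= k < M.+1) pmul (aT F k p) (dx (- k%:Z) q)).
have eT q : dTransp F p [::] q = A q + dRem F M p [::] q.
  by rewrite Text_expansion// /A /in_w PperpD.
have ok k q : (1 <= k)%N -> dom (Hs0 R t) q -> exists C1, supg (M.+1%:R + 2) C1 (aT F k p) /\
    pmul_conv (aT F k p) (dx (- k%:Z) q).
  move=> k1 [dq _]; have [C1] := daT_at F sig1 (M.+1%:R + 2) k1 Up av.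
  rewrite daT0// => ha; exists C1; split=> //.
  have hk : supg t (2 * nrm (Hs R t) q) (dx (- k%:Z) q).
    by apply: supg_le (dx_supg k (hsg_supg (hsg_nrm dq))); rewrite lerDl.
  by apply: (pmul_conv_supg ha hk); rewrite lerD2r.
have [C2 C20 hA] : exists2 C2, 0 <= C2 & forall q, dom (Hs0 R t) q -> ng (Esp S t) (C2 * nrm (Hs R t) q) (A q).
  have [k|C2 C20 hC2] := gsum_unif (gauge_hsg t) (Q := dom (Hs0 R t)) (b := nrm (Hs R t))
     (s := index_iota 1 M.+1) (T := fun k q => pmul (aT F k p) (dx (- k%:Z) q)).
    rewrite mem_index_iota => /andP[k1 _].
    have [C1] := daT_at F sig1 (M.+1%:R + 2) k1 Up av; rewrite daT0// => ha.
    exists (6 * 2 `^ M.+1%:R * (2 * C1)) => [|q [dq _]].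
      by rewrite !mulr_ge0 ?powR_ge0//; exact: supg_ge0 ha.
    have hd1 := hsg_le (s := t + k%:R) (r := t) _ (dx_hsg k (hsg_nrm dq)).
    have {}hd1 := hd1 _; rewrite lerDl ler0n in hd1; have {}hd1 := hd1 isT.
    apply: hsg_leK (pmul_hsg ha hd1 t1).
    by rewrite le_eqVlt; apply/orP; left; apply/eqP; ring.
  exists (1 + C2) => [|q dq]; first exact: addr_ge0.
  apply: in_w_ng; rewrite mulrDl mul1r; apply: hsgD; last exact: hC2.
  by have [dq' _] := dq; exact: hsg_nrm.
split=> [q dq|a q q' dq dq'|].
- rewrite eT; apply: (ndD nE); first by have [] := hA q dq.
  exact: (proj1 (Esp_mono le0 (dR q dq))).
- rewrite !eT lR// /A.
  have -> : \sum_(1 <= k < M.+1) pmul (aT F k p) (dx (- k%:Z) (a *: q + q')) =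
     a *: \sum_(1 <= k < M.+1) pmul (aT F k p) (dx (- k%:Z) q)
     + \sum_(1 <= k < M.+1) pmul (aT F k p) (dx (- k%:Z) q').
    rewrite scaler_sumr -big_split; apply: eq_big_seq => k; rewrite mem_index_iota => /andP[k1 _].
    have [C1 [_ h1]] := ok k q k1 dq; have [C3 [_ h2]] := ok k q' k1 dq'.
    by rewrite dxD dxZ pmulDr.
  set A1 := \sum_(_ <= _ < _) _; set A2 := \sum_(_ <= _ < _) _.
  rewrite addrACA -scalerDr in_wL.
  move: (dRem F M p [::] q) (dRem F M p [::] q') (in_w S _) (in_w S _) => x1 x2 x3 x4.
  by rewrite addrACA -scalerDr.
- exists (C2 + C) => q dq; rewrite eT.
  have dR1 := Esp_mono le0 (dR q dq); have [dA1 nA1] := hA q dq.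
  apply: le_trans (nrmD nE dA1 dR1.1) _; rewrite mulrDl; apply: lerD nA1 _.
  exact: le_trans dR1.2 (hC q dq).
Qed.

Lemma aT_jet s k : 0 <= s -> (1 <= k)%N -> is_jet X (Hs R s) U (aT F k) (daT F k).
Proof.
move=> s0 k1; pose s' := Num.max 1 s.
have s1 : 1 <= s' by rewrite le_max lexx.
have ss : s <= s' by rewrite le_max lexx orbT.
have n1 := normed_Psp (R := R) S 1; have nX := normed_Psp (R := R) S sigma.
have nH := normed_Hs (R := R) s; have nH' := normed_Hs (R := R) s'.
have j := is_jet_gjet nH' n1 (@sep_Hs R s') (aT_smooth F k1 s1).
have j2 := gjet_restr n1 (gauge_ng nH') (fun v => @Psp_mono R S _ _ v sig1) (VXi_le sig1) j.
apply: (gjet_is_jet nH) => [|p Up]; last exact: daT0.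
apply: (gjet_map (f := id) (c := 1) nX (gauge_ng nH') (gauge_ng nH)) j2 => //.
move=> C w C0 [dw nw]; have [d1 d2] := Hs_mono ss dw; split=> //.
by rewrite mul1r; exact: le_trans d2 nw.
Qed.

Lemma aT_bounds s k : 0 <= s -> (1 <= k)%N -> unif_bounds U (Esp S sigma) (Hs R s) (daT F k).
Proof.
move=> s0 k1; pose s' := Num.max 1 s.
have s1 : 1 <= s' by rewrite le_max lexx.
have ss : s <= s' by rewrite le_max lexx orbT.
have n1 := normed_Esp (R := R) S 1.
have mono (v : E R S) : dom (Esp S sigma) v -> dom (Esp S 1) v /\ nrm (Esp S 1) v <= nrm (Esp S sigma) v by exact: Esp_mono.
have key alpha l : exists2 C : R, 0 <= C & forall p xs, U p -> size xs = l -> all_in (Esp S sigma) xs ->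
    nrm (Hs R s) (daT F k p (dirs alpha xs)) <= C * nprod (Esp S sigma) xs.
  have [C C0 hC] := unif_bd alpha l (aT_est F k1 s1); exists C => // p xs Up sx ax.
  have ax1 : all_in (Esp S 1) xs by move=> x /ax/mono[].
  have [_ hd _ _ _] := aT_smooth F k1 s1.
  have d := hd p (dirs alpha xs) (VXi_le sig1 Up) (dirs_dom (alpha := alpha) ax1).
  apply: le_trans (Hs_mono ss d).2 _; apply: le_trans (hC p xs (VXi_le sig1 Up) sx ax1) _.
  by apply: (ler_wpM2l C0); exact: (nprod_le n1 mono ax).
split=> [alpha|alpha l _]; last by have [C _ hC] := key alpha l; exists C.
have [C _ hC] := key alpha 0%N; exists C => p Up.
by have := hC p [::] Up erefl (fun _ h => False_ind _ (Bool.diff_false_true h)); rewrite /nprod big_nil mulr1.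
Qed.

Lemma Rext_neg_bd alpha l : exists2 C : R, 0 <= C & forall s p xs q, -1 <= s <= M%:R + 1 -> U p ->
  size xs = l -> all_in (Esp S sigma) xs -> dom (Hs0 R (- s)) q ->
  nrm (Esp S (M%:R + 1 - s)) (dRem F M p (dirs alpha xs) q)
    <= C * (nrm (Hs R (- s)) q * nprod (Esp S sigma) xs).
Proof.
pose nus := reps (fun i : S => ((0, eS R i) : P R S)) (enum {: S}) alpha.
have ts := unif_est_dirs F (L%:R + 3) (size nus + l) m1 hsig.
have [C C0 hC] := Rext_neg_unif oXi al1 erefl erefl hsig Mm Mal ts.
exists C => // s p xs q hs Up sx ax dq.
have iv : isdirs sigma (dirs alpha xs) by exists alpha, xs.
have sv : (size (dirs alpha xs) <= size nus + l)%N by rewrite dirsE size_cat size_map sx.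
have [_] := hC p (dirs alpha xs) s q Up iv sv hs dq.
by rewrite nprod_dirs mulrAC mulrA.
Qed.

Lemma Rext_pos_sub s p : 1 <= s -> VXiE sigma (s + sigma) p -> VXiE 1 (s + sigma) p.
Proof. by move=> s1 [h1 h2]; split=> //; exact: VXi_le h1. Qed.
Let pos_le s : 1 <= s -> s + M%:R + 4 <= s + sigma.
Proof. by move=> _; rewrite -addrA lerD2l; apply: le_trans Msig; rewrite lerD2l ler_nat. Qed.
Let pos_sig s : 1 <= s -> sigma <= s + sigma.
Proof. by move=> s1; rewrite lerDr (le_trans ler01). Qed.
Let eMs s : s + M%:R + 1 = M%:R + 1 + s.
Proof. by ring. Qed.

(** On H^s, s >= 1, the remainder is given by [dRem_ae]; linearity in q is already known
    on H^1. *)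
Lemma Rext_pos_jet s : 1 <= s ->
  is_jet (Psp S (s + sigma)) (Bop (Hs0 R s) (Esp S (M%:R + 1 + s)))
    (VXiE sigma (s + sigma)) (fun p => dRem F M p [::]) (dRem F M).
Proof.
move=> s1; rewrite -eMs.
have nA := normed_Hs0 (R := R) s; have nE := normed_Esp (R := R) S (s + M%:R + 1).
have nP := normed_Psp (R := R) S (s + sigma).
have j := gjet_dRem_ae F M1 s1 (pos_le s1) (fun p => @Rext_pos_sub s p s1).
have aS vs : all_in (Psp S (s + sigma)) vs -> all_in X vs.
  by move=> avs v /avs/(Psp_mono (pos_sig s1))[].
apply: (gjet_is_jet_Bop nA nE nP) => //.
  apply: (gjet_ext nP _ _ j) => [p [Up dp]|p vs [Up _] avs]; first by split.
  apply/funext => x; have [dx1 _] := Hs0_mono s1 (svalP x).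
  exact: (dRem_expansion oXi F sig1 M1 Msig Up (aS _ avs) dx1).
move=> p vs [Up _] avs a u v du dv.
have hs : (-1 : R) <= (-1 : R) <= (M%:R + 1 : R) by rewrite lexx/= (le_trans (lerN10 _))// addr_ge0.
have [_ hd _ _ _] := Rext_neg_jet oXi F al1 erefl erefl hsig Mm Mal hs.
have [_ lR _] := hd p vs Up (aS _ avs); rewrite opprK in lR.
by apply: lR; [exact: (proj1 (Hs0_mono s1 du))|exact: (proj1 (Hs0_mono s1 dv))].
Qed.

Lemma Rext_pos_bd s alpha l : 1 <= s -> exists2 C : R, 0 <= C & forall p xs q,
  VXiE sigma (s + sigma) p -> size xs = l -> all_in (Esp S (s + sigma)) xs -> dom (Hs0 R s) q ->
  nrm (Esp S (M%:R + 1 + s)) (dRem F M p (dirs alpha xs) q)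
    <= C * (nrm (Hs R s) q * nprod (Esp S sigma) xs + nrm (Hs R 1) q *
      (ntame (Esp S (s + sigma)) (Esp S sigma) xs
        + nrm (Esp S (s + sigma)) (threduce p.1) * nprod (Esp S sigma) xs)).
Proof.
move=> s1; have [C C0 hC] := dRem_ae_tame F alpha l M1 s1 (pos_le s1).
exists C => // p xs q Up sx ax dq; have [Up1 dp] := Up.
have [dq1 _] := Hs0_mono s1 dq.
have axS : all_in (Esp S sigma) xs by move=> x /ax/(Esp_mono (pos_sig s1))[].
have ax1 : all_in (Esp S 1) xs by move=> x /axS/(Esp_mono sig1)[].
have avs : all_in X (dirs alpha xs) by exact: dirs_dom.
rewrite (dRem_expansion oXi F sig1 M1 Msig Up1 avs dq1) -eMs.
have [_ h] := hC p xs q (Rext_pos_sub s1 Up) sx ax dq; apply: le_trans h _.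
apply: (ler_wpM2l C0).
have n1 := normed_Esp (R := R) S 1; have nr := normed_Esp (R := R) S (s + sigma).
have mono (v : E R S) : dom (Esp S sigma) v -> dom (Esp S 1) v /\ nrm (Esp S 1) v <= nrm (Esp S sigma) v by exact: Esp_mono.
have q0 := nrm_ge0 (normed_Hs0 s) dq; have q1 := nrm_ge0 (normed_Hs0 1) dq1.
have l1 := nprod_le n1 mono axS.
have l2 := ntame_le nr n1 (fun v dv => conj dv (lexx _)) mono ax axS.
have l3 : nrm (Hs R (s + sigma)) (xw p.1) <= nrm (Esp S (s + sigma)) (threduce p.1).
  have nR := normed_RSsp R S; rewrite Esp_nrmE lerDr.
  by rewrite addr_ge0//; exact: (nrm_ge0 nR).
have w0 : 0 <= nrm (Hs R (s + sigma)) (xw p.1).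
  by have [_ [dw _]] := dp; exact: (nrm_ge0 (normed_Hs _) dw).
apply: lerD; first exact: (ler_wpM2l q0 l1).
apply: (ler_wpM2l q1); apply: lerD l2 _.
exact: (ler_pM w0 (nprod_ge0 n1 ax1) l3 l1).
Qed.
End Final.
Theorem corollary3p3 (R : realType) (S : {fset nat}) (hS : 0%N \notin S)
    (delta : R) (hdelta : 0 < delta) (Xi : set (RS R S))
    (hXi_open : nopen (RSsp R S) Xi)
    (hXi_bounded : exists C : R, forall nu, Xi nu -> nrm (RSsp R S) nu <= C)
    (hXi_pos : forall nu j, Xi nu -> 0 < (nu j : R))
    (hXi_ball : forall nu y j, Xi nu -> nrm (RSsp R S) y < delta ->
       0 < ((nu + y) j : R))
    (K : birkhoff R) (F : normal_form K delta Xi) (M : nat) (hM : (1 <= M)%N) :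
  exists (sigma : R)
    (Text : P R S -> dist R -> E R S)
    (aext : nat -> P R S -> dist R)
    (daext : nat -> P R S -> seq (P R S) -> dist R)
    (Rext : P R S -> dist R -> E R S)
    (dRext : P R S -> seq (P R S) -> dist R -> E R S),
    0 < sigma /\
    (* the maps are defined on the torus in theta *)
    (forall k, (1 <= k <= M)%N -> th_periodic (VXi delta Xi sigma) (aext k)) /\
    (forall q, dom (Hs0 R (- M.+1%:R)) q ->
       th_periodic (VXi delta Xi sigma) (fun p => Rext p q)) /\
    (* extension of the transpose, and its expansion *)
    (forall p, VXi delta Xi sigma p ->
       [/\ dom (Bop (Hs0 R (- M.+1%:R)) (Esp S (- M.+1%:R))) (Text p),
           forall q, dom (Hs0 R 0) q -> Text p q = dPsiT F p q &
           forall q, dom (Hs0 R (- M.+1%:R)) q ->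
             Text p q =
               (0, 0,
                Pperp S q
                + Pperp S (\sum_(1 <= k < M.+1)
                             pmul (aext k p) (dx (- k%:Z) q)))
               + Rext p q]) /\
    (* (i) *)
    (forall p, VXi delta Xi sigma p -> aext 1%N p = aT F 1%N p) /\
    (forall (s : R) k, 0 <= s -> (1 <= k <= M)%N ->
       is_jet (Psp S sigma) (Hs R s) (VXi delta Xi sigma) (aext k) (daext k) /\
       unif_bounds (VXi delta Xi sigma) (Esp S sigma) (Hs R s) (daext k)) /\
    (* (ii) *)
    (forall s : R, -1 <= s <= M%:R + 1 ->
       is_jet (Psp S sigma) (Bop (Hs0 R (- s)) (Esp S (M%:R + 1 - s)))
         (VXi delta Xi sigma) Rext dRext) /\
    (forall alpha, exists C : R, forall (s : R) p q,
       -1 <= s <= M%:R + 1 -> VXi delta Xi sigma p -> dom (Hs0 R (- s)) q ->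
       nrm (Esp S (M%:R + 1 - s)) (dRext p (dirs alpha [::]) q)
         <= C * nrm (Hs R (- s)) q) /\
    (forall (s : R) alpha (l : nat), -1 <= s <= M%:R + 1 -> (1 <= l)%N ->
       exists C : R, forall p xs q,
         VXi delta Xi sigma p -> size xs = l -> all_in (Esp S sigma) xs ->
         dom (Hs0 R (- s)) q ->
         nrm (Esp S (M%:R + 1 - s)) (dRext p (dirs alpha xs) q)
           <= C * (nrm (Hs R (- s)) q * nprod (Esp S sigma) xs)) /\
    (* (iii) *)
    (forall s : R, 1 <= s ->
       is_jet (Psp S (s + sigma)) (Bop (Hs0 R s) (Esp S (M%:R + 1 + s)))
         (VXiE delta Xi sigma (s + sigma)) Rext dRext) /\
    (forall (s : R) alpha, 1 <= s -> exists C : R, forall p q,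
       VXiE delta Xi sigma (s + sigma) p -> dom (Hs0 R s) q ->
       nrm (Esp S (M%:R + 1 + s)) (dRext p (dirs alpha [::]) q)
         <= C * (nrm (Hs R s) q
                 + nrm (Esp S (s + sigma)) (threduce p.1) * nrm (Hs R 1) q)) /\
    (forall (s : R) alpha (l : nat), 1 <= s -> (1 <= l)%N ->
       exists C : R, forall p xs q,
         VXiE delta Xi sigma (s + sigma) p -> size xs = l ->
         all_in (Esp S (s + sigma)) xs -> dom (Hs0 R s) q ->
         nrm (Esp S (M%:R + 1 + s)) (dRext p (dirs alpha xs) q)
           <= C * (nrm (Hs R s) q * nprod (Esp S sigma) xs
                   + nrm (Hs R 1) q
                     * (ntame (Esp S (s + sigma)) (Esp S sigma) xs
                        + nrm (Esp S (s + sigma)) (threduce p.1)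
                          * nprod (Esp S sigma) xs))).
Proof.
(* al = M + 3 is the decay of rows that maps H^{-M-1} to E_0 and H^1 to E_{M+2}; the auxiliary
   expansion has order 4 al, and on H^1 its smoothing terms need 4 al + 5 derivatives of w *)
pose sigma : R := (4 * (M + 3))%:R + 5.
have hs : (4 * (M + 3))%:R + 5 <= sigma by [].
have sig1 : 1 <= sigma by rewrite /sigma ler_wpDl// ler1n.
exists sigma, (fun p => dTransp F p [::]), (aT F), (daT F), (fun p => dRem F M p [::]), (dRem F M).
split; first exact: lt_le_trans sig1.
split.
  by move=> k /andP[k1 _] p c Up; exact: (aT_periodic F k1 c (VXi_le sig1 Up)).
split; first by move=> q _; exact: (Rext_periodic hXi_open F hs).
split.
  move=> p Up; split; first exact: (Text_dom hXi_open F hM hs Up).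
    by move=> q dq; exact: (Text_dPsiT F hs Up dq).
  by move=> q dq; exact: (Text_expansion F hs q Up).
split=> //.
split.
  by move=> s k s0 /andP[k1 _]; split; [exact: (aT_jet F hs s0 k1)|exact: (aT_bounds F hs s0 k1)].
split.
  move=> s h; have h1 : (1 <= M + 3)%N by lia.
  have h2 : (M <= 4 * (M + 3))%N by lia.
  exact: (Rext_neg_jet hXi_open F h1 erefl erefl hs h2 (leqnn _) h).
split.
  move=> alpha; have [C _ hC] := Rext_neg_bd hXi_open F hM hs alpha 0.
  exists C => s p q h Up dq; have := hC s p [::] q h Up erefl _ dq.
  by rewrite /nprod big_nil mulr1; apply.
split.
  move=> s alpha l h l1; have [C _ hC] := Rext_neg_bd hXi_open F hM hs alpha l.
  by exists C => p xs q Up sx ax dq; exact: hC.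
split; first by move=> s s1; exact: (Rext_pos_jet hXi_open F hM hs s1).
split.
  move=> s alpha s1; have [C _ hC] := Rext_pos_bd hXi_open F hM hs alpha 0 s1.
  exists C => p q Up dq; have := hC p [::] q Up erefl _ dq.
  by rewrite ntame_nil /nprod big_nil !mulr1 add0r [nrm (Hs R 1) q * _]mulrC; apply.
move=> s alpha l s1 _; have [C _ hC] := Rext_pos_bd hXi_open F hM hs alpha l s1.
by exists C => p xs q Up sx ax dq; exact: hC.
Qed.
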